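(* (1) Let $\varphi:\mathbb{D}\to\mathbb{E}$ be a complex geodesic in the tetrablock of the form $$\varphi(\lambda)=\left(\omega_1\frac{\psi(\lambda)+C}{1+C},\ \omega_2\lambda\frac{1+C\psi(\lambda)}{1+C},\ \omega_1\omega_2\lambda\psi(\lambda)\right),\quad\lambda\in\mathbb{D},$$ where $\omega_1,\omega_2\in\partial\mathbb{D}$, $C\in[0,1]$, and $\psi:\mathbb{D}\to\overline{\mathbb{D}}$ is holomorphic with $\psi(0)=-C$. Then $\varphi$ has a unique left inverse if and only if $C\in(0,1)$ and the function $\psi$ is not an automorphism of $\mathbb{D}$. (2) Let $\varphi:\mathbb{D}\to\mathbb{E}$ be a complex geodesic in the tetrablock such that $\varphi(\mathbb{D})\cap\Sigma=\emptyset$ and $$\varphi(\lambda)=\left(\frac{A(\lambda)(1-\beta^2)}{\Delta(\lambda)},\ \frac{C(\lambda)(1-\beta^2)}{\Delta(\lambda)},\ \frac{A(\lambda)C(\lambda)-(B(\lambda)+\beta)^2}{\Delta(\lambda)}\right),\quad\lambda\in\mathbb{D},$$ where $\beta\in(0,1)$; $a,b,c,d\in\overline{\mathbb{D}}$ satisfy $|a|^2+|b|^2=|c|^2+|d|^2=1$ and $a\bar c+b\bar d=0$; $Z:\mathbb{D}\to\mathbb{D}$ is a holomorphic mapping satisfying either $Z(\lambda)=\lambda$ for all $\lambda\in\mathbb{D}$, or $|Z(\lambda)|<|\lambda|$ for all $\lambda\in\mathbb{D}\setminus\{0\}$; and $$A(\lambda)=a^2\lambda+b^2Z(\lambda),\quad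 B(\lambda)=ac\lambda+bdZ(\lambda),\quad C(\lambda)=c^2\lambda+d^2Z(\lambda),$$ $$\Delta(\lambda)=(1+\beta B(\lambda))^2-A(\lambda)C(\lambda)\beta^2.$$ Then $\varphi$ has a unique left inverse if and only if $|Z(\lambda)|<|\lambda|$ for all $\lambda\in\mathbb{D}\setminus\{0\}$ and $|c||d|(1+\beta^2)=\beta$.
   Context: $\mathbb{D}$ denotes the open unit disc in $\mathbb{C}$. The tetrablock is the domain $$\mathbb{E}:=\{x\in\mathbb{C}^3:\ |x_1-\bar x_2x_3|+|x_2-\bar x_1x_3|+|x_3|^2<1\},$$ and its royal variety is $\Sigma:=\{z\in\mathbb{E}:z_1z_2=z_3\}$. A holomorphic map $\varphi:\mathbb{D}\to\mathbb{E}$ is a complex geodesic if there is a holomorphic function $F:\mathbb{E}\to\mathbb{D}$ with $F\circ\varphi=\operatorname{id}_{\mathbb{D}}$; any such $F$ is called a left inverse of $\varphi$. *)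

(* Defs.v *)
From Stdlib Require Export Reals.
From Coquelicot Require Export Coquelicot.

Open Scope R_scope.

Definition disc (z : C) : Prop := Cmod z < 1.
Definition closed_disc (z : C) : Prop := Cmod z <= 1.
Definition unit_circle (z : C) : Prop := Cmod z = 1.

Definition C3 : NormedModule C_AbsRing :=
  prod_NormedModule C_AbsRing
    (prod_NormedModule C_AbsRing C_NormedModule C_NormedModule) C_NormedModule.

(* Maps defined on a domain of C or C^3 are represented by total functions;
   only their values on the domain are ever constrained, and equality of two
   such maps means equality on the domain.  The disc and the tetrablock are
   open, so complex differentiability at their points does not depend on the
   values taken outside. *)
Definition holomorphic_disc {V : NormedModule C_AbsRing} (f : C -> V) : Prop :=
  forall z, disc z -> ex_derive (K := C_AbsRing) f z.

Definition tetrablock (x : C3) : Prop :=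
  let '(x1, x2, x3) := x in
  Cmod (x1 - Cconj x2 * x3)%C + Cmod (x2 - Cconj x1 * x3)%C + Cmod x3 ^ 2 < 1.

Definition royal_variety (z : C3) : Prop :=
  let '(z1, z2, z3) := z in tetrablock z /\ (z1 * z2)%C = z3.

(* Frechet differentiability over the scalar field C. *)
Definition holomorphic_tetrablock (F : C3 -> C) : Prop :=
  forall x, tetrablock x ->
    ex_filterdiff (K := C_AbsRing) (U := C3) (V := C_NormedModule) F (locally x).

Definition left_inverse (phi : C -> C3) (F : C3 -> C) : Prop :=
  holomorphic_tetrablock F /\
  (forall x, tetrablock x -> disc (F x)) /\
  (forall z, disc z -> F (phi z) = z).

Definition complex_geodesic (phi : C -> C3) : Prop :=
  holomorphic_disc phi /\
  (forall z, disc z -> tetrablock (phi z)) /\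
  exists F : C3 -> C, left_inverse phi F.

Definition unique_left_inverse (phi : C -> C3) : Prop :=
  exists F : C3 -> C,
    left_inverse phi F /\
    forall G : C3 -> C, left_inverse phi G ->
      forall x, tetrablock x -> G x = F x.

Definition disc_automorphism (psi : C -> C) : Prop :=
  holomorphic_disc (V := C_NormedModule) psi /\
  (forall z, disc z -> disc (psi z)) /\
  exists g : C -> C,
    holomorphic_disc (V := C_NormedModule) g /\
    (forall z, disc z -> disc (g z)) /\
    (forall z, disc z -> g (psi z) = z) /\
    (forall z, disc z -> psi (g z) = z).

(* Main.v *)
Require Import Defs.
From Stdlib Require Import Lra Psatz ClassicalEpsilon.

(** A Cayley-type change of coordinates [Xi] turns the tetrablock into the domain
    [Re P > 0], [Re S > 0], [|c| - Re c < 2 Re P Re S].  If a holomorphic [G] from the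
    tetrablock to the disc has at a point [(P0, S0, C0)] with [P0 > 0], [C0 >= 0] real the
    same differential as [(P0 - P) / (P0 + P)], then it equals that function: on discs
    [P = P0 (1 - z) / (1 + z)], [S = a + b z + q P], [c = C0 + q (P0^2 - P^2)] this is Schwarz's
    lemma, and the identity theorem does the rest.  Uniqueness in both parts follows by
    finding the differential of a left inverse [G] at one point: the derivative of [G] along a
    disc through that point has modulus at most 1, and it equals 1 along the geodesic, which
    is interior to a family of such discs.

    In part (2) one has [b = - conj c e], [d = conj a e] with [|e| = 1], and
    [(|a| - beta |c|) (|c| - beta |a|) = |c| |d| (1 + beta^2) - beta].  If this vanishes, the
    previous argument applies.  If it is negative, automorphisms bring the curve to the form
    [x2 - x3 r = r (1 - x1 r)], [x1 x2 - x3 = k (1 - x1 r)^2] with [0 < k < 1], which has a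
    one-parameter family of left inverses.  If it is positive and [|Z z| < |z|], a left
    inverse also inverts the curve with [Z = 0]; that curve touches the royal variety, and the
    Schwarz-Pick lemma on a bidisc gives a contradiction.  If [Z z = z], the matrix
    [[a, b], [c, d]] can be multiplied by a real rotation without changing the curve, and the
    absence of royal points forces the product to be at most 0 for a suitable rotation; if it
    is 0, both [P] and [S] provide left inverses. *)

(** * Complex derivatives *)

(** [Xi] is a matrix Cayley transform. Choose d with d^2 = x1 x2 - x3 and put Y = [[x1, d],
    [-d, -x2]]; then (1 + Y) (1 - Y)^-1 = [[S, e], [-e, P]] with e^2 = c. That Y is a contraction
    becomes positivity of the Hermitian part, where e enters only through (Im e)^2 = (|c| - Re c) /
    2. The quadratic discs do not fill an open set: for given P and S they reach only a segment of
    values c. It ends at C0, though, which is all that the identity theorem in c needs; S and c are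
    then freed in turn. The first-order arguments rest on one fact: an affine function of the
    parameters of a family of discs that has modulus at most 1, and equals 1 at an interior
    parameter, is constant. When |Z z| = |z| the parameter sits on the boundary of its range and a
    second left inverse is exhibited instead. The case distinction in part (2) is about the position
    of conj a / (beta conj c) relative to the unit circle: in the open disc it is the parameter of a
    normalising automorphism, on the circle it is a rotation. Swapping the coordinates exchanges a
    and c. *)

Lemma Cmod_sub_sym (a b : C) : Cmod (a - b)%C = Cmod (b - a)%C.
Proof. replace (a - b)%C with (- (b - a))%C by ring. apply Cmod_opp. Qed.

(** The filter is left abstract so that one algebra of limits serves both the neighbourhoods of a
    point of C and those of a point of C^3. *)
Definition Clim {U : Type} (F : (U -> Prop) -> Prop) (f : U -> C) (l : C) : Prop :=
  forall eps, 0 < eps -> F (fun u => Cmod (f u - l)%C < eps).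

Section Limits.
Context {U : Type} (F : (U -> Prop) -> Prop) {FF : Filter F}.

Lemma Clim_ext (f g : U -> C) (l : C) :
  (forall u, f u = g u) -> Clim F f l -> Clim F g l.
Proof.
intros H Hf e He. generalize (Hf e He). apply filter_imp. intros u. now rewrite H.
Qed.

Lemma Clim_const (c : C) : Clim F (fun _ => c) c.
Proof.
intros e He. apply filter_forall. intros _. replace (c - c)%C with (RtoC 0) by ring.
now rewrite Cmod_0.
Qed.

Lemma Clim_plus (f g : U -> C) (l m : C) :
  Clim F f l -> Clim F g m -> Clim F (fun u => f u + g u)%C (l + m)%C.
Proof.
intros Hf Hg e He.
assert (He2 : 0 < e / 2) by lra.
generalize (filter_and _ _ (Hf (e/2) He2) (Hg (e/2) He2)).
apply filter_imp. intros u [H1 H2].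
replace (f u + g u - (l + m))%C with ((f u - l) + (g u - m))%C by ring.
pose proof (Cmod_triangle (f u - l) (g u - m)). lra.
Qed.

Lemma Clim_mult (f g : U -> C) (l m : C) :
  Clim F f l -> Clim F g m -> Clim F (fun u => f u * g u)%C (l * m)%C.
Proof.
intros Hf Hg e He.
pose proof (Cmod_ge_0 l). pose proof (Cmod_ge_0 m).
set (d := Rmin 1 (e / (Cmod l + Cmod m + 1))).
assert (Hd : 0 < d). { apply Rmin_pos. lra. apply Rdiv_lt_0_compat; lra. }
generalize (filter_and _ _ (Hf d Hd) (Hg d Hd)).
apply filter_imp. intros u [H1 H2].
replace (f u * g u - l * m)%C with ((f u - l) * (g u - m) + (f u - l) * m + l * (g u - m))%C by ring.
pose proof (Cmod_triangle ((f u - l) * (g u - m) + (f u - l) * m) (l * (g u - m))).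
pose proof (Cmod_triangle ((f u - l) * (g u - m)) ((f u - l) * m)).
rewrite !Cmod_mult in *.
assert (Hd1 : d <= 1) by apply Rmin_l.
assert (Hd2 : d * (Cmod l + Cmod m + 1) <= e).
{ apply Rle_trans with (e / (Cmod l + Cmod m + 1) * (Cmod l + Cmod m + 1)).
  apply Rmult_le_compat_r. lra. apply Rmin_r. right. field. lra. }
pose proof (Cmod_ge_0 (g u - m)).
nra.
Qed.

Lemma Clim_opp (f : U -> C) (l : C) : Clim F f l -> Clim F (fun u => - f u)%C (- l)%C.
Proof.
intros Hf e He. generalize (Hf e He). apply filter_imp. intros u Hu.
replace (- f u - - l)%C with (- (f u - l))%C by ring. now rewrite Cmod_opp.
Qed.

Lemma Clim_minus (f g : U -> C) (l m : C) :
  Clim F f l -> Clim F g m -> Clim F (fun u => f u - g u)%C (l - m)%C.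
Proof. intros. apply Clim_plus; auto. now apply Clim_opp. Qed.

Lemma Clim_inv (f : U -> C) (l : C) :
  l <> RtoC 0 -> Clim F f l -> Clim F (fun u => / f u)%C (/ l)%C.
Proof.
intros Hl Hf e He.
assert (Hm : 0 < Cmod l) by now apply Cmod_gt_0.
set (d := Rmin (Cmod l / 2) (e * (Cmod l * Cmod l / 2))).
assert (Hd : 0 < d). { apply Rmin_pos. lra. apply Rmult_lt_0_compat; nra. }
generalize (Hf d Hd). apply filter_imp. intros u Hu.
assert (Hd1 : d <= Cmod l / 2) by apply Rmin_l.
assert (Hd2 : d <= e * (Cmod l * Cmod l / 2)) by apply Rmin_r.
assert (Hfu : Cmod l / 2 < Cmod (f u)).
{ pose proof (Cmod_triangle (f u) (l - f u)). rewrite (Cmod_sub_sym l) in H.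
  replace (f u + (l - f u))%C with l in H by ring. lra. }
assert (Hn : f u <> RtoC 0). { apply Cmod_gt_0. lra. }
replace (/ f u - / l)%C with ((l - f u) * / (f u * l))%C by now field.
rewrite Cmod_mult, Cmod_inv, Cmod_mult, Cmod_sub_sym by (now apply Cmult_neq_0).
apply Rmult_lt_reg_r with (Cmod (f u) * Cmod l). nra.
rewrite Rmult_assoc, Rinv_l, Rmult_1_r by nra. nra.
Qed.

End Limits.

Definition Cnear (z : C) (P : C -> Prop) : Prop :=
  exists d, 0 < d /\ forall w, Cmod (w - z)%C < d -> P w.

Lemma Cnear_filter (z : C) : ProperFilter (Cnear z).
Proof.
split.
- intros P [d [Hd H]]. exists z. apply H. replace (z - z)%C with (RtoC 0) by ring. now rewrite Cmod_0.
- split.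
  + exists 1. split. lra. auto.
  + intros P Q [d [Hd H]] [e [He H']]. exists (Rmin d e). split. now apply Rmin_pos.
    intros w Hw. split. apply H. apply Rlt_le_trans with (1 := Hw). apply Rmin_l.
    apply H'. apply Rlt_le_trans with (1 := Hw). apply Rmin_r.
  + intros P Q H [d [Hd H']]. exists d. split; auto.
Qed.
Global Existing Instance Cnear_filter.

Lemma Clim_id (z : C) : Clim (Cnear z) (fun w => w) z.
Proof. intros e He. exists e. auto. Qed.

Definition Ccont (f : C -> C) (z : C) : Prop := Clim (Cnear z) f (f z).

(* Caratheodory's form of complex differentiability: the difference quotient
   extends continuously to [z], with value [l]. *)
Definition hd (f : C -> C) (z l : C) : Prop :=
  exists p, Clim (Cnear z) p l /\ forall w, (f w = f z + p w * (w - z))%C.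

Lemma hd_eps (f : C -> C) (z l : C) :
  hd f z l <-> forall eps, 0 < eps -> exists d, 0 < d /\ forall w, Cmod (w - z)%C < d ->
    Cmod (f w - f z - l * (w - z))%C <= eps * Cmod (w - z)%C.
Proof.
split.
- intros [p [Hp Hf]] e He. destruct (Hp e He) as [d [Hd H]]. exists d. split; auto.
  intros w Hw. rewrite (Hf w).
  replace (f z + p w * (w - z) - f z - l * (w - z))%C with ((p w - l) * (w - z))%C by ring.
  rewrite Cmod_mult. apply Rmult_le_compat_r. apply Cmod_ge_0. left. auto.
- intros H. exists (fun w => if excluded_middle_informative (w = z) then l else (f w - f z) / (w - z))%C.
  split.
  + intros e He. assert (He2 : 0 < e / 2) by lra. destruct (H (e/2) He2) as [d [Hd H']]. exists d. split; auto.
    intros w Hw. destruct (excluded_middle_informative (w = z)) as [E|E].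
    * replace (l - l)%C with (RtoC 0) by ring. now rewrite Cmod_0.
    * assert (Hn : (w - z)%C <> RtoC 0). { intros E'. apply E. replace w with (w - z + z)%C by ring. rewrite E'. ring. }
      replace ((f w - f z) / (w - z) - l)%C with ((f w - f z - l * (w - z)) / (w - z))%C by now field.
      unfold Cdiv. rewrite Cmod_mult, Cmod_inv by auto.
      apply Rle_lt_trans with (e / 2). 2: lra.
      assert (0 < Cmod (w - z)) by now apply Cmod_gt_0.
      apply Rmult_le_reg_r with (Cmod (w - z)); auto.
      rewrite Rmult_assoc, Rinv_l, Rmult_1_r by lra. auto.
  + intros w. destruct (excluded_middle_informative (w = z)) as [E|E].
    * rewrite E. ring.
    * field. intros E'. apply E. replace w with (w - z + z)%C by ring. rewrite E'. ring.
Qed.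

Lemma hd_is_derive (f : C -> C) (z l : C) :
  hd f z l <-> is_derive (K := C_AbsRing) (V := C_NormedModule) f z l.
Proof.
rewrite hd_eps. split.
- intros H. split. apply is_linear_scal_l.
  intros x Hx eps. apply (is_filter_lim_locally_unique (K := C_AbsRing) (V := AbsRing_NormedModule C_AbsRing)) in Hx. subst x.
  destruct (H eps (cond_pos eps)) as [d [Hd H']].
  exists (mkposreal d Hd). intros y Hy.
  specialize (H' y Hy). rewrite (Cmult_comm l) in H'. exact H'.
- intros [_ H] e He. specialize (H z (fun P HP => HP) (mkposreal e He)).
  destruct H as [d Hd]. exists d. split. apply cond_pos.
  intros w Hw. rewrite (Cmult_comm l). exact (Hd w Hw).
Qed.

Lemma hd_cont (f : C -> C) (z l : C) : hd f z l -> Ccont f z.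
Proof.
intros [p [Hp Hf]]. unfold Ccont.
apply Clim_ext with (f := fun w => (f z + p w * (w - z))%C). apply _. intros; symmetry; auto.
cut (Clim (Cnear z) (fun w => f z + p w * (w - z))%C (f z + l * (z - z))%C).
{ now replace (f z + l * (z - z))%C with (f z) by ring. }
apply Clim_plus. apply _. apply Clim_const, _.
apply Clim_mult; auto. apply _. apply Clim_minus. apply _. apply Clim_id. apply Clim_const, _.
Qed.

Lemma hd_ext_near (f g : C -> C) (z l : C) :
  Cnear z (fun w => f w = g w) -> hd f z l -> hd g z l.
Proof.
intros [r [Hr E]] H. rewrite hd_eps in *. intros e He. destruct (H e He) as [d [Hd H']].
exists (Rmin r d). split. now apply Rmin_pos.
intros w Hw. rewrite <- !E. apply H'. apply Rlt_le_trans with (1 := Hw), Rmin_r.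
replace (z - z)%C with (RtoC 0) by ring. now rewrite Cmod_0.
apply Rlt_le_trans with (1 := Hw), Rmin_l.
Qed.

Lemma hd_eq (f : C -> C) (z l m : C) : hd f z l -> l = m -> hd f z m.
Proof. now intros H <-. Qed.

Lemma hd_const (c z : C) : hd (fun _ => c) z (RtoC 0).
Proof. exists (fun _ => RtoC 0). split. apply Clim_const, _. intros; ring. Qed.

Lemma hd_id (z : C) : hd (fun w => w) z (RtoC 1).
Proof. exists (fun _ => RtoC 1). split. apply Clim_const, _. intros; ring. Qed.

Lemma hd_plus (f g : C -> C) (z l m : C) :
  hd f z l -> hd g z m -> hd (fun w => f w + g w)%C z (l + m)%C.
Proof.
intros [p [Hp Hf]] [q [Hq Hg]]. exists (fun w => p w + q w)%C. split.
now apply Clim_plus; try apply _.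
intros w. rewrite (Hf w), (Hg w). ring.
Qed.

Lemma hd_mult (f g : C -> C) (z l m : C) :
  hd f z l -> hd g z m -> hd (fun w => f w * g w)%C z (l * g z + f z * m)%C.
Proof.
intros Hf' Hg'. destruct Hf' as [p [Hp Hf]]. generalize (hd_cont _ _ _ Hg'). intros Cg.
destruct Hg' as [q [Hq Hg]]. exists (fun w => p w * g w + f z * q w)%C. split.
apply Clim_plus. apply _. apply Clim_mult; auto. apply _. apply Clim_mult; auto. apply _. apply Clim_const, _.
intros w. rewrite (Hf w). rewrite (Hg w). ring.
Qed.

Lemma hd_opp (f : C -> C) (z l : C) : hd f z l -> hd (fun w => - f w)%C z (- l)%C.
Proof.
intros [p [Hp Hf]]. exists (fun w => - p w)%C. split. now apply Clim_opp; try apply _.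
intros w. rewrite (Hf w). ring.
Qed.

Lemma hd_minus (f g : C -> C) (z l m : C) :
  hd f z l -> hd g z m -> hd (fun w => f w - g w)%C z (l - m)%C.
Proof. intros. apply hd_plus; auto. now apply hd_opp. Qed.

Lemma hd_inv (f : C -> C) (z l : C) :
  f z <> RtoC 0 -> hd f z l -> hd (fun w => / f w)%C z (- (l / (f z * f z)))%C.
Proof.
intros Hz Hf'. generalize (hd_cont _ _ _ Hf'). intros Cf. destruct Hf' as [p [Hp Hf]].
(* Caratheodory's identity must hold at every [w], even where [f w = 0]. The zeros of [f], which
   keep away from [z], are patched with the value [f z]; there the slope 0 is exact. *)
apply hd_ext_near with (f := fun w => (/ (if excluded_middle_informative (f w = RtoC 0) then f z else f w))%C).
{ destruct (Cf (Cmod (f z))) as [d [Hd H]]. now apply Cmod_gt_0. exists d. split; auto.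
  intros w Hw. destruct (excluded_middle_informative (f w = RtoC 0)) as [E|E]; auto.
  exfalso. specialize (H w Hw). rewrite E in H. replace (0 - f z)%C with (- f z)%C in H by ring. rewrite Cmod_opp in H. lra. }
exists (fun w => if excluded_middle_informative (f w = RtoC 0) then RtoC 0 else (- (p w * / (f z * f w)))%C).
split.
- assert (H : Clim (Cnear z) (fun w => - (p w * / (f z * f w)))%C (- (l / (f z * f z)))%C).
  { apply Clim_opp. apply _. apply Clim_mult; auto. apply _. apply Clim_inv. apply _. now apply Cmult_neq_0.
    apply Clim_mult; auto. apply _. apply Clim_const, _. }
  destruct (Cf (Cmod (f z))) as [d [Hd H0]]. now apply Cmod_gt_0.
  intros e He. destruct (H e He) as [d' [Hd' H']]. exists (Rmin d d'). split. now apply Rmin_pos.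
  intros w Hw. destruct (excluded_middle_informative (f w = RtoC 0)) as [E|E].
  + exfalso. specialize (H0 w (Rlt_le_trans _ _ _ Hw (Rmin_l _ _))). rewrite E in H0. replace (0 - f z)%C with (- f z)%C in H0 by ring. rewrite Cmod_opp in H0. lra.
  + apply H'. apply Rlt_le_trans with (1 := Hw), Rmin_r.
- intros w. destruct (excluded_middle_informative (f z = RtoC 0)) as [E'|E']. contradiction.
  destruct (excluded_middle_informative (f w = RtoC 0)) as [E|E].
  + ring.
  + replace (- (p w * / (f z * f w)) * (w - z))%C with (- ((p w * (w - z)) * / (f z * f w)))%C by ring.
    replace (p w * (w - z))%C with (f w - f z)%C by (rewrite (Hf w); ring).
    now field.
Qed.

Lemma hd_div (f g : C -> C) (z l m : C) :
  g z <> RtoC 0 -> hd f z l -> hd g z m ->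
  hd (fun w => f w / g w)%C z ((l * g z - f z * m) / (g z * g z))%C.
Proof.
intros Hz Hf Hg. eapply hd_eq. apply hd_mult. apply Hf. apply hd_inv; eauto.
simpl. now field.
Qed.

Lemma hd_comp (f g : C -> C) (z l m : C) :
  hd f (g z) l -> hd g z m -> hd (fun w => f (g w)) z (l * m)%C.
Proof.
intros [p [Hp Hf]] Hg'. generalize (hd_cont _ _ _ Hg'). intros Cg. destruct Hg' as [q [Hq Hg]].
exists (fun w => p (g w) * q w)%C. split.
- apply Clim_mult; auto. apply _.
  intros e He. destruct (Hp e He) as [d [Hd H]]. destruct (Cg d Hd) as [d' [Hd' H']].
  exists d'. auto.
- intros w. rewrite (Hf (g w)). rewrite (Hg w) at 2. ring.
Qed.

Lemma hd_unique (f : C -> C) (z l m : C) : hd f z l -> hd f z m -> l = m.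
Proof.
intros Hl Hm. rewrite hd_is_derive in *.
rewrite <- (is_C_derive_unique _ _ _ Hl). now apply is_C_derive_unique.
Qed.

Definition holo (D : C -> Prop) (f : C -> C) : Prop := forall z, D z -> exists l, hd f z l.

Lemma holo_disc (f : C -> C) : holomorphic_disc (V := C_NormedModule) f <-> holo disc f.
Proof.
split; intros H z Hz; destruct (H z Hz) as [l Hl]; exists l; now apply hd_is_derive.
Qed.

(** * Goursat's lemma and primitives on discs *)

Definition Rc (f : R -> C) (t : R) : Prop :=
  forall eps, 0 < eps -> exists d, 0 < d /\ forall s, Rabs (s - t) < d -> Cmod (f s - f t)%C < eps.

Notation CRV := C_R_CompleteNormedModule.
Definition CI (f : R -> C) (a b : R) : C := RInt (V := CRV) f a b.

Lemma Rc_continuous (f : R -> C) (t : R) :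
  Rc f t <-> continuous (U := CRV) f t.
Proof.
split.
- intros H. apply filterlim_locally. intros e.
  destruct (H e (cond_pos e)) as [d [Hd H']]. exists (mkposreal d Hd). intros s Hs.
  apply (norm_compat1 (V := C_R_NormedModule)). specialize (H' s Hs). rewrite Cmod_norm in H'. exact H'.
- intros H e He.
  assert (He2 : 0 < e / 2) by lra.
  assert (Hb := proj1 (filterlim_locally _ _) H (mkposreal _ He2)).
  destruct Hb as [d Hd]. exists d. split. apply cond_pos.
  intros s Hs. specialize (Hd s Hs). destruct Hd as [H1 H2].
  unfold ball in H1, H2. simpl in H1, H2. unfold AbsRing_ball, abs, minus, plus, opp in H1, H2; simpl in H1, H2.
  apply Rle_lt_trans with (1 := Cmod_2Rmax _).
  set (m := Rmax _ _).
  assert (Hm : m < e / 2) by (apply Rmax_lub_lt; auto).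
  assert (sqrt 2 <= 2). { replace 2 with (sqrt (2 * 2)) at 2. apply sqrt_le_1_alt. lra. rewrite sqrt_square; lra. }

  assert (0 <= m). { apply Rle_trans with (2 := Rmax_l _ _). apply Rabs_pos. }
  nra.
Qed.

Lemma CI_ex (f : R -> C) (a b : R) :
  (forall t, Rmin a b <= t <= Rmax a b -> Rc f t) -> ex_RInt (V := CRV) f a b.
Proof. intros H. apply (ex_RInt_continuous (V := CRV)). intros t Ht. apply Rc_continuous. auto. Qed.

(** A complex factor is not a scalar of the real module in which the integral is taken, so linearity
    is recovered from real and imaginary parts. *)
Lemma CI_mult_is (f : R -> C) (c : C) (a b : R) (l : C) :
  is_RInt (V := CRV) f a b l -> is_RInt (V := CRV) (fun t => c * f t)%C a b (c * l)%C.
Proof.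
intros H.
pose proof (is_RInt_fct_extend_fst (U := R_NormedModule) (V := R_NormedModule) f a b l H) as H1.
pose proof (is_RInt_fct_extend_snd (U := R_NormedModule) (V := R_NormedModule) f a b l H) as H2.
apply (is_RInt_fct_extend_pair (U := R_NormedModule) (V := R_NormedModule)); simpl.
- apply (is_RInt_minus (V := R_NormedModule)); apply (is_RInt_scal (V := R_NormedModule)); auto.
- apply (is_RInt_plus (V := R_NormedModule)); apply (is_RInt_scal (V := R_NormedModule)); auto.
Qed.

Lemma CI_is (f : R -> C) (a b : R) : ex_RInt (V := CRV) f a b -> is_RInt (V := CRV) f a b (CI f a b).
Proof. apply (RInt_correct (V := CRV)). Qed.

Lemma CI_uniq (f : R -> C) (a b : R) (l : C) : is_RInt (V := CRV) f a b l -> CI f a b = l.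
Proof. apply (is_RInt_unique (V := CRV)). Qed.

Lemma CI_mult (f : R -> C) (c : C) (a b : R) :
  ex_RInt (V := CRV) f a b -> CI (fun t => c * f t)%C a b = (c * CI f a b)%C.
Proof. intros H. apply CI_uniq. apply CI_mult_is. now apply CI_is. Qed.

Lemma CI_plus (f g : R -> C) (a b : R) :
  ex_RInt (V := CRV) f a b -> ex_RInt (V := CRV) g a b -> CI (fun t => f t + g t)%C a b = (CI f a b + CI g a b)%C.
Proof. intros H1 H2. apply CI_uniq. apply (is_RInt_plus (V := CRV)); now apply CI_is. Qed.

Lemma CI_minus (f g : R -> C) (a b : R) :
  ex_RInt (V := CRV) f a b -> ex_RInt (V := CRV) g a b -> CI (fun t => f t - g t)%C a b = (CI f a b - CI g a b)%C.
Proof. intros H1 H2. apply CI_uniq. apply (is_RInt_minus (V := CRV)); now apply CI_is. Qed.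

Lemma CI_ext (f g : R -> C) (a b : R) :
  (forall t, Rmin a b <= t <= Rmax a b -> f t = g t) -> CI f a b = CI g a b.
Proof. intros H. apply (RInt_ext (V := CRV)). intros t Ht. apply H. lra. Qed.

Lemma CI_swap (f : R -> C) (a b : R) :
  ex_RInt (V := CRV) f a b -> CI f b a = (- CI f a b)%C.
Proof. intros H. apply CI_uniq. apply (is_RInt_swap (V := CRV)). now apply CI_is. Qed.

Lemma CI_chasles (f : R -> C) (a b c : R) :
  ex_RInt (V := CRV) f a b -> ex_RInt (V := CRV) f b c -> CI f a c = (CI f a b + CI f b c)%C.
Proof. intros H1 H2. apply CI_uniq. apply (is_RInt_Chasles (V := CRV)) with b; now apply CI_is. Qed.

Lemma CI_point (f : R -> C) (a : R) : CI f a a = RtoC 0.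
Proof. apply CI_uniq. apply (is_RInt_point (V := CRV)). Qed.

Lemma CI_bound (f : R -> C) (a b M : R) :
  a <= b -> ex_RInt (V := CRV) f a b -> (forall t, a <= t <= b -> Cmod (f t) <= M) ->
  Cmod (CI f a b) <= M * (b - a).
Proof.
intros Hab H HM. rewrite Cmod_norm.
apply (norm_RInt_le (V := CRV) f (fun _ => M) a b (CI f a b) (M * (b - a))); auto.
- intros t Ht. rewrite <- Cmod_norm. auto.
- now apply CI_is.
- replace (M * (b - a)) with (scal (b - a) M). apply (is_RInt_const (V := R_NormedModule)).
  unfold scal; simpl; unfold mult; simpl; ring.
Qed.

Lemma CI_bound_gen (f : R -> C) (a b M : R) :
  ex_RInt (V := CRV) f a b -> (forall t, Rmin a b <= t <= Rmax a b -> Cmod (f t) <= M) ->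
  Cmod (CI f a b) <= M * Rabs (b - a).
Proof.
intros H HM. destruct (Rle_lt_dec a b) as [L|L].
- rewrite Rabs_pos_eq by lra. apply CI_bound; auto. rewrite Rmin_left, Rmax_right in HM; auto.
- rewrite CI_swap by now apply (ex_RInt_swap (V := CRV)). rewrite Cmod_opp, Rabs_left, Ropp_minus_distr by lra.
  rewrite Rmin_right, Rmax_left in HM by lra.
  apply CI_bound; auto. lra. now apply (ex_RInt_swap (V := CRV)).
Qed.

Lemma CI_FTC (F f : R -> C) (a b : R) :
  (forall t, Rmin a b <= t <= Rmax a b -> is_derive (V := CRV) F t (f t)) ->
  (forall t, Rmin a b <= t <= Rmax a b -> Rc f t) ->
  CI f a b = (F b - F a)%C.
Proof.
intros H1 H2. apply CI_uniq. apply (is_RInt_derive (V := CRV) F f a b); auto.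
intros t Ht. apply Rc_continuous. auto.
Qed.

(** * Complex curves with a real parameter *)

Definition rd (g : R -> C) (t : R) (l : C) : Prop :=
  forall eps, 0 < eps -> exists d, 0 < d /\ forall s, Rabs (s - t) < d ->
    Cmod (g s - g t - l * RtoC (s - t))%C <= eps * Rabs (s - t).

Lemma rd_is_derive (g : R -> C) (t : R) (l : C) : rd g t l -> is_derive (V := CRV) g t l.
Proof.
intros H. split. apply (is_linear_scal_l (V := C_R_NormedModule)).
intros x Hx eps. apply (is_filter_lim_locally_unique (K := R_AbsRing) (V := R_NormedModule)) in Hx. subst x.
destruct (H eps (cond_pos eps)) as [d [Hd H']].
exists (mkposreal d Hd). intros s Hs. specialize (H' s Hs). rewrite Cmod_norm in H'.
replace (l * RtoC (s - t))%C with (scal (V := C_R_NormedModule) (minus s t) l) in H'.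
exact H'.
unfold scal; simpl. unfold prod_scal, scal, minus, plus, opp; simpl. unfold mult; simpl.
apply injective_projections; simpl; ring.
Qed.

Lemma rd_Rc (g : R -> C) (t : R) (l : C) : rd g t l -> Rc g t.
Proof.
intros H e He. destruct (H 1 Rlt_0_1) as [d [Hd H']].
pose proof (Cmod_ge_0 l).
assert (Hd2 : 0 < e / (Cmod l + 2)) by (apply Rdiv_lt_0_compat; lra).
exists (Rmin d (e / (Cmod l + 2))). split. now apply Rmin_pos.
intros s Hs. specialize (H' s (Rlt_le_trans _ _ _ Hs (Rmin_l _ _))).
assert (Hs2 := Rlt_le_trans _ _ _ Hs (Rmin_r _ _)).
replace (g s - g t)%C with ((g s - g t - l * RtoC (s - t)) + l * RtoC (s - t))%C by ring.
apply Rle_lt_trans with (1 := Cmod_triangle _ _). rewrite Cmod_mult, Cmod_R.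
assert (Rabs (s - t) * (Cmod l + 2) < e).
{ apply Rmult_lt_reg_r with (/ (Cmod l + 2)). apply Rinv_0_lt_compat; lra.
  rewrite Rmult_assoc, Rinv_r, Rmult_1_r by lra. auto. }
nra.
Qed.

Lemma rd_comp (F : C -> C) (g : R -> C) (t : R) (l m : C) :
  hd F (g t) l -> rd g t m -> rd (fun s => F (g s)) t (l * m)%C.
Proof.
intros HF Hg. pose proof (rd_Rc _ _ _ Hg) as Cg. rewrite hd_eps in HF.
intros e He. pose proof (Cmod_ge_0 l). pose proof (Cmod_ge_0 m).
set (e1 := Rmin 1 (e / (Cmod l + Cmod m + 2))).
assert (He1 : 0 < e1). { apply Rmin_pos. lra. apply Rdiv_lt_0_compat; lra. }
assert (He11 : e1 <= 1) by apply Rmin_l.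
assert (He12 : e1 * (Cmod l + Cmod m + 2) <= e).
{ apply Rle_trans with (e / (Cmod l + Cmod m + 2) * (Cmod l + Cmod m + 2)).
  apply Rmult_le_compat_r. lra. apply Rmin_r. right. field. lra. }
destruct (HF e1 He1) as [d1 [Hd1 H1]]. destruct (Hg e1 He1) as [d2 [Hd2 H2]].
destruct (Cg d1 Hd1) as [d3 [Hd3 H3]].
exists (Rmin d2 d3). split. now apply Rmin_pos.
intros s Hs. specialize (H2 s (Rlt_le_trans _ _ _ Hs (Rmin_l _ _))).
specialize (H3 s (Rlt_le_trans _ _ _ Hs (Rmin_r _ _))).
specialize (H1 _ H3).
replace (F (g s) - F (g t) - l * m * RtoC (s - t))%C with
  ((F (g s) - F (g t) - l * (g s - g t)) + l * (g s - g t - m * RtoC (s - t)))%C by ring.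
apply Rle_trans with (1 := Cmod_triangle _ _). rewrite Cmod_mult.
assert (Cmod (g s - g t) <= (Cmod m + e1) * Rabs (s - t)).
{ replace (g s - g t)%C with ((g s - g t - m * RtoC (s - t)) + m * RtoC (s - t))%C by ring.
  apply Rle_trans with (1 := Cmod_triangle _ _). rewrite Cmod_mult, Cmod_R. lra. }
set (A := Cmod (g s - g t - m * RtoC (s - t))) in *. set (B := Cmod (g s - g t)) in *.
set (D := Cmod (F (g s) - F (g t) - l * (g s - g t))) in *.
pose proof (Rabs_pos (s - t)). set (h := Rabs (s - t)) in *.
apply Rle_trans with (e1 * ((Cmod m + e1) * h) + Cmod l * (e1 * h)).
- apply Rplus_le_compat. apply Rle_trans with (1 := H1). apply Rmult_le_compat_l; lra.
  apply Rmult_le_compat_l; lra.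
- replace (e1 * ((Cmod m + e1) * h) + Cmod l * (e1 * h)) with ((e1 * (Cmod l + Cmod m + e1)) * h) by ring.
  apply Rmult_le_compat_r; auto. nra.
Qed.

Lemma rd_line_h (y t : R) : rd (fun s => (s, y) : C) t (RtoC 1).
Proof.
intros e He. exists 1. split. lra. intros s _.
replace ((s, y) - (t, y) - 1 * RtoC (s - t))%C with (RtoC 0).
rewrite Cmod_0. apply Rmult_le_pos. lra. apply Rabs_pos.
apply injective_projections; simpl; ring.
Qed.

Lemma rd_line_v (x t : R) : rd (fun s => (x, s) : C) t Ci.
Proof.
intros e He. exists 1. split. lra. intros s _.
replace ((x, s) - (x, t) - Ci * RtoC (s - t))%C with (RtoC 0).
rewrite Cmod_0. apply Rmult_le_pos. lra. apply Rabs_pos.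
apply injective_projections; simpl; ring.
Qed.

Lemma Rc_comp (q : C -> C) (g : R -> C) (t : R) : Ccont q (g t) -> Rc g t -> Rc (fun s => q (g s)) t.
Proof.
intros Hq Hg e He. destruct (Hq e He) as [d [Hd H]]. destruct (Hg d Hd) as [d' [Hd' H']].
exists d'. auto.
Qed.

Lemma Rc_h (q : C -> C) (x y : R) : Ccont q (x, y) -> Rc (fun s => q (s, y)) x.
Proof. intros H. apply (Rc_comp q (fun s => (s, y))); auto. apply rd_Rc with (RtoC 1). apply rd_line_h. Qed.
Lemma Rc_v (q : C -> C) (x y : R) : Ccont q (x, y) -> Rc (fun s => q (x, s)) y.
Proof. intros H. apply (Rc_comp q (fun s => (x, s))); auto. apply rd_Rc with Ci. apply rd_line_v. Qed.
Global Opaque CI.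

(** The contour integral of [q] over the boundary of a rectangle, counterclockwise; [Ci] is dz / dt
    on the vertical sides. *)
Definition bd (q : C -> C) (x1 x2 y1 y2 : R) : C :=
  (CI (fun t => q (t, y1)) x1 x2 + Ci * CI (fun t => q (x2, t)) y1 y2
   - CI (fun t => q (t, y2)) x1 x2 - Ci * CI (fun t => q (x1, t)) y1 y2)%C.

Definition contR (q : C -> C) (x1 x2 y1 y2 : R) : Prop :=
  forall x y, x1 <= x <= x2 -> y1 <= y <= y2 -> Ccont q (x, y).

Lemma contR_ex_h (q : C -> C) (x1 x2 y1 y2 : R) : contR q x1 x2 y1 y2 ->
  forall y a b, y1 <= y <= y2 -> x1 <= a <= x2 -> x1 <= b <= x2 ->
  ex_RInt (V := CRV) (fun t => q (t, y)) a b.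
Proof.
intros H y a b Hy Ha Hb. apply CI_ex. intros t Ht. apply Rc_h. apply H; auto.
unfold Rmin, Rmax in Ht. destruct (Rle_dec a b); lra.
Qed.

Lemma contR_ex_v (q : C -> C) (x1 x2 y1 y2 : R) : contR q x1 x2 y1 y2 ->
  forall x a b, x1 <= x <= x2 -> y1 <= a <= y2 -> y1 <= b <= y2 ->
  ex_RInt (V := CRV) (fun t => q (x, t)) a b.
Proof.
intros H y a b Hy Ha Hb. apply CI_ex. intros t Ht. apply Rc_v. apply H; auto.
unfold Rmin, Rmax in Ht. destruct (Rle_dec a b); lra.
Qed.

Lemma bd_split_h (q : C -> C) (x1 x2 x3 y1 y2 : R) : contR q x1 x3 y1 y2 ->
  x1 <= x2 <= x3 -> y1 <= y2 -> bd q x1 x3 y1 y2 = (bd q x1 x2 y1 y2 + bd q x2 x3 y1 y2)%C.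
Proof.
intros H Hx Hy. unfold bd.
rewrite (CI_chasles (fun t => q (t, y1)) x1 x2 x3) by (apply (contR_ex_h _ _ _ _ _ H); lra).
rewrite (CI_chasles (fun t => q (t, y2)) x1 x2 x3) by (apply (contR_ex_h _ _ _ _ _ H); lra).
ring.
Qed.

Lemma bd_split_v (q : C -> C) (x1 x2 y1 y2 y3 : R) : contR q x1 x2 y1 y3 ->
  x1 <= x2 -> y1 <= y2 <= y3 -> bd q x1 x2 y1 y3 = (bd q x1 x2 y1 y2 + bd q x1 x2 y2 y3)%C.
Proof.
intros H Hx Hy. unfold bd.
rewrite (CI_chasles (fun t => q (x1, t)) y1 y2 y3) by (apply (contR_ex_v _ _ _ _ _ H); lra).
rewrite (CI_chasles (fun t => q (x2, t)) y1 y2 y3) by (apply (contR_ex_v _ _ _ _ _ H); lra).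
ring.
Qed.

Lemma bd_minus (q r : C -> C) (x1 x2 y1 y2 : R) : x1 <= x2 -> y1 <= y2 ->
  contR q x1 x2 y1 y2 -> contR r x1 x2 y1 y2 ->
  bd (fun z => q z - r z)%C x1 x2 y1 y2 = (bd q x1 x2 y1 y2 - bd r x1 x2 y1 y2)%C.
Proof.
intros Hx Hy Hq Hr. unfold bd. cbv beta.
rewrite (CI_minus (fun t => q (t, y1)) (fun t => r (t, y1)) x1 x2);
  [ | apply (contR_ex_h _ _ _ _ _ Hq y1); lra | apply (contR_ex_h _ _ _ _ _ Hr y1); lra].
rewrite (CI_minus (fun t => q (t, y2)) (fun t => r (t, y2)) x1 x2);
  [ | apply (contR_ex_h _ _ _ _ _ Hq y2); lra | apply (contR_ex_h _ _ _ _ _ Hr y2); lra].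
rewrite (CI_minus (fun t => q (x1, t)) (fun t => r (x1, t)) y1 y2);
  [ | apply (contR_ex_v _ _ _ _ _ Hq x1); lra | apply (contR_ex_v _ _ _ _ _ Hr x1); lra].
rewrite (CI_minus (fun t => q (x2, t)) (fun t => r (x2, t)) y1 y2);
  [ | apply (contR_ex_v _ _ _ _ _ Hq x2); lra | apply (contR_ex_v _ _ _ _ _ Hr x2); lra].
ring.
Qed.

Lemma RtoC_neq0 (r : R) : r <> 0 -> RtoC r <> RtoC 0.
Proof. intros H E. apply H. now injection E. Qed.

Lemma Cmod_Ci : Cmod Ci = 1.
Proof. unfold Cmod, Ci; simpl. replace (0 * (0 * 1) + 1 * (1 * 1)) with 1 by ring. apply sqrt_1. Qed.

Lemma Cmod_sum4 (a b c d : C) :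
  Cmod (a + Ci * b - c - Ci * d)%C <= Cmod a + Cmod b + Cmod c + Cmod d.
Proof.
unfold Cminus.
pose proof (Cmod_triangle (a + Ci * b + - c) (- (Ci * d))) as H1.
pose proof (Cmod_triangle (a + Ci * b) (- c)) as H2.
pose proof (Cmod_triangle a (Ci * b)) as H3.
rewrite Cmod_opp in H1, H2. rewrite Cmod_mult, Cmod_Ci in H1, H3. lra.
Qed.

Lemma bd_bound (q : C -> C) (x1 x2 y1 y2 M : R) : x1 <= x2 -> y1 <= y2 ->
  contR q x1 x2 y1 y2 ->
  (forall x y, x1 <= x <= x2 -> y1 <= y <= y2 -> Cmod (q (x, y)) <= M) ->
  Cmod (bd q x1 x2 y1 y2) <= 2 * M * ((x2 - x1) + (y2 - y1)).
Proof.
intros Hx Hy Hq HM. unfold bd.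
assert (B1 : Cmod (CI (fun t => q (t, y1)) x1 x2) <= M * (x2 - x1)).
{ apply CI_bound; auto. apply (contR_ex_h _ _ _ _ _ Hq); lra. intros; apply HM; lra. }
assert (B2 : Cmod (CI (fun t => q (t, y2)) x1 x2) <= M * (x2 - x1)).
{ apply CI_bound; auto. apply (contR_ex_h _ _ _ _ _ Hq); lra. intros; apply HM; lra. }
assert (B3 : Cmod (CI (fun t => q (x1, t)) y1 y2) <= M * (y2 - y1)).
{ apply CI_bound; auto. apply (contR_ex_v _ _ _ _ _ Hq); lra. intros; apply HM; lra. }
assert (B4 : Cmod (CI (fun t => q (x2, t)) y1 y2) <= M * (y2 - y1)).
{ apply CI_bound; auto. apply (contR_ex_v _ _ _ _ _ Hq); lra. intros; apply HM; lra. }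
apply Rle_trans with (1 := Cmod_sum4 _ _ _ _). lra.
Qed.

Lemma bd_exact (F q : C -> C) (x1 x2 y1 y2 : R) : x1 <= x2 -> y1 <= y2 ->
  contR q x1 x2 y1 y2 ->
  (forall x y, x1 <= x <= x2 -> y1 <= y <= y2 -> hd F (x, y) (q (x, y))) ->
  bd q x1 x2 y1 y2 = RtoC 0.
Proof.
intros Hx Hy Hq HF. unfold bd.
assert (Eh : forall y, y1 <= y <= y2 -> CI (fun t => q (t, y)) x1 x2 = (F (x2, y) - F (x1, y))%C).
{ intros y Hyy. apply (CI_FTC (fun t => F (t, y))); rewrite Rmin_left, Rmax_right by auto; intros t Ht.
  - apply rd_is_derive. rewrite <- (Cmult_1_r (q (t, y))).
    apply (rd_comp F (fun t => (t, y))). apply HF; lra. apply rd_line_h.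
  - apply Rc_h. apply Hq; lra. }
assert (Ev : forall x, x1 <= x <= x2 -> (Ci * CI (fun t => q (x, t)) y1 y2)%C = (F (x, y2) - F (x, y1))%C).
{ intros x Hxx. rewrite <- CI_mult by (apply (contR_ex_v _ _ _ _ _ Hq); lra).
  apply (CI_FTC (fun t => F (x, t))); rewrite Rmin_left, Rmax_right by auto; intros t Ht.
  - apply rd_is_derive. rewrite Cmult_comm.
    apply (rd_comp F (fun t => (x, t))). apply HF; lra. apply rd_line_v.
  - apply (Rc_comp (fun z => Ci * q z)%C (fun t => (x, t))).
    + apply (Clim_mult (Cnear (x, t)) (fun _ => Ci)). apply Clim_const, _. apply Hq; lra.
    + apply rd_Rc with Ci. apply rd_line_v. }
rewrite !Eh, !Ev by lra. ring.
Qed.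

Lemma Cmod_le_abs (x y : R) : Cmod (x, y) <= Rabs x + Rabs y.
Proof.
unfold Cmod; simpl. pose proof (Rabs_pos x). pose proof (Rabs_pos y).
rewrite <- (sqrt_square (Rabs x + Rabs y)) by lra. apply sqrt_le_1_alt.
rewrite !Rmult_1_r.
pose proof (Rsqr_abs x). pose proof (Rsqr_abs y). unfold Rsqr in *. nra.
Qed.

Section Bisection.
Variables (q : C -> C) (x1 x2 y1 y2 : R).
Hypothesis (Hx : x1 <= x2) (Hy : y1 <= y2).
Hypothesis (Hq : forall x y, x1 <= x <= x2 -> y1 <= y <= y2 -> exists l, hd q (x, y) l).

Let w n := (x2 - x1) * (/ 2) ^ n.
Let h n := (y2 - y1) * (/ 2) ^ n.
Let c := Cmod (bd q x1 x2 y1 y2).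
(** The invariant of the bisection: [p] is the lower left corner of a subrectangle obtained by [n]
    halvings, and its boundary integral has lost at most a factor 4 at each of them. *)
Let bad (n : nat) (p : R * R) : Prop :=
  x1 <= fst p /\ fst p + w n <= x2 /\ y1 <= snd p /\ snd p + h n <= y2 /\
  c * (/ 4) ^ n <= Cmod (bd q (fst p) (fst p + w n) (snd p) (snd p + h n)).

Let w_pos n : 0 <= w n.
Proof. apply Rmult_le_pos. lra. apply pow_le. lra. Qed.
Let h_pos n : 0 <= h n.
Proof. apply Rmult_le_pos. lra. apply pow_le. lra. Qed.

Let cont : contR q x1 x2 y1 y2.
Proof. intros x y H1 H2. destruct (Hq x y H1 H2) as [l Hl]. eapply hd_cont; eauto. Qed.

Let sub a b a' b' : x1 <= a -> b <= x2 -> y1 <= a' -> b' <= y2 -> contR q a b a' b'.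
Proof. intros H1 H2 H3 H4 x y Hx' Hy'. apply cont; lra. Qed.

Let step n p : bad n p -> exists p', bad (S n) p' /\
  fst p <= fst p' /\ fst p' + w (S n) <= fst p + w n /\
  snd p <= snd p' /\ snd p' + h (S n) <= snd p + h n.
Proof.
intros [B1 [B2 [B3 [B4 B5]]]]. destruct p as [a b]; simpl fst in *; simpl snd in *.
assert (Ew : w n = 2 * w (S n)) by (unfold w; simpl; field).
assert (Eh : h n = 2 * h (S n)) by (unfold h; simpl; field).
pose proof (w_pos (S n)) as Pw. pose proof (h_pos (S n)) as Ph.
rewrite Ew, Eh in *. set (u := w (S n)) in *. set (v := h (S n)) in *.
rewrite (bd_split_h q a (a + u) (a + 2 * u)) in B5 by (try apply sub; lra).
rewrite (bd_split_v q a (a + u) b (b + v) (b + 2 * v)) in B5 by (try apply sub; lra).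
rewrite (bd_split_v q (a + u) (a + 2 * u) b (b + v) (b + 2 * v)) in B5 by (try apply sub; lra).
replace (a + 2 * u) with (a + u + u) in * by ring. replace (b + 2 * v) with (b + v + v) in * by ring.
set (c1 := bd q a (a + u) b (b + v)) in *. set (c2 := bd q a (a + u) (b + v) (b + v + v)) in *.
set (c3 := bd q (a + u) (a + u + u) b (b + v)) in *. set (c4 := bd q (a + u) (a + u + u) (b + v) (b + v + v)) in *.
pose proof (Cmod_triangle (c1 + c2) (c3 + c4)). pose proof (Cmod_triangle c1 c2). pose proof (Cmod_triangle c3 c4).
assert (Ep : c * (/ 4) ^ n = 4 * (c * (/ 4) ^ S n)) by (simpl; field).
rewrite Ep in B5. set (e := c * (/ 4) ^ S n) in *.
destruct (Rle_lt_dec e (Cmod c1)) as [L1|L1].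
{ exists (a, b). unfold bad; simpl fst; simpl snd. fold u v c1 e. repeat split; lra. }
destruct (Rle_lt_dec e (Cmod c2)) as [L2|L2].
{ exists (a, b + v). unfold bad; simpl fst; simpl snd. fold u v c2 e. repeat split; lra. }
destruct (Rle_lt_dec e (Cmod c3)) as [L3|L3].
{ exists (a + u, b). unfold bad; simpl fst; simpl snd. fold u v c3 e. repeat split; lra. }
destruct (Rle_lt_dec e (Cmod c4)) as [L4|L4].
{ exists (a + u, b + v). unfold bad; simpl fst; simpl snd. fold u v c4 e. repeat split; lra. }
exfalso. lra.
Qed.

Let bad0 : bad 0 (x1, y1).
Proof.
unfold bad, w, h; simpl. rewrite !Rmult_1_r.
replace (x1 + (x2 - x1)) with x2 by ring. replace (y1 + (y2 - y1)) with y2 by ring.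
fold c. repeat split; lra.
Qed.

Let sq : forall n, {p | bad n p} := fix sq n :=
  match n with
  | O => exist _ (x1, y1) bad0
  | S n => let (p', H) := constructive_indefinite_description _ (step n (proj1_sig (sq n)) (proj2_sig (sq n))) in
           exist _ p' (proj1 H)
  end.

Let sx n := fst (proj1_sig (sq n)).
Let sy n := snd (proj1_sig (sq n)).

Let sq_step n : sx n <= sx (S n) /\ sx (S n) + w (S n) <= sx n + w n /\
  sy n <= sy (S n) /\ sy (S n) + h (S n) <= sy n + h n.
Proof.
unfold sx, sy. cbn -[w h]. destruct (constructive_indefinite_description _ _) as [p' [H1 H2]]. exact H2.
Qed.

Lemma nested_limit (u v : nat -> R) : (forall n, 0 <= v n) ->
  (forall n, u n <= u (S n) /\ u (S n) + v (S n) <= u n + v n) ->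
  exists l, forall n, u n <= l <= u n + v n.
Proof.
intros Hv Hs.
assert (H1 : forall n k, u n <= u (n + k)%nat).
{ intros n k. induction k. rewrite Nat.add_0_r; lra. replace (n + S k)%nat with (S (n + k)) by lia. destruct (Hs (n + k)%nat). lra. }
assert (H2 : forall n k, u (n + k)%nat + v (n + k)%nat <= u n + v n).
{ intros n k. induction k. rewrite Nat.add_0_r; lra. replace (n + S k)%nat with (S (n + k)) by lia. destruct (Hs (n + k)%nat). lra. }
assert (H3 : forall n m, u m <= u n + v n).
{ intros n m. destruct (Nat.le_ge_cases m n).
  - specialize (H1 m (n - m)%nat). replace (m + (n - m))%nat with n in H1 by lia. specialize (Hv n). lra.
  - specialize (H2 n (m - n)%nat). replace (n + (m - n))%nat with m in H2 by lia. specialize (Hv m). lra. }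
destruct (completeness (fun x => exists n, x = u n)) as [l [Hl1 Hl2]].
- exists (u 0%nat + v 0%nat). intros x [n ->]. apply H3.
- exists (u 0%nat). now exists 0%nat.
- exists l. intros n. split. apply Hl1. now exists n. apply Hl2. intros x [m ->]. apply H3.
Qed.

Lemma goursat : bd q x1 x2 y1 y2 = RtoC 0.
Proof.
apply Cmod_eq_0. fold c.
destruct (Rle_lt_dec c 0) as [Hc|Hc]. apply Rle_antisym; auto. apply Cmod_ge_0.
exfalso.
destruct (nested_limit sx w w_pos) as [x0 Hx0]. { intros n. destruct (sq_step n) as [? [? ?]]; auto. }
destruct (nested_limit sy h h_pos) as [y0 Hy0]. { intros n. destruct (sq_step n) as [? [? [? ?]]]; auto. }
assert (Bd : forall n, bad n (sx n, sy n)).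
{ intros n. generalize (proj2_sig (sq n)). unfold sx, sy. now destruct (proj1_sig (sq n)). }
assert (H00 : x1 <= x0 <= x2 /\ y1 <= y0 <= y2).
{ destruct (Bd 0%nat) as [B1 [B2 [B3 [B4 _]]]]. simpl fst in *; simpl snd in *.
  specialize (Hx0 0%nat). specialize (Hy0 0%nat). lra. }
destruct (Hq x0 y0) as [l Hl]; try tauto. rewrite hd_eps in Hl.
set (D := (x2 - x1) + (y2 - y1)). assert (HD : 0 <= D) by (unfold D; lra).
(* Makes [2 * e * (D * D) < c]. With p = (1/2)^N the nonlinear part of [q] is at most [e * (D * p)]
   on a perimeter [2 * (D * p)], so the integral is at most [2 * e * (D * D) * (p * p)], too small
   for a bad rectangle. *)
set (e := c / (4 * (D * D + 1))).
assert (He : 0 < e). { apply Rdiv_lt_0_compat; nra. }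
assert (Hec : e * (4 * (D * D + 1)) = c). { unfold e. field. nra. }
destruct (Hl e He) as [d [Hd H]].
destruct (pow_lt_1_zero (/ 2)) with (y := d / (D + 1)) as [N HN].
{ rewrite Rabs_pos_eq; lra. } { apply Rdiv_lt_0_compat; lra. }
specialize (HN N (Nat.le_refl _)). rewrite Rabs_pos_eq in HN by (apply pow_le; lra).
assert (Hp : 0 < (/ 2) ^ N) by (apply pow_lt; lra).
assert (HDN : D * (/ 2) ^ N < d).
{ apply Rlt_le_trans with ((D + 1) * (d / (D + 1))). 2: right; field; lra. nra. }
specialize (Hx0 N). specialize (Hy0 N). specialize (Bd N).
destruct Bd as [B1 [B2 [B3 [B4 B5]]]]. simpl fst in *; simpl snd in *.
set (a := sx N) in *. set (b := sy N) in *.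
set (z0 := (x0, y0) : C) in *.
(* The affine part of [q] at the limit point has a primitive, hence does not contribute to the
   boundary integral. *)
set (A := fun z : C => (q z0 + l * (z - z0))%C).
assert (HA : forall z, hd (fun z => q z0 * z + l * ((z - z0) * (z - z0) * RtoC (/ 2)))%C z (A z)).
{ intros z. unfold A. eapply hd_eq. apply hd_plus. apply hd_mult. apply hd_const. apply hd_id.
  apply hd_mult. apply hd_const. apply hd_mult. apply hd_mult; apply hd_minus; try apply hd_id; apply hd_const. apply hd_const.
  cbv beta. rewrite RtoC_inv by lra. field. }
assert (CA : contR A a (a + w N) b (b + h N)).
{ intros x y _ _. eapply hd_cont. apply hd_plus. apply hd_const. apply hd_mult. apply hd_const. apply hd_minus. apply hd_id. apply hd_const. }
assert (Cq : contR q a (a + w N) b (b + h N)) by (apply sub; auto).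
assert (EA : bd A a (a + w N) b (b + h N) = RtoC 0).
{ eapply bd_exact; auto; lra. }

assert (EqA : bd q a (a + w N) b (b + h N) = bd (fun z => q z - A z)%C a (a + w N) b (b + h N)).
{ rewrite bd_minus by (auto; lra). rewrite EA. ring. }
rewrite EqA in B5.
assert (EwD : w N + h N = D * (/ 2) ^ N) by (unfold w, h, D; ring).
assert (B6 : Cmod (bd (fun z => q z - A z)%C a (a + w N) b (b + h N)) <= 2 * (e * (D * (/ 2) ^ N)) * ((a + w N - a) + (b + h N - b))).
{ apply bd_bound; try lra.
  - intros x y H1 H2. apply (Clim_minus (Cnear (x, y))). apply Cq; auto. apply CA; auto.
  - intros x y H1 H2. unfold A.
    assert (Hxy : Cmod ((x, y) - z0) <= D * (/ 2) ^ N).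
    { replace ((x, y) - z0)%C with ((x - x0, y - y0) : C) by (apply injective_projections; simpl; ring).
      apply Rle_trans with (1 := Cmod_le_abs _ _). rewrite <- EwD.
      apply Rplus_le_compat; apply Rabs_le; lra. }
    replace (q (x, y) - (q z0 + l * ((x, y) - z0)))%C with (q (x, y) - q z0 - l * ((x, y) - z0))%C by ring.
    apply Rle_trans with (1 := H _ (Rle_lt_trans _ _ _ Hxy HDN)). apply Rmult_le_compat_l; lra. }
replace ((a + w N - a) + (b + h N - b)) with (D * (/ 2) ^ N) in B6 by lra.
assert (E4 : (/ 4) ^ N = (/ 2) ^ N * (/ 2) ^ N).
{ rewrite <- Rpow_mult_distr. f_equal. field. }
rewrite E4 in B5. set (p := (/ 2) ^ N) in *.

assert (c <= 2 * e * (D * D)). { apply Rmult_le_reg_r with (p * p); nra. }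
nra.
Qed.
End Bisection.

Lemma bd_flat_h (q : C -> C) (x y1 y2 : R) : bd q x x y1 y2 = RtoC 0.
Proof. unfold bd. rewrite !CI_point. ring. Qed.

Lemma bd_flat_v (q : C -> C) (x1 x2 y : R) : bd q x1 x2 y y = RtoC 0.
Proof. unfold bd. rewrite !CI_point. ring. Qed.

Lemma Cmod_small (z : C) : (forall e, 0 < e -> Cmod z <= e) -> z = RtoC 0.
Proof.
intros H. apply Cmod_eq_0. apply Rle_antisym; [|apply Cmod_ge_0].
apply le_epsilon. intros e He. rewrite Rplus_0_l. auto.
Qed.

Lemma Csub_eq0 (z w : C) : (z - w)%C = RtoC 0 -> z = w.
Proof. intros H. replace z with (z - w + w)%C by ring. rewrite H. ring. Qed.

Lemma Cmod_pair_ge (x y : R) : Rabs x <= Cmod (x, y) /\ Rabs y <= Cmod (x, y).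
Proof. split; [apply (Rle_trans _ _ _ (Rmax_l _ _) (Rmax_Cmod (x, y)))|apply (Rle_trans _ _ _ (Rmax_r _ _) (Rmax_Cmod (x, y)))]. Qed.

(** Goursat's lemma applies outside a box of half-width [s] around [p], and the box contributes at
    most [8 * M * s <= e], where [M] bounds [q] on it. Difference quotients, which are only known to
    be continuous at their centre, need this form. *)
Lemma goursat_except (q : C -> C) (p : C) (x1 x2 y1 y2 : R) :
  x1 <= x2 -> y1 <= y2 -> contR q x1 x2 y1 y2 ->
  (forall x y, x1 <= x <= x2 -> y1 <= y <= y2 -> (x, y) <> p -> exists l, hd q (x, y) l) ->
  bd q x1 x2 y1 y2 = RtoC 0.
Proof.
intros Hx Hy Hc Hq. destruct p as [p1 p2].
assert (Hno : forall a b a' b', x1 <= a <= b -> b <= x2 -> y1 <= a' <= b' -> b' <= y2 ->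
   ~ (a <= p1 <= b /\ a' <= p2 <= b') -> bd q a b a' b' = RtoC 0).
{ intros a b a' b' H1 H2 H3 H4 H5. apply goursat; try lra. intros x y H6 H7. apply Hq; try lra.
  intros E. injection E. intros -> ->. apply H5. lra. }
destruct (classic (x1 <= p1 <= x2 /\ y1 <= p2 <= y2)) as [[Hp1 Hp2]|Hp].
2: { apply Hno; auto; lra. }
apply Cmod_small. intros e He.
assert (Cp : Ccont q (p1, p2)) by (apply Hc; lra).
destruct (Cp 1 Rlt_0_1) as [d [Hd H]].
set (M := Cmod (q (p1, p2)) + 1).
assert (HM : 0 < M). { unfold M. pose proof (Cmod_ge_0 (q (p1, p2))). lra. }
set (s := Rmin (d / 4) (e / (8 * M))).
assert (Hs : 0 < s). { apply Rmin_pos. lra. apply Rdiv_lt_0_compat; lra. }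
assert (Hs1 : s <= d / 4) by apply Rmin_l.
assert (Hs2 : s * (8 * M) <= e).
{ apply Rle_trans with (e / (8 * M) * (8 * M)). apply Rmult_le_compat_r. lra. apply Rmin_r. right. field. lra. }
set (a := Rmax x1 (p1 - s)). set (b := Rmin x2 (p1 + s)).
set (a' := Rmax y1 (p2 - s)). set (b' := Rmin y2 (p2 + s)).
assert (Ha : x1 <= a <= p1) by (unfold a; split; [apply Rmax_l|apply Rmax_lub; lra]).
assert (Hb : p1 <= b <= x2) by (unfold b; split; [apply Rmin_glb; lra|apply Rmin_l]).
assert (Ha' : y1 <= a' <= p2) by (unfold a'; split; [apply Rmax_l|apply Rmax_lub; lra]).
assert (Hb' : p2 <= b' <= y2) by (unfold b'; split; [apply Rmin_glb; lra|apply Rmin_l]).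
assert (Ha2 : p1 - s <= a) by apply Rmax_r. assert (Hb2 : b <= p1 + s) by apply Rmin_r.
assert (Ha2' : p2 - s <= a') by apply Rmax_r. assert (Hb2' : b' <= p2 + s) by apply Rmin_r.
assert (E1 : bd q x1 a y1 y2 = RtoC 0).
{ unfold a, Rmax. destruct (Rle_dec x1 (p1 - s)) as [L|L]. apply Hno; lra. apply bd_flat_h. }
assert (E2 : bd q b x2 y1 y2 = RtoC 0).
{ unfold b, Rmin. destruct (Rle_dec x2 (p1 + s)) as [L|L]. apply bd_flat_h. apply Hno; lra. }
assert (E3 : bd q a b y1 a' = RtoC 0).
{ unfold a', Rmax. destruct (Rle_dec y1 (p2 - s)) as [L|L]. apply Hno; lra. apply bd_flat_v. }
assert (E4 : bd q a b b' y2 = RtoC 0).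
{ unfold b', Rmin. destruct (Rle_dec y2 (p2 + s)) as [L|L]. apply bd_flat_v. apply Hno; lra. }
assert (Hsub : forall u v u' v', x1 <= u -> v <= x2 -> y1 <= u' -> v' <= y2 -> contR q u v u' v').
{ intros u v u' v' ? ? ? ? x y ? ?. apply Hc; lra. }
rewrite (bd_split_h q x1 a x2) by (auto; lra). rewrite (bd_split_h q a b x2) by (try apply Hsub; lra).
rewrite (bd_split_v q a b y1 a' y2) by (try apply Hsub; lra). rewrite (bd_split_v q a b a' b' y2) by (try apply Hsub; lra).
rewrite E1, E2, E3, E4. replace (0 + (0 + (bd q a b a' b' + 0) + 0))%C with (bd q a b a' b') by ring.
apply Rle_trans with (2 * M * ((b - a) + (b' - a'))).
- apply bd_bound; try lra. apply Hsub; lra.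
  intros x y H1 H2. unfold M.
  assert (Hxy : Cmod ((x, y) - (p1, p2)) < d).
  { replace ((x, y) - (p1, p2))%C with ((x - p1, y - p2) : C) by (apply injective_projections; simpl; ring).
    apply Rle_lt_trans with (1 := Cmod_le_abs _ _).
    apply Rle_lt_trans with (s + s). 2: lra. apply Rplus_le_compat; apply Rabs_le; lra. }
  specialize (H _ Hxy). replace (q (x, y)) with (q (p1, p2) + (q (x, y) - q (p1, p2)))%C by ring.
  pose proof (Cmod_triangle (q (p1, p2)) (q (x, y) - q (p1, p2))). lra.
- apply Rle_trans with (2 * M * (4 * s)). apply Rmult_le_compat_l; lra. lra.
Qed.

Lemma CI_const (c : C) (a b : R) : CI (fun _ => c) a b = (c * RtoC (b - a))%C.
Proof.
rewrite (CI_FTC (fun t => c * RtoC t)%C (fun _ => c)).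
- rewrite RtoC_minus. ring.
- intros t _. apply rd_is_derive. intros e He. exists 1. split. lra. intros s _.
  replace (c * s - c * t - c * RtoC (s - t))%C with (RtoC 0) by (rewrite RtoC_minus; ring).
  rewrite Cmod_0. apply Rmult_le_pos. lra. apply Rabs_pos.
- intros t _ e He. exists 1. split. lra. intros s _. replace (c - c)%C with (RtoC 0) by ring. now rewrite Cmod_0.
Qed.

(** * Primitives on a disc *)

Section Primitive.
Variables (q : C -> C) (p : C) (rho : R).
Hypothesis Hc : forall z, Cmod z < rho -> Ccont q z.
Hypothesis Hd : forall z, Cmod z < rho -> z <> p -> exists l, hd q z l.

(** Integrates along the real axis and then vertically; both legs stay in the disc centred at 0. *)
Let Q (z : C) : C := (CI (fun t => q (t, 0)) 0 (fst z) + Ci * CI (fun t => q (fst z, t)) 0 (snd z))%C.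

Let bd_signed x1 x2 y1 y2 :
  (forall x y, Rmin x1 x2 <= x <= Rmax x1 x2 -> Rmin y1 y2 <= y <= Rmax y1 y2 -> Cmod (x, y) < rho) ->
  bd q x1 x2 y1 y2 = RtoC 0.
Proof.
assert (A : forall x1 x2 y1 y2, x1 <= x2 -> y1 <= y2 ->
  (forall x y, x1 <= x <= x2 -> y1 <= y <= y2 -> Cmod (x, y) < rho) -> bd q x1 x2 y1 y2 = RtoC 0).
{ clear x1 x2 y1 y2. intros x1 x2 y1 y2 Hx Hy H. apply goursat_except with p; auto.
  intros x y H1 H2. auto. }
assert (B : forall x1 x2 y1 y2, x1 <= x2 ->
  (forall x y, x1 <= x <= x2 -> Rmin y1 y2 <= y <= Rmax y1 y2 -> Cmod (x, y) < rho) -> bd q x1 x2 y1 y2 = RtoC 0).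
{ clear x1 x2 y1 y2. intros x1 x2 y1 y2 Hx H. destruct (Rle_lt_dec y1 y2) as [L|L].
  - rewrite Rmin_left, Rmax_right in H by auto. auto.
  - rewrite Rmin_right, Rmax_left in H by lra.
    assert (E : bd q x1 x2 y2 y1 = RtoC 0) by (apply A; auto; lra).
    unfold bd in *. assert (Cr : contR q x1 x2 y2 y1) by (intros x y H1 H2; auto).
    rewrite (CI_swap (fun t => q (x2, t)) y2 y1) by (apply (contR_ex_v _ _ _ _ _ Cr); lra).
    rewrite (CI_swap (fun t => q (x1, t)) y2 y1) by (apply (contR_ex_v _ _ _ _ _ Cr); lra).
    rewrite <- Copp_0. rewrite <- E. ring. }
intros H. destruct (Rle_lt_dec x1 x2) as [L|L].
- rewrite Rmin_left, Rmax_right in H by auto. auto.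
- rewrite (Rmin_right x1), (Rmax_left x1) in H by lra.
  assert (E : bd q x2 x1 y1 y2 = RtoC 0) by (apply B; auto; lra).
  unfold bd in *.
  rewrite (CI_swap (fun t => q (t, y1)) x2 x1). rewrite (CI_swap (fun t => q (t, y2)) x2 x1).
  rewrite <- Copp_0. rewrite <- E. ring.
  apply CI_ex. intros t Ht. rewrite Rmin_left, Rmax_right in Ht by lra. apply Rc_h. apply Hc, H; auto. split; [apply Rmin_r|apply Rmax_r].
  apply CI_ex. intros t Ht. rewrite Rmin_left, Rmax_right in Ht by lra. apply Rc_h. apply Hc, H; auto. split; [apply Rmin_l|apply Rmax_l].
Qed.

Lemma Cmod_mono (x y x' y' : R) : Rabs x <= Rabs x' -> Rabs y <= Rabs y' -> Cmod (x, y) <= Cmod (x', y').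
Proof.
intros H1 H2. unfold Cmod; simpl. apply sqrt_le_1_alt. rewrite !Rmult_1_r.
apply Rplus_le_compat; apply Rsqr_le_abs_1; auto.
Qed.

Lemma Rmin0_abs (u y : R) : Rmin 0 y <= u <= Rmax 0 y -> Rabs u <= Rabs y.
Proof.
intros H. unfold Rmin, Rmax in H. destruct (Rle_dec 0 y).
- rewrite !Rabs_pos_eq; lra.
- rewrite !Rabs_left1; lra.
Qed.

Lemma Rmin_max_abs (u a b : R) : Rmin a b <= u <= Rmax a b -> Rabs (u - a) <= Rabs (b - a).
Proof.
intros H. unfold Rmin, Rmax in H. destruct (Rle_dec a b).
- rewrite !Rabs_pos_eq; lra.
- rewrite !Rabs_left1; lra.
Qed.

Lemma primitive : exists P, forall z, Cmod z < rho -> hd P z (q z).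
Proof.
exists Q. intros z Hz. rewrite hd_eps. intros e He.
assert (He2 : 0 < e / 2) by lra.
destruct (Hc z Hz (e / 2) He2) as [d [Hd1 H]].
set (d' := Rmin (d / 2) ((rho - Cmod z) / 2)).
assert (Hd' : 0 < d') by (apply Rmin_pos; lra).
exists d'. split; auto. intros w Hw.
destruct z as [x y]. destruct w as [x' y'].
replace ((x', y') - (x, y))%C with ((x' - x, y' - y) : C) in * by (apply injective_projections; simpl; ring).
destruct (Cmod_pair_ge (x' - x) (y' - y)) as [Gx Gy].
assert (Hw1 : Cmod (x' - x, y' - y) < d / 2) by (apply Rlt_le_trans with (1 := Hw), Rmin_l).
assert (Hw2 : Cmod (x' - x, y' - y) < (rho - Cmod (x, y)) / 2) by (apply Rlt_le_trans with (1 := Hw), Rmin_r).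
assert (In1 : forall u v, Rabs (u - x) <= Rabs (x' - x) -> Rabs v <= Rabs y -> Cmod (u, v) < rho).
{ intros u v Hu Hv. replace ((u, v) : C) with ((x, v) + RtoC (u - x))%C by (apply injective_projections; simpl; ring).
  apply Rle_lt_trans with (1 := Cmod_triangle _ _).
  pose proof (Cmod_mono x v x y (Rle_refl _) Hv).
  rewrite Cmod_R.
  lra. }
assert (In2 : forall u v, Rabs (u - x) <= Rabs (x' - x) -> Rabs (v - y) <= Rabs (y' - y) -> Cmod ((u, v) - (x, y)) < d /\ Cmod (u, v) < rho).
{ intros u v Hu Hv. assert (E : Cmod ((u, v) - (x, y)) <= Rabs (x' - x) + Rabs (y' - y)).
  { replace ((u, v) - (x, y))%C with ((u - x, v - y) : C) by (apply injective_projections; simpl; ring).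
    apply Rle_trans with (1 := Cmod_le_abs _ _). lra. }
  split. lra. replace ((u, v) : C) with ((x, y) + ((u, v) - (x, y)))%C by ring.
  apply Rle_lt_trans with (1 := Cmod_triangle _ _). lra. }
assert (X1 : ex_RInt (V := CRV) (fun t => q (t, 0)) 0 x).
{ apply CI_ex. intros t Ht. apply Rc_h, Hc. apply Rle_lt_trans with (2 := Hz). apply Cmod_mono. now apply Rmin0_abs. rewrite Rabs_R0; apply Rabs_pos. }
assert (X2 : ex_RInt (V := CRV) (fun t => q (t, 0)) x x').
{ apply CI_ex. intros t Ht. apply Rc_h, Hc. apply In1. now apply Rmin_max_abs. rewrite Rabs_R0; apply Rabs_pos. }
assert (X3 : ex_RInt (V := CRV) (fun t => q (x', t)) 0 y).
{ apply CI_ex. intros t Ht. apply Rc_v, Hc. apply In1. apply Rle_refl. now apply Rmin0_abs. }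
assert (X4 : ex_RInt (V := CRV) (fun t => q (x', t)) y y').
{ apply CI_ex. intros t Ht. apply Rc_v, Hc. apply In2. apply Rle_refl. now apply Rmin_max_abs. }
assert (X5 : ex_RInt (V := CRV) (fun t => q (t, y)) x x').
{ apply CI_ex. intros t Ht. apply Rc_h, Hc. apply In1. now apply Rmin_max_abs. apply Rle_refl. }
(* This rectangle moves the horizontal leg from height 0 to height [y], so that the increment of [Q]
   involves only values of [q] near [(x, y)]. *)
assert (E0 : bd q x x' 0 y = RtoC 0).
{ apply bd_signed. intros u v Hu Hv. apply In1. now apply Rmin_max_abs. now apply Rmin0_abs. }
assert (EQ : (Q (x', y') - Q (x, y))%C = (CI (fun t => q (t, y)) x x' + Ci * CI (fun t => q (x', t)) y y')%C).
{ unfold Q; simpl fst; simpl snd. rewrite (CI_chasles _ 0 x x') by auto. rewrite (CI_chasles (fun t => q (x', t)) 0 y y') by auto.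
  unfold bd in E0.
  replace (CI (fun t => q (t, y)) x x' + Ci * CI (fun t => q (x', t)) y y')%C with
   (CI (fun t => q (t, y)) x x' + Ci * CI (fun t => q (x', t)) y y' + 0)%C by ring. rewrite <- E0. ring. }
rewrite EQ.
assert (ED : (CI (fun t => q (t, y)) x x' + Ci * CI (fun t => q (x', t)) y y' - q (x, y) * ((x' - x)%R, (y' - y)%R))%C =
  (CI (fun t => q (t, y) - q (x, y))%C x x' + Ci * CI (fun t => q (x', t) - q (x, y))%C y y')%C).
{ rewrite (CI_minus (fun t => q (t, y)) (fun _ => q (x, y))); auto.
  rewrite (CI_minus (fun t => q (x', t)) (fun _ => q (x, y))); auto.
  rewrite !CI_const. replace ((x' - x, y' - y) : C) with (RtoC (x' - x) + Ci * RtoC (y' - y))%C by (apply injective_projections; simpl; ring).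
  ring.
  apply (ex_RInt_const (V := CRV)). apply (ex_RInt_const (V := CRV)). }
rewrite ED.
assert (B1 : Cmod (CI (fun t => q (t, y) - q (x, y))%C x x') <= e / 2 * Rabs (x' - x)).
{ apply CI_bound_gen. apply (ex_RInt_minus (V := CRV)); auto. apply (ex_RInt_const (V := CRV)).
  intros t Ht. left. apply H. apply In2. now apply Rmin_max_abs. rewrite Rminus_diag, Rabs_R0. apply Rabs_pos. }
assert (B2 : Cmod (CI (fun t => q (x', t) - q (x, y))%C y y') <= e / 2 * Rabs (y' - y)).
{ apply CI_bound_gen. apply (ex_RInt_minus (V := CRV)); auto. apply (ex_RInt_const (V := CRV)).
  intros t Ht. left. apply H. apply In2. apply Rle_refl. now apply Rmin_max_abs. }
apply Rle_trans with (1 := Cmod_triangle _ _). rewrite Cmod_mult, Cmod_Ci.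
assert (e / 2 * Rabs (x' - x) <= e / 2 * Cmod (x' - x, y' - y)) by (apply Rmult_le_compat_l; lra).
assert (e / 2 * Rabs (y' - y) <= e / 2 * Cmod (x' - x, y' - y)) by (apply Rmult_le_compat_l; lra).
lra.
Qed.
End Primitive.

(** * Cauchy's formula *)

Definition circ (r t : R) : C := (r * cos t, r * sin t).
(** Means over circles stand in for contour integrals: since dz / (2 pi i z) is dt / (2 pi),
    Cauchy's kernel becomes [z / (z - a)]. *)
Definition mean (f : C -> C) (r : R) : C := (RtoC (/ (2 * PI)) * CI (fun t => f (circ r t)) 0 (2 * PI))%C.
Definition onc (f : C -> C) (r : R) : Prop := forall z, Cmod z = r -> Ccont f z.

Lemma Cmod_circ (r t : R) : 0 <= r -> Cmod (circ r t) = r.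
Proof.
intros Hr. unfold Cmod, circ; simpl. rewrite !Rmult_1_r.
pose proof (sin2_cos2 t) as H. unfold Rsqr in H.
replace (r * cos t * (r * cos t) + r * sin t * (r * sin t)) with (r * r * (sin t * sin t + cos t * cos t)) by ring.
rewrite H, Rmult_1_r. now apply sqrt_square.
Qed.

Lemma rd_pair (f g : R -> R) (t a b : R) :
  derivable_pt_lim f t a -> derivable_pt_lim g t b -> rd (fun s => (f s, g s) : C) t (a, b).
Proof.
intros Hf Hg e He. assert (He2 : 0 < e / 2) by lra.
destruct (Hf _ He2) as [d1 H1]. destruct (Hg _ He2) as [d2 H2].
exists (Rmin d1 d2). split. apply Rmin_pos; apply cond_pos.
intros s Hs.
destruct (Req_dec (s - t) 0) as [E|E].
{ replace s with t by lra. rewrite Rminus_diag. replace (_ - _ - _)%C with (RtoC 0) by ring. rewrite Cmod_0, Rabs_R0. lra. }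
specialize (H1 (s - t) E (Rlt_le_trans _ _ _ Hs (Rmin_l _ _))).
specialize (H2 (s - t) E (Rlt_le_trans _ _ _ Hs (Rmin_r _ _))).
replace (t + (s - t)) with s in * by ring.
replace ((f s, g s) - (f t, g t) - (a, b) * RtoC (s - t))%C with
  (((f s - f t) - a * (s - t), (g s - g t) - b * (s - t)) : C) by (apply injective_projections; simpl; ring).
apply Rle_trans with (1 := Cmod_le_abs _ _).
assert (A : forall u v, Rabs (u / (s - t) - v) < e / 2 -> Rabs (u - v * (s - t)) <= e / 2 * Rabs (s - t)).
{ intros u v Huv. replace (u - v * (s - t)) with ((u / (s - t) - v) * (s - t)) by now field.
  rewrite Rabs_mult. apply Rmult_le_compat_r. apply Rabs_pos. lra. }
apply A in H1. apply A in H2. lra.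
Qed.

Lemma rd_circ (r t : R) : rd (circ r) t (Ci * circ r t)%C.
Proof.
replace (Ci * circ r t)%C with ((r * - sin t, r * cos t) : C) by (apply injective_projections; simpl; ring).
apply rd_pair.
- apply (derivable_pt_lim_scal cos r t (- sin t)). apply derivable_pt_lim_cos.
- apply (derivable_pt_lim_scal sin r t (cos t)). apply derivable_pt_lim_sin.
Qed.

Lemma Rc_circ (f : C -> C) (r t : R) : 0 <= r -> onc f r -> Rc (fun t => f (circ r t)) t.
Proof.
intros Hr H. apply (Rc_comp f (circ r)). apply H. now apply Cmod_circ. eapply rd_Rc. apply rd_circ.
Qed.

Lemma ex_circ (f : C -> C) (r a b : R) : 0 <= r -> onc f r -> ex_RInt (V := CRV) (fun t => f (circ r t)) a b.
Proof. intros Hr H. apply CI_ex. intros t _. now apply Rc_circ. Qed.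

Lemma twopi_pos : 0 < 2 * PI.
Proof. pose proof PI_RGT_0. lra. Qed.

Section Mean.
Variable r : R.
Hypothesis Hr : 0 <= r.

Lemma mean_ext (f g : C -> C) : (forall z, Cmod z = r -> f z = g z) -> mean f r = mean g r.
Proof. intros H. unfold mean. f_equal. apply CI_ext. intros t _. apply H. now apply Cmod_circ. Qed.

Lemma mean_plus (f g : C -> C) : onc f r -> onc g r -> mean (fun z => f z + g z)%C r = (mean f r + mean g r)%C.
Proof.
intros Hf Hg. unfold mean. rewrite (CI_plus (fun t => f (circ r t)) (fun t => g (circ r t))); try now apply ex_circ.
ring.
Qed.

Lemma mean_minus (f g : C -> C) : onc f r -> onc g r -> mean (fun z => f z - g z)%C r = (mean f r - mean g r)%C.
Proof.
intros Hf Hg. unfold mean. rewrite (CI_minus (fun t => f (circ r t)) (fun t => g (circ r t))); try now apply ex_circ.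
ring.
Qed.

Lemma mean_mult (c : C) (f : C -> C) : onc f r -> mean (fun z => c * f z)%C r = (c * mean f r)%C.
Proof.
intros Hf. unfold mean. rewrite (CI_mult (fun t => f (circ r t))); try now apply ex_circ.
ring.
Qed.

Lemma mean_const (c : C) : mean (fun _ => c) r = c.
Proof.
unfold mean. rewrite CI_const. rewrite Rminus_0_r. pose proof twopi_pos as H.
rewrite RtoC_inv by lra. field. apply RtoC_neq0. lra.
Qed.

Lemma mean_conj (f : C -> C) : onc f r -> mean (fun z => Cconj (f z)) r = Cconj (mean f r).
Proof.
intros Hf. unfold mean. rewrite Cmult_conj.
assert (E : CI (fun t => Cconj (f (circ r t))) 0 (2 * PI) = Cconj (CI (fun t => f (circ r t)) 0 (2 * PI))).
{ apply CI_uniq. pose proof (CI_is _ _ _ (ex_circ f r 0 (2 * PI) Hr Hf)) as H.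
  pose proof (is_RInt_fct_extend_fst (U := R_NormedModule) (V := R_NormedModule) _ _ _ _ H) as H1.
  pose proof (is_RInt_fct_extend_snd (U := R_NormedModule) (V := R_NormedModule) _ _ _ _ H) as H2.
  apply (is_RInt_fct_extend_pair (U := R_NormedModule) (V := R_NormedModule)); simpl; auto.
  apply (is_RInt_opp (V := R_NormedModule)); auto. }
rewrite E. f_equal. unfold Cconj, RtoC; simpl. f_equal. ring.
Qed.

Lemma mean_bound_fun (f : C -> C) (g : C -> R) : onc f r -> onc (fun z => RtoC (g z)) r ->
  (forall z, Cmod z = r -> Cmod (f z) <= g z) -> Cmod (mean f r) <= fst (mean (fun z => RtoC (g z)) r).
Proof.
intros Hf Hg H. unfold mean. rewrite Cmod_mult, Cmod_R.
pose proof twopi_pos as Hp.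
rewrite Rabs_pos_eq by (left; now apply Rinv_0_lt_compat).
set (I := CI (fun t => RtoC (g (circ r t))) 0 (2 * PI)).
simpl fst. replace (_ - _) with (/ (2 * PI) * fst I) by ring.
apply Rmult_le_compat_l. left; now apply Rinv_0_lt_compat.
rewrite Cmod_norm.
apply (norm_RInt_le (V := CRV) (fun t => f (circ r t)) (fun t => g (circ r t)) 0 (2 * PI) _ (fst I)); auto.
- lra.
- intros t _. rewrite <- Cmod_norm. apply H. now apply Cmod_circ.
- apply CI_is. now apply ex_circ.
- apply (is_RInt_fct_extend_fst (U := R_NormedModule) (V := R_NormedModule) (fun t => RtoC (g (circ r t)))).
  apply CI_is. now apply (ex_circ (fun z => RtoC (g z))).
Qed.

Lemma mean_bound (f : C -> C) (M : R) : onc f r -> (forall z, Cmod z = r -> Cmod (f z) <= M) -> Cmod (mean f r) <= M.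
Proof.
intros Hf H. replace M with (fst (mean (fun z => RtoC M) r)).
apply (mean_bound_fun f (fun _ => M)); auto. intros z _. apply Clim_const, _.
now rewrite mean_const.
Qed.
End Mean.

Lemma Ccont_const (c z : C) : Ccont (fun _ => c) z.
Proof. apply Clim_const, _. Qed.
Lemma Ccont_id (z : C) : Ccont (fun w => w) z.
Proof. apply Clim_id. Qed.
Lemma Ccont_plus (f g : C -> C) (z : C) : Ccont f z -> Ccont g z -> Ccont (fun w => f w + g w)%C z.
Proof. apply (Clim_plus (Cnear z)). Qed.
Lemma Ccont_minus (f g : C -> C) (z : C) : Ccont f z -> Ccont g z -> Ccont (fun w => f w - g w)%C z.
Proof. apply (Clim_minus (Cnear z)). Qed.
Lemma Ccont_mult (f g : C -> C) (z : C) : Ccont f z -> Ccont g z -> Ccont (fun w => f w * g w)%C z.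
Proof. apply (Clim_mult (Cnear z)). Qed.
Lemma Ccont_inv (f : C -> C) (z : C) : f z <> RtoC 0 -> Ccont f z -> Ccont (fun w => / f w)%C z.
Proof. apply (Clim_inv (Cnear z)). Qed.
Lemma Ccont_div (f g : C -> C) (z : C) : g z <> RtoC 0 -> Ccont f z -> Ccont g z -> Ccont (fun w => f w / g w)%C z.
Proof. intros. apply Ccont_mult; auto. apply (Ccont_inv g); auto. Qed.
Lemma Ccont_conj (f : C -> C) (z : C) : Ccont f z -> Ccont (fun w => Cconj (f w)) z.
Proof.
intros H e He. destruct (H e He) as [d [Hd H']]. exists d. split; auto.
intros w Hw. rewrite <- Cminus_conj, Cmod_conj. auto.
Qed.
Lemma Ccont_pow (f : C -> C) (n : nat) (z : C) : Ccont f z -> Ccont (fun w => f w ^ n)%C z.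
Proof.
intros H. induction n; simpl. apply Ccont_const. now apply (Ccont_mult f (fun w => f w ^ n)%C).
Qed.

Lemma sub_neq0 (a b : C) : a <> b -> (a - b)%C <> RtoC 0.
Proof. intros H E. apply H. now apply Csub_eq0. Qed.

Section Cauchy.
Variables (f : C -> C) (rho : R).
Hypothesis Hf : holo (fun z => Cmod z < rho) f.

(** The difference quotient [q1] of [f] at [a] is continuous, and holomorphic away from [a]; so it
    has a primitive, and the mean of [q1 z * z] is 0. This is Cauchy's formula up to the mean of the
    kernel, found in [mean_kernel]. *)
Lemma mean_quot (a : C) (r : R) : Cmod a < r < rho ->
  mean (fun z => f z * (z / (z - a)))%C r = (f a * mean (fun z => z / (z - a))%C r)%C.
Proof.
intros [Har Hrr]. assert (Hr : 0 <= r) by (pose proof (Cmod_ge_0 a); lra).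
destruct (Hf a) as [l Hl]. lra.
destruct (proj2 (iff_refl _) Hl) as [q [Hq Hq']].
set (q1 := fun z => if excluded_middle_informative (z = a) then l else q z).
assert (Hq1 : forall w, (f w = f a + q1 w * (w - a))%C).
{ intros w. unfold q1. destruct (excluded_middle_informative (w = a)) as [->|E]. ring. apply Hq'. }
assert (Hne : forall z, Cmod z = r -> (z - a)%C <> RtoC 0).
{ intros z Hz. apply sub_neq0. intros ->. lra. }
assert (Hq1d : forall z, Cmod z < rho -> z <> a -> exists l, hd q1 z l).
{ intros z Hz Hza. destruct (Hf z Hz) as [m Hm].
  eexists. apply hd_ext_near with (f := fun w => ((f w - f a) / (w - a))%C).
  - exists (Cmod (z - a)). split. apply Cmod_gt_0. now apply sub_neq0.
    intros w Hw. rewrite (Hq1 w). field. apply sub_neq0. intros ->. rewrite Cmod_sub_sym in Hw. lra.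
  - apply hd_div. now apply sub_neq0. apply hd_minus. apply Hm. apply hd_const. apply hd_minus. apply hd_id. apply hd_const. }
assert (Hq1c : forall z, Cmod z < rho -> Ccont q1 z).
{ intros z Hz. destruct (classic (z = a)) as [->|E].
  - unfold Ccont. unfold q1 at 2. destruct (excluded_middle_informative (a = a)); [|tauto].
    intros e0 He. destruct (Hq e0 He) as [d [Hd H]]. exists d. split; auto.
    intros w Hw. unfold q1. destruct (excluded_middle_informative (w = a)); auto.
    replace (l - l)%C with (RtoC 0) by ring. now rewrite Cmod_0.
  - destruct (Hq1d z Hz E) as [m Hm]. eapply hd_cont; eauto. }
destruct (primitive q1 a rho Hq1c Hq1d) as [P HP].
assert (E0 : mean (fun z => q1 z * z)%C r = RtoC 0).
{ assert (E : (Ci * CI (fun t => q1 (circ r t) * circ r t)%C 0 (2 * PI))%C = RtoC 0).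
  { assert (Ex : onc (fun z => q1 z * z)%C r). { intros z Hz. apply Ccont_mult. apply Hq1c; lra. apply Ccont_id. }
    rewrite <- CI_mult by (now apply (ex_circ (fun z => q1 z * z)%C)).
    rewrite (CI_FTC (fun t => P (circ r t))).
    - unfold circ. rewrite cos_2PI, sin_2PI, cos_0, sin_0. ring.
    - intros t _. apply rd_is_derive. replace (Ci * (q1 (circ r t) * circ r t))%C with (q1 (circ r t) * (Ci * circ r t))%C by ring.
      apply (rd_comp P (circ r)). apply HP. rewrite Cmod_circ; lra. apply rd_circ.
    - intros t _. apply (Rc_circ (fun z => Ci * (q1 z * z))%C); auto. intros z Hz. apply Ccont_mult. apply Ccont_const. auto. }
  unfold mean. replace (CI (fun t => q1 (circ r t) * circ r t)%C 0 (2 * PI)) with (- Ci * (Ci * CI (fun t => q1 (circ r t) * circ r t) 0 (2 * PI)))%C.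
  rewrite E. ring.
  transitivity (- (Ci * Ci) * CI (fun t => q1 (circ r t) * circ r t)%C 0 (2 * PI))%C. ring.
  replace (Ci * Ci)%C with (RtoC (-1)) by (apply injective_projections; simpl; ring). rewrite <- RtoC_opp. replace (- -1) with 1 by ring. ring. }
assert (Cf : onc f r). { intros z Hz. destruct (Hf z) as [m Hm]. lra. eapply hd_cont; eauto. }
assert (Cz : onc (fun z => z / (z - a))%C r).
{ intros z Hz. apply Ccont_div; auto. apply Ccont_id. apply Ccont_minus. apply Ccont_id. apply Ccont_const. }
rewrite <- (mean_mult r Hr) by auto.
apply Csub_eq0. rewrite <- (mean_minus r Hr).
- rewrite <- E0. apply mean_ext; auto. intros z Hz. rewrite (Hq1 z). field. auto.
- intros z Hz. apply Ccont_mult; auto.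
- intros z Hz. apply Ccont_mult; auto. apply Ccont_const.
Qed.

Lemma mean_value (r : R) : 0 < r < rho -> mean f r = f (RtoC 0).
Proof.
intros [H1 H2]. assert (Hr : 0 <= r) by lra.
pose proof (mean_quot (RtoC 0) r) as H. rewrite Cmod_0 in H. specialize (H (conj H1 H2)).
assert (E : forall z, Cmod z = r -> (z / (z - 0))%C = RtoC 1).
{ intros z Hz. assert (z <> RtoC 0). { intros E. rewrite E, Cmod_0 in Hz. lra. }
  field. now replace (z - 0)%C with z by ring. }
transitivity (mean (fun z => f z * (z / (z - 0)))%C r).
{ apply mean_ext; auto. intros z Hz. rewrite E by auto. ring. }
rewrite H. rewrite (mean_ext r Hr _ (fun _ => RtoC 1)) by auto. rewrite mean_const. ring.
Qed.
End Cauchy.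

Lemma holo_onc (f : C -> C) (rho r : R) : r < rho -> holo (fun z => Cmod z < rho) f -> onc f r.
Proof. intros H Hf z Hz. destruct (Hf z) as [l Hl]. lra. eapply hd_cont; eauto. Qed.

Lemma Cmod_sqr (z : C) : (z * Cconj z)%C = RtoC (Cmod z * Cmod z).
Proof.
unfold Cmod. rewrite sqrt_sqrt. apply injective_projections; simpl; ring.
simpl. rewrite !Rmult_1_r. pose proof (Rle_0_sqr (fst z)). pose proof (Rle_0_sqr (snd z)). unfold Rsqr in *. lra.
Qed.

(** On the circle [z / (z - a)] is the conjugate of [/ (1 - Cconj a * z / (r * r))], which is
    holomorphic beyond the circle and equals 1 at 0; the mean value property applies to it. *)
Lemma mean_kernel (a : C) (r : R) : Cmod a < r -> mean (fun z => z / (z - a))%C r = RtoC 1.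
Proof.
intros Ha. pose proof (Cmod_ge_0 a) as Ha0. assert (Hr : 0 <= r) by lra.
set (k := fun z => (/ (1 - Cconj a * z / RtoC (r * r)))%C).
assert (Hrr : 0 < r * r) by nra.
assert (Hrn : RtoC (r * r) <> RtoC 0) by (apply RtoC_neq0; lra).
(* Between [r] and the modulus [r * r / Cmod a] of the pole; dividing by the average of [Cmod a] and
   [r] avoids an exception for [a = 0]. *)
set (rho := r * r / ((Cmod a + r) / 2)).
assert (Hrho : r < rho).
{ unfold rho. apply Rmult_lt_reg_r with ((Cmod a + r) / 2). lra.
  unfold Rdiv. rewrite (Rmult_assoc (r * r)), Rinv_l by lra. nra. }
assert (Hden : forall z, Cmod z < rho -> (1 - Cconj a * z / RtoC (r * r))%C <> RtoC 0).
{ intros z Hz E. apply Csub_eq0 in E. apply (f_equal Cmod) in E. rewrite Cmod_1 in E. unfold Cdiv in E. rewrite !Cmod_mult, Cmod_conj, Cmod_inv, Cmod_R, Rabs_pos_eq in E by (auto; lra).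
  assert (Cmod a * Cmod z = r * r). { rewrite <- (Rmult_1_l (r * r)). rewrite E. field. lra. }
  assert (Hz2 : Cmod z * ((Cmod a + r) / 2) < r * r).
  { apply Rlt_le_trans with (rho * ((Cmod a + r) / 2)). apply Rmult_lt_compat_r; lra. unfold rho. right. field. lra. }
  nra. }
assert (Hk : holo (fun z => Cmod z < rho) k).
{ intros z Hz. eexists. apply hd_inv. now apply Hden. apply hd_minus. apply hd_const. apply hd_mult. apply hd_mult. apply hd_const. apply hd_id. apply hd_const. }
assert (Mk : mean k r = RtoC 1).
{ rewrite (mean_value k rho Hk) by lra. unfold k. field. auto. }
transitivity (Cconj (mean k r)). 2: { rewrite Mk. apply injective_projections; simpl; ring. }
rewrite <- mean_conj; auto. 2: now apply holo_onc with rho.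
apply mean_ext; auto. intros z Hz. unfold k.
assert (Hzz : (z * Cconj z)%C = RtoC (r * r)) by (rewrite Cmod_sqr, Hz; auto).
rewrite Cinv_conj. 2: apply Hden; lra.
rewrite Cminus_conj. unfold Cdiv. rewrite !Cmult_conj, Cconj_conj, Cinv_conj by auto.
replace (Cconj (RtoC (r * r))) with (RtoC (r * r)) by (apply injective_projections; simpl; ring).
replace (Cconj 1) with (RtoC 1) by (apply injective_projections; simpl; ring).
rewrite <- Hzz.
assert (Hz0 : z <> RtoC 0). { intros E. rewrite E, Cmod_0 in Hz. lra. }
assert (Hz1 : Cconj z <> RtoC 0). { intros E. apply Hz0. rewrite <- (Cconj_conj z), E. apply injective_projections; simpl; ring. }
assert (Hza : (z - a)%C <> RtoC 0). { apply sub_neq0. intros E. rewrite <- E in Ha. lra. }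
field. repeat split; auto.
Qed.

Lemma cauchy (f : C -> C) (rho r : R) (a : C) : holo (fun z => Cmod z < rho) f -> Cmod a < r < rho ->
  f a = mean (fun z => f z * (z / (z - a)))%C r.
Proof. intros Hf H. rewrite (mean_quot f rho Hf a r H), mean_kernel by lra. ring. Qed.

(** * Schwarz's lemma and the identity theorem *)

Definition Dr (rho : R) (z : C) : Prop := Cmod z < rho.

Lemma Cmod_sub_ge (a b : C) : Cmod a - Cmod b <= Cmod (a - b)%C.
Proof.
pose proof (Cmod_triangle (a - b) b) as H. replace (a - b + b)%C with a in H by ring. lra.
Qed.

Lemma onc_ext (f g : C -> C) (r : R) : (forall z, f z = g z) -> onc f r -> onc g r.
Proof.
intros E H z Hz. unfold Ccont. rewrite <- E. now apply Clim_ext with f; [apply _|..|apply H].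
Qed.

Lemma kernel_bound (z a : C) (r : R) : Cmod z = r -> Cmod a < r -> Cmod (z / (z - a))%C <= r / (r - Cmod a).
Proof.
intros Hz Ha. pose proof (Cmod_ge_0 a).
assert (Hza : (z - a)%C <> RtoC 0). { apply sub_neq0. intros E. rewrite <- E in Ha. lra. }
unfold Cdiv. rewrite Cmod_mult, Cmod_inv, Hz by auto. apply Rmult_le_compat_l. lra.
apply Rinv_le_contravar. lra. rewrite <- Hz. apply Cmod_sub_ge.
Qed.

Lemma circle_sub_neq0 (z a : C) (r : R) : Cmod z = r -> Cmod a < r -> (z - a)%C <> RtoC 0.
Proof. intros Hz Ha. apply sub_neq0. intros E. rewrite <- E in Ha. lra. Qed.

Lemma onc_kernel (f : C -> C) (a : C) (r : R) : onc f r -> Cmod a < r -> onc (fun z => f z * (z / (z - a)))%C r.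
Proof.
intros Hf Ha z Hz. apply Ccont_mult; auto. apply Ccont_div. now apply circle_sub_neq0 with r.
apply Ccont_id. apply Ccont_minus. apply Ccont_id. apply Ccont_const.
Qed.

(* The Taylor coefficient with its remainder: Cauchy's formula applied to the
   kernel [z / (z - a)] after [n] divisions by [z]. *)
Definition rem (f : C -> C) (r : R) (n : nat) (a : C) : C :=
  mean (fun z => f z / z ^ n * (z / (z - a)))%C r.

Lemma Cpow_neq0 (z : C) (n : nat) : z <> RtoC 0 -> (z ^ n)%C <> RtoC 0.
Proof. apply Cpow_nz. Qed.

Lemma circle_neq0 (z : C) (r : R) : 0 < r -> Cmod z = r -> z <> RtoC 0.
Proof. intros Hr Hz E. rewrite E, Cmod_0 in Hz. lra. Qed.

Lemma onc_div_pow (f : C -> C) (r : R) (n : nat) : 0 < r -> onc f r -> onc (fun z => f z / z ^ n)%C r.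
Proof.
intros Hr Hf z Hz. apply Ccont_div. apply Cpow_neq0. now apply circle_neq0 with r. auto.
apply (Ccont_pow (fun z => z)). apply Ccont_id.
Qed.

Lemma rem_bound (f : C -> C) (r M : R) (n : nat) (a : C) : onc f r -> Cmod a < r ->
  (forall z, Cmod z = r -> Cmod (f z) <= M) -> Cmod (rem f r n a) <= M / r ^ n * (r / (r - Cmod a)).
Proof.
intros Hf Ha HM. pose proof (Cmod_ge_0 a). assert (Hr : 0 < r) by lra.
apply mean_bound. lra. apply (onc_kernel (fun z => f z / z ^ n)%C); auto. now apply onc_div_pow.
intros z Hz. rewrite Cmod_mult.
assert (Hz0 : z <> RtoC 0) by now apply circle_neq0 with r.
apply Rmult_le_compat; try apply Cmod_ge_0. 2: now apply kernel_bound.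
unfold Cdiv. rewrite Cmod_mult, Cmod_inv, Cmod_pow, Hz by now apply Cpow_neq0.
apply Rmult_le_compat_r; auto. left. apply Rinv_0_lt_compat. now apply pow_lt.
Qed.

(** Rests on z / (z - a) = 1 + a / (z - a). *)
Lemma rem_succ (f : C -> C) (r : R) (n : nat) (a : C) : onc f r -> Cmod a < r ->
  rem f r n a = (mean (fun z => f z / z ^ n)%C r + a * rem f r (S n) a)%C.
Proof.
intros Hf Ha. pose proof (Cmod_ge_0 a). assert (Hr : 0 < r) by lra. assert (Hr0 : 0 <= r) by lra.
unfold rem. assert (K : onc (fun z => f z / z ^ S n * (z / (z - a)))%C r).
{ apply (onc_kernel (fun z => f z / z ^ S n)%C); auto. now apply onc_div_pow. }
rewrite <- (mean_mult r Hr0) by auto. rewrite <- (mean_plus r Hr0).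
- apply mean_ext; auto. intros z Hz. simpl.
  assert (Hz0 : z <> RtoC 0) by now apply circle_neq0 with r.
  assert (Hzn : (z ^ n)%C <> RtoC 0) by now apply Cpow_neq0.
  assert (Hza : (z - a)%C <> RtoC 0) by now apply circle_sub_neq0 with r.
  field. auto.
- now apply onc_div_pow.
- intros z Hz. apply Ccont_mult. apply Ccont_const. now apply K.
Qed.

Lemma rem_0 (f : C -> C) (rho r : R) (a : C) : holo (Dr rho) f -> Cmod a < r < rho -> f a = rem f r 0 a.
Proof.
intros Hf H. pose proof (Cmod_ge_0 a). rewrite (cauchy f rho r a Hf H) at 1.
apply mean_ext. lra. intros z Hz. simpl. field. apply circle_sub_neq0 with r; lra.
Qed.

(** Two uses of [rem_succ] give f w - f 0 - m w = w^2 rem 2 w with a bounded remainder, so the mean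
    [m] is a derivative of [f] at 0, and derivatives are unique. *)
Lemma coef1 (f : C -> C) (rho r M : R) (l : C) : holo (Dr rho) f -> 0 < r < rho ->
  (forall z, Cmod z = r -> Cmod (f z) <= M) ->
  hd f (RtoC 0) l -> mean (fun z => f z / z ^ 1)%C r = l.
Proof.
intros Hf Hr HM Hl. apply (hd_unique f (RtoC 0)); auto.
assert (Hc : onc f r) by (apply holo_onc with rho; auto; lra).
set (m := mean (fun z => f z / z ^ 1)%C r).
assert (HM0 : 0 <= M).
{ apply Rle_trans with (1 := Cmod_ge_0 (f (RtoC r))). apply HM. rewrite Cmod_R, Rabs_pos_eq; lra. }
set (K := M / r ^ 2 * (r / (r - r / 2))).
assert (HK : 0 <= K).
{ unfold K. apply Rmult_le_pos. apply Rmult_le_pos; auto. left. apply Rinv_0_lt_compat. apply pow_lt; lra.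
  apply Rmult_le_pos. lra. left. apply Rinv_0_lt_compat. lra. }
rewrite hd_eps. intros e He.
exists (Rmin (r / 2) (e / (K + 1))). split.
{ apply Rmin_pos. lra. apply Rdiv_lt_0_compat; lra. }
intros w Hw. replace (w - 0)%C with w in * by ring.
assert (Hw1 : Cmod w < r / 2) by (apply Rlt_le_trans with (1 := Hw), Rmin_l).
assert (Hw2 : Cmod w * (K + 1) < e).
{ apply Rlt_le_trans with (e / (K + 1) * (K + 1)). apply Rmult_lt_compat_r. lra. apply Rlt_le_trans with (1 := Hw), Rmin_r. right. field. lra. }
rewrite (rem_0 f rho r w) by (auto; lra). rewrite (rem_0 f rho r 0) by (auto; rewrite Cmod_0; lra).
rewrite (rem_succ f r 0 w), (rem_succ f r 1 w), (rem_succ f r 0 0) by (auto; rewrite ?Cmod_0; lra).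
fold m.
replace (_ - _ - _)%C with (w * (w * rem f r 2 w))%C by ring.
rewrite !Cmod_mult.
assert (Hb : Cmod (rem f r 2 w) <= K).
{ apply Rle_trans with (1 := rem_bound f r M 2 w Hc ltac:(lra) HM). unfold K. apply Rmult_le_compat_l.
  apply Rmult_le_pos; auto. left. apply Rinv_0_lt_compat. apply pow_lt; lra.
  apply Rmult_le_compat_l. lra. apply Rinv_le_contravar; lra. }
pose proof (Cmod_ge_0 w). rewrite Rmult_comm. apply Rmult_le_compat_r; auto.
apply Rle_trans with (Cmod w * K). apply Rmult_le_compat_l; auto. nra.
Qed.

Lemma schwarz_deriv (f : C -> C) (l : C) : holo disc f -> (forall z, disc z -> closed_disc (f z)) ->
  hd f (RtoC 0) l -> Cmod l <= 1.
Proof.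
intros Hf Hb Hl. destruct (Rle_lt_dec (Cmod l) 1) as [H|H]; auto. exfalso.
(* Midway between [/ Cmod l] and 1: Cauchy's estimate on this circle gives [Cmod l * r <= 1],
   whereas [Cmod l * r] is the average of [Cmod l] and 1. *)
set (r := (1 + / Cmod l) / 2).
assert (Hi : 0 < / Cmod l < 1).
{ split. apply Rinv_0_lt_compat; lra. rewrite <- Rinv_1. apply Rinv_lt_contravar; lra. }
assert (Hr : 0 < r < 1) by (unfold r; lra).
assert (HM : forall z, Cmod z = r -> Cmod (f z) <= 1). { intros z Hz. apply Hb. unfold disc. lra. }
pose proof (coef1 f 1 r 1 l Hf Hr HM Hl) as E.
assert (Hc : onc f r) by (apply holo_onc with 1; auto; lra).
assert (Cmod l <= 1 / r).
{ rewrite <- E. apply mean_bound. lra. apply onc_div_pow; auto; lra. intros z Hz.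
  assert (Hz0 : z <> RtoC 0) by (apply circle_neq0 with r; lra).
  unfold Cdiv. rewrite Cmod_mult, Cmod_inv, Cmod_pow, Hz, pow_1 by now apply Cpow_neq0.
  apply Rmult_le_compat_r; auto. left. apply Rinv_0_lt_compat. lra. }
assert (Cmod l * r <= 1). { apply Rle_trans with (1 / r * r). apply Rmult_le_compat_r; lra. right. field. lra. }
unfold r in H1. assert (Cmod l * / Cmod l = 1) by (apply Rinv_r; lra). nra.
Qed.

(** Provides the equality cases of Schwarz's lemma and of the maximum principle. Cauchy's formula
    bounds f - h at a point by a mean of |f - h|, the inequality x <= (d + x^2 / d) / 2 passes from
    there to the mean square, and radii with 1 - r^2 <= d^2 make the bound arbitrarily small. *)
Lemma eq_from_mean_square (f h : C -> C) : holo disc f -> holo disc h ->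
  (forall r, 0 < r < 1 -> fst (mean (fun z => (f z - h z) * Cconj (f z - h z))%C r) <= 1 - r * r) ->
  forall z, disc z -> f z = h z.
Proof.
intros Hf Hh Hm a Ha. apply Csub_eq0.
set (g := fun z => (f z - h z)%C).
assert (Hg : holo (Dr 1) g).
{ intros z Hz. destruct (Hf z Hz) as [l Hl]. destruct (Hh z Hz) as [m Hm']. exists (l - m)%C. now apply hd_minus. }
change (g a = RtoC 0). apply Cmod_small. intros e He. unfold disc in Ha.
pose proof (Cmod_ge_0 a).
set (K := 2 / (1 - Cmod a)).
assert (HK : 0 < K) by (apply Rdiv_lt_0_compat; lra).
set (d := Rmin 1 (e / K)). assert (Hd : 0 < d). { apply Rmin_pos. lra. now apply Rdiv_lt_0_compat. }

assert (Hd2 : d * K <= e). { apply Rle_trans with (e / K * K). apply Rmult_le_compat_r. lra. apply Rmin_r. right. field. lra. }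
set (r := Rmax ((1 + Cmod a) / 2) (1 - d * d / 4)).
assert (Hr1 : (1 + Cmod a) / 2 <= r) by apply Rmax_l.
assert (Hr2 : 1 - d * d / 4 <= r) by apply Rmax_r.
assert (Hr3 : r < 1). { unfold r. apply Rmax_lub_lt. lra. nra. }
assert (Hrr : 1 - r * r <= d * d) by nra.
assert (Hc : onc g r) by (apply holo_onc with 1; auto; lra).
rewrite (cauchy g 1 r a Hg) by lra.
assert (Hcg : onc (fun z => (g z) * Cconj (g z))%C r).
{ intros z Hz. apply Ccont_mult; auto. now apply Ccont_conj, Hc. }
set (u := fun z => K / 2 * (d + Cmod (g z) * Cmod (g z) / d)).
assert (Eu : forall z, RtoC (u z) = (RtoC (K / 2 * d) + RtoC (K / 2 / d) * (g z * Cconj (g z)))%C).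
{ intros z. rewrite Cmod_sqr, <- RtoC_mult, <- RtoC_plus. f_equal. unfold u. field. lra. }
assert (Hcu : onc (fun z => RtoC (K / 2 / d) * (g z * Cconj (g z)))%C r).
{ intros z Hz. apply Ccont_mult. apply Ccont_const. auto. }
apply Rle_trans with (fst (mean (fun z => RtoC (u z)) r)).
- apply mean_bound_fun. lra. apply onc_kernel; auto; lra.
  + apply (onc_ext (fun z => RtoC (K / 2 * d) + RtoC (K / 2 / d) * (g z * Cconj (g z)))%C).
    intros w. now rewrite Eu. intros z Hz. apply Ccont_plus. apply Ccont_const. auto.
  + intros z Hz. rewrite Cmod_mult. unfold u.
    assert (B1 : Cmod (z / (z - a)) <= K).
    { apply Rle_trans with (1 := kernel_bound z a r Hz ltac:(lra)).
      apply Rle_trans with (1 / (r - Cmod a)). apply Rmult_le_compat_r. left. apply Rinv_0_lt_compat. lra. lra.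
      unfold K. apply Rle_trans with (1 / ((1 - Cmod a) / 2)). apply Rmult_le_compat_l. lra. apply Rinv_le_contravar; lra.
      right. field. lra. }
    pose proof (Cmod_ge_0 (g z)) as G0. set (x := Cmod (g z)) in *.
    apply Rle_trans with (x * K). apply Rmult_le_compat_l; auto.
    assert (x <= (d + x * x / d) / 2).
    { assert (Q : 0 <= (x - d) * (x - d) / d). { apply Rmult_le_pos. apply (Rle_0_sqr (x - d)). left. now apply Rinv_0_lt_compat. }
      replace ((x - d) * (x - d) / d) with (x * x / d - 2 * x + d) in Q by (field; lra). lra. }
    nra.
- rewrite (mean_ext r ltac:(lra) _ _ (fun z _ => Eu z)).
  rewrite (mean_plus r ltac:(lra) (fun _ => RtoC (K / 2 * d))) by (auto; intros z Hz; apply Ccont_const).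
  rewrite mean_const, (mean_mult r ltac:(lra)) by (auto; lra).
  specialize (Hm r ltac:(lra)). change (fun z => ((f z - h z) * Cconj (f z - h z))%C) with (fun z => (g z * Cconj (g z))%C) in Hm.
  set (S := mean (fun z => (g z * Cconj (g z))%C) r) in *.
  replace (fst (RtoC (K / 2 * d) + RtoC (K / 2 / d) * S)%C) with (K / 2 * d + K / 2 / d * fst S) by (simpl; ring).
  apply Rle_trans with (K / 2 * d + K / 2 / d * (d * d)).
  apply Rplus_le_compat_l. apply Rmult_le_compat_l. apply Rmult_le_pos. lra. left. now apply Rinv_0_lt_compat. lra.
  replace (K / 2 * d + K / 2 / d * (d * d)) with (d * K) by (field; lra). auto.
Qed.

Lemma fst_le_Cmod (z : C) : fst z <= Cmod z.
Proof. apply Rle_trans with (1 := Rle_abs _). destruct z as [x y]. apply Cmod_pair_ge. Qed.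

Lemma mean_square (f h : C -> C) (r : R) : 0 <= r -> onc f r -> onc h r ->
  (forall z, Cmod z = r -> Cmod (f z) <= 1) ->
  fst (mean (fun z => (f z - h z) * Cconj (f z - h z))%C r) <=
  1 - 2 * fst (mean (fun z => f z * Cconj (h z))%C r) + fst (mean (fun z => h z * Cconj (h z))%C r).
Proof.
intros Hr Hf Hh Hb.
assert (C1 : onc (fun z => f z * Cconj (f z))%C r) by (intros z Hz; apply Ccont_mult; auto; now apply Ccont_conj, Hf).
assert (C2 : onc (fun z => f z * Cconj (h z))%C r) by (intros z Hz; apply Ccont_mult; auto; now apply Ccont_conj, Hh).
assert (C3 : onc (fun z => h z * Cconj (h z))%C r) by (intros z Hz; apply Ccont_mult; auto; now apply Ccont_conj, Hh).
assert (C4 : onc (fun z => Cconj (f z * Cconj (h z)))%C r) by (intros z Hz; now apply Ccont_conj, C2).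
rewrite (mean_ext r Hr _ (fun z => f z * Cconj (f z) - f z * Cconj (h z) - Cconj (f z * Cconj (h z)) + h z * Cconj (h z))%C).
2: { intros z _. rewrite Cminus_conj, Cmult_conj, Cconj_conj. ring. }
rewrite (mean_plus r Hr (fun z => f z * Cconj (f z) - f z * Cconj (h z) - Cconj (f z * Cconj (h z)))%C); auto.
rewrite (mean_minus r Hr (fun z => f z * Cconj (f z) - f z * Cconj (h z))%C); auto.
rewrite (mean_minus r Hr (fun z => f z * Cconj (f z))%C); auto.
rewrite (mean_conj r Hr); auto.
assert (B : fst (mean (fun z => f z * Cconj (f z))%C r) <= 1).
{ apply Rle_trans with (1 := fst_le_Cmod _). apply mean_bound; auto. intros z Hz.
  rewrite Cmod_mult, Cmod_conj. specialize (Hb z Hz). pose proof (Cmod_ge_0 (f z)). nra. }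
generalize dependent (mean (fun z => f z * Cconj (f z))%C r). generalize (mean (fun z => f z * Cconj (h z))%C r). generalize (mean (fun z => h z * Cconj (h z))%C r).
intros u v w B. simpl. lra.
all: intros z Hz; repeat apply Ccont_minus; auto.
Qed.

(** The mean of [f z * Cconj z] is r^2 times the derivative at 0, so the mean square of f z - z is
    at most 1 - 2 r^2 + r^2 = 1 - r^2. *)
Lemma schwarz_id (f : C -> C) : holo disc f -> (forall z, disc z -> closed_disc (f z)) ->
  hd f (RtoC 0) (RtoC 1) -> forall z, disc z -> f z = z.
Proof.
intros Hf Hb Hl. assert (Hh : holo disc (fun z => z)) by (intros z _; eexists; apply hd_id).
apply eq_from_mean_square; auto. intros r Hr.
assert (Hc : onc f r) by (apply holo_onc with 1; auto; lra).
assert (HM : forall z, Cmod z = r -> Cmod (f z) <= 1). { intros z Hz. apply Hb. unfold disc. lra. }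
apply Rle_trans with (1 := mean_square f (fun z => z) r ltac:(lra) Hc (fun z _ => Ccont_id z) HM).
pose proof (coef1 f 1 r 1 _ Hf ltac:(lra) HM Hl) as E.
rewrite (mean_ext r ltac:(lra) (fun z => z * Cconj z)%C (fun _ => RtoC (r * r))).
2: { intros z Hz. now rewrite Cmod_sqr, Hz. }
rewrite (mean_ext r ltac:(lra) (fun z => f z * Cconj z)%C (fun z => RtoC (r * r) * (f z / z ^ 1))%C).
2: { intros z Hz. rewrite <- Hz, <- Cmod_sqr. simpl. field. apply circle_neq0 with r; lra. }
rewrite mean_mult, E, mean_const; try lra. simpl. lra. apply onc_div_pow; auto; lra.
Qed.

Lemma schwarz_rot (f : C -> C) (u : C) : holo disc f -> (forall z, disc z -> closed_disc (f z)) ->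
  hd f (RtoC 0) u -> Cmod u = 1 -> forall z, disc z -> f z = (u * z)%C.
Proof.
intros Hf Hb Hl Hu z Hz.
assert (Eu : (Cconj u * u)%C = RtoC 1). { rewrite Cmult_comm, Cmod_sqr, Hu. f_equal. ring. }
replace (f z) with (u * (Cconj u * f z))%C.
- f_equal. apply (schwarz_id (fun z => Cconj u * f z)%C); auto.
  + intros w Hw. destruct (Hf w Hw) as [l Hl']. eexists. apply hd_mult. apply hd_const. apply Hl'.
  + intros w Hw. unfold closed_disc. rewrite Cmod_mult, Cmod_conj, Hu, Rmult_1_l. now apply Hb.
  + eapply hd_eq. apply hd_mult. apply hd_const. apply Hl. cbv beta. rewrite Eu. ring.
- transitivity (Cconj u * u * f z)%C. ring. rewrite Eu. ring.
Qed.

(** By the mean value property the mean square of the distance to the value at 0 is at most 1 - 2 +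
    1 = 0. *)
Lemma schwarz_const (f : C -> C) : holo disc f -> (forall z, disc z -> closed_disc (f z)) ->
  Cmod (f (RtoC 0)) = 1 -> forall z, disc z -> f z = f (RtoC 0).
Proof.
intros Hf Hb Hl. set (c := f (RtoC 0)) in *. assert (Hh : holo disc (fun z => c)) by (intros z _; eexists; apply hd_const).
apply (eq_from_mean_square f (fun _ => c)); auto. intros r Hr.
assert (Hc : onc f r) by (apply holo_onc with 1; auto; lra).
assert (HM : forall z, Cmod z = r -> Cmod (f z) <= 1). { intros z Hz. apply Hb. unfold disc. lra. }
apply Rle_trans with (1 := mean_square f (fun _ => c) r ltac:(lra) Hc (fun z _ => Ccont_const c z) HM).
rewrite (mean_ext r ltac:(lra) (fun z => f z * Cconj c)%C (fun z => Cconj c * f z)%C) by (intros; ring).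
rewrite mean_mult by (auto; lra).
rewrite (mean_value f 1) by (auto; lra). fold c.
rewrite (Cmult_comm (Cconj c)), mean_const by lra. rewrite Cmod_sqr, Hl. simpl. nra.
Qed.

Lemma pow_small_le (x K M : R) : 0 <= x < 1 -> 0 <= K -> (forall n, M <= K * x ^ n) -> M <= 0.
Proof.
intros Hx HK H. apply le_epsilon. intros e He. rewrite Rplus_0_l.
destruct (pow_lt_1_zero x ltac:(rewrite Rabs_pos_eq; lra) (e / (K + 1))) as [N HN].
apply Rdiv_lt_0_compat; lra. specialize (HN N (Nat.le_refl _)). specialize (H N).
rewrite Rabs_pos_eq in HN by (apply pow_le; lra).
apply Rle_trans with (1 := H). apply Rle_trans with (K * (e / (K + 1))). apply Rmult_le_compat_l; lra.
apply Rmult_le_reg_r with (K + 1). lra. replace (K * (e / (K + 1)) * (K + 1)) with (K * e) by (field; lra). nra.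
Qed.

(** Zeros accumulating at 0 kill the Taylor coefficients one after the other, so f w = w^n rem n w
    for every n, and the estimate of the remainder is geometric with ratio |a| / r < 1. *)
Lemma identity0 (f : C -> C) (rho M : R) : holo (Dr rho) f ->
  (forall z, Dr rho z -> Cmod (f z) <= M) ->
  (forall d, 0 < d -> exists z, z <> RtoC 0 /\ Cmod z < d /\ f z = RtoC 0) ->
  forall z, Dr rho z -> f z = RtoC 0.
Proof.
intros Hf HM Hz a Ha. unfold Dr in *.
set (r := (Cmod a + rho) / 2). pose proof (Cmod_ge_0 a).
assert (Hr : Cmod a < r < rho) by (unfold r; lra).
assert (Hc : onc f r) by (apply holo_onc with rho; auto; lra).
assert (HMr : forall z, Cmod z = r -> Cmod (f z) <= M) by (intros; apply HM; lra).
assert (HM0 : 0 <= M).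
{ apply Rle_trans with (1 := Cmod_ge_0 (f a)). apply HM. lra. }
assert (T : forall n w, Cmod w < r -> f w = (w ^ n * rem f r n w)%C).
{ induction n; intros w Hw.
  - simpl. rewrite Cmult_1_l. apply rem_0 with rho; auto; lra.
  - rewrite IHn by auto. rewrite rem_succ by auto.
    set (c := mean (fun z => f z / z ^ n)%C r).
    assert (Ec : c = RtoC 0).
    { apply Cmod_small. intros e He.
      set (K := M / r ^ S n * (r / (r - r / 2))).
      assert (HK : 0 <= K).
      { unfold K. apply Rmult_le_pos. apply Rmult_le_pos; auto. left. apply Rinv_0_lt_compat. apply pow_lt; lra.
        apply Rmult_le_pos. lra. left. apply Rinv_0_lt_compat. lra. }
      destruct (Hz (Rmin (r / 2) (e / (K + 1)))) as [v [Hv0 [Hv1 Hv2]]].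
      { apply Rmin_pos. lra. apply Rdiv_lt_0_compat; lra. }
      assert (Hv3 : Cmod v < r / 2) by (apply Rlt_le_trans with (1 := Hv1), Rmin_l).
      assert (Hv4 : Cmod v * (K + 1) < e).
      { apply Rlt_le_trans with (e / (K + 1) * (K + 1)). apply Rmult_lt_compat_r. lra. apply Rlt_le_trans with (1 := Hv1), Rmin_r. right. field. lra. }
      assert (E1 : rem f r n v = RtoC 0).
      { specialize (IHn v ltac:(lra)). rewrite Hv2 in IHn. destruct (classic (rem f r n v = RtoC 0)) as [E|E]; auto.
        exfalso. symmetry in IHn. revert IHn. apply Cmult_neq_0; auto. now apply Cpow_neq0. }
      rewrite rem_succ in E1 by (auto; lra). fold c in E1.
      replace c with (- (v * rem f r (S n) v))%C.
      2: { replace c with (c + v * rem f r (S n) v - v * rem f r (S n) v)%C by ring. rewrite E1. ring. }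
      rewrite Cmod_opp, Cmod_mult.
      assert (Hb : Cmod (rem f r (S n) v) <= K).
      { apply Rle_trans with (1 := rem_bound f r M (S n) v Hc ltac:(lra) HMr). unfold K. apply Rmult_le_compat_l.
        apply Rmult_le_pos; auto. left. apply Rinv_0_lt_compat. apply pow_lt; lra.
        apply Rmult_le_compat_l. lra. apply Rinv_le_contravar; lra. }
      pose proof (Cmod_ge_0 v). apply Rle_trans with (Cmod v * K). apply Rmult_le_compat_l; auto. nra. }
    rewrite Ec. simpl. ring. }
apply Cmod_eq_0. apply Rle_antisym; [|apply Cmod_ge_0].
assert (0 < / r) by (apply Rinv_0_lt_compat; lra).
assert (0 < / (r - Cmod a)) by (apply Rinv_0_lt_compat; lra).
apply pow_small_le with (x := Cmod a / r) (K := M * (r / (r - Cmod a))).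
- split. apply Rmult_le_pos; lra. apply Rmult_lt_reg_r with r. lra. replace (Cmod a / r * r) with (Cmod a) by (field; lra). lra.
- apply Rmult_le_pos; auto. apply Rmult_le_pos; lra.
- intros n. rewrite (T n) by lra. rewrite Cmod_mult, Cmod_pow.
  apply Rle_trans with (Cmod a ^ n * (M / r ^ n * (r / (r - Cmod a)))).
  apply Rmult_le_compat_l. now apply pow_le. apply rem_bound; auto; lra.
  right. unfold Rdiv. rewrite Rpow_mult_distr, pow_inv. ring.
Qed.

Lemma identity (f : C -> C) (z0 : C) (rho M : R) : holo (fun z => Cmod (z - z0)%C < rho) f ->
  (forall z, Cmod (z - z0)%C < rho -> Cmod (f z) <= M) ->
  (forall d, 0 < d -> exists z, z <> z0 /\ Cmod (z - z0)%C < d /\ f z = RtoC 0) ->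
  forall z, Cmod (z - z0)%C < rho -> f z = RtoC 0.
Proof.
intros Hf HM Hz z Hzr.
replace z with (z - z0 + z0)%C by ring.
apply (identity0 (fun w => f (w + z0)%C) rho M); auto.
- intros w Hw. destruct (Hf (w + z0)%C) as [l Hl]. now replace (w + z0 - z0)%C with w by ring.
  exists (l * (RtoC 1 + RtoC 0))%C. apply (hd_comp f (fun w => (w + z0)%C)); auto. apply hd_plus. apply hd_id. apply hd_const.
- intros w Hw. apply HM. now replace (w + z0 - z0)%C with w by ring.
- intros d Hd. destruct (Hz d Hd) as [v [H1 [H2 H3]]]. exists (v - z0)%C. repeat split; auto.
  now apply sub_neq0. now replace (v - z0 + z0)%C with v by ring.
Qed.

(** * Inequalities for the tetrablock *)

Definition N2 (z : C) : R := fst z * fst z + snd z * snd z.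

Lemma N2_Cmod (z : C) : N2 z = Cmod z * Cmod z.
Proof.
unfold N2, Cmod. rewrite sqrt_sqrt; simpl; nra.
Qed.

Lemma N2_nonneg (z : C) : 0 <= N2 z.
Proof. unfold N2. nra. Qed.

Lemma N2_mult (a b : C) : N2 (a * b)%C = N2 a * N2 b.
Proof. unfold N2; simpl; ring. Qed.

Lemma N2_pos (z : C) : z <> RtoC 0 -> 0 < N2 z.
Proof. intros H. rewrite N2_Cmod. pose proof (proj1 (Cmod_gt_0 z) H). nra. Qed.

Lemma N2_div (a b : C) : b <> RtoC 0 -> N2 (a / b)%C = N2 a / N2 b.
Proof.
intros H. pose proof (N2_pos b H) as Hb.
assert (E : N2 (a / b * b)%C = N2 a). { f_equal. now field. }
rewrite N2_mult in E. rewrite <- E. field. lra.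
Qed.

Lemma Cmod_div (a b : C) : b <> RtoC 0 -> Cmod (a / b)%C = Cmod a / Cmod b.
Proof. intros H. unfold Cdiv. now rewrite Cmod_mult, Cmod_inv. Qed.

Lemma N2_lt_Cmod (a b : C) : N2 a < N2 b <-> Cmod a < Cmod b.
Proof.
rewrite !N2_Cmod. pose proof (Cmod_ge_0 a). pose proof (Cmod_ge_0 b). split; intros; nra.
Qed.

Lemma N2_le_Cmod (a b : C) : N2 a <= N2 b <-> Cmod a <= Cmod b.
Proof.
rewrite !N2_Cmod. pose proof (Cmod_ge_0 a). pose proof (Cmod_ge_0 b). split; intros; nra.
Qed.

Lemma N2_lt_1 (a : C) : N2 a < 1 <-> Cmod a < 1.
Proof. rewrite !N2_Cmod. pose proof (Cmod_ge_0 a). split; intros; nra. Qed.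

Lemma N2_le_1 (a : C) : N2 a <= 1 <-> Cmod a <= 1.
Proof. rewrite !N2_Cmod. pose proof (Cmod_ge_0 a). split; intros; nra. Qed.

(** For the symmetric matrix X = [[x1, d], [d, x2]] with d^2 = x1 x2 - x3, this quantity minus 2
    |d|^2 is det (1 - X' X), where X' is the adjoint of X. *)
Definition defect (x1 x2 x3 : C) : R := 1 + N2 x3 - N2 x1 - N2 x2.

Lemma defect_id (x1 x2 x3 : C) :
  N2 (x2 - Cconj x1 * x3)%C = N2 (x1 * x2 - x3)%C + (1 - N2 x1) * (N2 x2 - N2 x3).
Proof. unfold N2; simpl; ring. Qed.

Lemma Cmod_prod_sub (x1 x2 x3 : C) :
  Rabs (Cmod x1 * Cmod x2 - Cmod x3) <= Cmod (x1 * x2 - x3)%C.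
Proof.
rewrite <- Cmod_mult. apply Rabs_le. split.
- pose proof (Cmod_sub_ge x3 (x1 * x2)%C). rewrite Cmod_sub_sym in H. lra.
- apply Cmod_sub_ge.
Qed.

(* [T > 2w] and [w >= |pq - s|] with [T = 1 + s^2 - p^2 - q^2] give the two square bounds. *)
Lemma defect_bounds (p q s w : R) : Rabs (p * q - s) <= w -> 2 * w < 1 + s * s - p * p - q * q ->
  (p + q) * (p + q) < (1 + s) * (1 + s) /\ (p - q) * (p - q) < (1 - s) * (1 - s).
Proof.
intros H1 H2. pose proof (Rle_abs (p * q - s)). pose proof (Rle_abs (- (p * q - s))). rewrite Rabs_Ropp in H0. split; nra.
Qed.

Lemma sq_lt (a b : R) : 0 <= b -> a * a < b * b -> - b < a < b.
Proof. intros. split; nra. Qed.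

(** Write n = 1 - |x3|^2, T for the defect, w = |x1 x2 - x3| and al, be for the two moduli in the
    definition. By [K3], (n^2 - al^2 - be^2)^2 - 4 al^2 be^2 = n^2 (T^2 - 4 w^2), so al + be < n and
    2 w < T agree up to the signs of n^2 - al^2 - be^2 and T. Most of the work settles these
    signs. *)
Lemma tetra_iff (x1 x2 x3 : C) :
  tetrablock (x1, x2, x3) <-> Cmod x3 < 1 /\ 2 * Cmod (x1 * x2 - x3)%C < defect x1 x2 x3.
Proof.
unfold tetrablock, defect.
pose proof (defect_id x1 x2 x3) as Eb. pose proof (defect_id x2 x1 x3) as Ea.
replace (x2 * x1 - x3)%C with (x1 * x2 - x3)%C in Ea by ring.
pose proof (Cmod_prod_sub x1 x2 x3) as Hw.
rewrite !N2_Cmod in *.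
pose proof (Cmod_ge_0 x1) as Hp. pose proof (Cmod_ge_0 x2) as Hq. pose proof (Cmod_ge_0 x3) as Hs.
pose proof (Cmod_ge_0 (x1 * x2 - x3)) as Hw0. pose proof (Cmod_ge_0 (x1 - Cconj x2 * x3)) as Ha0.
pose proof (Cmod_ge_0 (x2 - Cconj x1 * x3)) as Hb0.
set (p := Cmod x1) in *. set (q := Cmod x2) in *. set (s := Cmod x3) in *. set (w := Cmod (x1 * x2 - x3)) in *.
set (al := Cmod (x1 - Cconj x2 * x3)) in *. set (be := Cmod (x2 - Cconj x1 * x3)) in *.
replace (s ^ 2) with (s * s) by ring.
set (n := 1 - s * s). set (T := 1 + s * s - p * p - q * q).
assert (K1 : al * al - be * be = (p * p - q * q) * n) by (unfold n; lra).
assert (K2 : n * n - al * al - be * be = 1 + s * s * (s * s) - (p * p + q * q) * (1 + s * s) + 2 * (p * p) * (q * q) - 2 * (w * w)) by (unfold n; nra).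
assert (K3 : (n * n - al * al - be * be) * (n * n - al * al - be * be) - 4 * (al * al) * (be * be) = n * n * (T * T - 4 * (w * w))).
{ replace (4 * (al * al) * (be * be)) with ((al * al + be * be) * (al * al + be * be) - (al * al - be * be) * (al * al - be * be)) by ring.
  rewrite K1. replace (al * al + be * be) with (n * n - (n * n - al * al - be * be)) by ring. rewrite K2. unfold n, T. ring. }
split.
- intros H. assert (Hn : 0 < n) by (unfold n; lra). assert (Hs1 : s < 1) by (unfold n in Hn; nra).
  split; auto. assert (Hab : al + be < n) by (unfold n; lra).
  assert (G : 2 * (al * be) < n * n - al * al - be * be) by nra.
  assert (HT : 4 * (w * w) < T * T).
  { assert (0 < n * n * (T * T - 4 * (w * w))). { rewrite <- K3. assert (0 <= al * be) by nra. nra. }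
    nra. }
  destruct (Rlt_le_dec 0 T) as [L|L]. nra. exfalso.
  (* A negative [T] would reverse both bounds of [defect_bounds], and their product then exceeds
     what [K1] allows. *)
  assert (HT' : 2 * w < - T) by nra.
  assert (Hd1 : (1 + s) * (1 + s) < (p + q) * (p + q)).
  { unfold T in HT'. pose proof (Rle_abs (- (p * q - s))). rewrite Rabs_Ropp in H0. nra. }
  assert (Hd2 : (1 - s) * (1 - s) < (p - q) * (p - q)).
  { unfold T in HT'. pose proof (Rle_abs (p * q - s)). nra. }
  assert (Hd3 : n * n < (p * p - q * q) * (p * p - q * q)).
  { replace (n * n) with (((1 + s) * (1 + s)) * ((1 - s) * (1 - s))) by (unfold n; ring).
    replace ((p * p - q * q) * (p * p - q * q)) with (((p + q) * (p + q)) * ((p - q) * (p - q))) by ring.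
    apply Rmult_le_0_lt_compat; auto; nra. }
  assert (Hd4 : (al * al - be * be) * (al * al - be * be) <= n * n * (n * n)).
  { assert (- (n * n) <= al * al - be * be <= n * n) by (split; nra). nra. }
  rewrite K1 in Hd4. assert (0 < n * n) by nra. nra.
- intros [Hs1 HT]. fold T in HT.
  destruct (defect_bounds p q s w Hw HT) as [D1 D2].
  assert (Hn : 0 < n) by (unfold n; nra).
  assert (Hd3 : (p * p - q * q) * (p * p - q * q) < n * n).
  { replace (n * n) with (((1 + s) * (1 + s)) * ((1 - s) * (1 - s))) by (unfold n; ring).
    replace ((p * p - q * q) * (p * p - q * q)) with (((p + q) * (p + q)) * ((p - q) * (p - q))) by ring.
    apply Rmult_le_0_lt_compat; auto; apply Rle_0_sqr. }

  assert (G0 : 0 < n * n - al * al - be * be). { rewrite K2. unfold n, T in *. nra. }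
  assert (G1 : 0 < n * n * (T * T - 4 * (w * w))). { apply Rmult_lt_0_compat; nra. }
  rewrite <- K3 in G1.
  assert (G2 : 2 * (al * be) < n * n - al * al - be * be). { nra. }
  assert (al + be < n) by nra. unfold n in *. lra.
Qed.

Section InTetra.
Variables x1 x2 x3 : C.
Hypothesis Hx : tetrablock (x1, x2, x3).

Lemma tetra_x3 : Cmod x3 < 1.
Proof. now apply tetra_iff in Hx. Qed.

Lemma tetra_defect : 2 * Cmod (x1 * x2 - x3)%C < defect x1 x2 x3.
Proof. now apply tetra_iff in Hx. Qed.

Lemma tetra_pm : Cmod x1 + Cmod x2 < 1 + Cmod x3 /\ Cmod x1 - Cmod x2 < 1 - Cmod x3 /\ Cmod x2 - Cmod x1 < 1 - Cmod x3.
Proof.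
pose proof tetra_x3 as H3. pose proof tetra_defect as HT. unfold defect in HT. rewrite !N2_Cmod in HT.
destruct (defect_bounds _ _ _ _ (Cmod_prod_sub x1 x2 x3) HT) as [D1 D2].
pose proof (Cmod_ge_0 x3).
apply sq_lt in D1. 2: lra. apply sq_lt in D2. 2: lra. lra.
Qed.

Lemma tetra_x1 : Cmod x1 < 1.
Proof. pose proof tetra_pm. lra. Qed.

Lemma tetra_side : N2 x1 + N2 x3 < 1 + N2 x2.
Proof.
destruct tetra_pm as [H1 [H2 H3]]. rewrite !N2_Cmod.
pose proof (Cmod_ge_0 x2). pose proof (Cmod_ge_0 x3). nra.
Qed.
End InTetra.

Lemma tetra_swap (x1 x2 x3 : C) : tetrablock (x1, x2, x3) -> tetrablock (x2, x1, x3).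
Proof. unfold tetrablock. lra. Qed.

(** Trades [Cmod x3 < 1] for an inequality between squared moduli, which is easier to follow through
    an automorphism. Given the defect bound, |x3| >= 1 would force |x2|^2 - |x1|^2 < |x3|^2 - 1,
    against the side condition. *)
Lemma tetra_iff_side (x1 x2 x3 : C) :
  N2 x1 + N2 x3 < 1 + N2 x2 -> 2 * Cmod (x1 * x2 - x3)%C < defect x1 x2 x3 -> tetrablock (x1, x2, x3).
Proof.
intros H1 HT. apply tetra_iff. split; auto.
destruct (Rlt_le_dec (Cmod x3) 1) as [L|L]; auto. exfalso.
unfold defect in HT. rewrite !N2_Cmod in *.
destruct (defect_bounds _ _ _ _ (Cmod_prod_sub x1 x2 x3) HT) as [D1 D2].

apply sq_lt in D1. 2: lra.
replace ((1 - Cmod x3) * (1 - Cmod x3)) with ((Cmod x3 - 1) * (Cmod x3 - 1)) in D2 by ring.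
apply sq_lt in D2. 2: lra. nra.
Qed.

Lemma mobius_N2 (b w : C) : N2 (1 - Cconj b * w)%C - N2 (w - b)%C = (1 - N2 b) * (1 - N2 w).
Proof. unfold N2; simpl; ring. Qed.

Lemma mobius_le (b w : C) : Cmod b <= 1 -> Cmod w <= 1 -> Cmod (w - b)%C <= Cmod (1 - Cconj b * w)%C.
Proof.
intros Hb Hw. apply N2_le_Cmod. pose proof (mobius_N2 b w). apply N2_le_1 in Hb. apply N2_le_1 in Hw. nra.
Qed.

Lemma one_sub_neq0 (z : C) : Cmod z < 1 -> (1 - z)%C <> RtoC 0.
Proof. intros H. apply sub_neq0. intros E. rewrite <- E, Cmod_1 in H. lra. Qed.

Lemma Cmod_mult_lt1 (a b : C) : Cmod a <= 1 -> Cmod b < 1 -> Cmod (a * b)%C < 1.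
Proof. intros Ha Hb. rewrite Cmod_mult. pose proof (Cmod_ge_0 b). nra. Qed.

(* On the tetrablock the image of the closed disc under [z -> (x2 - x3 z) / (1 - x1 z)]
   is the disc of centre [m / (1 - |x1|^2)] and radius [|x1 x2 - x3| / (1 - |x1|^2)]. *)
Lemma tetra_psi (x1 x2 x3 eta : C) : tetrablock (x1, x2, x3) -> Cmod eta <= 1 ->
  Cmod (x2 - eta * x3)%C < Cmod (1 - eta * x1)%C.
Proof.
intros Hx He. pose proof (tetra_x1 _ _ _ Hx) as H1. pose proof (tetra_side _ _ _ Hx) as Hs.
pose proof (tetra_defect _ _ _ Hx) as HT. unfold defect in HT.
set (m := (x2 - Cconj x1 * x3)%C). set (w := Cmod (x1 * x2 - x3)) in *.
assert (E : ((x2 - eta * x3) * RtoC (1 - N2 x1))%C = (m * (1 - eta * x1) + (x1 * x2 - x3) * (eta - Cconj x1))%C).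
{ unfold m. apply injective_projections; unfold N2; simpl; ring. }
assert (Hp : 0 < 1 - N2 x1). { apply N2_lt_1 in H1. lra. }
pose proof (defect_id x1 x2 x3) as Em. fold m in Em. rewrite (N2_Cmod m), (N2_Cmod (x1 * x2 - x3)) in Em. fold w in Em.
assert (Hw0 : 0 <= w) by apply Cmod_ge_0.
assert (Hmw : Cmod m + w < 1 - N2 x1).
{ nra. }
apply (f_equal Cmod) in E. rewrite Cmod_mult, Cmod_R, Rabs_pos_eq in E by lra.
assert (Hd : 0 < Cmod (1 - eta * x1)). { apply Cmod_gt_0. apply one_sub_neq0. now apply Cmod_mult_lt1. }
assert (Hmb : Cmod (eta - Cconj x1) <= Cmod (1 - eta * x1)).
{ replace (eta * x1)%C with (Cconj (Cconj x1) * eta)%C by (rewrite Cconj_conj; ring). apply mobius_le; auto. rewrite Cmod_conj; lra. }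
pose proof (Cmod_triangle (m * (1 - eta * x1)) ((x1 * x2 - x3) * (eta - Cconj x1))) as Ht.
rewrite <- E in Ht. rewrite !Cmod_mult in Ht. fold w in Ht.
apply Rmult_lt_reg_r with (1 - N2 x1); auto.
apply Rle_lt_trans with (1 := Ht).

nra.
Qed.

(** * Siegel coordinates *)

(* The domain of the coordinates [P], [S], [c]; [Xi], whose inverse is given by [sP], [sS] and
   [sc], maps it onto the tetrablock.  [R] abbreviates [P S + c]. *)
Definition siegel (P S c : C) : Prop :=
  0 < fst P /\ 0 < fst S /\ Cmod c - fst c < 2 * fst P * fst S.

(** In the matrix [[S, e], [-e, P]] with e^2 = c, [R] is the determinant, and [xi_den] is the
    determinant of 1 plus the matrix. *)
Definition xi_den (P S R : C) : C := (1 + P + S + R)%C.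
Definition xi1 (P S R : C) : C := ((S + R - 1 - P) / xi_den P S R)%C.
Definition xi2 (P S R : C) : C := ((1 + S - P - R) / xi_den P S R)%C.
Definition xi3 (P S R : C) : C := ((P + S - 1 - R) / xi_den P S R)%C.
Definition Xi (P S c : C) : C3 := (xi1 P S (P * S + c)%C, xi2 P S (P * S + c)%C, xi3 P S (P * S + c)%C).

(** By [xi_den_N2] this makes [xi_den] nonzero and [xi3] smaller than 1 in modulus. Multiplied by Re
    (P + S), the expression splits into (Re (P + S))^2, a mixed term bounded below by [K2] and a
    term in [c] bounded below by [K1]; the last two bounds cancel. *)
Lemma siegel_pos (P S c : C) : siegel P S c ->
  0 < fst ((1 + (P * S + c)) * Cconj (P + S))%C.
Proof.
intros [HP [HS Hc]].
destruct P as [r1 p2]. destruct S as [s1 s2]. destruct c as [c1 c2]. simpl in *.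
set (h := r1 * s1). assert (Hh : 0 < h) by (unfold h; nra).
pose proof (N2_Cmod (c1, c2)) as Hq. unfold N2 in Hq; simpl in Hq. pose proof (Cmod_ge_0 (c1, c2)) as Hp.
set (q := Cmod (c1, c2)) in *. assert (Hm : q < c1 + 2 * h) by (unfold h; lra).
assert (Hc2 : c2 * c2 < 4 * h * (c1 + h)).
{ assert (q * q < (c1 + 2 * h) * (c1 + 2 * h)) by (apply Rmult_le_0_lt_compat; lra). lra. }
set (u := r1 + s1). set (v := p2 + s2). assert (Hu : 0 < u) by (unfold u; lra).
assert (K1 : - h * (u * u + v * v) < u * (c1 * u + c2 * v)).
{ (* [4h (c1 + h) > c2^2], so the difference times [4h] exceeds [(u c2 + 2 h v)^2] *)
  assert (0 <= (u * c2 + 2 * h * v) * (u * c2 + 2 * h * v)) by apply Rle_0_sqr.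
  assert (u * u * (c2 * c2) < u * u * (4 * h * (c1 + h))) by (apply Rmult_lt_compat_l; nra).
  apply Rmult_lt_reg_l with (4 * h). lra. nra. }
assert (K2 : h * (u * u + v * v) <= (r1 * (s1 * s1 + s2 * s2) + s1 * (r1 * r1 + p2 * p2)) * u).
{ assert (0 <= (r1 * s2 - s1 * p2) * (r1 * s2 - s1 * p2)) by apply Rle_0_sqr. unfold h, u, v. nra. }
apply Rmult_lt_reg_l with u; auto. rewrite Rmult_0_r.
match goal with |- 0 < ?e => replace e with (u * u + (r1 * (s1 * s1 + s2 * s2) + s1 * (r1 * r1 + p2 * p2)) * u + u * (c1 * u + c2 * v)) by (unfold h, u, v; ring) end.
assert (0 < u * u) by (apply Rmult_lt_0_compat; auto). lra.
Qed.

Lemma xi_den_N2 (P S R : C) :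
  N2 (1 + P + S + R)%C - N2 (P + S - 1 - R)%C = 4 * fst ((1 + R) * Cconj (P + S))%C.
Proof. unfold N2; simpl; ring. Qed.

Lemma xi_den_neq0 (P S c : C) : siegel P S c -> xi_den P S (P * S + c)%C <> RtoC 0.
Proof.
intros H E. pose proof (siegel_pos _ _ _ H) as Hp. pose proof (xi_den_N2 P S (P * S + c)) as K.
unfold xi_den in E. rewrite E in K. pose proof (N2_nonneg (P + S - 1 - (P * S + c))).
replace (N2 (RtoC 0)) with 0 in K by (unfold N2; simpl; ring). lra.
Qed.

(** Since Re (P conj S + P S + c) = 2 Re P Re S + Re c, and x1 x2 - x3 = 4 c / den^2 on the image of
    [Xi], the defect criterion turns into the third condition of [siegel]. *)
Lemma xi_defect (P S R : C) :
  N2 (1 + P + S + R)%C + N2 (P + S - 1 - R)%C - N2 (S + R - 1 - P)%C - N2 (1 + S - P - R)%C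
  = 8 * fst (P * Cconj S + R)%C.
Proof. unfold N2; simpl; ring. Qed.

Lemma Xi_tetra (P S c : C) : siegel P S c -> tetrablock (Xi P S c).
Proof.
intros H. pose proof (xi_den_neq0 _ _ _ H) as Hd. pose proof (siegel_pos _ _ _ H) as Hp.
pose proof (N2_pos _ Hd) as Hn. unfold Xi. apply tetra_iff.
set (R := (P * S + c)%C) in *. set (d := xi_den P S R) in *. split.
- unfold xi3. fold d. apply N2_lt_1. rewrite N2_div by auto.
  apply Rmult_lt_reg_r with (N2 d); auto. unfold Rdiv. rewrite Rmult_assoc, Rinv_l by lra.
  pose proof (xi_den_N2 P S R) as K. fold (xi_den P S R) in K. fold d in K. lra.
- unfold xi1, xi2, xi3. fold d.
  replace ((S + R - 1 - P) / d * ((1 + S - P - R) / d) - (P + S - 1 - R) / d)%C with (RtoC 4 * c / (d * d))%C.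
  2: { replace c with (R - P * S)%C by (unfold R; ring). clear Hp Hn. unfold d, xi_den in *. clearbody R. field. auto. }
  rewrite Cmod_div, !Cmod_mult, Cmod_R, Rabs_pos_eq, <- N2_Cmod by (lra || now apply Cmult_neq_0).
  unfold defect. rewrite !N2_div by auto.
  apply Rmult_lt_reg_r with (N2 d); auto.
  replace ((1 + N2 (P + S - 1 - R) / N2 d - N2 (S + R - 1 - P) / N2 d - N2 (1 + S - P - R) / N2 d) * N2 d)
    with (N2 d + N2 (P + S - 1 - R) - N2 (S + R - 1 - P) - N2 (1 + S - P - R)) by (field; lra).
  replace (2 * (4 * Cmod c / N2 d) * N2 d) with (8 * Cmod c) by (field; lra).
  unfold d, xi_den. rewrite xi_defect. destruct H as [_ [_ H]].
  replace (fst (P * Cconj S + R)%C) with (2 * fst P * fst S + fst c) by (unfold R; simpl; ring). lra.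
Qed.

Definition sden (x1 x2 x3 : C) : C := (1 - x1 + x2 - x3)%C.
Definition sP (x1 x2 x3 : C) : C := ((1 - x1 - x2 + x3) / sden x1 x2 x3)%C.
Definition sS (x1 x2 x3 : C) : C := ((1 + x1 + x2 + x3) / sden x1 x2 x3)%C.
Definition sc (x1 x2 x3 : C) : C := (4 * (x1 * x2 - x3) / (sden x1 x2 x3 * sden x1 x2 x3))%C.

Lemma sden_neq0 (x1 x2 x3 : C) : tetrablock (x1, x2, x3) -> sden x1 x2 x3 <> RtoC 0.
Proof.
intros H E. pose proof (tetra_psi x1 x2 x3 1 H ltac:(rewrite Cmod_1; lra)) as K.
rewrite !Cmult_1_l in K. replace (x2 - x3)%C with (- (1 - x1))%C in K. rewrite Cmod_opp in K. lra.
unfold sden in E. replace (x2 - x3)%C with ((1 - x1 + x2 - x3) - (1 - x1))%C by ring. rewrite E. ring.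
Qed.

Lemma fst_div (a b : C) : b <> RtoC 0 -> fst (a / b)%C = fst (a * Cconj b)%C / N2 b.
Proof.
intros H. pose proof (N2_pos b H). unfold N2 in *. destruct a as [a1 a2]. destruct b as [b1 b2]. simpl in *. field. lra.
Qed.

Lemma sg_of_tetra (x1 x2 x3 : C) : tetrablock (x1, x2, x3) ->
  siegel (sP x1 x2 x3) (sS x1 x2 x3) (sc x1 x2 x3).
Proof.
intros H. pose proof (sden_neq0 _ _ _ H) as Hd. pose proof (N2_pos _ Hd) as Hn.
(* Up to the positive factor [N2 (sden x1 x2 x3)], Re P is |1 - x1|^2 - |x2 - x3|^2 and Re S is |1 +
   x2|^2 - |x1 + x3|^2; hence the parameters 1 and -1. *)
pose proof (tetra_psi x1 x2 x3 1 H ltac:(rewrite Cmod_1; lra)) as K1.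
pose proof (tetra_psi x2 x1 x3 (-1) (tetra_swap _ _ _ H)) as K2.
assert (Hm1 : Cmod (RtoC (-1)) <= 1) by (rewrite Cmod_R, Rabs_left; lra). specialize (K2 Hm1).
apply N2_lt_Cmod in K1. apply N2_lt_Cmod in K2.
pose proof (tetra_defect _ _ _ H) as K3.
unfold siegel, sP, sS, sc. rewrite !fst_div by (auto; now apply Cmult_neq_0).
repeat split.
- apply Rdiv_lt_0_compat; auto. unfold sden. unfold N2 in K1. simpl in *. nra.
- apply Rdiv_lt_0_compat; auto. unfold sden. unfold N2 in K2. simpl in *. nra.
- rewrite Cmod_div, !Cmod_mult, Cmod_R, Rabs_pos_eq, <- N2_Cmod, N2_mult by (lra || now apply Cmult_neq_0).
  set (w := Cmod (x1 * x2 - x3)) in *.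
  apply Rmult_lt_reg_r with (N2 (sden x1 x2 x3) * N2 (sden x1 x2 x3)). nra.
  set (n := N2 (sden x1 x2 x3)) in *.
  set (A := fst _). set (B := fst _). set (D := fst _).
  replace ((4 * w / n - A / (n * n)) * (n * n)) with (4 * w * n - A) by (field; lra).
  replace (2 * (B / n) * (D / n) * (n * n)) with (2 * B * D) by (field; lra).
  assert (E : 2 * B * D + A = 2 * n * defect x1 x2 x3).
  { unfold A, B, D, n, sden, defect, N2. simpl. ring. }
  nra.
Qed.

Lemma Xi_of_tetra (x1 x2 x3 : C) : tetrablock (x1, x2, x3) ->
  Xi (sP x1 x2 x3) (sS x1 x2 x3) (sc x1 x2 x3) = (x1, x2, x3).
Proof.
intros H. pose proof (sden_neq0 _ _ _ H) as Hd.
set (d := sden x1 x2 x3) in *.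
assert (ER : (sP x1 x2 x3 * sS x1 x2 x3 + sc x1 x2 x3)%C = ((1 + x1 - x2 - x3) / d)%C).
{ unfold sP, sS, sc. fold d. unfold d, sden in *. field. auto. }
assert (Ed : xi_den (sP x1 x2 x3) (sS x1 x2 x3) ((1 + x1 - x2 - x3) / d)%C = (RtoC 4 / d)%C).
{ unfold xi_den, sP, sS. fold d. unfold d, sden in *. field. auto. }
unfold Xi, xi1, xi2, xi3. rewrite ER, Ed. unfold sP, sS. fold d.

f_equal; [f_equal|]; unfold d, sden in *; field; auto.
Qed.

Lemma tetra_Xi (x : C3) : tetrablock x -> exists P S c, siegel P S c /\ x = Xi P S c.
Proof.
destruct x as [[x1 x2] x3]. intros H. do 3 eexists. split. now apply (sg_of_tetra x1 x2 x3).
symmetry. now apply Xi_of_tetra.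
Qed.

Lemma xi_sP (P S c : C) : siegel P S c ->
  sP (xi1 P S (P * S + c)) (xi2 P S (P * S + c)) (xi3 P S (P * S + c)) = P /\
  sS (xi1 P S (P * S + c)) (xi2 P S (P * S + c)) (xi3 P S (P * S + c)) = S.
Proof.
intros H. pose proof (xi_den_neq0 _ _ _ H) as Hd.
set (R := (P * S + c)%C) in *.

assert (E : sden (xi1 P S R) (xi2 P S R) (xi3 P S R) = (RtoC 4 / xi_den P S R)%C).
{ unfold sden, xi1, xi2, xi3. unfold xi_den in *. field. auto. }
unfold sP, sS. rewrite E. unfold xi1, xi2, xi3, xi_den in *. split; field; auto.
Qed.

(** * Holomorphic functions of three variables *)

Definition pr1 (x : C3) : C := fst (fst x).
Definition pr2 (x : C3) : C := snd (fst x).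
Definition pr3 (x : C3) : C := snd x.

Definition C3near (x : C3) (P : C3 -> Prop) : Prop :=
  exists d, 0 < d /\ forall y : C3, Cmod (pr1 y - pr1 x)%C < d -> Cmod (pr2 y - pr2 x)%C < d ->
    Cmod (pr3 y - pr3 x)%C < d -> P y.

Lemma C3near_filter (x : C3) : Filter (C3near x).
Proof.
split.
- exists 1. split. lra. auto.
- intros P Q [d [Hd H]] [e [He H']]. exists (Rmin d e). split. now apply Rmin_pos.
  intros w H1 H2 H3. pose proof (Rmin_l d e). pose proof (Rmin_r d e). split. apply H; lra. apply H'; lra.
- intros P Q H [d [Hd H']]. exists d. split; auto.
Qed.
Global Existing Instance C3near_filter.

Lemma C_ball_lt (z w : C) (e : posreal) : Cmod (w - z)%C < e -> @ball C_NormedModule z e w.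
Proof.
intros H. destruct z as [a b]; destruct w as [c d].
replace ((c, d) - (a, b))%C with ((c - a, d - b) : C) in H by (apply injective_projections; simpl; ring).
destruct (Cmod_pair_ge (c - a) (d - b)) as [H1 H2].
split.
- change (Rabs (c - a) < e). lra.
- change (Rabs (d - b) < e). lra.
Qed.

Lemma C_ball_gt (z w : C) (e : posreal) : @ball C_NormedModule z e w -> Cmod (w - z)%C < 2 * e.
Proof.
intros [H1 H2]. destruct z as [a b]; destruct w as [c d].
replace ((c, d) - (a, b))%C with ((c - a, d - b) : C) by (apply injective_projections; simpl; ring).
change (Rabs (c - a) < e) in H1. change (Rabs (d - b) < e) in H2.
apply Rle_lt_trans with (1 := Cmod_le_abs _ _). lra.
Qed.

Lemma C3near_locally (x : C3) (P : C3 -> Prop) : C3near x P <-> locally x P.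
Proof.
split.
- intros [d [Hd H]]. assert (Hd2 : 0 < d / 2) by lra. exists (mkposreal _ Hd2). intros y [[H1 H2] H3].
  apply C_ball_gt in H1. apply C_ball_gt in H2. apply C_ball_gt in H3.
  replace d with (2 * (d / 2)) in H by field. apply H; assumption.
- intros [e He]. exists e. split. apply cond_pos. intros y H1 H2 H3. apply He.
  split. split. now apply C_ball_lt. now apply C_ball_lt. now apply C_ball_lt.
Qed.

(* Caratheodory's form of Frechet differentiability, with partial derivatives [l1], [l2], [l3]. *)
Definition fd (F : C3 -> C) (x : C3) (l1 l2 l3 : C) : Prop :=
  exists p1 p2 p3 : C3 -> C,
    Clim (C3near x) p1 l1 /\ Clim (C3near x) p2 l2 /\ Clim (C3near x) p3 l3 /\
    forall y, F y = (F x + p1 y * (pr1 y - pr1 x) + p2 y * (pr2 y - pr2 x) + p3 y * (pr3 y - pr3 x))%C.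

Lemma Clim_pr1 (x : C3) : Clim (C3near x) pr1 (pr1 x).
Proof. intros e He. exists e. auto. Qed.
Lemma Clim_pr2 (x : C3) : Clim (C3near x) pr2 (pr2 x).
Proof. intros e He. exists e. auto. Qed.
Lemma Clim_pr3 (x : C3) : Clim (C3near x) pr3 (pr3 x).
Proof. intros e He. exists e. auto. Qed.

Lemma fd_cont (F : C3 -> C) (x : C3) (l1 l2 l3 : C) : fd F x l1 l2 l3 -> Clim (C3near x) F (F x).
Proof.
intros [p1 [p2 [p3 [H1 [H2 [H3 E]]]]]].
apply Clim_ext with (f := fun y => (F x + p1 y * (pr1 y - pr1 x) + p2 y * (pr2 y - pr2 x) + p3 y * (pr3 y - pr3 x))%C). apply _.
intros y; symmetry; auto.
cut (Clim (C3near x) (fun y => F x + p1 y * (pr1 y - pr1 x) + p2 y * (pr2 y - pr2 x) + p3 y * (pr3 y - pr3 x))%C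
  (F x + l1 * (pr1 x - pr1 x) + l2 * (pr2 x - pr2 x) + l3 * (pr3 x - pr3 x))%C).
{ now replace (F x + l1 * (pr1 x - pr1 x) + l2 * (pr2 x - pr2 x) + l3 * (pr3 x - pr3 x))%C with (F x) by ring. }
repeat apply (Clim_plus (C3near x)); try apply (Clim_mult (C3near x)); auto; try apply Clim_const, _;
  apply (Clim_minus (C3near x)); try apply Clim_const, _; [apply Clim_pr1|apply Clim_pr2|apply Clim_pr3].
Qed.

Definition n3 (h : C3) : R := sqrt (N2 (pr1 h) + N2 (pr2 h) + N2 (pr3 h)).

Lemma n3_norm (h : C3) : norm h = n3 h.
Proof.
destruct h as [[a b] c]. unfold n3, pr1, pr2, pr3; simpl fst; simpl snd.
change (sqrt (sqrt (Cmod a ^ 2 + Cmod b ^ 2) ^ 2 + Cmod c ^ 2) = sqrt (N2 a + N2 b + N2 c)).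
rewrite pow2_sqrt. rewrite !N2_Cmod. f_equal. ring.
pose proof (pow2_ge_0 (Cmod a)). pose proof (pow2_ge_0 (Cmod b)). lra.
Qed.

Definition C3sub (y x : C3) : C3 := (pr1 y - pr1 x, pr2 y - pr2 x, pr3 y - pr3 x)%C.

Lemma fd_of_filterdiff (F : C3 -> C) (x : C3) :
  ex_filterdiff (K := C_AbsRing) (U := C3) (V := C_NormedModule) F (locally x) ->
  exists l1 l2 l3, fd F x l1 l2 l3.
Proof.
intros [l [Hl H]]. specialize (H x (fun P HP => HP)).
set (l1 := l ((RtoC 1, RtoC 0, RtoC 0) : C3)). set (l2 := l ((RtoC 0, RtoC 1, RtoC 0) : C3)). set (l3 := l ((RtoC 0, RtoC 0, RtoC 1) : C3)).
assert (El : forall h : C3, l h = (pr1 h * l1 + pr2 h * l2 + pr3 h * l3)%C).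
{ intros [[a b] c]. unfold pr1, pr2, pr3; simpl fst; simpl snd.
  assert (E : ((a, b, c) : C3) = plus (plus (scal a ((RtoC 1, RtoC 0, RtoC 0) : C3)) (scal b ((RtoC 0, RtoC 1, RtoC 0) : C3))) (scal c ((RtoC 0, RtoC 0, RtoC 1) : C3))).
  { assert (ra : forall u v w : C, u = (u * 1 + v * 0 + w * 0)%C) by (intros; ring).
    assert (rb : forall u v w : C, v = (u * 0 + v * 1 + w * 0)%C) by (intros; ring).
    assert (rc : forall u v w : C, w = (u * 0 + v * 0 + w * 1)%C) by (intros; ring).
    apply injective_projections; [apply injective_projections|]; simpl.
    - exact (ra a b c).
    - exact (rb a b c).
    - exact (rc a b c). }
  apply (f_equal l) in E. rewrite !(linear_plus l Hl), !(linear_scal l Hl) in E. exact E. }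
assert (HE : forall e, 0 < e -> C3near x (fun y => Cmod (F y - F x - l (C3sub y x))%C <= e * n3 (C3sub y x))).
{ intros e He. specialize (H (mkposreal e He)). apply C3near_locally. generalize H. apply filter_imp.
  intros y Hy. rewrite <- n3_norm. exact Hy. }
(* The error of the linear approximation is shared among the coordinates with the weights conj h_i /
   |h|^2, whose products with h_i add up to 1; each share is small because |h_i| <= |h|. *)
set (q := fun (f : C3 -> C) (y : C3) =>
  ((F y - F x - l (C3sub y x)) * Cconj (f (C3sub y x)) / RtoC (n3 (C3sub y x) * n3 (C3sub y x)))%C).
assert (En : forall h, n3 h * n3 h = N2 (pr1 h) + N2 (pr2 h) + N2 (pr3 h)).
{ intros h. apply sqrt_sqrt. pose proof (N2_nonneg (pr1 h)). pose proof (N2_nonneg (pr2 h)). pose proof (N2_nonneg (pr3 h)). lra. }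
set (p := fun (f : C3 -> C) (m : C) (y : C3) => if Req_EM_T (n3 (C3sub y x)) 0 then m else (m + q f y)%C).
assert (Hp : forall f m, (forall h, Cmod (f h) <= n3 h) -> Clim (C3near x) (p f m) m).
{ intros f m Hf e He. assert (He2 : 0 < e / 2) by lra. generalize (HE _ He2). apply filter_imp. intros y Hy.
  unfold p. destruct (Req_EM_T (n3 (C3sub y x)) 0) as [E|E].
  - replace (m - m)%C with (RtoC 0) by ring. now rewrite Cmod_0.
  - replace (m + q f y - m)%C with (q f y) by ring. unfold q.
    assert (Hn : 0 < n3 (C3sub y x)). { pose proof (sqrt_pos (N2 (pr1 (C3sub y x)) + N2 (pr2 (C3sub y x)) + N2 (pr3 (C3sub y x)))). unfold n3 in *. lra. }
    specialize (Hf (C3sub y x)). set (n := n3 (C3sub y x)) in *.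
    rewrite Cmod_div, Cmod_mult, Cmod_conj, Cmod_R, Rabs_pos_eq by (try apply RtoC_neq0; nra).
    set (A := Cmod _) in Hy. fold A. pose proof (Cmod_ge_0 (f (C3sub y x))).
    apply Rle_lt_trans with (e / 2 * n * n / (n * n)). 2: { replace (e / 2 * n * n / (n * n)) with (e / 2) by (field; lra). lra. }
    apply Rmult_le_compat_r. left. apply Rinv_0_lt_compat. nra.
    apply Rmult_le_compat; auto. apply Cmod_ge_0. }
assert (Hf : forall h, Cmod (pr1 h) <= n3 h /\ Cmod (pr2 h) <= n3 h /\ Cmod (pr3 h) <= n3 h).
{ intros h. pose proof (N2_nonneg (pr1 h)). pose proof (N2_nonneg (pr2 h)). pose proof (N2_nonneg (pr3 h)).
  assert (S : forall a, N2 a <= N2 (pr1 h) + N2 (pr2 h) + N2 (pr3 h) -> Cmod a <= n3 h).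
  { intros a Ha. rewrite <- (sqrt_square (Cmod a)) by apply Cmod_ge_0. rewrite <- N2_Cmod. now apply sqrt_le_1_alt. }
  repeat split; apply S; lra. }
exists l1, l2, l3. exists (p pr1 l1), (p pr2 l2), (p pr3 l3). repeat split; try (apply Hp; apply Hf).
intros y. unfold p. pose proof (El (C3sub y x)) as Ey. destruct (Req_EM_T (n3 (C3sub y x)) 0) as [E|E].
- pose proof (En (C3sub y x)) as E0. rewrite E in E0.
  destruct (Hf (C3sub y x)) as [Z1 [Z2 Z3]]. rewrite E in Z1, Z2, Z3.
  assert (Z : forall z, Cmod z <= 0 -> z = RtoC 0) by (intros z Hz; apply Cmod_eq_0; apply Rle_antisym; auto; apply Cmod_ge_0).
  apply Z in Z1. apply Z in Z2. apply Z in Z3. unfold C3sub, pr1, pr2, pr3 in Z1, Z2, Z3; simpl in Z1, Z2, Z3.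
  apply Csub_eq0 in Z1. apply Csub_eq0 in Z2. apply Csub_eq0 in Z3.
  assert (Eyx : y = x) by (apply injective_projections; [apply injective_projections|]; auto).
  rewrite Eyx. ring.
- assert (Hnn : RtoC (n3 (C3sub y x) * n3 (C3sub y x)) <> RtoC 0) by (apply RtoC_neq0; nra).
  set (A := (F y - F x - l (C3sub y x))%C).
  assert (EA : F y = (F x + (pr1 (C3sub y x) * l1 + pr2 (C3sub y x) * l2 + pr3 (C3sub y x) * l3) + A)%C).
  { rewrite <- Ey. unfold A. ring. }
  change (pr1 y - pr1 x)%C with (pr1 (C3sub y x)). change (pr2 y - pr2 x)%C with (pr2 (C3sub y x)). change (pr3 y - pr3 x)%C with (pr3 (C3sub y x)).
  unfold q. fold A. rewrite EA at 1.
  assert (EA2 : A = (A * (pr1 (C3sub y x) * Cconj (pr1 (C3sub y x)) + pr2 (C3sub y x) * Cconj (pr2 (C3sub y x)) + pr3 (C3sub y x) * Cconj (pr3 (C3sub y x))) / RtoC (n3 (C3sub y x) * n3 (C3sub y x)))%C).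
  { rewrite !Cmod_sqr, <- !N2_Cmod, <- !RtoC_plus, <- En. now field. }
  rewrite EA2 at 1. field. auto.
Qed.

Lemma fd_filterdiff (F : C3 -> C) (x : C3) (l1 l2 l3 : C) : fd F x l1 l2 l3 ->
  ex_filterdiff (K := C_AbsRing) (U := C3) (V := C_NormedModule) F (locally x).
Proof.
intros [p1 [p2 [p3 [H1 [H2 [H3 E]]]]]].
exists (fun h : C3 => (pr1 h * l1 + pr2 h * l2 + pr3 h * l3)%C). split.
- split.
  + assert (ra : forall u1 u2 u3 v1 v2 v3 : C, ((u1 + v1) * l1 + (u2 + v2) * l2 + (u3 + v3) * l3 =
      (u1 * l1 + u2 * l2 + u3 * l3) + (v1 * l1 + v2 * l2 + v3 * l3))%C) by (intros; ring).
    intros u v. exact (ra (pr1 u) (pr2 u) (pr3 u) (pr1 v) (pr2 v) (pr3 v)).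
  + assert (ra : forall k u1 u2 u3 : C, ((k * u1) * l1 + (k * u2) * l2 + (k * u3) * l3 =
      k * (u1 * l1 + u2 * l2 + u3 * l3))%C) by (intros; ring).
    intros k u. exact (ra k (pr1 u) (pr2 u) (pr3 u)).
  + exists (Cmod l1 + Cmod l2 + Cmod l3 + 1).
    pose proof (Cmod_ge_0 l1). pose proof (Cmod_ge_0 l2). pose proof (Cmod_ge_0 l3). split. lra.
    intros h. rewrite n3_norm. change (norm (pr1 h * l1 + pr2 h * l2 + pr3 h * l3)%C) with (Cmod (pr1 h * l1 + pr2 h * l2 + pr3 h * l3)%C).
    pose proof (N2_nonneg (pr1 h)). pose proof (N2_nonneg (pr2 h)). pose proof (N2_nonneg (pr3 h)).
    assert (S : forall a, N2 a <= N2 (pr1 h) + N2 (pr2 h) + N2 (pr3 h) -> Cmod a <= n3 h).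
    { intros a Ha. rewrite <- (sqrt_square (Cmod a)) by apply Cmod_ge_0. rewrite <- N2_Cmod. now apply sqrt_le_1_alt. }
    assert (S1 := S (pr1 h) ltac:(lra)). assert (S2 := S (pr2 h) ltac:(lra)). assert (S3 := S (pr3 h) ltac:(lra)).
    pose proof (Cmod_triangle (pr1 h * l1 + pr2 h * l2) (pr3 h * l3)) as T1. pose proof (Cmod_triangle (pr1 h * l1) (pr2 h * l2)) as T2.
    rewrite !Cmod_mult in *. pose proof (Cmod_ge_0 (pr3 h)). nra.
- intros x' Hx' eps. apply (is_filter_lim_locally_unique (K := C_AbsRing) (V := C3)) in Hx'. subst x'.
  apply C3near_locally.
  assert (He : 0 < eps / 3) by (pose proof (cond_pos eps); lra).
  generalize (filter_and _ _ (H1 _ He) (filter_and _ _ (H2 _ He) (H3 _ He))). apply filter_imp.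
  intros y [G1 [G2 G3]]. rewrite n3_norm.
  change (Cmod (F y - F x - (pr1 (C3sub y x) * l1 + pr2 (C3sub y x) * l2 + pr3 (C3sub y x) * l3))%C <= eps * n3 (C3sub y x)).
  rewrite (E y). set (h := C3sub y x).
  change (pr1 y - pr1 x)%C with (pr1 h). change (pr2 y - pr2 x)%C with (pr2 h). change (pr3 y - pr3 x)%C with (pr3 h).
  replace (F x + p1 y * pr1 h + p2 y * pr2 h + p3 y * pr3 h - F x - (pr1 h * l1 + pr2 h * l2 + pr3 h * l3))%C with
   ((p1 y - l1) * pr1 h + (p2 y - l2) * pr2 h + (p3 y - l3) * pr3 h)%C by ring.
  pose proof (N2_nonneg (pr1 h)). pose proof (N2_nonneg (pr2 h)). pose proof (N2_nonneg (pr3 h)).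
  assert (S : forall a, N2 a <= N2 (pr1 h) + N2 (pr2 h) + N2 (pr3 h) -> Cmod a <= n3 h).
  { intros a Ha. rewrite <- (sqrt_square (Cmod a)) by apply Cmod_ge_0. rewrite <- N2_Cmod. now apply sqrt_le_1_alt. }
  assert (S1 := S (pr1 h) ltac:(lra)). assert (S2 := S (pr2 h) ltac:(lra)). assert (S3 := S (pr3 h) ltac:(lra)).
  apply Rle_trans with (1 := Cmod_triangle _ _). pose proof (Cmod_triangle ((p1 y - l1) * pr1 h) ((p2 y - l2) * pr2 h)) as T2.
  rewrite !Cmod_mult in *.
  assert (M : forall a b : R, 0 <= a -> a < eps / 3 -> 0 <= b -> b <= n3 h -> a * b <= eps / 3 * n3 h) by (intros; apply Rmult_le_compat; lra).
  pose proof (M _ _ (Cmod_ge_0 (p1 y - l1)) G1 (Cmod_ge_0 _) S1).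
  pose proof (M _ _ (Cmod_ge_0 (p2 y - l2)) G2 (Cmod_ge_0 _) S2).
  pose proof (M _ _ (Cmod_ge_0 (p3 y - l3)) G3 (Cmod_ge_0 _) S3). lra.
Qed.

Lemma fd_const (c : C) (x : C3) : fd (fun _ => c) x (RtoC 0) (RtoC 0) (RtoC 0).
Proof. exists (fun _ => RtoC 0), (fun _ => RtoC 0), (fun _ => RtoC 0). repeat split; try apply Clim_const, _. intros; ring. Qed.

Lemma fd_pr1 (x : C3) : fd pr1 x (RtoC 1) (RtoC 0) (RtoC 0).
Proof. exists (fun _ => RtoC 1), (fun _ => RtoC 0), (fun _ => RtoC 0). repeat split; try apply Clim_const, _. intros; ring. Qed.
Lemma fd_pr2 (x : C3) : fd pr2 x (RtoC 0) (RtoC 1) (RtoC 0).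
Proof. exists (fun _ => RtoC 0), (fun _ => RtoC 1), (fun _ => RtoC 0). repeat split; try apply Clim_const, _. intros; ring. Qed.
Lemma fd_pr3 (x : C3) : fd pr3 x (RtoC 0) (RtoC 0) (RtoC 1).
Proof. exists (fun _ => RtoC 0), (fun _ => RtoC 0), (fun _ => RtoC 1). repeat split; try apply Clim_const, _. intros; ring. Qed.

Definition fdx (F : C3 -> C) (x : C3) : Prop := exists l1 l2 l3, fd F x l1 l2 l3.

Lemma fd_curve (F : C3 -> C) (g1 g2 g3 : C -> C) (z l1 l2 l3 m1 m2 m3 : C) :
  fd F (g1 z, g2 z, g3 z) l1 l2 l3 -> hd g1 z m1 -> hd g2 z m2 -> hd g3 z m3 ->
  hd (fun w => F (g1 w, g2 w, g3 w)) z (l1 * m1 + l2 * m2 + l3 * m3)%C.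
Proof.
intros [p1 [p2 [p3 [H1 [H2 [H3 E]]]]]] G1 G2 G3.
pose proof (hd_cont _ _ _ G1) as C1. pose proof (hd_cont _ _ _ G2) as C2. pose proof (hd_cont _ _ _ G3) as C3'.
destruct G1 as [q1 [Q1 E1]]. destruct G2 as [q2 [Q2 E2]]. destruct G3 as [q3 [Q3 E3]].
assert (K : forall (p : C3 -> C) l, Clim (C3near ((g1 z, g2 z, g3 z) : C3)) p l -> Clim (Cnear z) (fun w => p ((g1 w, g2 w, g3 w) : C3)) l).
{ intros p l Hp e He. destruct (Hp e He) as [d [Hd Hd']].
  generalize (filter_and _ _ (C1 d Hd) (filter_and _ _ (C2 d Hd) (C3' d Hd))). apply filter_imp.
  intros w [W1 [W2 W3]]. now apply Hd'. }
exists (fun w => p1 ((g1 w, g2 w, g3 w) : C3) * q1 w + p2 ((g1 w, g2 w, g3 w) : C3) * q2 w + p3 ((g1 w, g2 w, g3 w) : C3) * q3 w)%C. split.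
- repeat apply (Clim_plus (Cnear z)); apply (Clim_mult (Cnear z)); auto.
- intros w. rewrite (E ((g1 w, g2 w, g3 w) : C3)). unfold pr1, pr2, pr3; simpl fst; simpl snd.
  replace (g1 w - g1 z)%C with (q1 w * (w - z))%C by (rewrite (E1 w); ring).
  replace (g2 w - g2 z)%C with (q2 w * (w - z))%C by (rewrite (E2 w); ring).
  replace (g3 w - g3 z)%C with (q3 w * (w - z))%C by (rewrite (E3 w); ring). ring.
Qed.

Lemma fdx_comp3 (G f1 f2 f3 : C3 -> C) (x : C3) :
  fdx G (f1 x, f2 x, f3 x) -> fdx f1 x -> fdx f2 x -> fdx f3 x ->
  fdx (fun y => G (f1 y, f2 y, f3 y)) x.
Proof.
intros [l1 [l2 [l3 [p1 [p2 [p3 [H1 [H2 [H3 E]]]]]]]]] [m1 [m2 [m3 M]]] [n1 [n2 [n3 N]]] [o1 [o2 [o3 O]]].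
pose proof (fd_cont _ _ _ _ _ M) as C1. pose proof (fd_cont _ _ _ _ _ N) as C2. pose proof (fd_cont _ _ _ _ _ O) as C3'.
destruct M as [q1 [q2 [q3 [Q1 [Q2 [Q3 EQ]]]]]]. destruct N as [r1 [r2 [r3 [R1 [R2 [R3 ER]]]]]]. destruct O as [s1 [s2 [s3 [S1 [S2 [S3 ES]]]]]].
assert (K : forall (p : C3 -> C) l, Clim (C3near ((f1 x, f2 x, f3 x) : C3)) p l -> Clim (C3near x) (fun w => p ((f1 w, f2 w, f3 w) : C3)) l).
{ intros p l Hp e He. destruct (Hp e He) as [d [Hd Hd']].
  generalize (filter_and _ _ (C1 d Hd) (filter_and _ _ (C2 d Hd) (C3' d Hd))). apply filter_imp.
  intros w [W1 [W2 W3]]. now apply Hd'. }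
set (v := fun y => ((f1 y, f2 y, f3 y) : C3)).
do 3 eexists. exists (fun y => p1 (v y) * q1 y + p2 (v y) * r1 y + p3 (v y) * s1 y)%C,
  (fun y => p1 (v y) * q2 y + p2 (v y) * r2 y + p3 (v y) * s2 y)%C,
  (fun y => p1 (v y) * q3 y + p2 (v y) * r3 y + p3 (v y) * s3 y)%C.
split; [|split; [|split]].
4: { intros y. rewrite (E (f1 y, f2 y, f3 y)). change ((f1 y, f2 y, f3 y) : C3) with (v y).
  change (pr1 (v y)) with (f1 y). change (pr2 (v y)) with (f2 y). change (pr3 (v y)) with (f3 y).
  change (pr1 (f1 x, f2 x, f3 x)) with (f1 x). change (pr2 (f1 x, f2 x, f3 x)) with (f2 x). change (pr3 (f1 x, f2 x, f3 x)) with (f3 x).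
  replace (f1 y - f1 x)%C with (q1 y * (pr1 y - pr1 x) + q2 y * (pr2 y - pr2 x) + q3 y * (pr3 y - pr3 x))%C by (rewrite (EQ y); ring).
  replace (f2 y - f2 x)%C with (r1 y * (pr1 y - pr1 x) + r2 y * (pr2 y - pr2 x) + r3 y * (pr3 y - pr3 x))%C by (rewrite (ER y); ring).
  replace (f3 y - f3 x)%C with (s1 y * (pr1 y - pr1 x) + s2 y * (pr2 y - pr2 x) + s3 y * (pr3 y - pr3 x))%C by (rewrite (ES y); ring).
  ring. }
all: repeat apply (Clim_plus (C3near x)); apply (Clim_mult (C3near x)); eauto.
all: apply K; eauto.
Qed.

Lemma fdx_hd (g : C -> C) (F : C3 -> C) (x : C3) (l : C) : hd g (F x) l -> fdx F x -> fdx (fun y => g (F y)) x.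
Proof.
intros [p [Hp E]] [m1 [m2 [m3 M]]]. pose proof (fd_cont _ _ _ _ _ M) as C1.
destruct M as [q1 [q2 [q3 [Q1 [Q2 [Q3 EQ]]]]]].
assert (K : Clim (C3near x) (fun y => p (F y)) l).
{ intros e He. destruct (Hp e He) as [d [Hd Hd']]. generalize (C1 d Hd). apply filter_imp. auto. }
exists (l * m1)%C, (l * m2)%C, (l * m3)%C, (fun y => p (F y) * q1 y)%C, (fun y => p (F y) * q2 y)%C, (fun y => p (F y) * q3 y)%C.
split; [|split; [|split]]; try now apply (Clim_mult (C3near x)).
intros y. rewrite (E (F y)). rewrite (EQ y) at 2. ring.
Qed.

Lemma fdx_const (c : C) (x : C3) : fdx (fun _ => c) x.
Proof. do 3 eexists. apply fd_const. Qed.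
Lemma fdx_pr1 (x : C3) : fdx pr1 x.
Proof. do 3 eexists. apply fd_pr1. Qed.
Lemma fdx_pr2 (x : C3) : fdx pr2 x.
Proof. do 3 eexists. apply fd_pr2. Qed.
Lemma fdx_pr3 (x : C3) : fdx pr3 x.
Proof. do 3 eexists. apply fd_pr3. Qed.

Lemma fdx_plus (F G : C3 -> C) (x : C3) : fdx F x -> fdx G x -> fdx (fun y => F y + G y)%C x.
Proof.
intros HF HG. apply (fdx_comp3 (fun y => pr1 y + pr2 y)%C F G (fun _ => RtoC 0)); auto.
- exists (RtoC 1), (RtoC 1), (RtoC 0), (fun _ => RtoC 1), (fun _ => RtoC 1), (fun _ => RtoC 0).
  repeat split; try apply Clim_const, _. intros; ring.
- apply fdx_const.
Qed.

Lemma fdx_mult (F G : C3 -> C) (x : C3) : fdx F x -> fdx G x -> fdx (fun y => F y * G y)%C x.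
Proof.
intros HF HG. apply (fdx_comp3 (fun y => pr1 y * pr2 y)%C F G (fun _ => RtoC 0)); auto.
- set (a := ((F x, G x, RtoC 0) : C3)). exists (pr2 a), (pr1 a), (RtoC 0), pr2, (fun _ => pr1 a), (fun _ => RtoC 0).
  repeat split; try apply Clim_const, _. apply Clim_pr2. intros; ring.
- apply fdx_const.
Qed.

Lemma fdx_opp (F : C3 -> C) (x : C3) : fdx F x -> fdx (fun y => - F y)%C x.
Proof. intros H. eapply (fdx_hd (fun w => - w)%C); eauto. apply hd_opp. apply hd_id. Qed.

Lemma fdx_minus (F G : C3 -> C) (x : C3) : fdx F x -> fdx G x -> fdx (fun y => F y - G y)%C x.
Proof. intros HF HG. apply fdx_plus; auto. now apply fdx_opp. Qed.

Lemma fdx_div (F G : C3 -> C) (x : C3) : G x <> RtoC 0 -> fdx F x -> fdx G x -> fdx (fun y => F y / G y)%C x.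
Proof.
intros H HF HG. apply fdx_mult; auto. eapply (fdx_hd (fun w => / w)%C); eauto. apply hd_inv; auto. apply hd_id.
Qed.

Lemma holo_tetra (F : C3 -> C) : holomorphic_tetrablock F <-> forall x, tetrablock x -> fdx F x.
Proof.
split; intros H x Hx.
- apply fd_of_filterdiff. now apply H.
- destruct (H x Hx) as [l1 [l2 [l3 K]]]. eapply fd_filterdiff; eauto.
Qed.

(** * Left inverses with prescribed differential *)

Definition disc_map (G : C3 -> C) : Prop :=
  holomorphic_tetrablock G /\ forall x, tetrablock x -> disc (G x).

(** The three numbers, partial derivatives of [G] after [Xi], come before the curve in the
    quantifiers: all discs through the point give conditions on the same unknowns. *)
Lemma Xi_chain (G : C3 -> C) (P0 S0 c0 : C) : holomorphic_tetrablock G -> siegel P0 S0 c0 ->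
  exists gP gS gc, forall (P S c : C -> C) (z p s k : C), P z = P0 -> S z = S0 -> c z = c0 ->
    hd P z p -> hd S z s -> hd c z k ->
    hd (fun w => G (Xi (P w) (S w) (c w))) z (gP * p + gS * s + gc * k)%C.
Proof.
intros HG Hs. rewrite holo_tetra in HG. destruct (HG _ (Xi_tetra _ _ _ Hs)) as [l1 [l2 [l3 Hl]]].
pose proof (xi_den_neq0 _ _ _ Hs) as Hd.
set (R0 := (P0 * S0 + c0)%C) in *. set (d := xi_den P0 S0 R0) in *.
set (lin := fun p s k : C =>
 (let r := p * S0 + P0 * s + k in
  l1 * (((s + r - p) * d - (S0 + R0 - 1 - P0) * (p + s + r)) / (d * d)) +
  l2 * (((s - p - r) * d - (1 + S0 - P0 - R0) * (p + s + r)) / (d * d)) +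
  l3 * (((p + s - r) * d - (P0 + S0 - 1 - R0) * (p + s + r)) / (d * d)))%C).
exists (lin 1 0 0)%C, (lin 0 1 0)%C, (lin 0 0 1)%C.
intros P S c z p s k EP ES Ec HP HS Hc.
assert (HR : hd (fun w => P w * S w + c w)%C z (p * S0 + P0 * s + k)%C).
{ rewrite <- EP, <- ES. apply hd_plus; auto. now apply hd_mult. }
assert (Hden : hd (fun w => xi_den (P w) (S w) (P w * S w + c w)%C) z (p + s + (p * S0 + P0 * s + k))%C).
{ unfold xi_den. eapply hd_eq. apply hd_plus. apply hd_plus. apply hd_plus. apply hd_const. apply HP. apply HS. apply HR. ring. }
assert (Ed : xi_den (P z) (S z) (P z * S z + c z)%C = d) by (now rewrite EP, ES, Ec).
eapply hd_eq.
- apply (fd_curve G (fun w => xi1 (P w) (S w) (P w * S w + c w)%C) (fun w => xi2 (P w) (S w) (P w * S w + c w)%C)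
   (fun w => xi3 (P w) (S w) (P w * S w + c w)%C) z l1 l2 l3).
  + rewrite EP, ES, Ec. exact Hl.
  + unfold xi1. apply hd_div. now rewrite Ed. apply hd_minus. apply hd_minus. apply hd_plus. apply HS. apply HR. apply hd_const. apply HP. apply Hden.
  + unfold xi2. apply hd_div. now rewrite Ed. apply hd_minus. apply hd_minus. apply hd_plus. apply hd_const. apply HS. apply HP. apply HR. apply Hden.
  + unfold xi3. apply hd_div. now rewrite Ed. apply hd_minus. apply hd_minus. apply hd_plus. apply HP. apply HS. apply hd_const. apply HR. apply Hden.
- cbv beta. rewrite Ed, EP, ES, Ec. fold R0. unfold lin. cbv zeta. unfold Cdiv. ring.
Qed.

Lemma Xi_holo (G : C3 -> C) (P S c : C -> C) (z p s k : C) : holomorphic_tetrablock G ->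
  siegel (P z) (S z) (c z) -> hd P z p -> hd S z s -> hd c z k ->
  exists l, hd (fun w => G (Xi (P w) (S w) (c w))) z l.
Proof.
intros HG Hs HP HS Hc. destruct (Xi_chain G _ _ _ HG Hs) as [gP [gS [gc H]]].
eexists. now apply H with (p := p) (s := s) (k := k).
Qed.

Definition cay (u : C) : C := ((1 - u) / (1 + u))%C.

Lemma one_add_neq0 (u : C) : Cmod u < 1 -> (1 + u)%C <> RtoC 0.
Proof.
intros H. replace (1 + u)%C with (1 - - u)%C by ring. apply one_sub_neq0. now rewrite Cmod_opp.
Qed.

Lemma fst_cay (u : C) : Cmod u < 1 -> fst (cay u) = (1 - N2 u) / N2 (1 + u)%C.
Proof.
intros H. unfold cay. rewrite fst_div by now apply one_add_neq0. f_equal. unfold N2; simpl; ring.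
Qed.

Lemma cay_pos (u : C) : Cmod u < 1 -> 0 < fst (cay u).
Proof.
intros H. rewrite fst_cay by auto. apply Rdiv_lt_0_compat. apply N2_lt_1 in H. lra.
apply N2_pos. now apply one_add_neq0.
Qed.

Lemma hd_cay (u : C) : Cmod u < 1 -> hd cay u (- (2 / ((1 + u) * (1 + u))))%C.
Proof.
intros H. pose proof (one_add_neq0 u H). unfold cay. eapply hd_eq. apply hd_div; auto.
apply hd_minus. apply hd_const. apply hd_id. apply hd_plus. apply hd_const. apply hd_id.
simpl. field. auto.
Qed.

Lemma right_half_neq0 (z : C) : 0 < fst z -> z <> RtoC 0.
Proof. intros H E. rewrite E in H. simpl in H. lra. Qed.

Lemma cay_disc (P0 : R) (P : C) : 0 < P0 -> 0 < fst P -> disc ((RtoC P0 - P) / (RtoC P0 + P))%C.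
Proof.
intros H0 H. unfold disc. assert (Hd : (RtoC P0 + P)%C <> RtoC 0) by (apply right_half_neq0; simpl; lra).
rewrite Cmod_div by auto. pose proof (proj1 (Cmod_gt_0 _) Hd).
apply Rmult_lt_reg_r with (Cmod (RtoC P0 + P)); auto. unfold Rdiv. rewrite Rmult_assoc, Rinv_l, Rmult_1_r, Rmult_1_l by lra.
apply N2_lt_Cmod. unfold N2; simpl. nra.
Qed.

Lemma cay_inv (P0 : R) (P : C) : 0 < P0 -> 0 < fst P ->
  (RtoC P0 * cay ((RtoC P0 - P) / (RtoC P0 + P)))%C = P.
Proof.
intros H0 H. assert (Hd : (RtoC P0 + P)%C <> RtoC 0) by (apply right_half_neq0; simpl; lra).
assert (H2 : RtoC P0 <> RtoC 0) by (apply RtoC_neq0; lra).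
unfold cay. field. repeat split; auto.
replace (RtoC P0 + P + (RtoC P0 - P))%C with (2 * RtoC P0)%C by ring. apply Cmult_neq_0; auto. apply RtoC_neq0; lra.
Qed.

(** With [P] and [c] fixed the admissible [S] form a half plane; [cay] pulls it back to the unit
    disc with [S0] at the centre. *)
Lemma half_plane_identity (f : C -> C) (S0 S : C) (h d M : R) :
  (forall z, h < fst z -> exists l, hd f z l) -> (forall z, h < fst z -> Cmod (f z) <= M) ->
  h < fst S0 -> 0 < d -> (forall z, h < fst z -> Cmod (z - S0)%C < d -> f z = RtoC 0) -> h < fst S -> f S = RtoC 0.
Proof.
intros Hf HM H0 Hd Hz HS.
set (k := fst S0 - h). assert (Hk : 0 < k) by (unfold k; lra).
set (g := fun u => ((h, snd S0) + RtoC k * cay u)%C).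
assert (Hg : forall u, Cmod u < 1 -> h < fst (g u)).
{ intros u Hu. pose proof (cay_pos u Hu) as Hc. unfold g. set (c := cay u) in *. clearbody c. simpl. nra. }
assert (Hgd : forall u, Cmod u < 1 -> exists l, hd g u l).
{ intros u Hu. eexists. apply hd_plus. apply hd_const. apply hd_mult. apply hd_const. now apply hd_cay. }
assert (Eg0 : g (RtoC 0) = S0).
{ unfold g, cay. destruct S0 as [s1 s2]. unfold k. apply injective_projections; simpl; field. }
set (T := (S - (h, snd S0))%C).
assert (HT : 0 < fst T) by (unfold T; simpl; lra).
set (v := ((RtoC k - T) / (RtoC k + T))%C).
assert (Hv : disc v) by now apply cay_disc.
replace S with (g v).
2: { unfold g, v. rewrite cay_inv by auto. unfold T. ring. }
destruct (Hgd (RtoC 0)) as [l0 Hl0]. rewrite Cmod_0; lra.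
apply (identity0 (fun u => f (g u)) 1 M); auto.
- intros u Hu. destruct (Hf (g u) (Hg u Hu)) as [l Hl]. destruct (Hgd u Hu) as [m Hm].
  exists (l * m)%C. now apply hd_comp.
- intros e He. destruct (hd_cont _ _ _ Hl0 d Hd) as [d' [Hd' Hc]].
  set (r := Rmin (e / 2) (Rmin (d' / 2) (/ 2))).
  assert (Hr : 0 < r) by (repeat apply Rmin_pos; lra).
  assert (Hr1 : r <= e / 2) by apply Rmin_l. assert (Hr2 : r <= Rmin (d' / 2) (/ 2)) by apply Rmin_r.
  pose proof (Rmin_l (d' / 2) (/ 2)). pose proof (Rmin_r (d' / 2) (/ 2)).
  assert (Er : Cmod (RtoC r) = r) by (rewrite Cmod_R, Rabs_pos_eq; lra).
  exists (RtoC r). split; [|split]. apply RtoC_neq0; lra. lra.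
  apply Hz. apply Hg; lra. rewrite <- Eg0. apply Hc. replace (RtoC r - 0)%C with (RtoC r) by ring. lra.
Qed.

Lemma siegel_near (P S c : C) (C0 : R) : 0 <= C0 -> 0 < fst P -> 0 < fst S ->
  Cmod (c - RtoC C0)%C < fst P * fst S -> siegel P S c.
Proof.
intros H0 HP HS H. repeat split; auto.
pose proof (Cmod_triangle (c - RtoC C0) (RtoC C0)) as T. replace (c - C0 + C0)%C with c in T by ring.
rewrite Cmod_R, Rabs_pos_eq in T by auto.
pose proof (fst_le_Cmod (- (c - RtoC C0))) as T2. rewrite Cmod_opp in T2. simpl in T2. lra.
Qed.

(** From |c| <= C0 + q P0^2 + q |P|^2 follows |c| - Re c <= 2 q (Re P)^2, which is what the summand
    q P of the second coordinate pays for; Re S > 0 makes the inequality strict. *)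
Lemma siegel_quad (P0 C0 : R) (P S : C) (q : R) : 0 <= C0 -> 0 <= q -> 0 < fst P -> 0 < fst S ->
  siegel P (S + RtoC q * P)%C (RtoC C0 + RtoC q * (RtoC P0 * RtoC P0 - P * P))%C.
Proof.
intros HC0 Hq HP HS. split; auto. split. simpl. nra.
set (c := (RtoC C0 + RtoC q * (RtoC P0 * RtoC P0 - P * P))%C).
assert (B : Cmod c <= C0 + q * (P0 * P0) + q * N2 P).
{ replace c with (RtoC (C0 + q * (P0 * P0)) + - (RtoC q * (P * P)))%C.
  2: { unfold c. rewrite RtoC_plus, !RtoC_mult. ring. }
  apply Rle_trans with (1 := Cmod_triangle _ _). rewrite Cmod_opp, !Cmod_mult, !Cmod_R, N2_Cmod, !Rabs_pos_eq by nra. lra. }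
assert (E : fst c = C0 + q * (P0 * P0) - q * (fst P * fst P - snd P * snd P)) by (unfold c; simpl; ring).
rewrite E. unfold N2 in B. simpl. nra.
Qed.

(** * Uniqueness from the differential at one point *)

Section Key.
Variables (G : C3 -> C) (P0 C0 : R) (S0 : C).
Hypothesis HG : disc_map G.
Hypotheses (HP0 : 0 < P0) (HC0 : 0 <= C0) (HS0 : 0 < fst S0).
Hypothesis Hder : forall (P S c : C -> C) (p s k : C), P (RtoC 0) = RtoC P0 -> S (RtoC 0) = S0 -> c (RtoC 0) = RtoC C0 ->
  hd P (RtoC 0) p -> hd S (RtoC 0) s -> hd c (RtoC 0) k ->
  hd (fun w => G (Xi (P w) (S w) (c w))) (RtoC 0) (- (p / (2 * RtoC P0)))%C.

Let K (P S c : C) : C := (G (Xi P S c) - (RtoC P0 - P) / (RtoC P0 + P))%C.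

Let K_holo (P S c : C -> C) (z p s k : C) : siegel (P z) (S z) (c z) -> hd P z p -> hd S z s -> hd c z k ->
  exists l, hd (fun w => K (P w) (S w) (c w)) z l.
Proof.
intros Hs HP HS Hc. destruct (Xi_holo G P S c z p s k (proj1 HG) Hs HP HS Hc) as [l Hl].
eexists. unfold K. apply hd_minus. apply Hl. apply hd_div.
apply right_half_neq0. destruct Hs as [Hs _]. simpl. lra.
apply hd_minus. apply hd_const. apply HP. apply hd_plus. apply hd_const. apply HP.
Qed.

Let K_bound (P S c : C) : siegel P S c -> Cmod (K P S c) <= 2.
Proof.
intros Hs. unfold K. pose proof (proj2 HG _ (Xi_tetra _ _ _ Hs)) as H1.
pose proof (cay_disc P0 P HP0 (proj1 Hs)) as H2. unfold disc in *.
pose proof (Cmod_triangle (G (Xi P S c)) (- ((RtoC P0 - P) / (RtoC P0 + P)))) as T. rewrite Cmod_opp in T. unfold Cminus at 1. lra.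
Qed.

Let step1 (P S a b : C) (q : R) : 0 <= q -> 0 < fst P ->
  (forall u, Cmod u < 1 -> 0 < fst (a + b * u)%C) -> (a + RtoC q * RtoC P0)%C = S0 ->
  K P (a + b * ((RtoC P0 - P) / (RtoC P0 + P)) + RtoC q * P)%C (RtoC C0 + RtoC q * (RtoC P0 * RtoC P0 - P * P))%C = RtoC 0.
Proof.
intros Hq HP Hab Ha.
set (u := ((RtoC P0 - P) / (RtoC P0 + P))%C). assert (Hu : disc u) by now apply cay_disc.
set (p := fun v => (RtoC P0 * cay v)%C).
assert (Hp : forall v, Cmod v < 1 -> 0 < fst (p v)). { intros v Hv. pose proof (cay_pos v Hv) as Hc. unfold p. set (c := cay v) in *. clearbody c. simpl. nra. }
assert (Hpd : forall v, Cmod v < 1 -> exists l, hd p v l /\ (v = RtoC 0 -> l = (- (2 * RtoC P0))%C)).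
{ intros v Hv. eexists. split. apply hd_mult. apply hd_const. now apply hd_cay. intros ->. cbv beta. field. }
set (s := fun v => (a + b * v + RtoC q * p v)%C).
set (c := fun v => (RtoC C0 + RtoC q * (RtoC P0 * RtoC P0 - p v * p v))%C).
assert (Hsg : forall v, Cmod v < 1 -> siegel (p v) (s v) (c v)).
{ intros v Hv. apply siegel_quad; auto. }
assert (Hd : forall v, Cmod v < 1 -> exists m n, hd s v m /\ hd c v n).
{ intros v Hv. destruct (Hpd v Hv) as [l [Hl _]]. eexists. eexists. split.
  apply hd_plus. apply hd_plus. apply hd_const. apply hd_mult. apply hd_const. apply hd_id. apply hd_mult. apply hd_const. apply Hl.
  apply hd_plus. apply hd_const. apply hd_mult. apply hd_const. apply hd_minus. apply hd_const. apply hd_mult; apply Hl. }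
assert (H01 : Cmod (RtoC 0) < 1) by (rewrite Cmod_0; lra).
assert (Ep0 : p (RtoC 0) = RtoC P0). { unfold p, cay. field. }
assert (E : G (Xi (p u) (s u) (c u)) = u).
{ apply (schwarz_id (fun v => G (Xi (p v) (s v) (c v)))); auto.
  - intros v Hv. destruct (Hpd v Hv) as [l [Hl _]]. destruct (Hd v Hv) as [m [n [Hm Hn]]].
    eapply Xi_holo; eauto. apply HG.
  - intros v Hv. left. apply (proj2 HG). apply Xi_tetra. apply Hsg; auto.
  - destruct (Hpd _ H01) as [l [Hl El]]. destruct (Hd _ H01) as [m [n [Hm Hn]]].
    specialize (El eq_refl). subst l.
    eapply hd_eq. apply (Hder p s c (- (2 * RtoC P0))%C m n); auto.
    + unfold s. rewrite Ep0. rewrite <- Ha. ring.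
    + unfold c. rewrite Ep0. ring.
    + field. apply RtoC_neq0; lra. }
assert (Epu : p u = P) by (apply cay_inv; auto).
unfold s, c in E. rewrite Epu in E. unfold K. rewrite E. fold u. ring.
Qed.

(** Finds the disc through given [P] and [S]: the base point fixes [a], and [S] then fixes [b]. The
    smallness conditions give Re a >= 4/5 Re S0 and |b| <= Re S0 / 2, so Re (a + b v) > 0 on the
    disc. *)
Let step2 (P S : C) (q : R) : 0 < fst P -> P <> RtoC P0 -> 0 <= q ->
  let e := Cmod ((RtoC P0 - P) / (RtoC P0 + P))%C * fst S0 / 4 in
  Cmod (S - S0)%C <= e -> q * Cmod (P - RtoC P0)%C <= e -> q * P0 <= fst S0 / 5 ->
  K P S (RtoC C0 + RtoC q * (RtoC P0 * RtoC P0 - P * P))%C = RtoC 0.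
Proof.
intros HP HPn Hq e He1 He2 He3.
set (u := ((RtoC P0 - P) / (RtoC P0 + P))%C) in *.
assert (Hd : (RtoC P0 + P)%C <> RtoC 0) by (apply right_half_neq0; simpl; lra).
assert (Hu0 : u <> RtoC 0).
{ intros E. apply HPn. symmetry. apply Csub_eq0. replace (RtoC P0 - P)%C with (u * (RtoC P0 + P))%C by (unfold u; field; auto). rewrite E. ring. }
pose proof (proj1 (Cmod_gt_0 _) Hu0) as Hu1.
set (a := (S0 - RtoC q * RtoC P0)%C). set (b := ((S - RtoC q * P - a) / u)%C).
assert (ES : S = (a + b * u + RtoC q * P)%C) by (unfold b; field; auto).
rewrite ES. apply step1; auto.
2: unfold a; ring.
assert (Hb : Cmod b <= fst S0 / 2).
{ unfold b. rewrite Cmod_div by auto. apply Rmult_le_reg_r with (Cmod u); auto.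
  unfold Rdiv at 1. rewrite Rmult_assoc, Rinv_l, Rmult_1_r by lra.
  replace (S - RtoC q * P - a)%C with ((S - S0) + - (RtoC q * (P - RtoC P0)))%C by (unfold a; ring).
  apply Rle_trans with (1 := Cmod_triangle _ _). rewrite Cmod_opp, Cmod_mult, Cmod_R, Rabs_pos_eq by auto.
  unfold e in *. lra. }
intros v Hv. pose proof (fst_le_Cmod (- (b * v))) as T. rewrite Cmod_opp, Cmod_mult in T.
assert (Cmod b * Cmod v <= fst S0 / 2). { pose proof (Cmod_ge_0 v). nra. }
unfold a. simpl in *. nra.
Qed.

(** For fixed [P] and [S], the values of [c] reached with small [q > 0] form a segment ending at
    [C0], enough for the identity theorem in [c]. The segment does not collapse because
    [P <> P0]. *)
Let step3 (P S c : C) : 0 < fst P -> P <> RtoC P0 ->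
  Cmod (S - S0)%C <= Cmod ((RtoC P0 - P) / (RtoC P0 + P))%C * fst S0 / 4 ->
  Cmod (c - RtoC C0)%C < fst P * fst S -> K P S c = RtoC 0.
Proof.
intros HP HPn HS Hc.
set (u := ((RtoC P0 - P) / (RtoC P0 + P))%C) in *.
assert (Hd : (RtoC P0 + P)%C <> RtoC 0) by (apply right_half_neq0; simpl; lra).
assert (Hm : (RtoC P0 - P)%C <> RtoC 0) by (apply sub_neq0; auto).
assert (Hu0 : 0 < Cmod u). { apply Cmod_gt_0. intros E. apply Hm. replace (RtoC P0 - P)%C with (u * (RtoC P0 + P))%C by (unfold u; field; auto). rewrite E. ring. }
pose proof (cay_disc P0 P HP0 HP) as Hu1. fold u in Hu1. unfold disc in Hu1.
assert (HSp : 0 < fst S). { pose proof (fst_le_Cmod (- (S - S0))) as T. rewrite Cmod_opp in T. simpl in T. nra. }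
apply (identity (fun c => K P S c) (RtoC C0) (fst P * fst S) 2); auto.
- intros z Hz. eapply (K_holo (fun _ => P) (fun _ => S) (fun c => c)). now apply siegel_near with C0. apply hd_const. apply hd_const. apply hd_id.
- intros z Hz. apply K_bound. now apply siegel_near with C0.
- intros d Hd0. set (D := ((RtoC P0 - P) * (RtoC P0 + P))%C).
  assert (HD : D <> RtoC 0) by now apply Cmult_neq_0.
  pose proof (Cmod_ge_0 D). pose proof (Cmod_ge_0 (P - RtoC P0)).
  set (e := Cmod u * fst S0 / 4).
  assert (He : 0 < e) by (unfold e; nra).
  set (q := Rmin (d / (2 * (Cmod D + 1))) (Rmin (e / (Cmod (P - RtoC P0) + 1)) (fst S0 / 5 / P0))).
  assert (Hq : 0 < q). { repeat apply Rmin_pos; apply Rdiv_lt_0_compat; lra. }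
  assert (Q1 : q <= d / (2 * (Cmod D + 1))) by apply Rmin_l.
  assert (Q23 : q <= Rmin (e / (Cmod (P - RtoC P0) + 1)) (fst S0 / 5 / P0)) by apply Rmin_r.
  assert (Q2 : q <= e / (Cmod (P - RtoC P0) + 1)) by (apply Rle_trans with (1 := Q23), Rmin_l).
  assert (Q3 : q <= fst S0 / 5 / P0) by (apply Rle_trans with (1 := Q23), Rmin_r).
  assert (M : forall a b, 0 < b -> q <= a / b -> q * b <= a).
  { intros a b Hb Hq'. replace a with (a / b * b) by (field; lra). apply Rmult_le_compat_r; lra. }
  apply M in Q1; [|lra]. apply M in Q2; [|lra]. apply M in Q3; [|lra].
  assert (ED : (RtoC C0 + RtoC q * (RtoC P0 * RtoC P0 - P * P) - RtoC C0)%C = (RtoC q * D)%C) by (unfold D; ring).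
  exists (RtoC C0 + RtoC q * (RtoC P0 * RtoC P0 - P * P))%C. split; [|split].
  + intros E. apply (f_equal (fun w => w - RtoC C0)%C) in E. rewrite ED in E. replace (RtoC C0 - RtoC C0)%C with (RtoC 0) in E by ring.
    revert E. apply Cmult_neq_0; auto. apply RtoC_neq0. lra.
  + rewrite ED, Cmod_mult, Cmod_R, Rabs_pos_eq by lra. nra.
  + apply step2; auto; fold u; fold e; nra.
Qed.

(** Frees [S]: for [c] close to [C0] the admissible half plane Re S > h contains [S0], around which
    [step3] applies. *)
Let step4 (P S c : C) : P <> RtoC P0 -> siegel P S c -> Cmod (c - RtoC C0)%C < fst P * fst S0 / 2 -> K P S c = RtoC 0.
Proof.
intros HPn [HP [HS Hs]] Hc.
set (h := (Cmod c - fst c) / (2 * fst P)).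
assert (Hh0 : 0 <= h). { unfold h. apply Rmult_le_pos. pose proof (fst_le_Cmod c). lra. left. apply Rinv_0_lt_compat. lra. }
assert (Eh : h * (2 * fst P) = Cmod c - fst c) by (unfold h; field; lra).
set (u := ((RtoC P0 - P) / (RtoC P0 + P))%C).
assert (Hd : (RtoC P0 + P)%C <> RtoC 0) by (apply right_half_neq0; simpl; lra).
assert (Hm : (RtoC P0 - P)%C <> RtoC 0) by (apply sub_neq0; auto).
assert (Hu0 : 0 < Cmod u). { apply Cmod_gt_0. intros E. apply Hm. replace (RtoC P0 - P)%C with (u * (RtoC P0 + P))%C by (unfold u; field; auto). rewrite E. ring. }
pose proof (cay_disc P0 P HP0 HP) as Hu1. fold u in Hu1. unfold disc in Hu1.
assert (Hcc : Cmod c - fst c < fst P * fst S0).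
{ assert (siegel P (S0 / 2) c). { apply siegel_near with C0; auto. simpl. lra. replace (fst (S0 / 2)%C) with (fst S0 / 2). lra. simpl; field. }
  destruct H as [_ [_ H]]. replace (fst (S0 / 2)%C) with (fst S0 / 2) in H by (simpl; field). lra. }
apply (half_plane_identity (fun S => K P S c) S0 S h (Cmod u * fst S0 / 4) 2).
- intros z Hz. eapply (K_holo (fun _ => P) (fun z => z) (fun _ => c)). repeat split; auto. lra. nra. apply hd_const. apply hd_id. apply hd_const.
- intros z Hz. apply K_bound. repeat split; auto. lra. nra.
- nra.
- nra.
- intros z Hz Hzd. apply step3; auto. fold u. lra.
  assert (fst S0 * (3 / 4) <= fst z). { pose proof (fst_le_Cmod (- (z - S0))) as T. rewrite Cmod_opp in T. simpl in T. nra. }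
  nra.
- nra.
Qed.

(** Frees [c]: when Re S is large, the disc around [C0] on which the identity theorem in [c] works
    contains the given [c]; afterwards [S] is brought back within its half plane. *)
Let step5 (P S c : C) : P <> RtoC P0 -> siegel P S c -> K P S c = RtoC 0.
Proof.
intros HPn [HP [HS Hs]].
set (h := (Cmod c - fst c) / (2 * fst P)).
assert (Hh0 : 0 <= h). { unfold h. apply Rmult_le_pos. pose proof (fst_le_Cmod c). lra. left. apply Rinv_0_lt_compat. lra. }
assert (Eh : h * (2 * fst P) = Cmod c - fst c) by (unfold h; field; lra).
set (N := Cmod (c - RtoC C0) / fst P).
assert (HN : N * fst P = Cmod (c - RtoC C0)) by (unfold N; field; lra).
assert (HN0 : 0 <= N). { unfold N. apply Rmult_le_pos. apply Cmod_ge_0. left. apply Rinv_0_lt_compat. lra. }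
assert (A : forall z, N < fst z -> K P z c = RtoC 0).
{ intros z Hz. apply (identity (fun c => K P z c) (RtoC C0) (fst P * fst z) 2).
  - intros w Hw. eapply (K_holo (fun _ => P) (fun _ => z) (fun w => w)). apply siegel_near with C0; auto. lra. apply hd_const. apply hd_const. apply hd_id.
  - intros w Hw. apply K_bound. apply siegel_near with C0; auto. lra.
  - intros d Hd. set (r := Rmin (d / 2) (Rmin (fst P * fst S0 / 4) (fst P * fst z / 2))).
    assert (Hr : 0 < r). { repeat apply Rmin_pos; nra. }
    assert (R1 : r <= d / 2) by apply Rmin_l.
    assert (R2 : r <= fst P * fst S0 / 4) by (apply Rle_trans with (1 := Rmin_r _ _), Rmin_l).
    assert (R3 : r <= fst P * fst z / 2) by (apply Rle_trans with (1 := Rmin_r _ _), Rmin_r).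
    assert (E : Cmod (RtoC C0 + RtoC r - RtoC C0)%C = r).
    { replace (RtoC C0 + RtoC r - RtoC C0)%C with (RtoC r) by ring. rewrite Cmod_R, Rabs_pos_eq; lra. }
    exists (RtoC C0 + RtoC r)%C. split; [|split].
    + intros E'. rewrite E' in E. replace (RtoC C0 - RtoC C0)%C with (RtoC 0) in E by ring. rewrite Cmod_0 in E. lra.
    + lra.
    + apply step4; auto. apply siegel_near with C0; auto. lra. rewrite E. nra. rewrite E. nra.
  - nra. }
set (S1 := (S + RtoC (N + 2))%C).
apply (half_plane_identity (fun S => K P S c) S1 S h 1 2).
- intros z Hz. eapply (K_holo (fun _ => P) (fun z => z) (fun _ => c)). repeat split; auto. lra. nra. apply hd_const. apply hd_id. apply hd_const.
- intros z Hz. apply K_bound. repeat split; auto. lra. nra.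
- unfold S1. simpl. nra.
- lra.
- intros z Hz Hzd. apply A. pose proof (fst_le_Cmod (- (z - S1))) as T. rewrite Cmod_opp in T. unfold S1 in *. simpl in *. lra.
- nra.
Qed.

Lemma key_uniqueness (P S c : C) : siegel P S c -> G (Xi P S c) = ((RtoC P0 - P) / (RtoC P0 + P))%C.
Proof.
intros Hs. apply Csub_eq0. change (K P S c = RtoC 0).
(* The slice [P = P0], excluded so far, is recovered by the identity theorem in [P]. *)
destruct (classic (P = RtoC P0)) as [E|E]. 2: now apply step5.
destruct Hs as [HP [HS Hs]].
set (h := (Cmod c - fst c) / (2 * fst S)).
assert (Hh0 : 0 <= h). { unfold h. apply Rmult_le_pos. pose proof (fst_le_Cmod c). lra. left. apply Rinv_0_lt_compat. lra. }
assert (Eh : h * (2 * fst S) = Cmod c - fst c) by (unfold h; field; lra).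
assert (HPh : h < fst P) by nra.
apply (identity (fun P => K P S c) (RtoC P0) (P0 - h) 2).
- intros z Hz. assert (h < fst z). { pose proof (fst_le_Cmod (- (z - RtoC P0))) as T. rewrite Cmod_opp in T. simpl in T. lra. }
  eapply (K_holo (fun z => z) (fun _ => S) (fun _ => c)). repeat split; auto. lra. nra. apply hd_id. apply hd_const. apply hd_const.
- intros z Hz. assert (h < fst z). { pose proof (fst_le_Cmod (- (z - RtoC P0))) as T. rewrite Cmod_opp in T. simpl in T. lra. }
  apply K_bound. repeat split; auto. lra. nra.
- rewrite E in HPh. simpl in HPh. intros d Hd. set (r := Rmin (d / 2) ((P0 - h) / 2)).
  assert (Hr : 0 < r). { apply Rmin_pos; lra. }
  assert (R1 : r <= d / 2) by apply Rmin_l.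
  assert (E1 : Cmod (RtoC P0 + RtoC r - RtoC P0)%C = r).
  { replace (RtoC P0 + RtoC r - RtoC P0)%C with (RtoC r) by ring. rewrite Cmod_R, Rabs_pos_eq; lra. }
  assert (E2 : (RtoC P0 + RtoC r)%C <> RtoC P0).
  { intros E'. rewrite E' in E1. replace (RtoC P0 - RtoC P0)%C with (RtoC 0) in E1 by ring. rewrite Cmod_0 in E1. lra. }
  exists (RtoC P0 + RtoC r)%C. split; [auto|split]. lra.
  apply step5; auto. repeat split; auto. simpl; lra. simpl. nra.
- rewrite E. replace (RtoC P0 - RtoC P0)%C with (RtoC 0) by ring. rewrite Cmod_0. rewrite E in HPh. simpl in HPh. lra.
Qed.
End Key.

(** * The geodesics of part (1) *)

Definition rot (w1 w2 : C) (x : C3) : C3 := (w1 * pr1 x, w2 * pr2 x, w1 * w2 * pr3 x)%C.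

Lemma C3_eq (a b c a' b' c' : C) : a = a' -> b = b' -> c = c' -> ((a, b, c) : C3) = (a', b', c').
Proof. now intros -> -> ->. Qed.

Lemma tetra_rot (w1 w2 : C) (x : C3) : Cmod w1 = 1 -> Cmod w2 = 1 -> tetrablock x -> tetrablock (rot w1 w2 x).
Proof.
intros H1 H2. destruct x as [[x1 x2] x3]. unfold rot, pr1, pr2, pr3; simpl fst; simpl snd. rewrite !tetra_iff.
replace (w1 * x1 * (w2 * x2) - w1 * w2 * x3)%C with (w1 * w2 * (x1 * x2 - x3))%C by ring.
unfold defect. rewrite !N2_Cmod, !Cmod_mult, H1, H2, !Rmult_1_l. auto.
Qed.

Lemma unit_conj (w : C) : Cmod w = 1 -> (w * Cconj w)%C = RtoC 1.
Proof. intros H. rewrite Cmod_sqr, H. f_equal. ring. Qed.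

Lemma rot_inv (w1 w2 : C) (x : C3) : Cmod w1 = 1 -> Cmod w2 = 1 -> rot w1 w2 (rot (Cconj w1) (Cconj w2) x) = x.
Proof.
intros H1 H2. destruct x as [[x1 x2] x3]. unfold rot, pr1, pr2, pr3; simpl fst; simpl snd.
apply C3_eq.
- transitivity (w1 * Cconj w1 * x1)%C. ring. rewrite unit_conj by auto. ring.
- transitivity (w2 * Cconj w2 * x2)%C. ring. rewrite unit_conj by auto. ring.
- transitivity (w1 * Cconj w1 * (w2 * Cconj w2) * x3)%C. ring. rewrite !unit_conj by auto. ring.
Qed.

Lemma rot_inv' (w1 w2 : C) (x : C3) : Cmod w1 = 1 -> Cmod w2 = 1 -> rot (Cconj w1) (Cconj w2) (rot w1 w2 x) = x.
Proof.
intros H1 H2. rewrite <- (Cconj_conj w1) at 2. rewrite <- (Cconj_conj w2) at 2. apply rot_inv; now rewrite Cmod_conj.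
Qed.

Lemma disc_map_rot (G : C3 -> C) (w1 w2 : C) : Cmod w1 = 1 -> Cmod w2 = 1 -> disc_map G ->
  disc_map (fun x => G (rot w1 w2 x)).
Proof.
intros H1 H2 [HG HD]. split.
- apply holo_tetra; rewrite holo_tetra in HG. intros x Hx.
  apply (fdx_comp3 G (fun x => w1 * pr1 x)%C (fun x => w2 * pr2 x)%C (fun x => w1 * w2 * pr3 x)%C x).
  apply HG. exact (tetra_rot w1 w2 x H1 H2 Hx).
  apply fdx_mult. apply fdx_const. apply fdx_pr1. apply fdx_mult. apply fdx_const. apply fdx_pr2. apply fdx_mult. apply fdx_const. apply fdx_pr3.
- intros x Hx. apply HD. now apply tetra_rot.
Qed.

Lemma disc_map_mult (G : C3 -> C) (u : C) : Cmod u = 1 -> disc_map G -> disc_map (fun x => u * G x)%C.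
Proof.
intros Hu [HG HD]. split.
- apply holo_tetra; rewrite holo_tetra in HG. intros x Hx. apply fdx_mult. apply fdx_const. now apply HG.
- intros x Hx. unfold disc. rewrite Cmod_mult, Hu, Rmult_1_l. now apply HD.
Qed.

Lemma left_inverse_iff (phi : C -> C3) (F : C3 -> C) :
  left_inverse phi F <-> disc_map F /\ forall z, disc z -> F (phi z) = z.
Proof. unfold left_inverse, disc_map. tauto. Qed.

Lemma not_unique (phi : C -> C3) (F F' : C3 -> C) (x : C3) :
  left_inverse phi F -> left_inverse phi F' -> tetrablock x -> F x <> F' x -> ~ unique_left_inverse phi.
Proof.
intros H H' Hx Hn [F0 [_ Hu]]. apply Hn. now rewrite (Hu F H x Hx), (Hu F' H' x Hx).
Qed.

Lemma Cdiv_eq (a b c d : C) : b <> RtoC 0 -> d <> RtoC 0 -> (a / b = c / d)%C -> (a * d = c * b)%C.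
Proof.
intros Hb Hd E. transitivity (a / b * b * d)%C. field; auto. rewrite E. field. auto.
Qed.

(** On the closed disc |al + be w| has the maximum |al| + |be|, taken where the two terms are
    aligned; with [be] nonzero its value at the interior point [w0] would be less than 1. *)
Lemma affine_disc (al be w0 : C) : (forall w, Cmod w <= 1 -> Cmod (al + be * w)%C <= 1) ->
  (al + be * w0)%C = RtoC 1 -> Cmod w0 < 1 -> be = RtoC 0.
Proof.
intros H E Hw. destruct (classic (be = RtoC 0)) as [|Hb]; auto. exfalso.
pose proof (proj1 (Cmod_gt_0 _) Hb) as Hb0.
assert (Hsum : Cmod al + Cmod be <= 1).
{ destruct (classic (al = RtoC 0)) as [Ha|Ha].
  - specialize (H 1 ltac:(rewrite Cmod_1; lra)). rewrite Ha in *. rewrite Cmod_0. replace (0 + be * 1)%C with be in H by ring. lra.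
  - pose proof (proj1 (Cmod_gt_0 _) Ha) as Ha0.
    set (w := (RtoC (Cmod be / Cmod al) * (al / be))%C).
    assert (Hwn : Cmod w = 1).
    { unfold w. rewrite Cmod_mult, Cmod_div, Cmod_R, Rabs_pos_eq; auto. field. lra.
      left. now apply Rdiv_lt_0_compat. }
    specialize (H w ltac:(lra)).
    assert (Ew : (al + be * w)%C = (al * RtoC (1 + Cmod be / Cmod al))%C).
    { unfold w. rewrite RtoC_plus. field. auto. }
    rewrite Ew, Cmod_mult, Cmod_R, Rabs_pos_eq in H.
    replace (Cmod al * (1 + Cmod be / Cmod al)) with (Cmod al + Cmod be) in H by (field; lra). auto.
    assert (0 < Cmod be / Cmod al) by now apply Rdiv_lt_0_compat. lra. }
pose proof (Cmod_triangle al (be * w0)) as T. rewrite E, Cmod_1, Cmod_mult in T. nra.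
Qed.

(** Around the interior point [k] the function is 1 + be s with small real [s] of both signs; adding
    the bounds for s and - s leaves |be|^2 s^2 <= 0. *)
Lemma affine_real (al be : C) (k : R) : 0 < k < 1 -> (forall t : R, 0 <= t < 1 -> Cmod (al + be * RtoC t)%C <= 1) ->
  (al + be * RtoC k)%C = RtoC 1 -> be = RtoC 0.
Proof.
intros Hk H E.
assert (B : forall s, - k <= s < 1 - k -> 2 * (fst be * s) + N2 be * (s * s) <= 0).
{ intros s Hs. specialize (H (k + s) ltac:(lra)). apply N2_le_1 in H.
  replace (al + be * RtoC (k + s))%C with (1 + be * RtoC s)%C in H by (rewrite <- E, RtoC_plus; ring).
  unfold N2 in *. simpl in H. nra. }
set (s := Rmin k (1 - k) / 2).
assert (Hs : 0 < s). { unfold s. pose proof (Rmin_pos k (1 - k) ltac:(lra) ltac:(lra)). lra. }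
assert (Hs1 : s < k /\ s < 1 - k). { unfold s in *. pose proof (Rmin_l k (1 - k)). pose proof (Rmin_r k (1 - k)). lra. }
pose proof (B s ltac:(lra)). pose proof (B (- s) ltac:(lra)).
pose proof (N2_nonneg be). assert (0 < s * s) by nra.
assert (N2 be = 0). { apply Rle_antisym; auto. apply Rmult_le_reg_r with (s * s); auto. nra. }
apply Cmod_eq_0. rewrite N2_Cmod in *. nra.
Qed.

Lemma cay_0 : cay (RtoC 0) = RtoC 1.
Proof. unfold cay. field. Qed.

Section Part1.
Variables (phi : C -> C3) (w1 w2 : C) (k : R) (psi : C -> C).
Hypotheses (Hw1 : Cmod w1 = 1) (Hw2 : Cmod w2 = 1) (Hk : 0 <= k <= 1).
Hypothesis Hphi : forall z, disc z -> tetrablock (phi z).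
Hypothesis Hpsi : holo disc psi.
Hypothesis Hpsi1 : forall z, disc z -> closed_disc (psi z).
Hypothesis Hpsi0 : psi (RtoC 0) = RtoC (- k).
Hypothesis Ephi : forall z, disc z ->
  phi z = ((w1 * ((psi z + RtoC k) / (1 + RtoC k)))%C,
           (w2 * z * ((1 + RtoC k * psi z) / (1 + RtoC k)))%C,
           (w1 * w2 * z * psi z)%C).

Let y1 (z : C) : C := ((psi z + RtoC k) / (1 + RtoC k))%C.
Let y2 (z : C) : C := (z * ((1 + RtoC k * psi z) / (1 + RtoC k)))%C.
Let y3 (z : C) : C := (z * psi z)%C.

Let Erot z : disc z -> phi z = rot w1 w2 (y1 z, y2 z, y3 z).
Proof.
intros Hz. rewrite Ephi by auto. unfold rot, pr1, pr2, pr3, y1, y2, y3. simpl fst. simpl snd. apply C3_eq; unfold Cdiv; ring.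
Qed.

Let Ey z : disc z -> rot (Cconj w1) (Cconj w2) (phi z) = (y1 z, y2 z, y3 z).
Proof. intros Hz. rewrite Erot by auto. now apply rot_inv'. Qed.

Let Hy z : disc z -> tetrablock (y1 z, y2 z, y3 z).
Proof. intros Hz. rewrite <- Ey by auto. apply tetra_rot; try rewrite Cmod_conj; auto. Qed.

Let k1 : (1 + RtoC k)%C <> RtoC 0.
Proof. rewrite <- RtoC_plus. apply RtoC_neq0. lra. Qed.

Let psi_ne1 z : disc z -> (1 - psi z)%C <> RtoC 0.
Proof.
intros Hz E. apply Csub_eq0 in E. pose proof (tetra_x1 _ _ _ (Hy z Hz)) as H. unfold y1 in H. rewrite <- E in H.
replace ((1 + RtoC k) / (1 + RtoC k))%C with (RtoC 1) in H by (field; auto). rewrite Cmod_1 in H. lra.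
Qed.

Let left_inv (F : C3 -> C) : disc_map F -> (forall z, disc z -> F (y1 z, y2 z, y3 z) = z) ->
  left_inverse phi (fun x => F (rot (Cconj w1) (Cconj w2) x)).
Proof.
intros HF H. apply left_inverse_iff. split. apply disc_map_rot; try rewrite Cmod_conj; auto.
intros z Hz. rewrite Ey by auto. auto.
Qed.

Let two (F F' : C3 -> C) (y : C3) : disc_map F -> disc_map F' ->
  (forall z, disc z -> F (y1 z, y2 z, y3 z) = z) -> (forall z, disc z -> F' (y1 z, y2 z, y3 z) = z) ->
  tetrablock y -> F y <> F' y -> ~ unique_left_inverse phi.
Proof.
intros H1 H2 H3 H4 Hyy Hne.
apply (not_unique phi _ _ (rot w1 w2 y) (left_inv F H1 H3) (left_inv F' H2 H4)). now apply tetra_rot.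
now rewrite rot_inv'.
Qed.

Lemma one_sub_x1 (x1 x2 x3 eta : C) : tetrablock (x1, x2, x3) -> Cmod eta <= 1 -> (1 - eta * x1)%C <> RtoC 0.
Proof. intros H He. apply one_sub_neq0. apply Cmod_mult_lt1; auto. now apply tetra_x1 in H. Qed.

(** One of the two families of linear fractional functions by which the tetrablock is classically
    described; [tetra_psi] bounds it by 1. *)
Definition psi2 (eta : C) (x : C3) : C := ((pr2 x - eta * pr3 x) / (1 - eta * pr1 x))%C.
Definition psi1 (eta : C) (x : C3) : C := ((pr1 x - eta * pr3 x) / (1 - eta * pr2 x))%C.

Lemma disc_map_psi2 (eta : C) : Cmod eta <= 1 -> disc_map (psi2 eta).
Proof.
intros He. split.
- rewrite holo_tetra. intros [[x1 x2] x3] Hx. apply fdx_div. apply (one_sub_x1 x1 x2 x3); auto.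
  apply fdx_minus. apply fdx_pr2. apply fdx_mult. apply fdx_const. apply fdx_pr3.
  apply fdx_minus. apply fdx_const. apply fdx_mult. apply fdx_const. apply fdx_pr1.
- intros [[x1 x2] x3] Hx. pose proof (one_sub_x1 x1 x2 x3 eta Hx He) as Hd. pose proof (proj1 (Cmod_gt_0 _) Hd).
  unfold disc, psi2, pr1, pr2, pr3; simpl fst; simpl snd.
  rewrite Cmod_div by auto. apply Rmult_lt_reg_r with (Cmod (1 - eta * x1)); auto. unfold Rdiv. rewrite Rmult_assoc, Rinv_l, Rmult_1_r, Rmult_1_l by lra.
  now apply tetra_psi.
Qed.

Definition swap (x : C3) : C3 := (pr2 x, pr1 x, pr3 x).

Lemma tetra_swap3 (x : C3) : tetrablock x -> tetrablock (swap x).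
Proof. destruct x as [[x1 x2] x3]. apply tetra_swap. Qed.

Lemma disc_map_swap (G : C3 -> C) : disc_map G -> disc_map (fun x => G (swap x)).
Proof.
intros [HG HD]. split.
- apply holo_tetra; rewrite holo_tetra in HG. intros x Hx. apply (fdx_comp3 G pr2 pr1 pr3).
  apply HG. now apply (tetra_swap3 x). apply fdx_pr2. apply fdx_pr1. apply fdx_pr3.
- intros x Hx. apply HD. now apply tetra_swap3.
Qed.

Lemma disc_map_psi1 (eta : C) : Cmod eta <= 1 -> disc_map (psi1 eta).
Proof. intros He. exact (disc_map_swap _ (disc_map_psi2 eta He)). Qed.

Lemma disc_map_x3 : disc_map (fun x => (- pr3 x)%C).
Proof.
split.
- rewrite holo_tetra. intros x Hx. apply fdx_opp. apply fdx_pr3.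
- intros [[x1 x2] x3] Hx. unfold disc, pr3; simpl snd. rewrite Cmod_opp. now apply tetra_x3 in Hx.
Qed.

Lemma tetra_axis1 (x : R) : 0 <= x < 1 -> tetrablock (RtoC x, RtoC 0, RtoC 0).
Proof.
intros H. apply tetra_iff. rewrite Cmod_0. split. lra.
replace (RtoC x * 0 - 0)%C with (RtoC 0) by ring. rewrite Cmod_0. unfold defect, N2; simpl. nra.
Qed.

Lemma tetra_axis2 (x : R) : 0 <= x < 1 -> tetrablock (RtoC 0, RtoC x, RtoC 0).
Proof. intros H. apply tetra_swap. now apply tetra_axis1. Qed.

(** Holds for every [psi] and [k], so that each exceptional case needs only one further left
    inverse. *)
Let f1_inv z : disc z -> psi2 (RtoC 1) (y1 z, y2 z, y3 z) = z.
Proof.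
intros Hz. unfold psi2, pr1, pr2, pr3, y1, y2, y3; simpl fst; simpl snd. field. split; auto.
replace (1 + RtoC k - (psi z + RtoC k))%C with (1 - psi z)%C by ring. auto.
Qed.

Let F1d := disc_map_psi2 (RtoC 1) ltac:(rewrite Cmod_1; lra).

(** Here y2 z = z: the second coordinate, which is [psi2] at 0, is also a left inverse. *)
Let not_k0 : k = 0 -> ~ unique_left_inverse phi.
Proof.
intros E. apply (two (psi2 (RtoC 1)) (psi2 (RtoC 0)) (RtoC (/ 4), RtoC (/ 4), RtoC 0)); auto.
- apply disc_map_psi2. rewrite Cmod_0. lra.
- intros z Hz. unfold psi2, pr1, pr2, pr3, y1, y2, y3; simpl fst; simpl snd. rewrite E. field.
- apply tetra_iff. rewrite Cmod_0. split. lra.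
  replace (RtoC (/ 4) * RtoC (/ 4) - 0)%C with (RtoC (/ 16)). rewrite Cmod_R, Rabs_pos_eq by lra. unfold defect, N2; simpl. lra.
  rewrite <- RtoC_mult. replace (/ 4 * / 4) with (/ 16) by field. ring.
- unfold psi2, pr1, pr2, pr3; simpl fst; simpl snd. intros H.
  apply Cdiv_eq in H. apply (f_equal fst) in H. simpl in H. lra.
  rewrite <- RtoC_mult, <- RtoC_minus. apply RtoC_neq0. lra.
  replace (1 - 0 * RtoC (/ 4))%C with (RtoC 1) by ring. apply RtoC_neq0; lra.
Qed.

(** By the maximum principle [psi] is the constant -1, hence y3 z = - z. *)
Let not_k1 : k = 1 -> ~ unique_left_inverse phi.
Proof.
intros E. assert (Ep : forall z, disc z -> psi z = RtoC (- k)).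
{ rewrite <- Hpsi0. apply schwarz_const; auto. rewrite Hpsi0, Cmod_R, Rabs_left; lra. }
apply (two (psi2 (RtoC 1)) (fun x => - pr3 x)%C (RtoC 0, RtoC (/ 4), RtoC 0)); auto.
- apply disc_map_x3.
- intros z Hz. unfold pr3, y3; simpl snd. rewrite Ep by auto. rewrite E, RtoC_opp. ring.
- apply tetra_axis2. lra.
- unfold psi2, pr1, pr2, pr3; simpl fst; simpl snd. intros H.
  replace (- RtoC 0)%C with (RtoC 0 / RtoC 1)%C in H by (unfold Cdiv; ring).
  apply Cdiv_eq in H. apply (f_equal fst) in H. simpl in H. lra.
  replace (1 - 1 * 0)%C with (RtoC 1) by ring. apply RtoC_neq0; lra. apply RtoC_neq0; lra.
Qed.

(** [psi] followed by the disc automorphism that sends - k to 0. So g 0 = 0, and for k < 1 [psi] is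
    an automorphism exactly when [g] is a rotation, which Schwarz's lemma reads off the derivative
    at 0. *)
Let g (z : C) : C := ((psi z + RtoC k) / (1 + RtoC k * psi z))%C.

Let gden z : k < 1 -> closed_disc (psi z) -> (1 + RtoC k * psi z)%C <> RtoC 0.
Proof.
intros H Hz. apply one_add_neq0. rewrite Cmod_mult, Cmod_R, Rabs_pos_eq by lra. unfold closed_disc in Hz. nra.
Qed.

Let g_holo : k < 1 -> holo disc g.
Proof.
intros H z Hz. destruct (Hpsi z Hz) as [l Hl]. eexists. apply hd_div. auto.
apply hd_plus. apply Hl. apply hd_const. apply hd_plus. apply hd_const. apply hd_mult. apply hd_const. apply Hl.
Qed.

Let g_le z : k < 1 -> disc z -> closed_disc (g z).
Proof.
intros H Hz. pose proof (gden z H (Hpsi1 z Hz)) as Hd. pose proof (proj1 (Cmod_gt_0 _) Hd). unfold closed_disc, g.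
rewrite Cmod_div by auto. apply Rmult_le_reg_r with (Cmod (1 + RtoC k * psi z)); auto. unfold Rdiv. rewrite Rmult_assoc, Rinv_l, Rmult_1_r, Rmult_1_l by lra.
pose proof (mobius_le (RtoC (- k)) (psi z)) as M.
replace (psi z - RtoC (- k))%C with (psi z + RtoC k)%C in M by (rewrite RtoC_opp; ring).
replace (1 - Cconj (RtoC (- k)) * psi z)%C with (1 + RtoC k * psi z)%C in M.
apply M. rewrite Cmod_R, Rabs_left1; lra. now apply Hpsi1.
apply injective_projections; simpl; ring.
Qed.

Let kk (H : k < 1) : RtoC (1 - k * k) <> RtoC 0.
Proof. apply RtoC_neq0. nra. Qed.

Let hd_g l : k < 1 -> hd psi (RtoC 0) l -> hd g (RtoC 0) (l / RtoC (1 - k * k))%C.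
Proof.
intros H Hl. assert (E : (1 + RtoC k * psi (RtoC 0))%C = RtoC (1 - k * k)).
{ rewrite Hpsi0, <- RtoC_mult, <- RtoC_plus. f_equal. ring. }
eapply hd_eq. apply hd_div. apply gden; auto. apply Hpsi1. unfold disc. rewrite Cmod_0; lra.
apply hd_plus. apply Hl. apply hd_const. apply hd_plus. apply hd_const. apply hd_mult. apply hd_const. apply Hl.
cbv beta. rewrite E. rewrite Hpsi0, RtoC_opp. field. auto.
Qed.

Let psi_of_g u : k < 1 -> (forall z, disc z -> g z = (u * z)%C) -> Cmod u = 1 ->
  forall z, disc z -> psi z = ((u * z - RtoC k) / (1 - RtoC k * (u * z)))%C.
Proof.
intros H Hg Hu z Hz.
assert (Hd2 : (1 - RtoC k * (u * z))%C <> RtoC 0).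
{ apply one_sub_neq0. apply Cmod_mult_lt1. rewrite Cmod_R, Rabs_pos_eq; lra. rewrite Cmod_mult, Hu, Rmult_1_l. exact Hz. }
pose proof (Hg z Hz) as E. unfold g in E.
assert (E2 : (psi z + RtoC k = u * z * (1 + RtoC k * psi z))%C). { rewrite <- E. field. auto. }
assert (E3 : (psi z * (1 - RtoC k * (u * z)) = u * z - RtoC k)%C).
{ transitivity (psi z + RtoC k - RtoC k - RtoC k * (u * z) * psi z)%C. ring. rewrite E2. ring. }
rewrite <- E3. field. auto.
Qed.

Lemma mobius_disc (b w : C) : Cmod b < 1 -> Cmod w < 1 -> Cmod ((w - b) / (1 - Cconj b * w))%C < 1.
Proof.
intros Hb Hw. assert (Hd : (1 - Cconj b * w)%C <> RtoC 0).
{ apply one_sub_neq0. apply Cmod_mult_lt1; auto. rewrite Cmod_conj. lra. }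
rewrite Cmod_div by auto. pose proof (proj1 (Cmod_gt_0 _) Hd).
apply Rmult_lt_reg_r with (Cmod (1 - Cconj b * w)); auto. unfold Rdiv. rewrite Rmult_assoc, Rinv_l, Rmult_1_r, Rmult_1_l by lra.
apply N2_lt_Cmod. pose proof (mobius_N2 b w). apply N2_lt_1 in Hb. apply N2_lt_1 in Hw. nra.
Qed.

Let mob_k (s w : C) : k < 1 -> s = RtoC k -> Cmod w < 1 ->
  Cmod ((w - s) / (1 - s * w))%C < 1 /\ Cmod ((w + s) / (1 + s * w))%C < 1 /\ (1 - s * w)%C <> RtoC 0 /\ (1 + s * w)%C <> RtoC 0.
Proof.
intros H -> Hw. assert (Hc : forall t, Cconj (RtoC t) = RtoC t) by (intros; apply injective_projections; simpl; ring).
assert (Hkw : Cmod (RtoC k * w) < 1). { apply Cmod_mult_lt1; auto. rewrite Cmod_R, Rabs_pos_eq; lra. }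
split; [|split; [|split]].
- rewrite <- (Hc k) at 2. apply mobius_disc; auto. rewrite Cmod_R, Rabs_pos_eq; lra.
- pose proof (mobius_disc (RtoC (- k)) w) as M. rewrite Hc, RtoC_opp in M.
  replace (w + RtoC k)%C with (w - - RtoC k)%C by ring. replace (1 + RtoC k * w)%C with (1 - - RtoC k * w)%C by ring.
  apply M; auto. rewrite Cmod_opp, Cmod_R, Rabs_pos_eq; lra.
- now apply one_sub_neq0.
- now apply one_add_neq0.
Qed.

Let aut_of_g u : k < 1 -> (forall z, disc z -> g z = (u * z)%C) -> Cmod u = 1 -> disc_automorphism psi.
Proof.
intros H Hg Hu. pose proof (psi_of_g u H Hg Hu) as Ep.
assert (Huz : forall z, disc z -> Cmod (u * z) < 1). { intros z Hz. rewrite Cmod_mult, Hu, Rmult_1_l. exact Hz. }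
assert (Hn : forall z, disc z -> disc (psi z)).
{ intros z Hz. rewrite Ep by auto. apply (mob_k (RtoC k) (u * z)); auto. }
split; [|split]; auto. now apply holo_disc.
exists (fun w => Cconj u * ((w + RtoC k) / (1 + RtoC k * w)))%C.
assert (Huu : (u * Cconj u)%C = RtoC 1) by now apply unit_conj.
assert (Hi : forall z, disc z -> disc (Cconj u * ((z + RtoC k) / (1 + RtoC k * z)))%C).
{ intros z Hz. unfold disc. rewrite Cmod_mult, Cmod_conj, Hu, Rmult_1_l. apply (mob_k (RtoC k) z); auto. }
split; [|split; [|split]]; auto.
- apply holo_disc. intros z Hz. eexists. apply hd_mult. apply hd_const. apply hd_div.
  apply (mob_k (RtoC k) z); auto.
  apply hd_plus. apply hd_id. apply hd_const. apply hd_plus. apply hd_const. apply hd_mult. apply hd_const. apply hd_id.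
- intros z Hz. change ((psi z + RtoC k) / (1 + RtoC k * psi z))%C with (g z). rewrite Hg by auto.
  transitivity (u * Cconj u * z)%C. ring. rewrite Huu. ring.
- intros z Hz. rewrite Ep by auto.
  destruct (mob_k (RtoC k) z H eq_refl Hz) as [_ [_ [_ D]]].
  replace (u * (Cconj u * ((z + RtoC k) / (1 + RtoC k * z))))%C with ((z + RtoC k) / (1 + RtoC k * z))%C.
  2: { transitivity (u * Cconj u * ((z + RtoC k) / (1 + RtoC k * z)))%C. rewrite Huu. ring. ring. }
  pose proof (kk H) as Hkk. rewrite RtoC_minus, RtoC_mult in Hkk.
  field. split; auto. replace (1 + RtoC k * z - RtoC k * (z + RtoC k))%C with (1 - RtoC k * RtoC k)%C by ring. auto.
Qed.

(** The map w -> h (m w) is a right inverse of [g] and also fixes 0. Both derivatives at 0 have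
    modulus at most 1 and their product is 1, so Schwarz's lemma makes [g] a rotation. *)
Let g_of_aut : k < 1 -> disc_automorphism psi -> exists u, Cmod u = 1 /\ forall z, disc z -> g z = (u * z)%C.
Proof.
intros H [_ [Hp [h [Hh [Hh1 [Hh2 Hh3]]]]]]. apply holo_disc in Hh.
assert (H0 : disc (RtoC 0)) by (unfold disc; rewrite Cmod_0; lra).
set (m := fun w => ((w - RtoC k) / (1 - RtoC k * w))%C).
assert (Hm : forall w, disc w -> disc (m w)). { intros w Hw. apply (mob_k (RtoC k) w); auto. }
assert (Hmd : forall w, disc w -> exists l, hd m w l).
{ intros w Hw. eexists. apply hd_div. apply (mob_k (RtoC k) w); auto.
  apply hd_minus. apply hd_id. apply hd_const. apply hd_minus. apply hd_const. apply hd_mult. apply hd_const. apply hd_id. }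
assert (Hgm : forall w, disc w -> g (h (m w)) = w).
{ intros w Hw. unfold g. rewrite Hh3 by auto. unfold m.
  destruct (mob_k (RtoC k) w H eq_refl Hw) as [_ [_ [D _]]].
  pose proof (kk H) as Hkk. rewrite RtoC_minus, RtoC_mult in Hkk.
  field. split; auto. replace (1 - RtoC k * w + RtoC k * (w - RtoC k))%C with (1 - RtoC k * RtoC k)%C by ring. auto. }
assert (Em0 : m (RtoC 0) = psi (RtoC 0)). { rewrite Hpsi0. unfold m. rewrite RtoC_opp. field. }
assert (Ehm : h (m (RtoC 0)) = RtoC 0). { rewrite Em0. now apply Hh2. }
destruct (g_holo H (RtoC 0) H0) as [u Hu].
destruct (Hmd (RtoC 0) H0) as [a Ha]. destruct (Hh (m (RtoC 0)) (Hm _ H0)) as [b Hb].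
pose proof (hd_comp h m (RtoC 0) b a Hb Ha) as Hhm.
assert (Hcomp : hd (fun w => g (h (m w))) (RtoC 0) (u * (b * a))%C).
{ apply (hd_comp g (fun w => h (m w))); auto. now rewrite Ehm. }
assert (E1 : (u * (b * a))%C = RtoC 1).
{ apply (hd_unique (fun w => g (h (m w))) (RtoC 0)); auto. apply hd_ext_near with (f := fun w => w).
  exists 1. split. lra. intros w Hw. symmetry. apply Hgm. replace (w - 0)%C with w in Hw by ring. exact Hw. apply hd_id. }
assert (B1 : Cmod u <= 1) by (apply (schwarz_deriv g); auto).
assert (B2 : Cmod (b * a) <= 1).
{ apply (schwarz_deriv (fun w => h (m w))); auto.
  - intros w Hw. destruct (Hmd w Hw) as [c Hc]. destruct (Hh (m w) (Hm w Hw)) as [d Hd]. exists (d * c)%C. now apply hd_comp.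
  - intros w Hw. left. apply Hh1. auto. }
assert (Hu1 : Cmod u = 1).
{ apply (f_equal Cmod) in E1. rewrite Cmod_mult, Cmod_1 in E1. pose proof (Cmod_ge_0 u). nra. }
exists u. split; auto. apply schwarz_rot; auto.
Qed.

(** When g z = u z, the mirrored function [psi1 u] takes the value u z on the curve. *)
Let not_aut : k < 1 -> disc_automorphism psi -> ~ unique_left_inverse phi.
Proof.
intros H Ha. destruct (g_of_aut H Ha) as [u [Hu Hg]].
pose proof (psi_of_g u H Hg Hu) as Ep.
assert (Huu : (u * Cconj u)%C = RtoC 1) by now apply unit_conj.
apply (two (psi2 (RtoC 1)) (fun x => Cconj u * psi1 u x)%C (RtoC 0, RtoC (/ 4), RtoC 0)); auto.
- apply disc_map_mult. now rewrite Cmod_conj. apply disc_map_psi1. lra.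
- intros z Hz.
  assert (E : psi1 u (y1 z, y2 z, y3 z) = (u * z)%C).
  { pose proof (one_sub_x1 _ _ _ u (tetra_swap _ _ _ (Hy z Hz)) ltac:(lra)) as Hd.
    unfold psi1, pr1, pr2, pr3; simpl fst; simpl snd.
    replace (y1 z - u * y3 z)%C with (u * z * (1 - u * y2 z))%C. field. auto.
    unfold y1, y2, y3. rewrite Ep by auto.
    assert (Hd2 : (1 - RtoC k * (u * z))%C <> RtoC 0).
    { apply one_sub_neq0. apply Cmod_mult_lt1. rewrite Cmod_R, Rabs_pos_eq; lra. rewrite Cmod_mult, Hu, Rmult_1_l. exact Hz. }
    field. auto. }
  rewrite E. transitivity (u * Cconj u * z)%C. ring. rewrite Huu. ring.
- apply tetra_axis2. lra.
- unfold psi2, psi1, pr1, pr2, pr3; simpl fst; simpl snd. intros E.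
  replace (Cconj u * ((0 - u * 0) / (1 - u * RtoC (/ 4))))%C with (RtoC 0 / RtoC 1)%C in E by (unfold Cdiv; ring).
  apply Cdiv_eq in E. apply (f_equal fst) in E. simpl in E. lra.
  replace (1 - 1 * 0)%C with (RtoC 1) by ring. apply RtoC_neq0; lra. apply RtoC_neq0; lra.
Qed.

Let psi_deriv l : k < 1 -> ~ disc_automorphism psi -> hd psi (RtoC 0) l -> Cmod l < 1 - k * k.
Proof.
intros H Hna Hl.
assert (B1 : Cmod (l / RtoC (1 - k * k)) <= 1) by (apply (schwarz_deriv g); auto).
assert (Hkp : 0 < 1 - k * k) by nra.
assert (E : Cmod (l / RtoC (1 - k * k)) * (1 - k * k) = Cmod l).
{ rewrite Cmod_div, Cmod_R, Rabs_pos_eq by (auto; lra). field. lra. }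
destruct (Req_dec (Cmod (l / RtoC (1 - k * k))) 1) as [E1|E1].
- exfalso. apply Hna. apply (aut_of_g (l / RtoC (1 - k * k)))%C; auto. intros z Hz. apply schwarz_rot; auto.
- nra.
Qed.

(** The curve resembles a quadratic disc with base point (1, 1, 0) and q = k; only a + b z is
    replaced by (1 + k) cay (- psi z), whose value at 0 is 1 - k. *)
Let siegel_curve z : disc z ->
  (y1 z, y2 z, y3 z) = Xi (cay z) (RtoC (1 + k) * cay (- psi z) + RtoC k * cay z)%C
    (RtoC 0 + RtoC k * (RtoC 1 * RtoC 1 - cay z * cay z))%C.
Proof.
intros Hz. pose proof (psi_ne1 z Hz) as H1. pose proof (one_add_neq0 z Hz) as H2.

set (R := (cay z * (RtoC (1 + k) * cay (- psi z) + RtoC k * cay z) + (RtoC 0 + RtoC k * (RtoC 1 * RtoC 1 - cay z * cay z)))%C).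
assert (ER : R = (RtoC (1 + k) * cay (- psi z) * cay z + RtoC k)%C) by (unfold R; ring).
assert (Hden : xi_den (cay z) (RtoC (1 + k) * cay (- psi z) + RtoC k * cay z)%C R = (4 * (1 + RtoC k) / ((1 + z) * (1 - psi z)))%C).
{ rewrite ER. unfold xi_den, cay. rewrite RtoC_plus. field. auto. }

unfold Xi. fold R. unfold xi1, xi2, xi3. rewrite Hden, ER. unfold cay, y1, y2, y3. rewrite RtoC_plus.
apply C3_eq; field; auto.
Qed.

Let first_order (G : C3 -> C) : 0 < k < 1 -> ~ disc_automorphism psi -> disc_map G ->
  (forall z, disc z -> G (y1 z, y2 z, y3 z) = z) ->
  forall (P S c : C -> C) (p s m : C), P (RtoC 0) = RtoC 1 -> S (RtoC 0) = RtoC 1 -> c (RtoC 0) = RtoC 0 ->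
  hd P (RtoC 0) p -> hd S (RtoC 0) s -> hd c (RtoC 0) m ->
  hd (fun w => G (Xi (P w) (S w) (c w))) (RtoC 0) (- (p / (2 * RtoC 1)))%C.
Proof.
intros Hk01 Hna HG Hinv.
assert (H0 : disc (RtoC 0)) by (unfold disc; rewrite Cmod_0; lra).
assert (Hs0 : siegel (RtoC 1) (RtoC 1) (RtoC 0)).
{ repeat split; simpl; try lra. rewrite Cmod_0. lra. }
destruct (Xi_chain G _ _ _ (proj1 HG) Hs0) as [gP [gS [gc Hch]]].
assert (Hcay : hd cay (RtoC 0) (- RtoC 2)%C).
{ eapply hd_eq. apply hd_cay. rewrite Cmod_0; lra. field. }
(* The derivative of [G] along the disc with parameters [(t, w)] is an affine function of [t] and of
   [w], of modulus at most 1; on the curve itself it equals 1, at the interior point [(k, w0)]. *)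
destruct (Hpsi (RtoC 0) H0) as [l Hl].
assert (Hl1 := psi_deriv l ltac:(lra) Hna Hl).
(* Chosen so that (1 - k) (- 2 w0) is the derivative at 0 of (1 + k) cay (- psi z); [psi_deriv]
   places it inside the disc. *)
set (w0 := (- l / RtoC (1 - k * k))%C).
assert (Hkp : 0 < 1 - k * k) by nra.
assert (Hkn : RtoC (1 - k * k) <> RtoC 0) by (apply RtoC_neq0; lra).
assert (Hw0 : Cmod w0 < 1).
{ unfold w0. rewrite Cmod_div, Cmod_opp, Cmod_R, Rabs_pos_eq by (auto; lra).
  apply Rmult_lt_reg_r with (1 - k * k); auto. unfold Rdiv. rewrite Rmult_assoc, Rinv_l, Rmult_1_r, Rmult_1_l by lra. auto. }
assert (D1 : (gP * - RtoC 2 + gS * (RtoC (1 - k) * (- RtoC 2 * w0) + RtoC k * - RtoC 2) + gc * (RtoC k * RtoC 4))%C = RtoC 1).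
{ apply (hd_unique (fun w => w) (RtoC 0)); [|apply hd_id].
  apply hd_ext_near with (f := fun z => G (Xi (cay z) (RtoC (1 + k) * cay (- psi z) + RtoC k * cay z)%C
    (RtoC 0 + RtoC k * (RtoC 1 * RtoC 1 - cay z * cay z))%C)).
  { exists 1. split. lra. intros w Hw. replace (w - 0)%C with w in Hw by ring. rewrite <- siegel_curve by auto. auto. }
  assert (Hcp : hd (fun z => cay (- psi z)) (RtoC 0) (RtoC 2 * l / (RtoC (1 + k) * RtoC (1 + k)))%C).
  { eapply hd_eq. apply (hd_comp cay (fun z => - psi z)%C).
    apply hd_cay. rewrite Cmod_opp, Hpsi0, Cmod_R, Rabs_left; lra. apply hd_opp. apply Hl.
    rewrite Hpsi0, RtoC_opp, RtoC_plus. field. auto. }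
  apply Hch.
  - apply cay_0.
  - rewrite Hpsi0, cay_0, <- RtoC_opp, Ropp_involutive. unfold cay. rewrite RtoC_plus. field. auto.
  - rewrite cay_0. ring.
  - apply Hcay.
  - eapply hd_eq. apply hd_plus. apply hd_mult. apply hd_const. apply Hcp. apply hd_mult. apply hd_const. apply Hcay.
    cbv beta. unfold w0. rewrite !RtoC_minus, RtoC_mult, !RtoC_plus in *. field.
    split; auto.
  - eapply hd_eq. apply hd_plus. apply hd_const. apply hd_mult. apply hd_const. apply hd_minus. apply hd_const. apply hd_mult; apply Hcay.
    cbv beta. rewrite cay_0. ring. }
assert (D2 : forall (t : R) (w : C), 0 <= t < 1 -> Cmod w <= 1 ->
  Cmod (gP * - RtoC 2 + gS * (RtoC (1 - t) * (- RtoC 2 * w) + RtoC t * - RtoC 2) + gc * (RtoC t * RtoC 4))%C <= 1).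
{ intros t w Ht Hw.
  assert (Hwz : forall z, Cmod z < 1 -> Cmod (w * z) < 1) by (intros; now apply Cmod_mult_lt1).
  set (S := fun z => (RtoC (1 - t) * cay (w * z) + RtoC t * cay z)%C).
  set (c := fun z => (RtoC 0 + RtoC t * (RtoC 1 * RtoC 1 - cay z * cay z))%C).
  assert (HS : forall z, Cmod z < 1 -> exists m, hd S z m /\ (z = RtoC 0 -> m = (RtoC (1 - t) * (- RtoC 2 * w) + RtoC t * - RtoC 2)%C)).
  { intros z Hz. eexists. split. apply hd_plus. apply hd_mult. apply hd_const. apply (hd_comp cay (fun z => w * z)%C). apply hd_cay; auto.
    apply hd_mult. apply hd_const. apply hd_id. apply hd_mult. apply hd_const. now apply hd_cay.
    intros ->. cbv beta. rewrite Cmult_0_r. field. }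
  assert (Hc : forall z, Cmod z < 1 -> exists m, hd c z m /\ (z = RtoC 0 -> m = (RtoC t * RtoC 4)%C)).
  { intros z Hz. eexists. split. apply hd_plus. apply hd_const. apply hd_mult. apply hd_const. apply hd_minus. apply hd_const. apply hd_mult; now apply hd_cay.
    intros ->. cbv beta. rewrite cay_0. field. }
  assert (HSg : forall z, Cmod z < 1 -> siegel (cay z) (S z) (c z)).
  { intros z Hz. apply (siegel_quad 1 0 (cay z) (RtoC (1 - t) * cay (w * z))%C t); try lra. now apply cay_pos.
    pose proof (cay_pos _ (Hwz z Hz)) as Hp. set (u := cay (w * z)) in *. clearbody u. simpl. nra. }
  destruct (HS (RtoC 0)) as [m1 [Hm1 Em1]]. auto. destruct (Hc (RtoC 0)) as [m2 [Hm2 Em2]]. auto.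
  apply (schwarz_deriv (fun z => G (Xi (cay z) (S z) (c z)))).
  - intros z Hz. destruct (HS z Hz) as [n1 [Hn1 _]]. destruct (Hc z Hz) as [n2 [Hn2 _]].
    eapply Xi_holo. apply HG. apply HSg; auto. now apply hd_cay. apply Hn1. apply Hn2.
  - intros z Hz. left. apply (proj2 HG). apply Xi_tetra. now apply HSg.
  - rewrite <- (Em1 eq_refl), <- (Em2 eq_refl). apply Hch; auto.
    + apply cay_0.
    + unfold S. rewrite Cmult_0_r, cay_0, <- !RtoC_mult, <- RtoC_plus. f_equal. ring.
    + unfold c. rewrite cay_0. ring. }
assert (EgS : gS = RtoC 0).
{ assert (E : (gS * (RtoC (1 - k) * - RtoC 2))%C = RtoC 0).
  { apply affine_disc with (al := (gP * - RtoC 2 + gS * (RtoC k * - RtoC 2) + gc * (RtoC k * RtoC 4))%C) (w0 := w0); auto.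
    - intros w Hw. specialize (D2 k w ltac:(lra) Hw).
      replace (gP * - RtoC 2 + gS * (RtoC k * - RtoC 2) + gc * (RtoC k * RtoC 4) + gS * (RtoC (1 - k) * - RtoC 2) * w)%C with
       (gP * - RtoC 2 + gS * (RtoC (1 - k) * (- RtoC 2 * w) + RtoC k * - RtoC 2) + gc * (RtoC k * RtoC 4))%C by ring. auto.
    - rewrite <- D1. ring. }
  destruct (classic (gS = RtoC 0)) as [|N]; auto. exfalso. revert E. apply Cmult_neq_0; auto.
  rewrite <- RtoC_opp, <- RtoC_mult. apply RtoC_neq0. nra. }
assert (Egc : gc = RtoC 0).
{ assert (E : (gc * RtoC 4)%C = RtoC 0).
  { apply affine_real with (al := (gP * - RtoC 2)%C) (k := k); auto.
    - intros t Ht. specialize (D2 t (RtoC 0) Ht ltac:(rewrite Cmod_0; lra)). rewrite EgS in D2.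
      replace (gP * - RtoC 2 + gc * RtoC 4 * RtoC t)%C with
       (gP * - RtoC 2 + 0 * (RtoC (1 - t) * (- RtoC 2 * 0) + RtoC t * - RtoC 2) + gc * (RtoC t * RtoC 4))%C by ring. auto.
    - rewrite <- D1, EgS. ring. }
  destruct (classic (gc = RtoC 0)) as [|N]; auto. exfalso. revert E. apply Cmult_neq_0; auto. apply RtoC_neq0. lra. }
assert (EgP : (gP * - RtoC 2)%C = RtoC 1). { rewrite <- D1, EgS, Egc. ring. }
intros P S c p s m EP ES Ec HP HS Hc. eapply hd_eq. apply Hch; eauto.
rewrite EgS, Egc. replace (- (p / (2 * RtoC 1)))%C with (- (p / 2) * (gP * - RtoC 2))%C. field. rewrite EgP. field.
Qed.

Let unique_part1 : 0 < k < 1 -> ~ disc_automorphism psi -> (exists F, left_inverse phi F) -> unique_left_inverse phi.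
Proof.
intros Hk01 Hna [F HF].
assert (A : forall G, left_inverse phi G -> forall P S c, siegel P S c ->
  G (rot w1 w2 (Xi P S c)) = ((RtoC 1 - P) / (RtoC 1 + P))%C).
{ intros G HG. apply left_inverse_iff in HG. destruct HG as [HG Hinv].
  pose proof (disc_map_rot G w1 w2 Hw1 Hw2 HG) as HG2.
  apply (key_uniqueness (fun x => G (rot w1 w2 x)) 1 0 (RtoC 1)); auto; try lra. simpl; lra.
  apply (first_order (fun x => G (rot w1 w2 x))); auto. intros z Hz. rewrite <- Erot by auto. auto. }
exists F. split; auto. intros G HG x Hx.
assert (Hy' : tetrablock (rot (Cconj w1) (Cconj w2) x)) by (apply tetra_rot; try rewrite Cmod_conj; auto).
rewrite <- (rot_inv w1 w2 x) by auto.
destruct (tetra_Xi _ Hy') as [P [S [c [Hs ->]]]].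
now rewrite (A G HG), (A F HF).
Qed.

Lemma part1 : (exists F, left_inverse phi F) ->
  (unique_left_inverse phi <-> 0 < k < 1 /\ ~ disc_automorphism psi).
Proof.
intros HF. split.
- intros Hu.
  assert (K0 : k <> 0) by (intros E; now apply not_k0).
  assert (K1 : k <> 1) by (intros E; now apply not_k1).
  split. lra. intros Ha. apply not_aut; auto. lra.
- intros [H1 H2]. now apply unique_part1.
Qed.
End Part1.

(** * The curves of part (2) *)

Definition tden (be : R) (B K : C) : C := (1 + 2 * RtoC be * B - RtoC be * RtoC be * K)%C.
Definition tnum (be : R) (B K : C) : C := (K - 2 * RtoC be * B - RtoC be * RtoC be)%C.
(** Over [tden], a square root of x1 x2 - x3 by [toff_sqr]: the off-diagonal entry of the translated
    matrix up to sign. Its zeros are the royal points. *)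
Definition toff (be : R) (B K : C) : C := (RtoC be + (1 + RtoC be * RtoC be) * B - RtoC be * K)%C.

(* The image in C^3 of a Moebius translate, by the antidiagonal matrix [be], of the
   symmetric matrix [[A, B], [B, D]]; [K] stands for its determinant. *)
Definition tpoint (be : R) (A B D K : C) : C3 :=
  (A * RtoC (1 - be * be) / tden be B K, D * RtoC (1 - be * be) / tden be B K, tnum be B K / tden be B K)%C.

Lemma tden_id (be : R) (B K : C) :
  N2 (tden be B K) - N2 (tnum be B K) =
  (1 - be * be) * ((1 + be * be) * (1 - N2 K) + 4 * be * fst (B + Cconj B * K)%C).
Proof. unfold tden, tnum, N2; simpl; ring. Qed.

Lemma tdefect_id (be : R) (B K : C) :
  N2 (tden be B K) + N2 (tnum be B K) - 2 * N2 (toff be B K) =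
  (1 - be * be) * (1 - be * be) * (1 + N2 K - 2 * N2 B).
Proof. unfold tden, tnum, toff, N2; simpl; ring. Qed.

Lemma toff_sqr (be : R) (A B D K : C) : (A * D - B * B)%C = K -> tden be B K <> RtoC 0 ->
  (A * RtoC (1 - be * be) / tden be B K * (D * RtoC (1 - be * be) / tden be B K) - tnum be B K / tden be B K =
   toff be B K * toff be B K / (tden be B K * tden be B K))%C.
Proof.
intros E H. replace (A * RtoC (1 - be * be) / tden be B K * (D * RtoC (1 - be * be) / tden be B K))%C with
  ((K + B * B) * (RtoC (1 - be * be) * RtoC (1 - be * be)) / (tden be B K * tden be B K))%C.
2: { replace (K + B * B)%C with (A * D)%C by (rewrite <- E; ring). field. auto. }
replace (tnum be B K / tden be B K)%C with (tnum be B K * tden be B K / (tden be B K * tden be B K))%C by (field; auto).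
rewrite RtoC_minus, RtoC_mult. unfold tnum, toff, tden, Cdiv. ring.
Qed.

Section TPoint.
Variables (be : R) (A B D K : C).
Hypotheses (Hbe : -1 < be < 1) (HK : (A * D - B * B)%C = K) (HK1 : Cmod K < 1).
Hypothesis HB : 2 * N2 B < 1 + N2 K - N2 A - N2 D.

(** By [tden_id] it is enough that 2 |B + conj B K| < 1 - |K|^2, because 1 + be^2 - 2 |be| = (1 -
    |be|)^2 > 0. The identity [E] derives this bound from 2 |A D| <= |A|^2 + |D|^2 < 1 + |K|^2 - 2
    |B|^2. *)
Lemma tpoint_aux : 0 < N2 (tden be B K) - N2 (tnum be B K).
Proof.
rewrite tden_id. apply N2_lt_1 in HK1.
assert (Hab : 2 * Cmod (K + B * B) <= N2 A + N2 D).
{ replace (K + B * B)%C with (A * D)%C by (rewrite <- HK; ring). rewrite Cmod_mult, !N2_Cmod.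
  pose proof (Rle_0_sqr (Cmod A - Cmod D)) as Q. unfold Rsqr in Q. lra. }
pose proof (Cmod_ge_0 (K + B * B)).
assert (E : (1 + N2 K - 2 * N2 B) * (1 + N2 K - 2 * N2 B) - 4 * N2 (K + B * B)%C =
  (1 - N2 K) * (1 - N2 K) - 4 * N2 (B + Cconj B * K)%C) by (unfold N2; simpl; ring).
rewrite (N2_Cmod (K + B * B)) in E. set (w := Cmod (K + B * B)) in *.

rewrite (N2_Cmod (B + Cconj B * K)) in E.
pose proof (fst_le_Cmod (B + Cconj B * K)) as U1. pose proof (fst_le_Cmod (- (B + Cconj B * K))) as U2. rewrite Cmod_opp in U2.
set (v := Cmod (B + Cconj B * K)) in *.
replace (fst (- (B + Cconj B * K))%C) with (- fst (B + Cconj B * K)%C) in U2 by reflexivity.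
set (f := fst (B + Cconj B * K)%C) in *. clearbody f v.
assert (Hv : 2 * v < 1 - N2 K) by nra.
apply Rmult_lt_0_compat. nra.
assert (0 < (1 - be) * (1 - be)) by nra. assert (0 < (1 + be) * (1 + be)) by nra.
destruct (Rle_lt_dec 0 be); nra.
Qed.

Lemma tden_neq0 : tden be B K <> RtoC 0.
Proof.
intros E. pose proof tpoint_aux as H. rewrite E in H. pose proof (N2_nonneg (tnum be B K)).
replace (N2 (RtoC 0)) with 0 in H by (unfold N2; simpl; ring). lra.
Qed.

Lemma tpoint_tetra : tetrablock (tpoint be A B D K).
Proof.
pose proof tden_neq0 as Hd. pose proof (N2_pos _ Hd) as Hn. pose proof tpoint_aux as Ha.
unfold tpoint. apply tetra_iff. split.
- apply N2_lt_1. rewrite N2_div by auto. apply Rmult_lt_reg_r with (N2 (tden be B K)); auto.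
  unfold Rdiv. rewrite Rmult_assoc, Rinv_l by lra. lra.
- rewrite toff_sqr by auto. rewrite Cmod_div, !Cmod_mult, <- !N2_Cmod by now apply Cmult_neq_0.
  unfold defect. rewrite !N2_div, !N2_mult by auto.
  replace (N2 (RtoC (1 - be * be))) with ((1 - be * be) * (1 - be * be)) by (unfold N2; simpl; ring).
  pose proof (tdefect_id be B K) as I. set (n := N2 (tden be B K)) in *.
  apply Rmult_lt_reg_r with n; auto.
  set (p := (1 - be * be) * (1 - be * be)) in *.
  assert (Hp : 0 < p). { assert (0 < 1 - be * be) by nra. unfold p. now apply Rmult_lt_0_compat. }
  replace (2 * (N2 (toff be B K) / n) * n) with (2 * N2 (toff be B K)) by (field; lra).
  replace ((1 + N2 (tnum be B K) / n - N2 A * p / n - N2 D * p / n) * n) with (n + N2 (tnum be B K) - p * (N2 A + N2 D)) by (field; lra).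
  nra.
Qed.
End TPoint.

Section Data.
Variables (a c : C) (be : R).
Hypotheses (Hac : N2 a + N2 c = 1) (Hbe : 0 < be < 1).

(** [mA], [mB] and [mD] are the entries of U diag(z, w) U^T for the unitary U = [[a, - conj c],
    [c, conj a]] of determinant 1; hence the determinant z w and the preserved sum of squares. *)
Definition mA (a c z w : C) : C := (a * a * z + Cconj c * Cconj c * w)%C.
Definition mB (a c z w : C) : C := (a * c * z - Cconj a * Cconj c * w)%C.
Definition mD (a c z w : C) : C := (c * c * z + Cconj a * Cconj a * w)%C.

Lemma ac_conj : (a * Cconj a + c * Cconj c)%C = RtoC 1.
Proof. rewrite !Cmod_sqr, <- !N2_Cmod, <- RtoC_plus, Hac. reflexivity. Qed.

Lemma m_det (z w : C) : (mA a c z w * mD a c z w - mB a c z w * mB a c z w)%C = (z * w)%C.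
Proof.
transitivity ((a * Cconj a + c * Cconj c) * (a * Cconj a + c * Cconj c) * (z * w))%C.
- unfold mA, mB, mD. ring.
- rewrite ac_conj. ring.
Qed.

Lemma m_defect (z w : C) : N2 (mA a c z w) + 2 * N2 (mB a c z w) + N2 (mD a c z w) = N2 z + N2 w.
Proof.
transitivity ((N2 a + N2 c) * (N2 a + N2 c) * (N2 z + N2 w)).
- unfold mA, mB, mD, N2; simpl; ring.
- rewrite Hac. ring.
Qed.

Definition Phi (a c : C) (be : R) (z w : C) : C3 :=
  tpoint be (mA a c z w) (mB a c z w) (mD a c z w) (z * w)%C.

Lemma Phi_side (z w : C) : disc z -> disc w ->
  Cmod (z * w) < 1 /\ 2 * N2 (mB a c z w) < 1 + N2 (z * w) - N2 (mA a c z w) - N2 (mD a c z w).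
Proof.
intros Hz Hw. unfold disc in *. split.
- apply Cmod_mult_lt1; lra.
- pose proof (m_defect z w). rewrite N2_mult. apply N2_lt_1 in Hz. apply N2_lt_1 in Hw. nra.
Qed.

Lemma Phi_tetra (z w : C) : disc z -> disc w -> tetrablock (Phi a c be z w).
Proof.
intros Hz Hw. destruct (Phi_side z w Hz Hw) as [H1 H2]. apply tpoint_tetra; auto. lra. apply m_det.
Qed.

Lemma Phi_den (z w : C) : disc z -> disc w -> tden be (mB a c z w) (z * w) <> RtoC 0.
Proof.
intros Hz Hw. destruct (Phi_side z w Hz Hw) as [H1 H2].
apply (tden_neq0 be (mA a c z w) (mB a c z w) (mD a c z w) (z * w)); auto. lra. apply m_det.
Qed.
End Data.

Lemma Phi_swap (a c : C) (be : R) (z w : C) : swap (Phi a c be z w) = Phi c a be z w.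
Proof.
unfold swap, Phi, tpoint, pr1, pr2, pr3; simpl fst; simpl snd.
assert (E : mB c a z w = mB a c z w) by (unfold mB; ring). rewrite E. reflexivity.
Qed.

Lemma swap_swap (x : C3) : swap (swap x) = x.
Proof. now destruct x as [[x1 x2] x3]. Qed.

Lemma left_inverse_swap (phi phi' : C -> C3) (F : C3 -> C) : (forall z, disc z -> phi' z = swap (phi z)) ->
  left_inverse phi F -> left_inverse phi' (fun x => F (swap x)).
Proof.
intros E HF. apply left_inverse_iff in HF. destruct HF as [HF Hi]. apply left_inverse_iff. split.
- now apply disc_map_swap.
- intros z Hz. rewrite E, swap_swap by auto. auto.
Qed.

Lemma unique_swap (phi phi' : C -> C3) : (forall z, disc z -> phi' z = swap (phi z)) ->
  unique_left_inverse phi -> unique_left_inverse phi'.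
Proof.
intros E [F [HF Hu]]. exists (fun x => F (swap x)). split.
- now apply left_inverse_swap with phi.
- intros G HG x Hx. rewrite <- (swap_swap x) at 1.
  apply (Hu (fun y => G (swap y))); [|now apply tetra_swap3].
  apply left_inverse_swap with phi'; auto. intros z Hz. rewrite E, swap_swap by auto. reflexivity.
Qed.

Lemma RtoC_pos_neq0 (r : R) : 0 < r -> RtoC r <> RtoC 0.
Proof. intros H. apply RtoC_neq0. lra. Qed.

(** The normal form of the critical curves: the first coordinate depends on [r] alone, the second on
    [s] alone, and the third is constant. *)
Lemma siegel_norm (b r s : C) : (1 + b * b)%C <> RtoC 0 -> (1 + r)%C <> RtoC 0 -> (1 - s)%C <> RtoC 0 ->
  (1 + 2 * b * (b * (r - s) / (1 + b * b)) - b * b * (r * s))%C <> RtoC 0 ->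
  let k := ((1 - b * b) / (1 + b * b))%C in
  let De := (1 + 2 * b * (b * (r - s) / (1 + b * b)) - b * b * (r * s))%C in
  Xi (k * cay r) (k * cay (- s)) (1 - k * k) =
  ((b * b * r + s) / (1 + b * b) * (1 - b * b) / De,
   (r + b * b * s) / (1 + b * b) * (1 - b * b) / De,
   (r * s - 2 * b * (b * (r - s) / (1 + b * b)) - b * b) / De)%C.
Proof.
intros Hn Hr Hs HDe k De.

assert (HDn : (De * (1 + b * b) = (1 + b * b) + 2 * b * b * (r - s) - b * b * (r * s) * (1 + b * b))%C).
{ unfold De. field. auto. }
set (E := (De * (1 + b * b))%C) in *.
assert (HE : E <> RtoC 0) by (unfold E; apply Cmult_neq_0; auto).
assert (EDe : De = (E / (1 + b * b))%C) by (unfold E; field; auto).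
rewrite EDe.
set (R := (k * cay r * (k * cay (- s)) + (1 - k * k))%C).
assert (Hden : xi_den (k * cay r) (k * cay (- s)) R = (4 * E / ((1 + b * b) * (1 + b * b) * (1 + r) * (1 - s)))%C).
{ rewrite HDn. unfold xi_den, R, k, cay. field. auto. }
unfold Xi. fold R. unfold xi1, xi2, xi3. rewrite Hden.
assert (Hq : forall N M : C, (N * ((1 + b * b) * (1 + b * b) * (1 + r) * (1 - s)) = 4 * M)%C -> (N / (4 * E / ((1 + b * b) * (1 + b * b) * (1 + r) * (1 - s))) = M / E)%C).
{ intros N M HNM. replace (M / E)%C with (4 * M / (4 * E))%C by (field; auto). rewrite <- HNM. field. auto. }
apply C3_eq.
- rewrite (Hq _ ((b * b * r + s) * (1 - b * b))%C). field; auto. unfold R, k, cay. field. auto.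
- rewrite (Hq _ ((r + b * b * s) * (1 - b * b))%C). field; auto. unfold R, k, cay. field. auto.
- rewrite (Hq _ ((1 + b * b) * (r * s - b * b) - 2 * b * b * (r - s))%C). field; auto. unfold R, k, cay. field. auto.
Qed.

(** * First-order information on curves with constant third coordinate *)

Section FirstOrder.
Variables (G : C3 -> C) (P0 S0 C0 : R) (Sf : C -> C) (s0 : C).
Hypothesis HG : disc_map G.
Hypotheses (HP0 : 0 < P0) (HS0 : 0 < S0) (HC0 : 0 < C0).
Hypotheses (HSf0 : Sf (RtoC 0) = RtoC S0) (HSfd : hd Sf (RtoC 0) s0) (Hs0 : Cmod s0 < 2 * S0).
Hypothesis Hinv : forall z, disc z -> G (Xi (RtoC P0 * cay z) (Sf z) (RtoC C0)) = z.

(** The interior parameter is [w0]: S0 cay (w z) has derivative - 2 S0 w at 0, and the bound [Hs0]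
    on the slope of [Sf] gives |w0| < 1. This disposes of [gS]; [gc] needs an argument of its own,
    as [c] is constant on the curve. *)
Lemma first_order_c (P S c : C -> C) (p s m : C) : P (RtoC 0) = RtoC P0 -> S (RtoC 0) = RtoC S0 -> c (RtoC 0) = RtoC C0 ->
  hd P (RtoC 0) p -> hd S (RtoC 0) s -> hd c (RtoC 0) m ->
  hd (fun w => G (Xi (P w) (S w) (c w))) (RtoC 0) (- (p / (2 * RtoC P0)))%C.
Proof.
assert (H01 : Cmod (RtoC 0) < 1) by (rewrite Cmod_0; lra).
assert (HcC : Cmod (RtoC C0) - fst (RtoC C0) = 0) by (rewrite Cmod_R, Rabs_pos_eq; simpl; lra).
assert (Hs1 : siegel (RtoC P0) (RtoC S0) (RtoC C0)) by (repeat split; auto; rewrite HcC; simpl; nra).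
destruct (Xi_chain G _ _ _ (proj1 HG) Hs1) as [gP [gS [gc Hch]]].
assert (HPc : forall z, Cmod z < 1 -> exists m, hd (fun z => RtoC P0 * cay z)%C z m /\ (z = RtoC 0 -> m = (- (2 * RtoC P0))%C)).
{ intros z Hz. eexists. split. apply hd_mult. apply hd_const. now apply hd_cay. intros ->. cbv beta. field. }
assert (HPp : forall z, Cmod z < 1 -> 0 < fst (RtoC P0 * cay z)%C).
{ intros z Hz. pose proof (cay_pos z Hz). set (t := cay z) in *. clearbody t. simpl. nra. }
destruct (HPc _ H01) as [p0 [Hp0 Ep0]]. specialize (Ep0 eq_refl). subst p0.
assert (E0 : (RtoC P0 * cay 0)%C = RtoC P0) by (rewrite cay_0; ring).
assert (D1 : (gP * - (2 * RtoC P0) + gS * s0 + gc * RtoC 0)%C = RtoC 1).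
{ apply (hd_unique (fun w => w) (RtoC 0)); [|apply hd_id].
  apply hd_ext_near with (f := fun z => G (Xi (RtoC P0 * cay z) (Sf z) (RtoC C0))).
  - exists 1. split. lra. intros w Hw. apply Hinv. replace (w - 0)%C with w in Hw by ring. exact Hw.
  - apply (Hch (fun z => RtoC P0 * cay z)%C Sf (fun _ => RtoC C0)); auto. apply hd_const. }
set (w0 := (- s0 / RtoC (2 * S0))%C).
assert (H2S : RtoC (2 * S0) <> RtoC 0) by (apply RtoC_neq0; lra).
assert (Hw0 : Cmod w0 < 1).
{ unfold w0. rewrite Cmod_div, Cmod_opp, Cmod_R, Rabs_pos_eq by (auto; lra).
  apply Rmult_lt_reg_r with (2 * S0). lra. unfold Rdiv. rewrite Rmult_assoc, Rinv_l, Rmult_1_r, Rmult_1_l by lra. auto. }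
assert (EgS : gS = RtoC 0).
{ assert (E : (gS * - RtoC (2 * S0))%C = RtoC 0).
  { apply affine_disc with (al := (gP * - (2 * RtoC P0))%C) (w0 := w0); auto.
    - intros w Hw.
      assert (Hwz : forall z, Cmod z < 1 -> Cmod (w * z) < 1) by (intros; now apply Cmod_mult_lt1).
      assert (HS : forall z, Cmod z < 1 -> exists m, hd (fun z => RtoC S0 * cay (w * z))%C z m /\ (z = RtoC 0 -> m = (- RtoC (2 * S0) * w)%C)).
      { intros z Hz. eexists. split. apply hd_mult. apply hd_const. apply (hd_comp cay (fun z => w * z)%C). apply hd_cay; auto.
        apply hd_mult. apply hd_const. apply hd_id. intros ->. cbv beta. rewrite Cmult_0_r, RtoC_mult. field. }
      assert (HSg : forall z, Cmod z < 1 -> siegel (RtoC P0 * cay z) (RtoC S0 * cay (w * z)) (RtoC C0)).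
      { intros z Hz. pose proof (HPp z Hz) as Q1. pose proof (cay_pos _ (Hwz z Hz)) as Q2.
        assert (Q3 : 0 < fst (RtoC S0 * cay (w * z))%C). { set (t := cay (w * z)) in *. clearbody t. simpl. nra. }
        repeat split; auto. rewrite HcC. nra. }
      destruct (HS _ H01) as [m1 [Hm1 Em1]]. specialize (Em1 eq_refl). subst m1.
      apply (schwarz_deriv (fun z => G (Xi (RtoC P0 * cay z) (RtoC S0 * cay (w * z)) (RtoC C0)))).
      + intros z Hz. destruct (HS z Hz) as [n1 [Hn1 _]]. destruct (HPc z Hz) as [n2 [Hn2 _]].
        apply (Xi_holo G (fun z => RtoC P0 * cay z)%C (fun z => RtoC S0 * cay (w * z))%C (fun _ => RtoC C0) z n2 n1 (RtoC 0)); auto. apply HG. apply hd_const.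
      + intros z Hz. left. apply (proj2 HG). apply Xi_tetra. now apply HSg.
      + eapply hd_eq. apply (Hch (fun z => RtoC P0 * cay z)%C (fun z => RtoC S0 * cay (w * z))%C (fun _ => RtoC C0)); eauto.
        * rewrite Cmult_0_r, cay_0. ring.
        * apply hd_const.
        * ring.
    - rewrite <- D1. unfold w0. rewrite RtoC_mult in *. field. apply RtoC_neq0. lra. }
  destruct (classic (gS = RtoC 0)) as [|N]; auto. exfalso. revert E. apply Cmult_neq_0; auto.
  rewrite <- RtoC_opp. apply RtoC_neq0. lra. }
assert (EgP : (gP * - (2 * RtoC P0))%C = RtoC 1). { rewrite <- D1, EgS. ring. }
(* A perturbation of the off-diagonal entry by [eps] costs only [O(eps^2)] in the first
   coordinate, so the derivative in that direction vanishes. *)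
assert (Egc : gc = RtoC 0).
{ apply Cmod_small. intros e He.
  set (q := sqrt C0). assert (Hq : 0 < q) by now apply sqrt_lt_R0.
  assert (Hqq : q * q = C0) by (apply sqrt_sqrt; lra).
  (* The first bound brings the final estimate |gc| <= 2 eps / (q P0 S0) below [e]; the other two
     ensure [d < 1]. *)
  set (eps := Rmin (e * (P0 * S0) * q / 4) (Rmin (P0 * S0 / 8) (/ 2))).
  assert (HPS : 0 < P0 * S0) by nra.
  assert (Heps : 0 < eps). { assert (0 < e * (P0 * S0) * q) by (repeat apply Rmult_lt_0_compat; auto). repeat apply Rmin_pos; lra. }
  assert (I1 : eps <= e * (P0 * S0) * q / 4) by apply Rmin_l.
  assert (I2 : eps <= P0 * S0 / 8) by (apply Rle_trans with (1 := Rmin_r _ _), Rmin_l).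
  assert (I3 : eps <= / 2) by (apply Rle_trans with (1 := Rmin_r _ _), Rmin_r).
  (* Shrinking the disc of [P] to the radius r with r^2 = 1 - d keeps Re P >= P0 d / 4, hence 2 Re P
     S0 >= 2 eps^2. This exceeds |c| - Re c, which is twice the squared imaginary part of the
     perturbed square root of [c]. *)
  set (d := 4 * (eps * eps) / (P0 * S0)).
  assert (Hd : d * (P0 * S0) = 4 * (eps * eps)) by (unfold d; field; split; apply Rgt_not_eq; auto).
  assert (Hd1 : 0 < d < 1). { split; nra. }
  set (r := sqrt (1 - d)). assert (Hr0 : 0 <= r) by apply sqrt_pos.
  assert (Hrr : r * r = 1 - d) by (apply sqrt_sqrt; lra).
  assert (Hr1 : r < 1) by nra.
  (* The perturbation is aligned with [gc], which makes both terms of the derivative nonnegative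
     reals. *)
  assert (exists u, Cmod u = 1 /\ (gc * u)%C = RtoC (Cmod gc)) as [u [Hu Eu]].
  { destruct (classic (gc = RtoC 0)) as [N|N].
    - exists (RtoC 1). split. apply Cmod_1. rewrite N, Cmod_0. ring.
    - exists (RtoC (Cmod gc) / gc)%C. pose proof (proj1 (Cmod_gt_0 _) N). split.
      + rewrite Cmod_div, Cmod_R, Rabs_pos_eq by (auto; lra). field. lra.
      + field. auto. }
  assert (Hrz : forall z, Cmod z < 1 -> Cmod (RtoC r * z) < 1).
  { intros z Hz. apply Cmod_mult_lt1; auto. rewrite Cmod_R, Rabs_pos_eq; lra. }
  assert (HP : forall z, Cmod z < 1 -> exists m, hd (fun z => RtoC P0 * cay (RtoC r * z))%C z m /\ (z = RtoC 0 -> m = (- (2 * RtoC P0) * RtoC r)%C)).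
  { intros z Hz. eexists. split. apply hd_mult. apply hd_const. apply (hd_comp cay (fun z => RtoC r * z)%C). apply hd_cay; auto.
    apply hd_mult. apply hd_const. apply hd_id. intros ->. cbv beta. rewrite Cmult_0_r. field. }
  set (cc := fun z => ((RtoC q + RtoC eps * u * z) * (RtoC q + RtoC eps * u * z))%C).
  assert (Hc : forall z, exists m, hd cc z m /\ (z = RtoC 0 -> m = (2 * RtoC q * RtoC eps * u)%C)).
  { intros z. eexists. split. apply hd_mult; apply hd_plus; try apply hd_const; apply hd_mult; try apply hd_const; apply hd_id.
    intros ->. cbv beta. ring. }
  assert (HSg : forall z, Cmod z < 1 -> siegel (RtoC P0 * cay (RtoC r * z)) (RtoC S0) (cc z)).
  { intros z Hz. repeat split; auto.
    unfold cc. rewrite Cmod_mult, <- N2_Cmod.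
    set (de := (RtoC q + RtoC eps * u * z)%C).
    replace (N2 de - fst (de * de)%C) with (2 * (snd de * snd de)) by (unfold N2; simpl; ring).
    assert (Hde : snd de * snd de < eps * eps).
    { replace (snd de) with (snd (RtoC eps * (u * z))%C) by (unfold de; simpl; ring).
      assert (Q : N2 (RtoC eps * (u * z))%C < eps * eps).
      { rewrite !N2_mult, N2_Cmod, Cmod_R, Rabs_pos_eq, (N2_Cmod u), Hu by lra. apply N2_lt_1 in Hz. assert (0 < eps * eps) by (apply Rmult_lt_0_compat; auto). nra. }
      unfold N2 in Q. nra. }
    assert (Q4 : P0 * d / 4 <= fst (RtoC P0 * cay (RtoC r * z))%C).
    { pose proof (fst_cay _ (Hrz z Hz)) as Ec. pose proof (N2_pos _ (one_add_neq0 _ (Hrz z Hz))) as Hn.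
      set (t := cay (RtoC r * z)) in *. replace (fst (RtoC P0 * t)%C) with (P0 * fst t) by (simpl; ring).
      rewrite Ec. clearbody t.
      assert (Q5 : d <= 1 - N2 (RtoC r * z)%C).
      { rewrite N2_mult. replace (N2 (RtoC r)) with (r * r) by (unfold N2; simpl; ring). rewrite Hrr. apply N2_lt_1 in Hz. nra. }
      assert (Q6 : N2 (1 + RtoC r * z)%C <= 4).
      { rewrite N2_Cmod. pose proof (Cmod_triangle 1 (RtoC r * z)) as T. rewrite Cmod_1 in T. pose proof (Hrz z Hz). pose proof (Cmod_ge_0 (1 + RtoC r * z)). nra. }
      unfold Rdiv. rewrite Rmult_assoc. apply Rmult_le_compat_l. lra.
      apply Rmult_le_compat; try lra. apply Rinv_le_contravar; lra. }
    simpl fst at 2. nra. }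
  assert (Bd : Cmod (gP * (- (2 * RtoC P0) * RtoC r) + gS * RtoC 0 + gc * (2 * RtoC q * RtoC eps * u))%C <= 1).
  { destruct (HP _ H01) as [m1 [Hm1 Em1]]. specialize (Em1 eq_refl). subst m1.
    destruct (Hc (RtoC 0)) as [m2 [Hm2 Em2]]. specialize (Em2 eq_refl). subst m2.
    apply (schwarz_deriv (fun z => G (Xi (RtoC P0 * cay (RtoC r * z)) (RtoC S0) (cc z)))).
    - intros z Hz. destruct (HP z Hz) as [n1 [Hn1 _]]. destruct (Hc z) as [n2 [Hn2 _]].
      apply (Xi_holo G (fun z => RtoC P0 * cay (RtoC r * z))%C (fun _ => RtoC S0) cc z n1 (RtoC 0) n2); auto. apply HG. apply hd_const.
    - intros z Hz. left. apply (proj2 HG). apply Xi_tetra. now apply HSg.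
    - apply (Hch (fun z => RtoC P0 * cay (RtoC r * z))%C (fun _ => RtoC S0) cc); auto.
      + rewrite Cmult_0_r, cay_0. ring.
      + unfold cc. rewrite <- Hqq, RtoC_mult. ring.
      + apply hd_const. }
  replace (gP * (- (2 * RtoC P0) * RtoC r) + gS * RtoC 0 + gc * (2 * RtoC q * RtoC eps * u))%C with (RtoC (r + 2 * q * eps * Cmod gc)) in Bd.
  2: { rewrite RtoC_plus, !RtoC_mult, <- Eu.
       transitivity (gP * - (2 * RtoC P0) * RtoC r + gc * (2 * RtoC q * RtoC eps * u))%C. rewrite EgP. ring. ring. }
  pose proof (Cmod_ge_0 gc) as Hg0.
  assert (0 <= 2 * q * eps * Cmod gc). { repeat apply Rmult_le_pos; lra. }
  rewrite Cmod_R, Rabs_pos_eq in Bd by lra.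
  (* [Bd] leaves at most 1 - r for this term, and 1 - r <= 1 - r^2 = d. Since [d] is quadratic in
     [eps], dividing by [eps] gains a factor. *)
  assert (B1 : 2 * q * eps * Cmod gc <= d) by nra.

  assert (B3 : q * (P0 * S0) * Cmod gc <= 2 * eps).
  { apply Rmult_le_reg_l with (2 * eps). lra. nra. }
  apply Rmult_le_reg_l with (q * (P0 * S0)). nra. nra. }
intros EP ES Ec HP HS Hc. eapply hd_eq. apply (Hch P S c); eauto.
rewrite EgS, Egc. replace (- (p / (2 * RtoC P0)))%C with (- (p / (2 * RtoC P0)) * (gP * - (2 * RtoC P0)))%C.
- field. apply RtoC_pos_neq0; auto.
- rewrite EgP. ring.
Qed.
End FirstOrder.

(** * The critical case *)

Section Critical.
Variables (a c : C) (be : R) (W : C -> C) (phi : C -> C3).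
Hypotheses (Hac : N2 a + N2 c = 1) (Hbe : 0 < be < 1) (Hcrit : Cmod a = be * Cmod c).
Hypothesis HW1 : forall z, disc z -> disc (W z).
Hypothesis Ephi : forall z, disc z -> phi z = Phi a c be z (W z).

Let n : R := 1 + be * be.
Let c_norm : n * N2 c = 1.
Proof. rewrite <- Hac. rewrite !N2_Cmod, Hcrit. unfold n. ring. Qed.

Let c_neq0 : c <> RtoC 0.
Proof. intros E. pose proof c_norm as H. rewrite E in H. unfold N2 in H. simpl in H. lra. Qed.

(** Unimodular by [Hcrit]. Rotating the coordinates by it, and the parameters by [u], removes all
    phases and leaves the real number [be]. *)
Let om : C := (Cconj a / (RtoC be * Cconj c))%C.

Let be_neq0 : RtoC be <> RtoC 0.
Proof. apply RtoC_neq0. lra. Qed.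

Let cc_neq0 : Cconj c <> RtoC 0.
Proof. intros E. apply c_neq0. rewrite <- (Cconj_conj c), E. apply injective_projections; simpl; ring. Qed.

Let om_unit : Cmod om = 1.
Proof.
unfold om. rewrite Cmod_div, Cmod_mult, !Cmod_conj, Cmod_R, Rabs_pos_eq, Hcrit by (lra || now apply Cmult_neq_0).
field. pose proof (proj1 (Cmod_gt_0 _) c_neq0). split; lra.
Qed.

Let conj_a : Cconj a = (RtoC be * om * Cconj c)%C.
Proof. unfold om. field. auto. Qed.

Let Cconj_R (r : R) : Cconj (RtoC r) = RtoC r.
Proof. apply injective_projections; simpl; ring. Qed.

Let a_eq : a = (RtoC be * Cconj om * c)%C.
Proof. rewrite <- (Cconj_conj a), conj_a, !Cmult_conj, Cconj_conj, Cconj_R. reflexivity. Qed.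

Let u : C := (RtoC n * Cconj om * (c * c))%C.

Let n_pos : 0 < n.
Proof. unfold n. nra. Qed.

Let u_unit : Cmod u = 1.
Proof.
unfold u. rewrite !Cmod_mult, Cmod_conj, om_unit, Cmod_R, Rabs_pos_eq by lra. rewrite <- N2_Cmod, Rmult_1_r. exact c_norm.
Qed.

Let oo : (om * Cconj om)%C = RtoC 1.
Proof. now apply unit_conj. Qed.

Let k0 : R := (1 - be * be) / n.

Let k0_pos : 0 < k0 < 1.
Proof.
unfold k0. split. apply Rdiv_lt_0_compat; auto. nra.
apply Rmult_lt_reg_r with n; auto. unfold Rdiv. rewrite Rmult_assoc, Rinv_l by lra. unfold n. nra.
Qed.

Let conj_u : Cconj u = (RtoC n * om * (Cconj c * Cconj c))%C.
Proof. unfold u. now rewrite !Cmult_conj, Cconj_conj, Cconj_R. Qed.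

Let uu : (u * Cconj u)%C = RtoC 1.
Proof. now apply unit_conj. Qed.

(** Without the phases the matrix entries are (be^2 r + s) / n, be (r - s) / n and (r + be^2 s) / n,
    which is the situation of [siegel_norm]. *)
Let critical_siegel (z w : C) : disc z -> disc w ->
  rot om (Cconj om) (Phi a c be z w) =
  Xi (RtoC k0 * cay (u * z)) (RtoC k0 * cay (- (Cconj u * w))) (RtoC (1 - k0 * k0)).
Proof.
intros Hz Hw.
assert (Hn : RtoC n <> RtoC 0) by now apply RtoC_pos_neq0.
assert (En : RtoC n = (1 + RtoC be * RtoC be)%C) by (unfold n; now rewrite RtoC_plus, RtoC_mult).
set (r := (u * z)%C). set (s := (Cconj u * w)%C).
assert (EA : mA a c z w = (Cconj om * ((RtoC be * RtoC be * r + s) / RtoC n))%C).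
{ unfold mA. rewrite a_eq. unfold r, s. rewrite conj_u. unfold u.
  transitivity (RtoC be * RtoC be * (Cconj om * Cconj om * (c * c)) * z + 1 * (Cconj c * Cconj c) * w)%C. ring.
  rewrite <- oo. field. auto. }
assert (EB : mB a c z w = (RtoC be * (r - s) / RtoC n)%C).
{ unfold mB. rewrite conj_a, a_eq. unfold r, s. rewrite conj_u. unfold u. field. auto. }
assert (ED : mD a c z w = (om * ((r + RtoC be * RtoC be * s) / RtoC n))%C).
{ unfold mD. rewrite conj_a. unfold r, s. rewrite conj_u. unfold u.
  transitivity (1 * (c * c) * z + RtoC be * RtoC be * (om * om * (Cconj c * Cconj c)) * w)%C. ring.
  rewrite <- oo. field. auto. }
assert (EK : (z * w = r * s)%C).
{ unfold r, s. transitivity (u * Cconj u * (z * w))%C. rewrite uu. ring. ring. }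
assert (Hr : disc r) by (unfold r, disc; rewrite Cmod_mult, u_unit, Rmult_1_l; exact Hz).
assert (Hs : disc s) by (unfold s, disc; rewrite Cmod_mult, Cmod_conj, u_unit, Rmult_1_l; exact Hw).
pose proof (Phi_den a c be Hac Hbe z w Hz Hw) as HDe.
unfold Phi, tpoint. rewrite EA, ED. unfold tnum. rewrite EB, EK in *.
unfold tden in *. rewrite En in *.
replace (RtoC k0) with ((1 - RtoC be * RtoC be) / (1 + RtoC be * RtoC be))%C.
2: { unfold k0. rewrite RtoC_div by lra. rewrite En, RtoC_minus, RtoC_mult. reflexivity. }
replace (RtoC (1 - k0 * k0)) with (1 - (1 - RtoC be * RtoC be) / (1 + RtoC be * RtoC be) * ((1 - RtoC be * RtoC be) / (1 + RtoC be * RtoC be)))%C.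
2: { rewrite RtoC_minus, RtoC_mult. unfold k0. rewrite RtoC_div by lra. rewrite En, RtoC_minus, RtoC_mult. reflexivity. }
rewrite siegel_norm; auto.
2: now apply one_add_neq0. 2: now apply one_sub_neq0.
unfold rot, pr1, pr2, pr3; simpl fst; simpl snd. rewrite RtoC_minus, RtoC_mult.
assert (oo' : (Cconj om * om)%C = RtoC 1) by (rewrite Cmult_comm; exact oo).
apply C3_eq.
- unfold Cdiv. transitivity (om * Cconj om * ((RtoC be * RtoC be * r + s) * / (1 + RtoC be * RtoC be) * (1 - RtoC be * RtoC be) * / (1 + 2 * RtoC be * (RtoC be * (r - s) * / (1 + RtoC be * RtoC be)) - RtoC be * RtoC be * (r * s))))%C. ring. rewrite oo. ring.
- unfold Cdiv. transitivity (Cconj om * om * ((r + RtoC be * RtoC be * s) * / (1 + RtoC be * RtoC be) * (1 - RtoC be * RtoC be) * / (1 + 2 * RtoC be * (RtoC be * (r - s) * / (1 + RtoC be * RtoC be)) - RtoC be * RtoC be * (r * s))))%C. ring. rewrite oo'. ring.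
- rewrite oo. ring.
Qed.

Let Hom' : Cmod (Cconj om) = 1.
Proof. now rewrite Cmod_conj. Qed.

Let rotA (y : C3) : rot (Cconj om) om (rot om (Cconj om) y) = y.
Proof. pose proof (rot_inv (Cconj om) om y Hom' om_unit) as H. rewrite Cconj_conj in H. exact H. Qed.

Let rotB (y : C3) : rot om (Cconj om) (rot (Cconj om) om y) = y.
Proof. pose proof (rot_inv om (Cconj om) y om_unit Hom') as H. rewrite Cconj_conj in H. exact H. Qed.

Let phi_siegel z : disc z -> phi z = rot (Cconj om) om (Xi (RtoC k0 * cay (u * z)) (RtoC k0 * cay (- (Cconj u * W z))) (RtoC (1 - k0 * k0))).
Proof.
intros Hz. rewrite Ephi by auto. rewrite <- critical_siegel by auto.
now rewrite rotA.
Qed.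

Lemma critical_unique (m : C) : W (RtoC 0) = RtoC 0 -> hd W (RtoC 0) m -> Cmod m < 1 ->
  (exists F, left_inverse phi F) -> unique_left_inverse phi.
Proof.
intros HW0 Hm Hm1 [F HF].
assert (A : forall G, left_inverse phi G -> forall P S c, siegel P S c ->
  (u * G (rot (Cconj om) om (Xi P S c)))%C = ((RtoC k0 - P) / (RtoC k0 + P))%C).
{ intros G HG. apply left_inverse_iff in HG. destruct HG as [HG Hinv].
  pose proof (disc_map_mult _ u u_unit (disc_map_rot G _ _ Hom' om_unit HG)) as HG2.
  (* Reparametrising the curve by conj u turns its first coordinate into k0 cay z; the factor [u] in
     front of [G] compensates. *)
  set (Sf := fun z => (RtoC k0 * cay (- (Cconj u * W (Cconj u * z))))%C).
  assert (Hu0 : forall z, disc z -> disc (Cconj u * z)). { intros z Hz. unfold disc. rewrite Cmod_mult, Cmod_conj, u_unit, Rmult_1_l. exact Hz. }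

  assert (ES : Sf (RtoC 0) = RtoC k0).
  { unfold Sf. rewrite Cmult_0_r, HW0, Cmult_0_r. replace (- RtoC 0)%C with (RtoC 0) by ring. rewrite cay_0. ring. }
  assert (HSf : hd Sf (RtoC 0) (2 * RtoC k0 * (Cconj u * Cconj u * m))%C).
  { eapply hd_eq. apply hd_mult. apply hd_const. apply (hd_comp cay (fun z => - (Cconj u * W (Cconj u * z)))%C).
    apply hd_cay. rewrite Cmult_0_r, HW0, Cmult_0_r, Cmod_opp, Cmod_0. lra.
    apply hd_opp. apply hd_mult. apply hd_const. apply (hd_comp W (fun z => Cconj u * z)%C). rewrite Cmult_0_r. apply Hm.
    apply hd_mult. apply hd_const. apply hd_id.
    cbv beta. rewrite Cmult_0_r, HW0, Cmult_0_r. replace (1 + - RtoC 0)%C with (RtoC 1) by ring. field. }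
  assert (HC0 : 0 < 1 - k0 * k0) by nra.
  apply (key_uniqueness (fun x => u * G (rot (Cconj om) om x))%C k0 (1 - k0 * k0) (RtoC k0)); try (simpl; lra); auto.
  apply (first_order_c (fun x => u * G (rot (Cconj om) om x))%C k0 k0 (1 - k0 * k0) Sf (2 * RtoC k0 * (Cconj u * Cconj u * m))%C); auto; try lra.
  - rewrite !Cmod_mult, Cmod_conj, u_unit, !Cmod_R, !Rabs_pos_eq by lra. nra.
  - intros z Hz. unfold Sf.
    replace (cay z) with (cay (u * (Cconj u * z))). 2: { f_equal. transitivity (u * Cconj u * z)%C. ring. rewrite uu. ring. }
    rewrite <- (phi_siegel (Cconj u * z)) by auto. rewrite Hinv by auto.
    transitivity (u * Cconj u * z)%C. ring. rewrite uu. ring. }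
exists F. split; auto. intros G HG x Hx.
assert (Hy' : tetrablock (rot om (Cconj om) x)) by (apply tetra_rot; auto).
rewrite <- (rotA x). destruct (tetra_Xi _ Hy') as [P [S [c' [Hs ->]]]].
pose proof (A G HG _ _ _ Hs) as E1. rewrite <- (A F HF _ _ _ Hs) in E1.
replace (G (rot (Cconj om) om (Xi P S c'))) with (Cconj u * (u * G (rot (Cconj om) om (Xi P S c'))))%C.
- rewrite E1. transitivity (u * Cconj u * F (rot (Cconj om) om (Xi P S c')))%C. ring. rewrite uu. ring.
- transitivity (u * Cconj u * G (rot (Cconj om) om (Xi P S c')))%C. ring. rewrite uu. ring.
Qed.

Let cayP (x : C3) : C := ((RtoC k0 - sP (pr1 x) (pr2 x) (pr3 x)) / (RtoC k0 + sP (pr1 x) (pr2 x) (pr3 x)))%C.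
Let cayS (x : C3) : C := ((RtoC k0 - sS (pr1 x) (pr2 x) (pr3 x)) / (RtoC k0 + sS (pr1 x) (pr2 x) (pr3 x)))%C.

Let fdx_sden x : fdx (fun x => sden (pr1 x) (pr2 x) (pr3 x)) x.
Proof. unfold sden. apply fdx_minus. apply fdx_plus. apply fdx_minus. apply fdx_const. apply fdx_pr1. apply fdx_pr2. apply fdx_pr3. Qed.

Let sd_cayP : disc_map cayP.
Proof.
split.
- rewrite holo_tetra. intros x Hx. destruct x as [[x1 x2] x3].
  destruct (sg_of_tetra _ _ _ Hx) as [H1 [H2 _]]. pose proof (sden_neq0 _ _ _ Hx) as Hd.
  assert (K : fdx (fun x => sP (pr1 x) (pr2 x) (pr3 x)) (x1, x2, x3)).
  { unfold sP. apply fdx_div; auto. apply fdx_plus. apply fdx_minus. apply fdx_minus. apply fdx_const. apply fdx_pr1. apply fdx_pr2. apply fdx_pr3. }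
  unfold cayP. apply fdx_div. apply right_half_neq0. unfold pr1, pr2, pr3. simpl fst in *. simpl snd in *.
  set (t := sP x1 x2 x3) in *. clearbody t. simpl. lra.
  apply fdx_minus; auto. apply fdx_const. apply fdx_plus; auto. apply fdx_const.
- intros [[x1 x2] x3] Hx. destruct (sg_of_tetra _ _ _ Hx) as [H1 _]. apply cay_disc; auto. lra.
Qed.

Let sd_cayS : disc_map cayS.
Proof.
split.
- rewrite holo_tetra. intros x Hx. destruct x as [[x1 x2] x3].
  destruct (sg_of_tetra _ _ _ Hx) as [_ [H2 _]]. pose proof (sden_neq0 _ _ _ Hx) as Hd.
  assert (K : fdx (fun x => sS (pr1 x) (pr2 x) (pr3 x)) (x1, x2, x3)).
  { unfold sS. apply fdx_div; auto. apply fdx_plus. apply fdx_plus. apply fdx_plus. apply fdx_const. apply fdx_pr1. apply fdx_pr2. apply fdx_pr3. }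
  unfold cayS. apply fdx_div. apply right_half_neq0. unfold pr1, pr2, pr3. simpl fst in *. simpl snd in *.
  set (t := sS x1 x2 x3) in *. clearbody t. simpl. lra.
  apply fdx_minus; auto. apply fdx_const. apply fdx_plus; auto. apply fdx_const.
- intros [[x1 x2] x3] Hx. destruct (sg_of_tetra _ _ _ Hx) as [_ [H1 _]]. apply cay_disc; auto. lra.
Qed.

Let cayPS_Xi P S c' : siegel P S c' -> cayP (Xi P S c') = ((RtoC k0 - P) / (RtoC k0 + P))%C /\ cayS (Xi P S c') = ((RtoC k0 - S) / (RtoC k0 + S))%C.
Proof.
intros H. destruct (xi_sP _ _ _ H) as [E1 E2]. unfold cayP, cayS, Xi, pr1, pr2, pr3; simpl fst; simpl snd.
rewrite E1, E2. auto.
Qed.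

Lemma cay_scale (k : R) (z : C) : k <> 0 -> (1 + z)%C <> RtoC 0 -> ((RtoC k - RtoC k * cay z) / (RtoC k + RtoC k * cay z))%C = z.
Proof.
intros Hk H. assert (RtoC k <> RtoC 0) by now apply RtoC_neq0.
assert (RtoC 2 <> RtoC 0) by (apply RtoC_neq0; lra). unfold cay.
field. split; auto.
replace (RtoC k * (1 + z) + RtoC k * (1 - z))%C with (RtoC k * RtoC 2)%C. now apply Cmult_neq_0.
transitivity (RtoC k * (1 + 1))%C. f_equal. apply injective_projections; simpl; ring. ring.
Qed.

Lemma critical_two (v : C) : Cmod v = 1 -> (forall z, disc z -> W z = (v * z)%C) -> ~ unique_left_inverse phi.
Proof.
intros Hv HWv.
set (u2 := (- (Cconj u * v))%C). assert (Hu2 : Cmod u2 = 1) by (unfold u2; rewrite Cmod_opp, Cmod_mult, Cmod_conj, u_unit, Hv; ring).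
assert (HSgz : forall z, disc z -> siegel (RtoC k0 * cay (u * z)) (RtoC k0 * cay (u2 * z)) (RtoC (1 - k0 * k0)) /\ (1 + u * z)%C <> RtoC 0 /\ (1 + u2 * z)%C <> RtoC 0).
{ intros z Hz.
  assert (Q : forall w, Cmod w = 1 -> 0 < fst (RtoC k0 * cay (w * z))%C /\ (1 + w * z)%C <> RtoC 0).
  { intros w Hw. assert (Cmod (w * z) < 1) by (rewrite Cmod_mult, Hw, Rmult_1_l; exact Hz).
    split; [|now apply one_add_neq0]. pose proof (cay_pos (w * z) H) as Q. set (t := cay (w * z)) in *. clearbody t. simpl. nra. }
  destruct (Q u u_unit) as [Q1 Q2]. destruct (Q u2 Hu2) as [Q3 Q4]. split; auto. split; auto. split; auto.
  assert (0 < 1 - k0 * k0) by nra. rewrite Cmod_R, Rabs_pos_eq by lra. simpl fst at 1. rewrite Rminus_diag. nra. }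
assert (LI : forall (H : C3 -> C) w, disc_map H -> Cmod w = 1 ->
  (forall z, disc z -> H (Xi (RtoC k0 * cay (u * z)) (RtoC k0 * cay (u2 * z)) (RtoC (1 - k0 * k0))) = (w * z)%C) ->
  left_inverse phi (fun x => Cconj w * H (rot om (Cconj om) x))%C).
{ intros H w HH Hw HE. apply left_inverse_iff. split.
  - apply disc_map_mult. now rewrite Cmod_conj. now apply disc_map_rot.
  - intros z Hz. rewrite phi_siegel by auto.
    rewrite HWv by auto. replace (- (Cconj u * (v * z)))%C with (u2 * z)%C by (unfold u2; ring).
    rewrite rotB. rewrite HE by auto. pose proof (unit_conj w Hw) as E. transitivity (w * Cconj w * z)%C. ring. rewrite E. ring. }
assert (L1 := LI cayP u sd_cayP u_unit). assert (L2 := LI cayS u2 sd_cayS Hu2).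
(* A test point with P = k0 and S = 2 k0: there [cayP] vanishes and [cayS] does not. *)
assert (T1 : siegel (RtoC k0) (RtoC (2 * k0)) (RtoC 0)).
{ repeat split; simpl; try lra. rewrite Cmod_0. nra. }
destruct (cayPS_Xi _ _ _ T1) as [V1 V2].
apply (not_unique phi (fun x => Cconj u * cayP (rot om (Cconj om) x))%C (fun x => Cconj u2 * cayS (rot om (Cconj om) x))%C (rot (Cconj om) om (Xi (RtoC k0) (RtoC (2 * k0)) (RtoC 0)))).
- apply L1. intros z Hz. destruct (HSgz z Hz) as [Q1 [Q2 Q3]]. rewrite (proj1 (cayPS_Xi _ _ _ Q1)). apply cay_scale; auto. lra.
- apply L2. intros z Hz. destruct (HSgz z Hz) as [Q1 [Q2 Q3]]. rewrite (proj2 (cayPS_Xi _ _ _ Q1)). apply cay_scale; auto. lra.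
- apply tetra_rot; auto. now apply Xi_tetra.
- cbv beta.
  rewrite rotB, V1, V2. intros E.

  assert (E' : ((RtoC k0 - RtoC (2 * k0)) / (RtoC k0 + RtoC (2 * k0)))%C = RtoC 0).
  { pose proof (unit_conj u2 Hu2) as U.
    transitivity (u2 * Cconj u2 * ((RtoC k0 - RtoC (2 * k0)) / (RtoC k0 + RtoC (2 * k0))))%C. rewrite U. ring.
    transitivity (u2 * (Cconj u2 * ((RtoC k0 - RtoC (2 * k0)) / (RtoC k0 + RtoC (2 * k0)))))%C. ring.
    rewrite <- E. unfold Cdiv. ring. }
  rewrite <- RtoC_minus, <- RtoC_plus in E'.
  replace (RtoC 0) with (RtoC 0 / RtoC 1)%C in E' by (unfold Cdiv; ring).
  apply Cdiv_eq in E'. apply (f_equal fst) in E'. simpl in E'. lra. apply RtoC_neq0; lra. apply RtoC_neq0; lra.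
Qed.
End Critical.

(** * The subcritical case *)

Lemma Csqrt_ex (z : C) : exists d : C, (d * d)%C = z.
Proof.
destruct z as [x y]. pose proof (Cmod_pair_ge x y) as [H1 H2].
assert (HN : x * x + y * y = Cmod (x, y) * Cmod (x, y)) by (rewrite <- N2_Cmod; reflexivity).
set (r := Cmod (x, y)) in *. clearbody r.
pose proof (Rle_abs x). pose proof (Rle_abs (- x)) as H3. rewrite Rabs_Ropp in H3.
assert (P1 : 0 <= (r + x) / 2) by lra. assert (P2 : 0 <= (r - x) / 2) by lra.
assert (E : sqrt ((r + x) / 2) * sqrt ((r - x) / 2) = Rabs y / 2).
{ rewrite <- sqrt_mult by auto. replace ((r + x) / 2 * ((r - x) / 2)) with (Rsqr (y / 2)).
  2: { unfold Rsqr. nra. }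
  rewrite sqrt_Rsqr_abs. unfold Rdiv. rewrite Rabs_mult, (Rabs_pos_eq (/ 2)) by lra. reflexivity. }
pose proof (sqrt_sqrt _ P1) as Q1. pose proof (sqrt_sqrt _ P2) as Q2.
set (p := sqrt ((r + x) / 2)) in *. set (q := sqrt ((r - x) / 2)) in *. clearbody p q.
destruct (Rle_lt_dec 0 y) as [L|L].
- rewrite Rabs_pos_eq in E by auto. exists ((p, q) : C). apply injective_projections; simpl; lra.
- rewrite Rabs_left in E by auto. exists ((p, - q) : C). apply injective_projections; simpl; lra.
Qed.

(* The automorphism of the tetrablock acting on [x |-> (x2 - x3 w) / (1 - x1 w)] by
   precomposition with a disc automorphism. *)
Definition mob (t : C) (x : C3) : C3 :=
  ((pr1 x - Cconj t) / (1 - t * pr1 x), (pr2 x - t * pr3 x) / (1 - t * pr1 x),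
   (pr3 x - Cconj t * pr2 x) / (1 - t * pr1 x))%C.

Lemma mob_den (t : C) (x : C3) : Cmod t < 1 -> tetrablock x -> (1 - t * pr1 x)%C <> RtoC 0.
Proof.
intros Ht Hx. destruct x as [[x1 x2] x3]. apply one_sub_neq0. apply Cmod_mult_lt1. lra. now apply tetra_x1 in Hx.
Qed.

Lemma mob_off (t : C) (x : C3) : (1 - t * pr1 x)%C <> RtoC 0 ->
  (pr1 (mob t x) * pr2 (mob t x) - pr3 (mob t x) =
   RtoC (1 - N2 t) * (pr1 x * pr2 x - pr3 x) / ((1 - t * pr1 x) * (1 - t * pr1 x)))%C.
Proof.
intros H. unfold mob. cbn [pr1 pr2 pr3 fst snd].
replace (RtoC (1 - N2 t)) with (1 - t * Cconj t)%C by (apply injective_projections; unfold N2; simpl; ring).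
field. auto.
Qed.

(** The sum of [I1] and [I2] is the side condition, their difference the defect, each multiplied by
    1 - |t|^2. The same factor appears in [mob_off], so both conditions of [tetra_iff_side] are
    preserved. *)
Lemma mob_tetra (t : C) (x : C3) : Cmod t < 1 -> tetrablock x -> tetrablock (mob t x).
Proof.
intros Ht Hx. pose proof (mob_den t x Ht Hx) as Hd. pose proof (mob_off t x Hd) as Ho.
destruct x as [[x1 x2] x3]. unfold mob in *. cbn [pr1 pr2 pr3 fst snd] in *.
pose proof (N2_pos _ Hd) as Hn. apply N2_lt_1 in Ht.
pose proof (tetra_side _ _ _ Hx) as Hs. pose proof (tetra_defect _ _ _ Hx) as HT.
assert (I1 : N2 (1 - t * x1)%C - N2 (x1 - Cconj t)%C = (1 - N2 t) * (1 - N2 x1)) by (unfold N2; simpl; ring).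
assert (I2 : N2 (x2 - t * x3)%C - N2 (x3 - Cconj t * x2)%C = (1 - N2 t) * (N2 x2 - N2 x3)) by (unfold N2; simpl; ring).
apply tetra_iff_side.
- rewrite !N2_div by auto. apply Rmult_lt_reg_r with (N2 (1 - t * x1)%C); auto.
  set (n := N2 (1 - t * x1)%C) in *.
  replace ((N2 (x1 - Cconj t)%C / n + N2 (x3 - Cconj t * x2)%C / n) * n) with (N2 (x1 - Cconj t)%C + N2 (x3 - Cconj t * x2)%C) by (field; lra).
  replace ((1 + N2 (x2 - t * x3)%C / n) * n) with (n + N2 (x2 - t * x3)%C) by (field; lra). nra.
- rewrite Ho. unfold defect in *. rewrite !N2_div by auto. rewrite Cmod_div, !Cmod_mult, <- N2_Cmod by now apply Cmult_neq_0.
  rewrite Cmod_R, Rabs_pos_eq by lra.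
  set (n := N2 (1 - t * x1)%C) in *. set (w := Cmod (x1 * x2 - x3)) in *.
  apply Rmult_lt_reg_r with n; auto.
  replace (2 * ((1 - N2 t) * w / n) * n) with (2 * (1 - N2 t) * w) by (field; lra).
  replace ((1 + N2 (x3 - Cconj t * x2)%C / n - N2 (x1 - Cconj t)%C / n - N2 (x2 - t * x3)%C / n) * n) with
    (n + N2 (x3 - Cconj t * x2)%C - N2 (x1 - Cconj t)%C - N2 (x2 - t * x3)%C) by (field; lra).
  nra.
Qed.

Lemma mob_inv (t : C) (x : C3) : Cmod t < 1 -> tetrablock x -> mob t (mob (- t) x) = x.
Proof.
intros Ht Hx.
assert (Ht' : Cmod (- t) < 1) by now rewrite Cmod_opp.
pose proof (mob_den _ x Ht' Hx) as H1.
destruct x as [[x1 x2] x3]. unfold mob in *. cbn [pr1 pr2 pr3 fst snd] in *.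
assert (E : Cconj (- t) = (- Cconj t)%C) by (apply injective_projections; simpl; ring). rewrite E in *.
assert (H3 : (1 - t * Cconj t)%C <> RtoC 0).
{ apply one_sub_neq0. apply Cmod_mult_lt1. lra. now rewrite Cmod_conj. }
assert (H4 : (1 - - t * x1 - t * (x1 - - Cconj t))%C <> RtoC 0) by (intros E'; apply H3; rewrite <- E'; ring).
apply C3_eq; field; auto.
Qed.

Lemma disc_map_mob (G : C3 -> C) (t : C) : Cmod t < 1 -> disc_map G -> disc_map (fun x => G (mob t x)).
Proof.
intros Ht [HG HD]. split.
- apply holo_tetra; rewrite holo_tetra in HG. intros x Hx. pose proof (mob_den t x Ht Hx) as Hd.
  assert (fdx (fun x => 1 - t * pr1 x)%C x).
  { apply fdx_minus. apply fdx_const. apply fdx_mult. apply fdx_const. apply fdx_pr1. }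
  apply (fdx_comp3 G (fun x => (pr1 x - Cconj t) / (1 - t * pr1 x))%C (fun x => (pr2 x - t * pr3 x) / (1 - t * pr1 x))%C
    (fun x => (pr3 x - Cconj t * pr2 x) / (1 - t * pr1 x))%C).
  + apply HG. exact (mob_tetra t x Ht Hx).
  + apply fdx_div; auto. apply fdx_minus. apply fdx_pr1. apply fdx_const.
  + apply fdx_div; auto. apply fdx_minus. apply fdx_pr2. apply fdx_mult. apply fdx_const. apply fdx_pr3.
  + apply fdx_div; auto. apply fdx_minus. apply fdx_pr3. apply fdx_mult. apply fdx_const. apply fdx_pr2.
- intros x Hx. apply HD. now apply mob_tetra.
Qed.

(** * A family of disc-valued maps that agree on a curve *)

Section GF.
Variable k : R.
Hypothesis Hk : 0 < k < 1.

Definition gnum (om : C) (x : C3) : C :=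
  ((1 - RtoC k * RtoC k) * pr2 x * (1 - pr3 x) +
   om * ((pr3 x + RtoC k) * (pr3 x + RtoC k) - (1 + RtoC k) * (1 + RtoC k) * (pr1 x * pr2 x)))%C.
Definition gden (om : C) (x : C3) : C :=
  ((1 + RtoC k * pr3 x) * (1 + RtoC k * pr3 x) - (1 + RtoC k) * (1 + RtoC k) * (pr1 x * pr2 x) -
   om * ((1 - RtoC k * RtoC k) * pr1 x * (1 - pr3 x)))%C.

(* With [d * d = x1 x2 - x3], the map [gnum / gden] is [l |-> (x2 - l x3) / (1 - l x1)] applied
   successively at the two points [tpoint (- sqrt k) x1 (-d) x2 x3] and [tpoint (- sqrt k) x1 d x2 x3]. *)
Lemma gnum_lt_gden (om : C) (x : C3) : Cmod om <= 1 -> tetrablock x -> Cmod (gnum om x) < Cmod (gden om x).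
Proof.
intros Hom Hx. destruct x as [[x1 x2] x3]. destruct (proj1 (tetra_iff _ _ _) Hx) as [H3 HT].
destruct (Csqrt_ex (x1 * x2 - x3)%C) as [d Hd].
set (q := sqrt k). assert (Hq0 : 0 < q) by (apply sqrt_lt_R0; lra).
assert (Hqq : q * q = k) by (apply sqrt_sqrt; lra).
assert (Hq1 : q < 1) by nra.
assert (Hb : -1 < - q < 1) by lra.
assert (HNd : N2 d = Cmod (x1 * x2 - x3)) by (rewrite <- Hd, Cmod_mult, N2_Cmod; reflexivity).
assert (S1 : forall B, (B * B)%C = (x1 * x2 - x3)%C -> N2 B = N2 d ->
  (1 - 2 * RtoC q * B - RtoC k * x3)%C <> RtoC 0 /\
  tetrablock ((x1 * (1 - RtoC k)) / (1 - 2 * RtoC q * B - RtoC k * x3), (x2 * (1 - RtoC k)) / (1 - 2 * RtoC q * B - RtoC k * x3), (x3 + 2 * RtoC q * B - RtoC k) / (1 - 2 * RtoC q * B - RtoC k * x3))%C).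
{ intros B HB HNB.
  assert (K1 : (x1 * x2 - B * B)%C = x3) by (rewrite HB; ring).
  assert (K2 : 2 * N2 B < 1 + N2 x3 - N2 x1 - N2 x2) by (rewrite HNB, HNd; exact HT).
  pose proof (tden_neq0 (- q) x1 B x2 x3 Hb K1 H3 K2) as D1.
  pose proof (tpoint_tetra (- q) x1 B x2 x3 Hb K1 H3 K2) as D2.
  unfold tpoint in D2.
  assert (Ed : tden (- q) B x3 = (1 - 2 * RtoC q * B - RtoC k * x3)%C).
  { unfold tden. rewrite <- Hqq, RtoC_mult, RtoC_opp. ring. }
  assert (En : tnum (- q) B x3 = (x3 + 2 * RtoC q * B - RtoC k)%C).
  { unfold tnum. rewrite <- Hqq, RtoC_mult, RtoC_opp. ring. }
  rewrite Ed in D1. rewrite Ed, En in D2. split; auto.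
  replace (RtoC (1 - - q * - q)) with (1 - RtoC k)%C in D2. auto.
  rewrite <- Hqq, RtoC_minus, !RtoC_mult, RtoC_opp. ring. }
destruct (S1 d Hd eq_refl) as [D1 T1].
destruct (S1 (- d)%C) as [D2 T2]. rewrite <- Hd; ring. unfold N2; simpl; ring.
clear S1.
set (Dm := (1 - 2 * RtoC q * d - RtoC k * x3)%C) in *. set (Dp := (1 - 2 * RtoC q * - d - RtoC k * x3)%C) in *.
set (Ep := (x3 + 2 * RtoC q * d - RtoC k)%C) in *. set (Em := (x3 + 2 * RtoC q * - d - RtoC k)%C) in *.
set (al := (x2 * (1 - RtoC k))%C) in *. set (ga := (x1 * (1 - RtoC k))%C) in *.
assert (P1 : forall eta, Cmod eta <= 1 -> Cmod (al - eta * Em) < Cmod (Dp - eta * ga)).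
{ intros eta He. pose proof (tetra_psi _ _ _ eta T2 He) as H.
  replace (al / Dp - eta * (Em / Dp))%C with ((al - eta * Em) / Dp)%C in H by (field; auto).
  replace (1 - eta * (ga / Dp))%C with ((Dp - eta * ga) / Dp)%C in H by (field; auto).
  rewrite !Cmod_div in H by auto. apply Rmult_lt_reg_r with (/ Cmod Dp); auto.
  apply Rinv_0_lt_compat. now apply Cmod_gt_0. }
assert (P2 : forall eta, Cmod eta <= 1 -> Cmod (al - eta * Ep) < Cmod (Dm - eta * ga)).
{ intros eta He. pose proof (tetra_psi _ _ _ eta T1 He) as H.
  replace (al / Dm - eta * (Ep / Dm))%C with ((al - eta * Ep) / Dm)%C in H by (field; auto).
  replace (1 - eta * (ga / Dm))%C with ((Dm - eta * ga) / Dm)%C in H by (field; auto).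
  rewrite !Cmod_div in H by auto. apply Rmult_lt_reg_r with (/ Cmod Dm); auto.
  apply Rinv_0_lt_compat. now apply Cmod_gt_0. }
pose proof (P1 om Hom) as L1.
assert (L0 : 0 < Cmod (Dp - om * ga)) by (pose proof (Cmod_ge_0 (al - om * Em)); lra).
assert (Hnz : (Dp - om * ga)%C <> RtoC 0) by now apply Cmod_gt_0.
set (l := ((al - om * Em) / (Dp - om * ga))%C).
assert (Hl : Cmod l <= 1).
{ unfold l. rewrite Cmod_div by auto. apply Rmult_le_reg_r with (Cmod (Dp - om * ga)); auto.
  unfold Rdiv. rewrite Rmult_assoc, Rinv_l by lra. lra. }

assert (EK : (RtoC q * RtoC q)%C = RtoC k) by (rewrite <- RtoC_mult, Hqq; reflexivity).
assert (E1 : gnum om ((x1, x2, x3) : C3) = ((Dp - om * ga) * (al - l * Ep))%C).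
{ replace ((Dp - om * ga) * (al - l * Ep))%C with ((Dp - om * ga) * al - (al - om * Em) * Ep)%C by (unfold l; field; auto).
  unfold gnum. cbn [pr1 pr2 pr3 fst snd]. unfold Dp, ga, al, Em, Ep.
  replace (((1 - 2 * RtoC q * - d - RtoC k * x3 - om * (x1 * (1 - RtoC k))) * (x2 * (1 - RtoC k)) - (x2 * (1 - RtoC k) - om * (x3 + 2 * RtoC q * - d - RtoC k)) * (x3 + 2 * RtoC q * d - RtoC k)))%C with
    ((1 - RtoC k * RtoC k) * x2 * (1 - x3) + om * ((x3 - RtoC k) * (x3 - RtoC k) - 4 * (RtoC q * RtoC q) * (d * d) - (1 - RtoC k) * (1 - RtoC k) * (x1 * x2)))%C by ring.
  rewrite Hd, EK. ring. }
assert (E2 : gden om ((x1, x2, x3) : C3) = ((Dp - om * ga) * (Dm - l * ga))%C).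
{ replace ((Dp - om * ga) * (Dm - l * ga))%C with ((Dp - om * ga) * Dm - (al - om * Em) * ga)%C by (unfold l; field; auto).
  unfold gden. cbn [pr1 pr2 pr3 fst snd]. unfold Dp, ga, al, Em, Dm.
  transitivity ((1 - RtoC k * x3) * (1 - RtoC k * x3) - 4 * (RtoC q * RtoC q) * (d * d) - (1 - RtoC k) * (1 - RtoC k) * (x1 * x2) - om * ((1 - RtoC k * RtoC k) * x1 * (1 - x3)))%C.
  rewrite Hd, EK. ring. ring. }
change (Cmod (gnum om ((x1, x2, x3) : C3)) < Cmod (gden om ((x1, x2, x3) : C3))). rewrite E1, E2, !Cmod_mult. apply Rmult_lt_compat_l; auto.
Qed.

Lemma gden_neq0 (om : C) (x : C3) : Cmod om <= 1 -> tetrablock x -> gden om x <> RtoC 0.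
Proof.
intros Ho Hx. pose proof (gnum_lt_gden om x Ho Hx). pose proof (Cmod_ge_0 (gnum om x)). apply Cmod_gt_0. lra.
Qed.

Lemma disc_map_gf (om : C) : Cmod om <= 1 -> disc_map (fun x => gnum om x / gden om x)%C.
Proof.
intros Ho. split.
- rewrite holo_tetra. intros x Hx.
  pose proof (fdx_pr1 x). pose proof (fdx_pr2 x). pose proof (fdx_pr3 x).
  apply fdx_div. now apply gden_neq0.
  + unfold gnum. repeat first [assumption | apply fdx_const | apply fdx_minus | apply fdx_plus | apply fdx_mult].
  + unfold gden. repeat first [assumption | apply fdx_const | apply fdx_minus | apply fdx_plus | apply fdx_mult].
- intros x Hx. pose proof (gden_neq0 om x Ho Hx) as Hd. unfold disc. rewrite Cmod_div by auto.
  pose proof (proj1 (Cmod_gt_0 _) Hd). apply Rmult_lt_reg_r with (Cmod (gden om x)); auto.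
  unfold Rdiv. rewrite Rmult_assoc, Rinv_l, Rmult_1_l, Rmult_1_r by lra. now apply gnum_lt_gden.
Qed.

(** The two relations express [x3] and [x2] through [x1] and [r], after which gnum = r gden is a
    polynomial identity for every [om]. *)
Lemma gf_value (om : C) (x : C3) (r : C) : Cmod om <= 1 -> tetrablock x -> Cmod r < 1 ->
  (pr2 x - pr3 x * r = r * (1 - pr1 x * r))%C ->
  (pr1 x * pr2 x - pr3 x = RtoC k * ((1 - pr1 x * r) * (1 - pr1 x * r)))%C ->
  (gnum om x / gden om x)%C = r.
Proof.
intros Ho Hx Hr E1 E2. pose proof (gden_neq0 om x Ho Hx) as Hd.
cut (gnum om x = r * gden om x)%C. intros ->. field. auto. clear Hd.
assert (H1 : Cmod (pr1 x) < 1). { destruct x as [[x1 x2] x3]. now apply tetra_x1 in Hx. }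
unfold gnum, gden. revert H1 E1 E2. generalize (pr1 x) (pr2 x) (pr3 x). clear x Hx. intros x1 x2 x3 H1 E1 E2.
assert (Hj : (1 - x1 * r)%C <> RtoC 0). { apply one_sub_neq0. apply Cmod_mult_lt1; auto. lra. }
assert (F3 : x3 = (x1 * r - RtoC k * (1 - x1 * r))%C).
{ apply Csub_eq0. destruct (classic ((x3 - (x1 * r - RtoC k * (1 - x1 * r)))%C = RtoC 0)) as [|N]; auto. exfalso.
  apply (Cmult_neq_0 _ _ Hj N).
  transitivity (x1 * (x2 - x3 * r) - (x1 * x2 - x3) - (x1 * r) * (1 - x1 * r) + RtoC k * ((1 - x1 * r) * (1 - x1 * r)))%C. ring.
  rewrite E1, E2. ring. }
assert (F2 : x2 = (r * (1 - RtoC k * (1 - x1 * r)))%C).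
{ transitivity (x2 - x3 * r + x3 * r)%C. ring. rewrite E1, F3. ring. }
rewrite F2, F3. ring.
Qed.
End GF.

Section SubCritical.
Variables (a c : C) (be : R) (W : C -> C) (phi : C -> C3).
Hypotheses (Hac : N2 a + N2 c = 1) (Hbe : 0 < be < 1) (Hsub : Cmod a < be * Cmod c).
Hypothesis HW1 : forall z, disc z -> disc (W z).
Hypothesis Ephi : forall z, disc z -> phi z = Phi a c be z (W z).

Let be_neq0 : RtoC be <> RtoC 0.
Proof. apply RtoC_neq0. lra. Qed.

Let c_pos : 0 < Cmod c.
Proof. pose proof (Cmod_ge_0 a). nra. Qed.

Let cc_neq0 : Cconj c <> RtoC 0.
Proof. apply Cmod_gt_0. now rewrite Cmod_conj. Qed.

(** The number called [om] in the critical case. The strict inequality [Hsub] moves it into the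
    disc, where it can be the parameter of an automorphism. *)
Let z0 : C := (Cconj a / (RtoC be * Cconj c))%C.
Let w0 : C := (RtoC (be * be) * z0)%C.

Let z0_lt : Cmod z0 < 1.
Proof.
unfold z0. rewrite Cmod_div, Cmod_mult, !Cmod_conj, Cmod_R, Rabs_pos_eq by (lra || now apply Cmult_neq_0).
assert (0 < be * Cmod c) by nra.
apply Rmult_lt_reg_r with (be * Cmod c); auto. unfold Rdiv. rewrite Rmult_assoc, Rinv_l; lra.
Qed.

Let w0_lt : Cmod w0 < 1.
Proof. unfold w0. rewrite Cmod_mult, Cmod_R, Rabs_pos_eq by nra. nra. Qed.

Let w0c_lt : Cmod (Cconj w0) < 1.
Proof. now rewrite Cmod_conj. Qed.

(** Collects the factors 1 - |z0|^2 and 1 - |w0|^2 that x1 x2 - x3 acquires under the two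
    automorphisms of [hat], and the square of be / (1 - |w0|^2) from [B3] in [hat_relations]. *)
Let k : R := be * be * (1 - N2 z0) / (1 - N2 w0).

Let N2_w0 : N2 w0 = be * be * (be * be) * N2 z0.
Proof. unfold w0. rewrite N2_mult. unfold N2 at 1. simpl. ring. Qed.

Let k_lt : 0 < k < 1.
Proof.
pose proof z0_lt as H. apply N2_lt_1 in H. pose proof w0_lt as H'. apply N2_lt_1 in H'. pose proof (N2_nonneg z0).
assert (0 < be * be < 1) by nra.
unfold k. split. apply Rdiv_lt_0_compat; try lra. nra.
apply Rmult_lt_reg_r with (1 - N2 w0). lra. unfold Rdiv. rewrite Rmult_assoc, Rinv_l by lra. rewrite N2_w0.
assert (0 <= (be * be) * N2 z0 * (1 - be * be)) by (repeat apply Rmult_le_pos; lra). nra.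
Qed.

(** The Moebius map l -> (x2 - l x3) / (1 - l x1) attached to a point is precomposed with an
    automorphism of parameter [z0] and, thanks to the swaps, postcomposed with one of parameter
    [w0]. For the points of the curve the result fixes lam z. *)
Let hat (x : C3) : C3 := swap (mob (Cconj w0) (swap (mob z0 x))).

Let hat_tetra x : tetrablock x -> tetrablock (hat x).
Proof. intros H. unfold hat. apply tetra_swap3. apply mob_tetra; auto. apply tetra_swap3. apply mob_tetra; auto. Qed.

Let disc_map_hat G : disc_map G -> disc_map (fun x => G (hat x)).
Proof.
intros H. unfold hat. apply (disc_map_mob (fun y => G (swap (mob (Cconj w0) (swap y))))); auto.
apply (disc_map_swap (fun y => G (swap (mob (Cconj w0) y)))).
apply (disc_map_mob (fun y => G (swap y))); auto. now apply disc_map_swap.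
Qed.

Let hat_onto y : tetrablock y -> exists x, tetrablock x /\ hat x = y.
Proof.
intros Hy. exists (mob (- z0)%C (swap (mob (- Cconj w0)%C (swap y)))).
assert (T1 : tetrablock (mob (- Cconj w0)%C (swap y))). { apply mob_tetra. now rewrite Cmod_opp. now apply tetra_swap3. }
split.
- apply mob_tetra. now rewrite Cmod_opp. now apply tetra_swap3.
- unfold hat. rewrite mob_inv by (auto; now apply tetra_swap3). rewrite swap_swap.
  rewrite mob_inv by (auto; now apply tetra_swap3). apply swap_swap.
Qed.

Let lam : C := (c / Cconj c)%C.
Let lam_unit : Cmod lam = 1.
Proof. unfold lam. rewrite Cmod_div, Cmod_conj by auto. field. lra. Qed.

(* The points of the curve are solutions of a linear system, [d] being a square root of [x1 x2 - x3]. *)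
Let linear z : disc z -> exists x1 x2 x3 d : C, phi z = (x1, x2, x3) /\ (x1 * x2 - x3 = d * d)%C /\
  (x1 * (RtoC be * (z0 + lam * z)) + d * (1 + Cconj w0 * (lam * z)) = RtoC be * (1 + Cconj z0 * (lam * z)))%C /\
  (d * (RtoC be * (z0 + lam * z)) + x2 * (1 + Cconj w0 * (lam * z)) = lam * z + w0)%C.
Proof.
intros Hz. rewrite Ephi by auto. set (w := W z).
pose proof (Phi_den a c be Hac Hbe z w Hz (HW1 z Hz)) as Hd.
pose proof (toff_sqr be (mA a c z w) (mB a c z w) (mD a c z w) (z * w)%C (m_det a c Hac z w) Hd) as Ho.
pose proof (ac_conj a c Hac) as Eac.
set (A := mA a c z w) in *. set (B := mB a c z w) in *. set (D := mD a c z w) in *.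
assert (r1 : (A * Cconj a + B * Cconj c = z * a)%C).
{ transitivity (z * a * (a * Cconj a + c * Cconj c))%C. unfold A, B, mA, mB. ring. rewrite Eac. ring. }
assert (r2 : (A * c - B * a = Cconj c * w)%C).
{ transitivity (Cconj c * w * (a * Cconj a + c * Cconj c))%C. unfold A, B, mA, mB. ring. rewrite Eac. ring. }
assert (r3 : (D * Cconj c + B * Cconj a = z * c)%C).
{ transitivity (z * c * (a * Cconj a + c * Cconj c))%C. unfold D, B, mD, mB. ring. rewrite Eac. ring. }
assert (r4 : (D * a - B * c = Cconj a * w)%C).
{ transitivity (Cconj a * w * (a * Cconj a + c * Cconj c))%C. unfold D, B, mD, mB. ring. rewrite Eac. ring. }
set (De := tden be B (z * w)) in *.
exists (A * RtoC (1 - be * be) / De)%C, (D * RtoC (1 - be * be) / De)%C, (tnum be B (z * w) / De)%C, (toff be B (z * w) / De)%C.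
split; [reflexivity|].
split; [rewrite Ho; field; auto|].
assert (Ew : Cconj w0 = (RtoC be * a / c)%C).
{ unfold w0, z0. rewrite Cmult_conj.
  rewrite Cdiv_conj by now apply Cmult_neq_0.
  rewrite Cmult_conj, !Cconj_conj. assert (Hc : c <> RtoC 0) by now apply Cmod_gt_0.
  replace (Cconj (RtoC (be * be))) with (RtoC be * RtoC be)%C by (apply injective_projections; simpl; ring).
  replace (Cconj (RtoC be)) with (RtoC be) by (apply injective_projections; simpl; ring). field. auto. }
assert (Ez : Cconj z0 = (a / (RtoC be * c))%C).
{ unfold z0. rewrite Cdiv_conj by now apply Cmult_neq_0.
  rewrite Cmult_conj, !Cconj_conj.
  replace (Cconj (RtoC be)) with (RtoC be) by (apply injective_projections; simpl; ring). reflexivity. }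
assert (Hc : c <> RtoC 0) by now apply Cmod_gt_0.
assert (EX1 : (RtoC be * (z0 + lam * z) = (Cconj a + RtoC be * (z * c)) / Cconj c)%C) by (unfold z0, lam; field; auto).
assert (EX2 : (1 + Cconj w0 * (lam * z) = (Cconj c + RtoC be * (z * a)) / Cconj c)%C) by (rewrite Ew; unfold lam; field; auto).
assert (EY1 : (RtoC be * (1 + Cconj z0 * (lam * z)) = (z * a + RtoC be * Cconj c) / Cconj c)%C) by (rewrite Ez; unfold lam; field; auto).
assert (EY2 : (lam * z + w0 = (z * c + RtoC be * Cconj a) / Cconj c)%C) by (unfold w0, z0, lam; rewrite RtoC_mult; field; auto).
rewrite EX1, EX2, EY1, EY2.
replace (RtoC (1 - be * be)) with (1 - RtoC be * RtoC be)%C by (rewrite RtoC_minus, RtoC_mult; reflexivity).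
assert (G : forall u v w : C, (u - De * w = RtoC 0)%C -> (u / (De * Cconj c) = w / Cconj c)%C).
{ intros u v t E. apply Csub_eq0 in E. rewrite E. field. auto. }
split.
- transitivity ((A * (1 - RtoC be * RtoC be) * (Cconj a + RtoC be * (z * c)) + toff be B (z * w) * (Cconj c + RtoC be * (z * a))) / (De * Cconj c))%C.
  field; auto. apply (G _ (RtoC 0)). unfold De, toff, tden.
  transitivity ((1 - RtoC be * RtoC be) * ((A * Cconj a + B * Cconj c) - z * a) + RtoC be * z * (1 - RtoC be * RtoC be) * ((A * c - B * a) - Cconj c * w))%C.
  ring. rewrite r1, r2. ring.
- transitivity ((D * (1 - RtoC be * RtoC be) * (Cconj c + RtoC be * (z * a)) + toff be B (z * w) * (Cconj a + RtoC be * (z * c))) / (De * Cconj c))%C.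
  field; auto. apply (G _ (RtoC 0)). unfold De, toff, tden.
  transitivity ((1 - RtoC be * RtoC be) * ((D * Cconj c + B * Cconj a) - z * c) + RtoC be * z * (1 - RtoC be * RtoC be) * ((D * a - B * c) - Cconj a * w))%C.
  ring. rewrite r3, r4. ring.
Qed.

Let hat_relations z : disc z -> let y := hat (phi z) in let r := (lam * z)%C in
  (pr2 y - pr3 y * r = r * (1 - pr1 y * r))%C /\
  (pr1 y * pr2 y - pr3 y = RtoC k * ((1 - pr1 y * r) * (1 - pr1 y * r)))%C.
Proof.
intros Hz y r.
assert (HP : tetrablock (phi z)) by (rewrite Ephi by auto; apply Phi_tetra; auto).
assert (Hr : Cmod r < 1) by (unfold r; rewrite Cmod_mult, lam_unit, Rmult_1_l; exact Hz).
destruct (linear z Hz) as [x1 [x2 [x3 [d [E [Ed [L1 L2]]]]]]]. fold r in L1, L2.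
unfold y. rewrite E in *. clear E y.
pose proof (mob_den _ _ z0_lt HP) as D1.
pose proof (mob_den _ _ w0c_lt (tetra_swap3 _ (mob_tetra _ _ z0_lt HP))) as D2.
unfold hat, swap, mob in *. cbn [pr1 pr2 pr3 fst snd] in *. rewrite Cconj_conj.
set (zc := Cconj z0) in *. set (wc := Cconj w0) in *.
set (Q := (1 - z0 * x1 - wc * (x2 - z0 * x3))%C).
assert (HQ : Q <> RtoC 0).
{ replace Q with ((1 - z0 * x1) * (1 - wc * ((x2 - z0 * x3) / (1 - z0 * x1))))%C. now apply Cmult_neq_0. unfold Q. field. auto. }
assert (Q0 : forall u v : C, ((u / (1 - z0 * x1) - v / (1 - z0 * x1)) / (1 - wc * ((x2 - z0 * x3) / (1 - z0 * x1))) = (u - v) / Q)%C).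
{ intros u v. unfold Q. field. repeat split; auto. }
assert (Y1 : (((x1 - zc) / (1 - z0 * x1) - wc * ((x3 - zc * x2) / (1 - z0 * x1))) / (1 - wc * ((x2 - z0 * x3) / (1 - z0 * x1))) = ((x1 - zc) - wc * (x3 - zc * x2)) / Q)%C).
{ rewrite <- Q0. unfold Cdiv. ring. }
assert (Y2 : (((x2 - z0 * x3) / (1 - z0 * x1) - w0) / (1 - wc * ((x2 - z0 * x3) / (1 - z0 * x1))) = ((x2 - z0 * x3) - w0 * (1 - z0 * x1)) / Q)%C).
{ rewrite <- Q0. do 2 f_equal. field. auto. }
assert (Y3 : (((x3 - zc * x2) / (1 - z0 * x1) - w0 * ((x1 - zc) / (1 - z0 * x1))) / (1 - wc * ((x2 - z0 * x3) / (1 - z0 * x1))) = ((x3 - zc * x2) - w0 * (x1 - zc)) / Q)%C).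
{ rewrite <- Q0. unfold Cdiv. ring. }
rewrite Y1, Y2, Y3. clear Y1 Y2 Y3 Q0 D2.
assert (Ha2 : (1 + wc * r)%C <> RtoC 0).
{ apply one_add_neq0. apply Cmod_mult_lt1; auto. unfold wc. rewrite Cmod_conj. lra. }
set (a1 := (z0 + r)%C) in *. set (a2 := (1 + wc * r)%C) in *. set (b1 := (1 + zc * r)%C) in *. set (b2 := (r + w0)%C) in *.
assert (B1 : (RtoC be * (b1 - x1 * a1) = d * a2)%C).
{ transitivity (RtoC be * b1 - x1 * (RtoC be * a1))%C. ring. rewrite <- L1. ring. }
assert (F3 : x3 = (x1 * x2 - d * d)%C) by (rewrite <- Ed; ring).
(* Eliminating [d] from the linear system: the Moebius map l -> (x2 - l x3) / (1 - l x1) takes (z0 +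
   r) / (1 + conj z0 r) to (r + w0) / (1 + conj w0 r). This relation dictates the two automorphisms
   in [hat]. *)
assert (B2 : (a2 * (x2 * b1 - x3 * a1) = b2 * (b1 - x1 * a1))%C).
{ apply Csub_eq0. apply Csub_eq0. rewrite F3.
  assert (T : (RtoC be * (a2 * (x2 * b1 - (x1 * x2 - d * d) * a1) - b2 * (b1 - x1 * a1)))%C = RtoC 0).
  { transitivity (a2 * (x2 * (RtoC be * (b1 - x1 * a1)) + d * (d * (RtoC be * a1))) - b2 * (RtoC be * (b1 - x1 * a1)))%C. ring.
    rewrite B1. rewrite <- L2. ring. }
  destruct (classic ((a2 * (x2 * b1 - (x1 * x2 - d * d) * a1) - b2 * (b1 - x1 * a1))%C = RtoC 0)) as [->|N]. ring.
  exfalso. now apply (Cmult_neq_0 _ _ be_neq0 N). }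
assert (B3 : (RtoC be * (Q - r * ((x1 - zc) - wc * (x3 - zc * x2))) = d * RtoC (1 - N2 w0))%C).
{ replace (RtoC (1 - N2 w0)) with (1 - wc * w0)%C by (unfold wc; apply injective_projections; unfold N2; simpl; ring).
  assert (T : (a2 * (RtoC be * (Q - r * ((x1 - zc) - wc * (x3 - zc * x2)))) = a2 * (d * (1 - wc * w0)))%C).
  { transitivity (a2 * (RtoC be * (b1 - x1 * a1)) - RtoC be * wc * (a2 * (x2 * b1 - x3 * a1)))%C.
    unfold Q, a1, b1. ring. rewrite B2.
    transitivity (a2 * (RtoC be * (b1 - x1 * a1)) - wc * b2 * (RtoC be * (b1 - x1 * a1)))%C. ring.
    rewrite B1. unfold a2, b2. ring. }
  replace (RtoC be * (Q - r * ((x1 - zc) - wc * (x3 - zc * x2))))%C with (/ a2 * (a2 * (RtoC be * (Q - r * ((x1 - zc) - wc * (x3 - zc * x2))))))%C by (field; auto).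
  rewrite T. field. auto. }
split.
- assert (T : (((x2 - z0 * x3) - w0 * (1 - z0 * x1)) - r * ((x3 - zc * x2) - w0 * (x1 - zc)) = r * (Q - r * ((x1 - zc) - wc * (x3 - zc * x2))))%C).
  { apply Csub_eq0. transitivity (a2 * (x2 * b1 - x3 * a1) - b2 * (b1 - x1 * a1))%C. unfold Q, a1, a2, b1, b2. ring. rewrite B2. ring. }
  transitivity ((((x2 - z0 * x3) - w0 * (1 - z0 * x1)) - r * ((x3 - zc * x2) - w0 * (x1 - zc))) / Q)%C. field; auto.
  rewrite T. field. auto.
- transitivity (RtoC k * ((Q - r * ((x1 - zc) - wc * (x3 - zc * x2))) * (Q - r * ((x1 - zc) - wc * (x3 - zc * x2)))) / (Q * Q))%C.
  2: field; auto.
  transitivity ((1 - z0 * zc) * (1 - w0 * wc) * (x1 * x2 - x3) / (Q * Q))%C.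
  unfold Q. field. exact HQ. rewrite Ed.
  f_equal.
  assert (T : (RtoC be * RtoC be * (RtoC k * ((Q - r * ((x1 - zc) - wc * (x3 - zc * x2))) * (Q - r * ((x1 - zc) - wc * (x3 - zc * x2)))))
    = RtoC be * RtoC be * ((1 - z0 * zc) * (1 - w0 * wc) * (d * d)))%C).
  { transitivity (RtoC k * ((RtoC be * (Q - r * ((x1 - zc) - wc * (x3 - zc * x2)))) * (RtoC be * (Q - r * ((x1 - zc) - wc * (x3 - zc * x2))))))%C. ring.
    rewrite B3.
    replace (1 - z0 * zc)%C with (RtoC (1 - N2 z0)) by (unfold zc; apply injective_projections; unfold N2; simpl; ring).
    replace (1 - w0 * wc)%C with (RtoC (1 - N2 w0)) by (unfold wc; apply injective_projections; unfold N2; simpl; ring).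
    pose proof w0_lt as Hw. apply N2_lt_1 in Hw.
    unfold k. rewrite RtoC_div by lra. rewrite RtoC_mult, RtoC_mult. field. apply RtoC_neq0. lra. }
  set (V := (RtoC k * _)%C) in *. set (V' := ((1 - z0 * zc) * _ * _)%C) in *.
  replace V with (/ (RtoC be * RtoC be) * (RtoC be * RtoC be * V))%C by (field; auto). rewrite T. field. auto.
Qed.

Let family om : Cmod om <= 1 -> left_inverse phi (fun x => Cconj lam * (gnum k om (hat x) / gden k om (hat x)))%C.
Proof.
intros Ho. apply left_inverse_iff. split.
- apply (disc_map_mult (fun x => gnum k om (hat x) / gden k om (hat x))%C). now rewrite Cmod_conj.
  apply (disc_map_hat (fun y => gnum k om y / gden k om y)%C). apply disc_map_gf; auto.
- intros z Hz. destruct (hat_relations z Hz) as [E1 E2].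
  rewrite (gf_value k k_lt om (hat (phi z)) (lam * z)%C); auto.
  + transitivity (lam * Cconj lam * z)%C. ring. rewrite unit_conj by auto. ring.
  + apply hat_tetra. rewrite Ephi by auto. apply Phi_tetra; auto.
  + rewrite Cmod_mult, lam_unit, Rmult_1_l. exact Hz.
Qed.

Lemma subcritical_not_unique : ~ unique_left_inverse phi.
Proof.
assert (T0 : tetrablock (RtoC 0, RtoC 0, RtoC 0)). { apply (tetra_axis1 0). lra. }
destruct (hat_onto _ T0) as [x [Hx Ex]].
assert (H0 : Cmod (RtoC 0) <= 1) by (rewrite Cmod_0; lra).
assert (H1 : Cmod (RtoC 1) <= 1) by (rewrite Cmod_1; lra).
(* At the point that [hat] sends to the origin the quotient equals om k^2, so om = 0 and om = 1 are
   told apart. *)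
apply (not_unique phi _ _ x (family _ H0) (family _ H1) Hx).
rewrite Ex. unfold gnum, gden, pr1, pr2, pr3; simpl fst; simpl snd. intros E.
apply (f_equal (fun w => lam * w)%C) in E.
pose proof (unit_conj lam lam_unit) as U.
assert (E2 : (RtoC k * RtoC k)%C = RtoC 0).
{ transitivity (lam * Cconj lam * (RtoC k * RtoC k))%C. rewrite U. ring.
  match type of E with ?l = ?r => transitivity r; [|rewrite <- E] end.
  field. field. }
rewrite <- RtoC_mult in E2. apply (f_equal fst) in E2. simpl in E2. nra.
Qed.
End SubCritical.

(** * The supercritical case *)

Lemma schwarz_pick_0 (f : C -> C) (l : C) : holo disc f -> (forall z, disc z -> disc (f z)) -> hd f (RtoC 0) l ->
  Cmod l <= 1 - N2 (f (RtoC 0)).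
Proof.
intros Hf Hb Hl. set (b := f (RtoC 0)).
assert (H0 : disc (RtoC 0)) by (unfold disc; rewrite Cmod_0; lra).
assert (Hb1 : Cmod b < 1) by (apply Hb; auto). pose proof Hb1 as Hn. apply N2_lt_1 in Hn.
assert (Hden : forall z, disc z -> (1 - Cconj b * f z)%C <> RtoC 0).
{ intros z Hz. apply one_sub_neq0. apply Cmod_mult_lt1. rewrite Cmod_conj; lra. now apply Hb. }
assert (Hg : forall z m, disc z -> hd f z m -> hd (fun z => (f z - b) / (1 - Cconj b * f z))%C z
  (((m - RtoC 0) * (1 - Cconj b * f z) - (f z - b) * (RtoC 0 - (RtoC 0 * f z + Cconj b * m))) / ((1 - Cconj b * f z) * (1 - Cconj b * f z)))%C).
{ intros z m Hz Hm. eapply hd_eq. apply hd_div; auto. apply hd_minus. apply Hm. apply hd_const. apply hd_minus. apply hd_const.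
  apply hd_mult. apply hd_const. apply Hm. reflexivity. }
assert (B : Cmod (l / RtoC (1 - N2 b)) <= 1).
{ apply (schwarz_deriv (fun z => (f z - b) / (1 - Cconj b * f z))%C).
  - intros z Hz. destruct (Hf z Hz) as [m Hm]. eexists. apply Hg; eauto.
  - intros z Hz. left. apply mobius_disc; auto. now apply Hb.
  - eapply hd_eq. apply Hg; eauto. fold b.
    assert (E : (1 - Cconj b * b)%C = RtoC (1 - N2 b)) by (apply injective_projections; unfold N2; simpl; ring).
    rewrite E. field. apply RtoC_neq0. lra. }
rewrite Cmod_div, Cmod_R, Rabs_pos_eq in B by (try apply RtoC_neq0; lra).
apply Rmult_le_compat_r with (r := 1 - N2 b) in B; [|lra]. unfold Rdiv in B. rewrite Rmult_assoc, Rinv_l in B by lra. lra.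
Qed.

Lemma bidisc_tetra (s1 s2 : C) : Cmod s1 < 1 -> Cmod s2 < 1 -> tetrablock (s1, s2, (s1 * s2)%C).
Proof.
intros H1 H2. apply tetra_iff. split. apply Cmod_mult_lt1; lra.
replace (s1 * s2 - s1 * s2)%C with (RtoC 0) by ring. rewrite Cmod_0. unfold defect. rewrite N2_mult.
apply N2_lt_1 in H1. apply N2_lt_1 in H2. nra.
Qed.

Section SuperCritical.
Variables (a c : C) (be : R) (F : C3 -> C).
Hypotheses (Hac : N2 a + N2 c = 1) (Hbe : 0 < be < 1) (HF : disc_map F).

Let H01 : disc (RtoC 0).
Proof. unfold disc. rewrite Cmod_0. lra. Qed.

Lemma hd_tpoint (A B D K : C -> C) (z A' B' D' K' : C) :
  hd A z A' -> hd B z B' -> hd D z D' -> hd K z K' -> tden be (B z) (K z) <> RtoC 0 ->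
  forall l1 l2 l3, fd F (tpoint be (A z) (B z) (D z) (K z)) l1 l2 l3 ->
  let p := RtoC (1 - be * be) in let b := RtoC be in let De := tden be (B z) (K z) in
  let De' := (2 * b * B' - b * b * K')%C in
  hd (fun z => F (tpoint be (A z) (B z) (D z) (K z))) z
   (l1 * (p * (A' * De - A z * De') / (De * De)) + l2 * (p * (D' * De - D z * De') / (De * De)) +
    l3 * (((K' - 2 * b * B') * De - tnum be (B z) (K z) * De') / (De * De)))%C.
Proof.
intros HA HB HD HK Hd l1 l2 l3 HL p b De De'.
assert (H1 : hd (fun z => tden be (B z) (K z)) z De').
{ eapply hd_eq. unfold tden. apply hd_minus. apply hd_plus. apply hd_const. apply hd_mult. apply hd_const. apply HB.
  apply hd_mult. apply hd_const. apply HK. unfold De', b. ring. }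
unfold tpoint.
apply (fd_curve F (fun z => A z * RtoC (1 - be * be) / tden be (B z) (K z))%C (fun z => D z * RtoC (1 - be * be) / tden be (B z) (K z))%C
  (fun z => tnum be (B z) (K z) / tden be (B z) (K z))%C); auto.
- eapply hd_eq. apply hd_div; auto. apply hd_mult. apply HA. apply hd_const. apply H1. unfold p, De. field. auto.
- eapply hd_eq. apply hd_div; auto. apply hd_mult. apply HD. apply hd_const. apply H1. unfold p, De. field. auto.
- eapply hd_eq. apply hd_div; auto. unfold tnum. apply hd_minus. apply hd_minus. apply HK. apply hd_mult. apply hd_const. apply HB. apply hd_const. apply H1.
  unfold De, b, tnum. field. auto.
Qed.

Lemma hd_Phi (w : C -> C) (z m : C) : disc z -> disc (w z) -> hd w z m -> exists l, hd (fun z => F (Phi a c be z (w z))) z l.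
Proof.
intros Hz Hw Hm.
destruct (proj1 (holo_tetra F) (proj1 HF) _ (Phi_tetra a c be Hac Hbe z (w z) Hz Hw)) as [l1 [l2 [l3 HL]]].
eexists. unfold Phi in *. eapply (hd_tpoint (fun z => mA a c z (w z)) (fun z => mB a c z (w z)) (fun z => mD a c z (w z)) (fun z => z * w z)%C).
- unfold mA. apply hd_plus; apply hd_mult. apply hd_const. apply hd_id. apply hd_const. apply Hm.
- unfold mB. apply hd_minus; apply hd_mult. apply hd_const. apply hd_id. apply hd_const. apply Hm.
- unfold mD. apply hd_plus; apply hd_mult. apply hd_const. apply hd_id. apply hd_const. apply Hm.
- apply hd_mult. apply hd_id. apply Hm.
- apply Phi_den; auto.
- exact HL.
Qed.

(** At 0 the three matrix entries vanish, and the product z w vanishes together with its derivative;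
    the derivative of [F] therefore sees [w] only through [m], and affinely. *)
Lemma hd_Phi_0 : exists al bt : C, forall (w : C -> C) (m : C), w (RtoC 0) = RtoC 0 -> hd w (RtoC 0) m ->
  hd (fun z => F (Phi a c be z (w z))) (RtoC 0) (al + bt * m)%C.
Proof.
destruct (proj1 (holo_tetra F) (proj1 HF) _ (Phi_tetra a c be Hac Hbe (RtoC 0) (RtoC 0) H01 H01)) as [l1 [l2 [l3 HL]]].
set (p := RtoC (1 - be * be)).
exists (p * (l1 * (a * a) + l2 * (c * c) - l3 * (2 * RtoC be * (a * c))))%C,
  (p * (l1 * (Cconj c * Cconj c) + l2 * (Cconj a * Cconj a) + l3 * (2 * RtoC be * (Cconj a * Cconj c))))%C.
intros w m H0 Hm. unfold Phi in *.
assert (HL' : fd F (tpoint be (mA a c (RtoC 0) (w (RtoC 0))) (mB a c (RtoC 0) (w (RtoC 0))) (mD a c (RtoC 0) (w (RtoC 0))) (RtoC 0 * w (RtoC 0))%C) l1 l2 l3) by now rewrite H0.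
eapply hd_eq.
- eapply (hd_tpoint (fun z => mA a c z (w z)) (fun z => mB a c z (w z)) (fun z => mD a c z (w z)) (fun z => z * w z)%C); [| | | | |exact HL'].
  + unfold mA. apply hd_plus; apply hd_mult. apply hd_const. apply hd_id. apply hd_const. apply Hm.
  + unfold mB. apply hd_minus; apply hd_mult. apply hd_const. apply hd_id. apply hd_const. apply Hm.
  + unfold mD. apply hd_plus; apply hd_mult. apply hd_const. apply hd_id. apply hd_const. apply Hm.
  + apply hd_mult. apply hd_id. apply Hm.
  + apply Phi_den; auto. rewrite H0. exact H01.
- cbv beta. rewrite H0. unfold tden, tnum, mA, mB, mD, p. rewrite RtoC_minus, RtoC_mult. field.
Qed.

(** The derivative al + bt m equals 1 at an interior [m] and, by testing linear [w], has modulus at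
    most 1 over the closed disc. So bt = 0, the slice w = 0 has derivative 1 as well, and Schwarz's
    lemma applies to it. *)
Lemma inverse_of_slice (W : C -> C) (m : C) : holo disc W -> (forall z, disc z -> disc (W z)) -> W (RtoC 0) = RtoC 0 ->
  hd W (RtoC 0) m -> Cmod m < 1 -> (forall z, disc z -> F (Phi a c be z (W z)) = z) ->
  forall z, disc z -> F (Phi a c be z (RtoC 0)) = z.
Proof.
intros HW HW1 HW0 Hm Hm1 Hinv.
destruct hd_Phi_0 as [al [bt Hd]].
assert (E1 : (al + bt * m)%C = RtoC 1).
{ apply (hd_unique (fun w => w) (RtoC 0)); [|apply hd_id].
  apply hd_ext_near with (f := fun z => F (Phi a c be z (W z))).
  - exists 1. split. lra. intros w Hw. apply Hinv. replace (w - 0)%C with w in Hw by ring. exact Hw.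
  - now apply Hd. }
assert (Eb : bt = RtoC 0).
{ apply affine_disc with (al := al) (w0 := m); auto. intros w Hw.
  apply (schwarz_deriv (fun z => F (Phi a c be z (w * z)))).
  - intros z Hz. apply (hd_Phi (fun z => w * z)%C z (RtoC 0 * z + w * RtoC 1)%C); auto.
    now apply Cmod_mult_lt1. apply hd_mult. apply hd_const. apply hd_id.
  - intros z Hz. left. apply (proj2 HF). apply Phi_tetra; auto. now apply Cmod_mult_lt1.
  - apply (Hd (fun z => w * z)%C). ring. eapply hd_eq. apply hd_mult. apply hd_const. apply hd_id. cbv beta. ring. }
apply (schwarz_id (fun z => F (Phi a c be z (RtoC 0)))).
- intros z Hz. apply (hd_Phi (fun _ => RtoC 0) z (RtoC 0)); auto. apply hd_const.
- intros z Hz. left. apply (proj2 HF). apply Phi_tetra; auto.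
- eapply hd_eq. apply (Hd (fun _ => RtoC 0) (RtoC 0)); auto. apply hd_const. rewrite <- E1, Eb. ring.
Qed.

Hypothesis Hslice : forall z, disc z -> F (Phi a c be z (RtoC 0)) = z.
Hypotheses (Ha : be * Cmod c < Cmod a) (Hc : be * Cmod a < Cmod c).

(* The slice meets the royal variety at [la], tangentially; there [F] restricted to the
   bidisc [(s1, s2) |-> (s1, s2, s1 s2)] has too large a derivative. *)
Lemma supercritical_absurd : False.
Proof.
pose proof (Cmod_ge_0 c) as C0.
assert (Ap : 0 < Cmod a) by nra. assert (Cp : 0 < Cmod c) by nra.
assert (Ha0 : a <> RtoC 0) by now apply Cmod_gt_0. assert (Hc0 : c <> RtoC 0) by now apply Cmod_gt_0.
set (p := N2 a) in *. set (q := N2 c) in *.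
assert (Ep : p = Cmod a * Cmod a) by apply N2_Cmod. assert (Eq : q = Cmod c * Cmod c) by apply N2_Cmod.
set (g := be * be). assert (Hg : 0 < g < 1) by (unfold g; nra).
set (u := q - g * p). set (v := p - g * q).
assert (Hu : 0 < u). { unfold u, g. rewrite Ep, Eq. assert (0 <= be * Cmod a) by nra. nra. }
assert (Hv : 0 < v). { unfold v, g. rewrite Ep, Eq. assert (0 <= be * Cmod c) by nra. nra. }
assert (Huv : u + v = 1 - g). { unfold u, v. replace p with (1 - q) by lra. ring. }
assert (Hprod : u * v = (1 + g) * (1 + g) * (p * q) - g).
{ unfold u, v. replace p with (1 - q) by lra. ring. }
assert (Pp : 0 < p) by (rewrite Ep; nra). assert (Qp : 0 < q) by (rewrite Eq; nra).
assert (PQ : 0 < p * q) by nra.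
assert (Hg1 : RtoC (1 + g) <> RtoC 0) by (apply RtoC_neq0; lra).
assert (Hg2 : RtoC (1 - g) <> RtoC 0) by (apply RtoC_neq0; lra).
assert (Eg1 : RtoC (1 + g) = (1 + RtoC be * RtoC be)%C) by (unfold g; rewrite RtoC_plus, RtoC_mult; reflexivity).
assert (Eg2 : RtoC (1 - g) = (1 - RtoC be * RtoC be)%C) by (unfold g; rewrite RtoC_minus, RtoC_mult; reflexivity).
(* The zero of be + (1 + be^2) a c z, which is [toff] on the slice. By [Hprod] it lies in the disc
   because u v > 0; this is where [Ha] and [Hc] enter. *)
set (la := (- RtoC be / (RtoC (1 + g) * (a * c)))%C).
assert (Hac0 : (a * c)%C <> RtoC 0) by now apply Cmult_neq_0.
assert (Nla : N2 la = g / ((1 + g) * (1 + g) * (p * q))).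
{ unfold la. rewrite N2_div by now apply Cmult_neq_0. rewrite !N2_mult. fold p q.
  replace (N2 (- RtoC be)) with g by (unfold N2, g; simpl; ring).
  replace (N2 (RtoC (1 + g))) with ((1 + g) * (1 + g)) by (unfold N2; simpl; ring). reflexivity. }
assert (Hden0 : 0 < (1 + g) * (1 + g) * (p * q)) by (apply Rmult_lt_0_compat; nra).
assert (Hla : disc la).
{ apply N2_lt_1. rewrite Nla. apply Rmult_lt_reg_r with ((1 + g) * (1 + g) * (p * q)); auto.
  unfold Rdiv. rewrite Rmult_assoc, Rinv_l by lra. nra. }
set (x1 := (- (RtoC be * a / c))%C). set (x2 := (- (RtoC be * c / a))%C).
assert (N1 : N2 x1 = g * p / q).
{ unfold x1. replace (N2 (- (RtoC be * a / c))) with (N2 (RtoC be * a / c)) by (unfold N2; simpl; ring).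
  rewrite N2_div, N2_mult by auto. fold p q. f_equal. f_equal. unfold N2, g; simpl; ring. }
assert (N3 : N2 x2 = g * q / p).
{ unfold x2. replace (N2 (- (RtoC be * c / a))) with (N2 (RtoC be * c / a)) by (unfold N2; simpl; ring).
  rewrite N2_div, N2_mult by auto. fold p q. f_equal. f_equal. unfold N2, g; simpl; ring. }
assert (M1 : 1 - N2 x1 = u / q) by (rewrite N1; unfold u; field; lra).
assert (M2 : 1 - N2 x2 = v / p) by (rewrite N3; unfold v; field; lra).
assert (M1p : 0 < 1 - N2 x1) by (rewrite M1; apply Rdiv_lt_0_compat; auto).
assert (M2p : 0 < 1 - N2 x2) by (rewrite M2; apply Rdiv_lt_0_compat; auto).
(* The first two coordinates of the slice have velocity s (a^2, c^2) at [la]. *)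
set (s := (1 + g) * (1 + g) / (1 - g)). assert (Hs : 0 < s) by (unfold s; apply Rdiv_lt_0_compat; nra).
(* The largest factor for which [ka] times this velocity is that of a disc in the bidisc centred at
   (x1, x2): Schwarz-Pick in each factor asks for ka s p <= 1 - |x1|^2 = u / q and ka s q <= 1 -
   |x2|^2 = v / p. *)
set (ka := Rmin u v / (s * (p * q))).
assert (Hmin : 0 < Rmin u v) by now apply Rmin_pos.
assert (Hka : 0 < ka). { unfold ka. apply Rdiv_lt_0_compat; auto. apply Rmult_lt_0_compat; auto. }
set (k1 := (RtoC (ka * s / (1 - N2 x1)) * (a * a))%C). set (k2 := (RtoC (ka * s / (1 - N2 x2)) * (c * c))%C).
assert (Hk1 : Cmod k1 <= 1).
{ unfold k1. rewrite !Cmod_mult, <- N2_Cmod. fold p. rewrite Cmod_R, Rabs_pos_eq.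
  2: { left. apply Rdiv_lt_0_compat; auto. apply Rmult_lt_0_compat; auto. }
  rewrite M1. unfold ka. replace (Rmin u v / (s * (p * q)) * s / (u / q) * p) with (Rmin u v / u) by (field; repeat split; lra).
  apply Rmult_le_reg_r with u; auto. unfold Rdiv. rewrite Rmult_assoc, Rinv_l by lra. pose proof (Rmin_l u v). lra. }
assert (Hk2 : Cmod k2 <= 1).
{ unfold k2. rewrite !Cmod_mult, <- N2_Cmod. fold q. rewrite Cmod_R, Rabs_pos_eq.
  2: { left. apply Rdiv_lt_0_compat; auto. apply Rmult_lt_0_compat; auto. }
  rewrite M2. unfold ka. replace (Rmin u v / (s * (p * q)) * s / (v / p) * q) with (Rmin u v / v) by (field; repeat split; lra).
  apply Rmult_le_reg_r with v; auto. unfold Rdiv. rewrite Rmult_assoc, Rinv_l by lra. pose proof (Rmin_r u v). lra. }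
(* Along that disc [F] has derivative [ka] at a point where its value is [la], so this inequality
   contradicts Schwarz-Pick. It holds because 1 - g = u + v exceeds the larger of [u] and [v]. *)
assert (Hbig : 1 - N2 la < ka).
{ rewrite Nla. unfold ka, s.
  replace (1 - g / ((1 + g) * (1 + g) * (p * q))) with (u * v / ((1 + g) * (1 + g) * (p * q))) by (rewrite Hprod; field; repeat split; lra).
  replace (Rmin u v / ((1 + g) * (1 + g) / (1 - g) * (p * q))) with (Rmin u v * (1 - g) / ((1 + g) * (1 + g) * (p * q))) by (field; repeat split; lra).
  apply Rmult_lt_compat_r. now apply Rinv_0_lt_compat. unfold Rmin. destruct (Rle_dec u v); nra. }
assert (X1 : Cmod x1 < 1) by (apply N2_lt_1; lra). assert (X2 : Cmod x2 < 1) by (apply N2_lt_1; lra).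
assert (EPhi : Phi a c be la (RtoC 0) = ((x1, x2, (x1 * x2)%C) : C3)).
{ unfold Phi, tpoint, mA, mB, mD, tden, tnum, la, x1, x2. change (1 - be * be) with (1 - g). rewrite Eg2, Eg1 in *.
  assert (D : (1 + RtoC be * RtoC be + 2 * RtoC be * - RtoC be)%C <> RtoC 0) by (intros E; apply Hg2; rewrite <- E; ring).
  apply C3_eq; field; repeat split; auto. }
assert (HT : tetrablock (x1, x2, (x1 * x2)%C)) by now apply bidisc_tetra.
destruct (proj1 (holo_tetra F) (proj1 HF) _ HT) as [l1 [l2 [l3 HL]]].
set (x1' := (RtoC s * (a * a))%C). set (x2' := (RtoC s * (c * c))%C).
(* Since x1 x2 - x3 is a square along the slice, its zero is double: the third coordinate has the
   velocity of the product x1 x2. *)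
assert (D1 : (l1 * x1' + l2 * x2' + l3 * (x1 * x2' + x1' * x2))%C = RtoC 1).
{ apply (hd_unique (fun w => w) la); [|apply hd_id].
  apply hd_ext_near with (f := fun z => F (Phi a c be z (RtoC 0))).
  - exists (1 - Cmod la). unfold disc in Hla. split. lra. intros w Hw. apply Hslice.
    unfold disc. pose proof (Cmod_triangle (w - la) la) as T. replace (w - la + la)%C with w in T by ring. lra.
  - eapply hd_eq. unfold Phi. eapply (hd_tpoint (fun z => mA a c z (RtoC 0)) (fun z => mB a c z (RtoC 0)) (fun z => mD a c z (RtoC 0)) (fun z => z * RtoC 0)%C).
    + unfold mA. apply hd_plus. apply hd_mult. apply hd_const. apply hd_id. apply hd_const.
    + unfold mB. apply hd_minus. apply hd_mult. apply hd_const. apply hd_id. apply hd_const.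
    + unfold mD. apply hd_plus. apply hd_mult. apply hd_const. apply hd_id. apply hd_const.
    + apply hd_mult. apply hd_id. apply hd_const.
    + apply Phi_den; auto.
    + unfold Phi in EPhi. rewrite EPhi. exact HL.
    + cbv beta zeta. unfold mA, mB, mD, tden, tnum, la, x1', x2', x1, x2, s. rewrite RtoC_div by lra. rewrite RtoC_mult.
      change (1 - be * be) with (1 - g). rewrite Eg2, Eg1 in *.

      field; repeat split; auto. }
set (s1 := fun z => ((k1 * z + x1) / (1 + Cconj x1 * (k1 * z)))%C). set (s2 := fun z => ((k2 * z + x2) / (1 + Cconj x2 * (k2 * z)))%C).
assert (MB : forall x k z, Cmod x < 1 -> Cmod k <= 1 -> disc z -> disc ((k * z + x) / (1 + Cconj x * (k * z)))%C /\ (1 + Cconj x * (k * z))%C <> RtoC 0).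
{ intros x k z Hx Hk Hz. assert (Hkz : Cmod (k * z) < 1) by now apply Cmod_mult_lt1. split.
  - pose proof (mobius_disc (- x)%C (k * z)%C) as M. rewrite Cmod_opp in M. specialize (M Hx Hkz).
    replace (Cconj (- x)) with (- Cconj x)%C in M by (apply injective_projections; simpl; ring).
    replace (k * z - - x)%C with (k * z + x)%C in M by ring.
    replace (1 - - Cconj x * (k * z))%C with (1 + Cconj x * (k * z))%C in M by ring. exact M.
  - apply one_add_neq0. apply Cmod_mult_lt1; auto. rewrite Cmod_conj. lra. }
assert (MD : forall x k z, Cmod x < 1 -> Cmod k <= 1 -> disc z -> hd (fun z => (k * z + x) / (1 + Cconj x * (k * z)))%C z
  (k * RtoC (1 - N2 x) / ((1 + Cconj x * (k * z)) * (1 + Cconj x * (k * z))))%C).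
{ intros x k z Hx Hk Hz. destruct (MB x k z Hx Hk Hz) as [_ H]. eapply hd_eq. apply hd_div; auto.
  apply hd_plus. apply hd_mult. apply hd_const. apply hd_id. apply hd_const.
  apply hd_plus. apply hd_const. apply hd_mult. apply hd_const. apply hd_mult. apply hd_const. apply hd_id.
  cbv beta. replace (RtoC (1 - N2 x)) with (1 - x * Cconj x)%C by (apply injective_projections; unfold N2; simpl; ring).
  field. auto. }
assert (P : Cmod (RtoC ka) <= 1 - N2 (F ((s1 (RtoC 0), s2 (RtoC 0), (s1 (RtoC 0) * s2 (RtoC 0))%C) : C3))).
{ apply (schwarz_pick_0 (fun z => F ((s1 z, s2 z, (s1 z * s2 z)%C) : C3))).
  - intros z Hz. destruct (MB x1 k1 z X1 Hk1 Hz) as [B1 _]. destruct (MB x2 k2 z X2 Hk2 Hz) as [B2 _].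
    destruct (proj1 (holo_tetra F) (proj1 HF) _ (bidisc_tetra _ _ B1 B2)) as [n1 [n2 [n3 HN]]].
    eexists. eapply (fd_curve F s1 s2 (fun z => s1 z * s2 z)%C). exact HN. apply MD; auto. apply MD; auto.
    apply hd_mult; apply MD; auto.
  - intros z Hz. destruct (MB x1 k1 z X1 Hk1 Hz) as [B1 _]. destruct (MB x2 k2 z X2 Hk2 Hz) as [B2 _].
    apply (proj2 HF). apply bidisc_tetra; auto.
  - assert (Z1 : s1 (RtoC 0) = x1) by (unfold s1; field; replace (1 + Cconj x1 * (k1 * 0))%C with (RtoC 1) by ring; apply RtoC_neq0; lra).
    assert (Z2 : s2 (RtoC 0) = x2) by (unfold s2; field; replace (1 + Cconj x2 * (k2 * 0))%C with (RtoC 1) by ring; apply RtoC_neq0; lra).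
    assert (HL' : fd F ((s1 (RtoC 0), s2 (RtoC 0), (s1 (RtoC 0) * s2 (RtoC 0))%C) : C3) l1 l2 l3) by (rewrite Z1, Z2; exact HL).
    eapply hd_eq. eapply (fd_curve F s1 s2 (fun z => s1 z * s2 z)%C). exact HL'. apply MD; auto. apply MD; auto.
    apply hd_mult; apply MD; auto. rewrite Z1, Z2. rewrite !Cmult_0_r.
    transitivity (RtoC ka * (l1 * x1' + l2 * x2' + l3 * (x1 * x2' + x1' * x2)))%C; [|rewrite D1; ring].
    unfold k1, k2, x1', x2'. rewrite !RtoC_div by lra. rewrite !RtoC_mult.
    assert (RtoC (1 - N2 x1) <> RtoC 0) by (apply RtoC_neq0; lra). assert (RtoC (1 - N2 x2) <> RtoC 0) by (apply RtoC_neq0; lra).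
    generalize dependent (RtoC (1 - N2 x1)). generalize dependent (RtoC (1 - N2 x2)). intros. field. auto. }
assert (Z1 : s1 (RtoC 0) = x1) by (unfold s1; field; replace (1 + Cconj x1 * (k1 * 0))%C with (RtoC 1) by ring; apply RtoC_neq0; lra).
assert (Z2 : s2 (RtoC 0) = x2) by (unfold s2; field; replace (1 + Cconj x2 * (k2 * 0))%C with (RtoC 1) by ring; apply RtoC_neq0; lra).
rewrite Z1, Z2, <- EPhi, Hslice, Cmod_R, Rabs_pos_eq in P by (auto; lra). lra.
Qed.
End SuperCritical.

(** * Proof of part (2) *)

Lemma crossing_sign (p q be : R) : p * p + q * q = 1 -> (p - be * q) * (q - be * p) = p * q * (1 + be ^ 2) - be.
Proof. intros H. transitivity (p * q * (1 + be * be) - be * (p * p + q * q)). ring. rewrite H. ring. Qed.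

Section Cases.
Variables (a c : C) (be : R) (W : C -> C) (phi : C -> C3).
Hypotheses (Hac : N2 a + N2 c = 1) (Hbe : 0 < be < 1).
Hypotheses (HW : holo disc W) (HW1 : forall z, disc z -> disc (W z)).
Hypothesis Ephi : forall z, disc z -> phi z = Phi a c be z (W z).

Let phi' (z : C) : C3 := swap (phi z).
Let Ephi' z : disc z -> phi' z = Phi c a be z (W z).
Proof. intros Hz. unfold phi'. rewrite Ephi by auto. apply Phi_swap. Qed.
Let Hca : N2 c + N2 a = 1.
Proof. lra. Qed.
Let sign : (Cmod a - be * Cmod c) * (Cmod c - be * Cmod a) = Cmod a * Cmod c * (1 + be ^ 2) - be.
Proof. apply crossing_sign. now rewrite <- !N2_Cmod. Qed.

Let to_swap : unique_left_inverse phi -> unique_left_inverse phi'.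
Proof. apply unique_swap. reflexivity. Qed.

Let from_swap : unique_left_inverse phi' -> unique_left_inverse phi.
Proof. apply unique_swap. intros z _. unfold phi'. now rewrite swap_swap. Qed.

(** By [sign] the two factors are not both positive, so one of the two non-uniqueness results
    applies, possibly after swapping the coordinates. *)
Lemma linear_case (v : C) : Cmod v = 1 -> (forall z, disc z -> W z = (v * z)%C) ->
  Cmod a * Cmod c * (1 + be ^ 2) <= be -> ~ unique_left_inverse phi.
Proof.
intros Hv HWv Ht.
destruct (Rtotal_order (Cmod a) (be * Cmod c)) as [L|[L|L]].
- now apply (subcritical_not_unique a c be W).
- now apply (critical_two a c be W) with v.
- intros U. apply to_swap in U. revert U.
  destruct (Rtotal_order (Cmod c) (be * Cmod a)) as [L'|[L'|L']].
  + now apply (subcritical_not_unique c a be W).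
  + now apply (critical_two c a be W) with v.
  + exfalso. assert (0 < (Cmod a - be * Cmod c) * (Cmod c - be * Cmod a)) by (apply Rmult_lt_0_compat; lra). lra.
Qed.

Lemma strict_case : (exists F, left_inverse phi F) -> (forall z, disc z -> z <> RtoC 0 -> Cmod (W z) < Cmod z) ->
  (unique_left_inverse phi <-> Cmod a * Cmod c * (1 + be ^ 2) = be).
Proof.
intros HF Hlt.
assert (H0 : disc (RtoC 0)) by (unfold disc; rewrite Cmod_0; lra).
destruct (HW _ H0) as [m Hm].
(* [Hlt] says nothing at 0; the value there comes from continuity. *)
assert (HW0 : W (RtoC 0) = RtoC 0).
{ destruct (classic (W (RtoC 0) = RtoC 0)) as [|N]; auto. exfalso.
  pose proof (proj1 (Cmod_gt_0 _) N) as P. set (r := Cmod (W (RtoC 0))) in *.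
  destruct (hd_cont _ _ _ Hm (r / 2) ltac:(lra)) as [d [Hd HC]].
  set (t := Rmin (d / 2) (Rmin (r / 2) (/ 2))).
  assert (Ht : 0 < t) by (repeat apply Rmin_pos; lra).
  assert (T1 : t <= d / 2) by apply Rmin_l. assert (T2 : t <= r / 2) by (apply Rle_trans with (1 := Rmin_r _ _), Rmin_l).
  assert (T3 : t <= / 2) by (apply Rle_trans with (1 := Rmin_r _ _), Rmin_r).
  assert (Et : Cmod (RtoC t) = t) by (rewrite Cmod_R, Rabs_pos_eq; lra).
  specialize (HC (RtoC t)). replace (RtoC t - RtoC 0)%C with (RtoC t) in HC by ring. specialize (HC ltac:(lra)).
  assert (Hz : disc (RtoC t)) by (unfold disc; lra).
  specialize (Hlt _ Hz (RtoC_pos_neq0 t Ht)). rewrite Et in Hlt.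
  pose proof (Cmod_triangle (W (RtoC 0) - W (RtoC t)) (W (RtoC t))) as T.
  replace (W (RtoC 0) - W (RtoC t) + W (RtoC t))%C with (W (RtoC 0)) in T by ring. fold r in T. rewrite Cmod_sub_sym in T. lra. }
(* Equality in Schwarz's lemma would make [W] a rotation, against [Hlt] at 1/2. *)
assert (Hm1 : Cmod m < 1).
{ assert (HWc : forall z, disc z -> closed_disc (W z)) by (intros z Hz; left; now apply HW1).
  destruct (schwarz_deriv W m HW HWc Hm) as [|E]; auto. exfalso.
  assert (Eh : Cmod (RtoC (/ 2)) = / 2) by (rewrite Cmod_R, Rabs_pos_eq; lra).
  assert (Hh : disc (RtoC (/ 2))) by (unfold disc; lra).
  specialize (Hlt _ Hh ltac:(apply RtoC_pos_neq0; lra)).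
  rewrite (schwarz_rot W m HW HWc Hm E _ Hh), Cmod_mult, E in Hlt. lra. }
assert (HF' : exists F, left_inverse phi' F).
{ destruct HF as [F HF]. exists (fun x => F (swap x)). now apply left_inverse_swap with phi. }
pose proof (Cmod_ge_0 a) as A0. pose proof (Cmod_ge_0 c) as C0.
assert (P1 : 0 < Cmod a + Cmod c). { rewrite !N2_Cmod in Hac. nra. }
destruct (Rtotal_order (Cmod a) (be * Cmod c)) as [L|[L|L]].
- split. intros U; exfalso; revert U. now apply (subcritical_not_unique a c be W).
  intros E. exfalso.
  assert (be * Cmod c < Cmod c) by nra. assert (be * Cmod a <= Cmod a) by nra.
  assert (0 < (be * Cmod c - Cmod a) * (Cmod c - be * Cmod a)) by (apply Rmult_lt_0_compat; lra). lra.
- split. intros _. replace (Cmod a - be * Cmod c) with 0 in sign by lra. lra. intros _. now apply (critical_unique a c be W phi Hac Hbe L HW1 Ephi m).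
- destruct (Rtotal_order (Cmod c) (be * Cmod a)) as [L'|[L'|L']].
  + split. intros U; exfalso. apply to_swap in U. revert U. now apply (subcritical_not_unique c a be W).
    intros E. exfalso. nra.
  + split. intros _. replace (Cmod c - be * Cmod a) with 0 in sign by lra. lra. intros _. apply from_swap.
    now apply (critical_unique c a be W phi' Hca Hbe L' HW1 Ephi' m).
  + exfalso. destruct HF as [F HF]. apply left_inverse_iff in HF. destruct HF as [HF Hi].
    apply (supercritical_absurd a c be F Hac Hbe HF); auto.
    apply (inverse_of_slice a c be F Hac Hbe HF W m); auto. intros z Hz. rewrite <- Ephi by auto. now apply Hi.
Qed.
End Cases.

(** * The case where [Z] is the identity *)

Section Diagonal.
Variables (a c e : C) (be : R) (phi : C -> C3).
Hypotheses (Hac : N2 a + N2 c = 1) (Hbe : 0 < be < 1) (He : Cmod e = 1).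
Hypothesis Ephi : forall z, disc z -> phi z = Phi a c be z (e * e * z).

Let ee : (e * Cconj e)%C = RtoC 1.
Proof. now apply unit_conj. Qed.

Let Hee : Cmod (e * e) = 1.
Proof. rewrite Cmod_mult, He. ring. Qed.

(* If [a c conj e] is purely imaginary, then on the curve [x1 x2 - x3] vanishes at [i s conj e]
   when [s] is a root of [be s^2 - 2 (1 + be^2) y s + be], where [y = Im (a c conj e)]. *)
Lemma no_royal_bound : fst (a * c * Cconj e)%C = 0 -> (forall z, disc z -> ~ royal_variety (phi z)) ->
  Cmod a * Cmod c * (1 + be ^ 2) <= be.
Proof.
intros Hre Hroy. set (y := snd (a * c * Cconj e)%C).
assert (E1 : (a * c = Ci * RtoC y * e)%C).
{ transitivity (a * c * Cconj e * e)%C. transitivity (a * c * (e * Cconj e))%C. rewrite ee; ring. ring.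
  f_equal. apply injective_projections; [rewrite Hre|fold y]; simpl; ring. }
assert (E2 : (Cconj a * Cconj c = - (Ci * RtoC y * Cconj e))%C).
{ rewrite <- Cmult_conj, E1, !Cmult_conj. apply injective_projections; simpl; ring. }
assert (Ey : Cmod a * Cmod c = Rabs y).
{ rewrite <- Cmod_mult, E1, !Cmod_mult, He, Cmod_R. replace (Cmod Ci) with 1. ring.
  unfold Cmod, Ci; simpl. rewrite <- sqrt_1 at 1. f_equal. ring. }
destruct (Rle_lt_dec (Cmod a * Cmod c * (1 + be ^ 2)) be) as [|L]; auto. exfalso. rewrite Ey in L.
set (T := (1 + be ^ 2) * y / be).
assert (ET : be * T = (1 + be ^ 2) * y) by (unfold T; field; lra).
assert (HT : 1 < Rabs T).
{ unfold T, Rdiv. rewrite !Rabs_mult, Rabs_inv, (Rabs_pos_eq be), (Rabs_pos_eq (1 + be ^ 2)) by nra.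
  apply Rmult_lt_reg_r with be. lra. rewrite Rmult_assoc, Rinv_l by lra. lra. }
(* For |T| > 1 the roots are real and distinct with product 1, so exactly one of them lies in (-1,
   1). *)
assert (exists s, -1 < s < 1 /\ s * s - 2 * T * s + 1 = 0) as [s [Hs Es]].
{ assert (P : 0 < T * T - 1). { assert (E : T * T = Rabs T * Rabs T) by (rewrite <- Rabs_mult; symmetry; apply Rabs_pos_eq; nra). nra. }
  set (D := sqrt (T * T - 1)). assert (D0 : 0 < D) by now apply sqrt_lt_R0.
  assert (DD : D * D = T * T - 1) by (apply sqrt_sqrt; lra).
  unfold Rabs in HT. destruct (Rcase_abs T).
  - exists (T + D). split; [split; nra|nra].
  - exists (T - D). split; [split; nra|nra]. }
set (z := (Ci * RtoC s * Cconj e)%C).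
assert (Ez : (e * z = Ci * RtoC s)%C). { unfold z. transitivity (Ci * RtoC s * (e * Cconj e))%C. ring. rewrite ee. ring. }
assert (Hz : disc z).
{ unfold z, disc. rewrite !Cmod_mult, Cmod_conj, He, Cmod_R. replace (Cmod Ci) with 1.
  unfold Rabs. destruct (Rcase_abs s); lra. unfold Cmod, Ci; simpl. rewrite <- sqrt_1 at 1. f_equal. ring. }
assert (Hw : disc (e * e * z)) by (unfold disc; rewrite Cmod_mult, Hee, Rmult_1_l; exact Hz).
assert (Ci2 : (Ci * Ci = - RtoC 1)%C) by (apply injective_projections; simpl; ring).
assert (E0 : toff be (mB a c z (e * e * z)) (z * (e * e * z)) = RtoC 0).
{ assert (EB : mB a c z (e * e * z) = (- (2 * RtoC y * RtoC s))%C).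
  { unfold mB. rewrite E2, E1.
    transitivity (Ci * RtoC y * (e * z) + Ci * RtoC y * (e * Cconj e) * (e * z))%C. ring.
    rewrite ee, Ez. transitivity (2 * (Ci * Ci) * RtoC y * RtoC s)%C. ring. rewrite Ci2. ring. }
  unfold toff. rewrite EB. replace (z * (e * e * z))%C with ((e * z) * (e * z))%C by ring. rewrite Ez.
  transitivity (RtoC be - 2 * ((1 + RtoC be * RtoC be) * RtoC y) * RtoC s - RtoC be * (Ci * Ci) * (RtoC s * RtoC s))%C. ring.
  rewrite Ci2. replace ((1 + RtoC be * RtoC be) * RtoC y)%C with (RtoC (be * T)).
  2: { rewrite ET, RtoC_mult, RtoC_plus. f_equal. f_equal. rewrite <- RtoC_mult. f_equal. ring. }
  transitivity (RtoC be * RtoC (s * s - 2 * T * s + 1))%C. rewrite RtoC_plus, RtoC_minus, !RtoC_mult. ring.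
  rewrite Es. ring. }
apply (Hroy z Hz). rewrite Ephi by auto. unfold Phi, tpoint.
unfold royal_variety. split. exact (Phi_tetra a c be Hac Hbe z (e * e * z) Hz Hw).
apply Csub_eq0. rewrite toff_sqr; [|now apply m_det|now apply Phi_den]. rewrite E0. unfold Cdiv. ring.
Qed.

Lemma diagonal_aux : fst (a * c * Cconj e)%C = 0 -> (forall z, disc z -> ~ royal_variety (phi z)) ->
  ~ unique_left_inverse phi.
Proof.
intros Hre Hroy. apply (linear_case a c be (fun z => e * e * z)%C phi Hac Hbe) with (v := (e * e)%C); auto.
- intros z Hz. unfold disc. rewrite Cmod_mult, Hee, Rmult_1_l. exact Hz.
- now apply no_royal_bound.
Qed.
End Diagonal.

(** Up to normalisation (p, q) is (x, 1) with r (x^2 - 1) + h x = 0, whose discriminant h^2 + 4 r^2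
    is never negative. *)
Lemma real_rotation (r h : R) : exists p q, p * p + q * q = 1 /\ r * (p * p - q * q) + h * (p * q) = 0.
Proof.
destruct (Req_dec r 0) as [->|Hr].
- exists 1, 0. split; ring.
- set (x := (- h + sqrt (h * h + 4 * (r * r))) / (2 * r)).
  assert (Hx : r * (x * x - 1) + h * x = 0).
  { assert (S : sqrt (h * h + 4 * (r * r)) * sqrt (h * h + 4 * (r * r)) = h * h + 4 * (r * r)) by (apply sqrt_sqrt; nra).
    set (s := sqrt (h * h + 4 * (r * r))) in *. unfold x.
    replace (r * ((- h + s) / (2 * r) * ((- h + s) / (2 * r)) - 1) + h * ((- h + s) / (2 * r))) with ((s * s - (h * h + 4 * (r * r))) / (4 * r)) by (field; auto).
    rewrite S. field. auto. }
  assert (N : 0 < x * x + 1) by nra.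
  assert (S : sqrt (x * x + 1) * sqrt (x * x + 1) = x * x + 1) by (apply sqrt_sqrt; lra).
  assert (Sp : 0 < sqrt (x * x + 1)) by now apply sqrt_lt_R0.
  set (s := sqrt (x * x + 1)) in *.
  exists (x / s), (1 / s). split.
  + replace (x / s * (x / s) + 1 / s * (1 / s)) with ((x * x + 1) / (s * s)) by (field; lra). rewrite S. field. lra.
  + replace (r * (x / s * (x / s) - 1 / s * (1 / s)) + h * (x / s * (1 / s))) with ((r * (x * x - 1) + h * x) / (s * s)) by (field; lra).
    rewrite Hx. field. lra.
Qed.

(* For [W z = e^2 z] the curve only depends on [U U^T], where [U = [[a, - conj c e], [c, conj a e]]],
   so [U] can be multiplied by a real rotation to make [a c conj e] purely imaginary. *)
Lemma diagonal_case (a c e : C) (be : R) (phi : C -> C3) : N2 a + N2 c = 1 -> 0 < be < 1 -> Cmod e = 1 ->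
  (forall z, disc z -> phi z = Phi a c be z (e * e * z)) ->
  (forall z, disc z -> ~ royal_variety (phi z)) -> ~ unique_left_inverse phi.
Proof.
intros Hac Hbe He Ephi Hroy.
assert (ee : (e * Cconj e)%C = RtoC 1) by now apply unit_conj.
assert (Ne : N2 e = 1) by (rewrite N2_Cmod, He; ring).
destruct (real_rotation (fst (a * c * Cconj e)%C) (N2 a - N2 c)) as [p [q [Hpq Hrot]]].
set (a' := (a * RtoC p - Cconj c * e * RtoC q)%C). set (c' := (c * RtoC p + Cconj a * e * RtoC q)%C).
assert (HpqC : (RtoC p * RtoC p + RtoC q * RtoC q)%C = RtoC 1) by (rewrite <- !RtoC_mult, <- RtoC_plus, Hpq; reflexivity).
assert (CR : forall r : R, Cconj (RtoC r) = RtoC r) by (intros; apply injective_projections; simpl; ring).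
assert (Ea : (e * Cconj a' = Cconj a * e * RtoC p - c * RtoC q)%C).
{ unfold a'. rewrite Cminus_conj, !Cmult_conj, Cconj_conj, !CR.
  transitivity (Cconj a * e * RtoC p - c * RtoC q * (e * Cconj e))%C. ring. rewrite ee. ring. }
assert (Ec : (e * Cconj c' = Cconj c * e * RtoC p + a * RtoC q)%C).
{ unfold c'. rewrite Cplus_conj, !Cmult_conj, Cconj_conj, !CR.
  transitivity (Cconj c * e * RtoC p + a * RtoC q * (e * Cconj e))%C. ring. rewrite ee. ring. }
apply (diagonal_aux a' c' e be phi); auto.
- transitivity ((p * p + q * q * N2 e) * (N2 a + N2 c)).
  unfold a', c', N2; simpl; ring. rewrite Hac, Ne. lra.
- intros z Hz. rewrite Ephi by auto. unfold Phi.
  replace (mA a' c' z (e * e * z)) with (mA a c z (e * e * z)).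
  replace (mB a' c' z (e * e * z)) with (mB a c z (e * e * z)).
  replace (mD a' c' z (e * e * z)) with (mD a c z (e * e * z)). reflexivity.
  + unfold mD. transitivity ((c' * c' + (e * Cconj a') * (e * Cconj a')) * z)%C; [|ring]. rewrite Ea. unfold c'.
    transitivity ((c * c + Cconj a * e * (Cconj a * e)) * (RtoC p * RtoC p + RtoC q * RtoC q) * z)%C. rewrite HpqC; ring. ring.
  + unfold mB. transitivity ((a' * c' - (e * Cconj a') * (e * Cconj c')) * z)%C; [|ring]. rewrite Ea, Ec. unfold a', c'.
    transitivity ((a * c - Cconj a * e * (Cconj c * e)) * (RtoC p * RtoC p + RtoC q * RtoC q) * z)%C. rewrite HpqC; ring. ring.
  + unfold mA. transitivity ((a' * a' + (e * Cconj c') * (e * Cconj c')) * z)%C; [|ring]. rewrite Ec. unfold a'.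
    transitivity ((a * a + Cconj c * e * (Cconj c * e)) * (RtoC p * RtoC p + RtoC q * RtoC q) * z)%C. rewrite HpqC; ring. ring.
(* As a number and its conjugate have the same real part, the real part of the new product is the
   quadratic form that [real_rotation] makes vanish. *)
- replace (a' * c' * Cconj e)%C with
   (a * c * Cconj e * (RtoC p * RtoC p) + (a * Cconj a - c * Cconj c) * (e * Cconj e) * (RtoC p * RtoC q) - Cconj (a * c * Cconj e) * (e * Cconj e) * (RtoC q * RtoC q))%C.
  2: { unfold a', c'. rewrite !Cmult_conj, Cconj_conj. ring. }
  rewrite ee, !Cmod_sqr, <- !N2_Cmod. rewrite <- Hrot. set (g := (a * c * Cconj e)%C). simpl. ring.
Qed.

Lemma part2 (phi : C -> C3) (beta : R) (a b c d : C) (Z : C -> C) :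
  let A z := (a ^ 2 * z + b ^ 2 * Z z)%C in
  let B z := (a * c * z + b * d * Z z)%C in
  let D z := (c ^ 2 * z + d ^ 2 * Z z)%C in
  let Delta z := ((1 + RtoC beta * B z) ^ 2 - A z * D z * RtoC beta ^ 2)%C in
  (exists F, left_inverse phi F) -> (forall z, disc z -> ~ royal_variety (phi z)) -> 0 < beta < 1 ->
  Cmod a ^ 2 + Cmod b ^ 2 = 1 -> Cmod c ^ 2 + Cmod d ^ 2 = 1 -> (a * Cconj c + b * Cconj d)%C = RtoC 0 ->
  holo disc Z -> (forall z, disc z -> disc (Z z)) ->
  ((forall z, disc z -> Z z = z) \/ (forall z, disc z -> z <> RtoC 0 -> Cmod (Z z) < Cmod z)) ->
  (forall z, disc z -> phi z = ((A z * (1 - RtoC beta ^ 2) / Delta z)%C, (D z * (1 - RtoC beta ^ 2) / Delta z)%C,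
     ((A z * D z - (B z + RtoC beta) ^ 2) / Delta z)%C)) ->
  (unique_left_inverse phi <->
    (forall z, disc z -> z <> RtoC 0 -> Cmod (Z z) < Cmod z) /\ Cmod c * Cmod d * (1 + beta ^ 2) = beta).
Proof.
intros A B D Delta HF Hroy Hbe Nab Ncd Horth HZ HZ1 HZc Ephi.
set (e := (a * d - b * c)%C).
assert (Sq : forall z : C, Cmod z ^ 2 = N2 z) by (intros; rewrite N2_Cmod; ring).
rewrite !Sq in Nab, Ncd.
assert (Horth' : (Cconj a * c + Cconj b * d)%C = RtoC 0).
{ rewrite <- (Cconj_conj c), <- (Cconj_conj d), <- !Cmult_conj, <- Cplus_conj, Horth. apply injective_projections; simpl; ring. }
assert (SC : forall z : C, (z * Cconj z)%C = RtoC (N2 z)) by (intros; rewrite Cmod_sqr, N2_Cmod; reflexivity).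
(* Lagrange's identity: [e] is the determinant of a matrix with orthonormal rows. *)
assert (He : Cmod e = 1).
{ assert (E : N2 e = (N2 a + N2 b) * (N2 c + N2 d) - N2 (a * Cconj c + b * Cconj d)%C) by (unfold e, N2; simpl; ring).
  rewrite Nab, Ncd, Horth in E. replace (N2 (RtoC 0)) with 0 in E by (unfold N2; simpl; ring). rewrite N2_Cmod in E.
  pose proof (Cmod_ge_0 e). nra. }
assert (Eb : b = (- (Cconj c * e))%C).
{ transitivity (b * (c * Cconj c + d * Cconj d) - d * (a * Cconj c + b * Cconj d))%C.
  rewrite !SC, <- RtoC_plus, Ncd, Horth. ring. unfold e. ring. }
assert (Ed : d = (Cconj a * e)%C).
{ transitivity (d * (a * Cconj a + b * Cconj b) - b * (Cconj a * c + Cconj b * d))%C.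
  rewrite !SC, <- RtoC_plus, Nab, Horth'. ring. unfold e. ring. }
assert (Hac : N2 a + N2 c = 1).
{ rewrite <- Nab, Eb. f_equal. rewrite (N2_Cmod (- (Cconj c * e))%C), Cmod_opp, Cmod_mult, Cmod_conj, He, N2_Cmod. ring. }
assert (Md : Cmod d = Cmod a) by (rewrite Ed, Cmod_mult, Cmod_conj, He; ring).
(* Absorbing the unimodular e^2 into the second parameter leaves [a] and [c] as the only data, with
   |W z| = |Z z|. *)
set (W := fun z => (e * e * Z z)%C).
assert (Mee : Cmod (e * e) = 1) by (rewrite Cmod_mult, He; ring).
assert (MW : forall z, Cmod (W z) = Cmod (Z z)) by (intros z; unfold W; rewrite Cmod_mult, Mee; ring).
assert (HW : holo disc W). { intros z Hz. destruct (HZ z Hz) as [l Hl]. eexists. apply hd_mult. apply hd_const. apply Hl. }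
assert (HW1 : forall z, disc z -> disc (W z)) by (intros z Hz; unfold disc; rewrite MW; now apply HZ1).
assert (EW : forall z, disc z -> phi z = Phi a c beta z (W z)).
{ intros z Hz. rewrite Ephi by auto. unfold Phi, tpoint.
  assert (EA : A z = mA a c z (W z)) by (unfold A, mA, W; rewrite Eb; simpl; ring).
  assert (EB : B z = mB a c z (W z)) by (unfold B, mB, W; rewrite Eb, Ed; simpl; ring).
  assert (ED : D z = mD a c z (W z)) by (unfold D, mD, W; rewrite Ed; simpl; ring).
  pose proof (m_det a c Hac z (W z)) as EK. rewrite <- EA, <- EB, <- ED in *.
  assert (EDe : Delta z = tden beta (B z) (z * W z)) by (unfold Delta, tden; rewrite <- EK; simpl; ring).
  rewrite EDe. apply C3_eq.
  - do 2 f_equal. rewrite RtoC_minus, RtoC_mult. simpl. ring.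
  - do 2 f_equal. rewrite RtoC_minus, RtoC_mult. simpl. ring.
  - f_equal. unfold tnum. rewrite <- EK. simpl. ring. }
destruct HZc as [HZc|HZc].
- split.
  + intros U. exfalso. revert U. apply (diagonal_case a c e beta); auto.
    intros z Hz. rewrite EW by auto. unfold W. now rewrite HZc.
  + intros [H _]. exfalso. assert (Eh : Cmod (RtoC (/ 2)) = / 2) by (rewrite Cmod_R, Rabs_pos_eq; lra).
    assert (Hh : disc (RtoC (/ 2))) by (unfold disc; lra).
    specialize (H _ Hh ltac:(apply RtoC_pos_neq0; lra)). rewrite HZc in H by auto. lra.
- rewrite (strict_case a c beta W phi Hac Hbe HW HW1 EW HF).
  + rewrite Md, (Rmult_comm (Cmod c)). tauto.
  + intros z Hz Hz0. rewrite MW. auto.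
Qed.

Theorem theorem6p3 :
  (forall (phi : C -> C3) (omega1 omega2 : C) (k : R) (psi : C -> C),
      complex_geodesic phi ->
      unit_circle omega1 -> unit_circle omega2 ->
      0 <= k <= 1 ->
      holomorphic_disc (V := C_NormedModule) psi ->
      (forall z, disc z -> closed_disc (psi z)) ->
      psi (RtoC 0) = RtoC (- k) ->
      (forall z, disc z ->
         phi z = ((omega1 * ((psi z + RtoC k) / (1 + RtoC k)))%C,
                  (omega2 * z * ((1 + RtoC k * psi z) / (1 + RtoC k)))%C,
                  (omega1 * omega2 * z * psi z)%C)) ->
      (unique_left_inverse phi <-> 0 < k < 1 /\ ~ disc_automorphism psi))
  /\
  (forall (phi : C -> C3) (beta : R) (a b c d : C) (Z : C -> C),
      let A (z : C) := (a ^ 2 * z + b ^ 2 * Z z)%C in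
      let B (z : C) := (a * c * z + b * d * Z z)%C in
      let D (z : C) := (c ^ 2 * z + d ^ 2 * Z z)%C in
      let Delta (z : C) :=
        ((1 + RtoC beta * B z) ^ 2 - A z * D z * RtoC beta ^ 2)%C in
      complex_geodesic phi ->
      (forall z, disc z -> ~ royal_variety (phi z)) ->
      0 < beta < 1 ->
      closed_disc a -> closed_disc b -> closed_disc c -> closed_disc d ->
      Cmod a ^ 2 + Cmod b ^ 2 = 1 ->
      Cmod c ^ 2 + Cmod d ^ 2 = 1 ->
      (a * Cconj c + b * Cconj d)%C = RtoC 0 ->
      holomorphic_disc (V := C_NormedModule) Z ->
      (forall z, disc z -> disc (Z z)) ->
      ((forall z, disc z -> Z z = z) \/
       (forall z, disc z -> z <> RtoC 0 -> Cmod (Z z) < Cmod z)) ->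
      (forall z, disc z ->
         phi z = ((A z * (1 - RtoC beta ^ 2) / Delta z)%C,
                  (D z * (1 - RtoC beta ^ 2) / Delta z)%C,
                  ((A z * D z - (B z + RtoC beta) ^ 2) / Delta z)%C)) ->
      (unique_left_inverse phi <->
         (forall z, disc z -> z <> RtoC 0 -> Cmod (Z z) < Cmod z) /\
         Cmod c * Cmod d * (1 + beta ^ 2) = beta)).

Proof.
split.
- intros phi w1 w2 k psi [_ [Hphi HF]] Hw1 Hw2 Hk Hpsi Hb H0 E.
  apply holo_disc in Hpsi. now apply (part1 phi w1 w2 k psi).
- intros phi beta a b c d Z A B D Delta [_ [_ HF]] Hroy Hbe _ _ _ _ Nab Ncd Ho HZ HZ1 HZc E.
  apply holo_disc in HZ. now apply (part2 phi beta a b c d Z).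
Qed.
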